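(* Let $k\ge 1$ be an integer, $\alpha<b$ real, $\Sigma=[\alpha,b]$, and let $\rho$ be a finite positive Borel measure, compactly supported in $(-\infty,\alpha]$, of total mass $\|\rho\|$. Consider on $\Sigma$ the external field $Q=U^{\rho/k}$, and the strictly decreasing function on $\Sigma$ (possibly with value $+\infty$ at $\alpha$) $$\eta(a):=\int\sqrt{\frac{b-y}{a-y}}\,d\rho(y).$$ Set $a=\alpha$ if $k+\|\rho\|\ge \eta(\alpha)$, and otherwise let $a$ be the unique solution in $\Sigma$ of $k+\|\rho\|=\eta(a)$. Then the extremal measure $\mu$ and the function $f$ associated with $\Sigma$ and $Q$ (see context) satisfy $$\operatorname{supp}(\mu)=[a,b],\qquad k f(x)=(k+\|\rho\|)\,g_{[a,b]}(x,\infty)-\int g_{[a,b]}(x,y)\,d\rho(y).$$ Moreover, there exists a universal real constant $C_{BW}>0$ (independent of $k,\alpha,b,\rho$) such that, for every integer $k\ge 2$, all real $\alpha<b$, and every finite positive Borel measure $\rho$ compactly supported in $(-\infty,\alpha]$, with $\mu$ and $f$ the extremal measure and the function associated with $\Sigma=[\alpha,b]$ and $Q=U^{\rho/k}$, and with $a$ given by $a=\alpha$ if $k+\|\rho\|\ge\eta(\alpha)$ and by the unique solution in $\Sigma$ of $k+\|\rho\|=\eta(a)$ otherwise, there is a polynomial $P_k$ of degree $k$ such that for all $x_0\in\mathbb R\setminus[a,b]$ $$\frac{|w(x_0)^kP_k(x_0)|}{\|w^kP_k\|_{\operatorname{supp}(\mu)}}\ \ge\ e^{-C_{BW}}\,e^{k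 f(x_0)},$$ where $w=e^{-Q}$ on $\mathbb R$.
   Context: For a positive Borel measure $\nu$ with compact support, $U^\nu(x)=\int\log\frac1{|x-t|}\,d\nu(t)$ and $I(\nu)=\iint\log\frac1{|x-t|}\,d\nu(t)\,d\nu(x)$. $\mathcal M_1(\Sigma)$ is the set of Borel probability measures with support in $\Sigma$. Given an external field $Q$ with weight $w=e^{-Q}$, the extremal measure $\mu\in\mathcal M_1(\Sigma)$ is the unique minimizer of $I(\mu)+2\int Q\,d\mu$ over $\mathcal M_1(\Sigma)$; it is uniquely characterized by the existence of a constant $F\in\mathbb R$ such that $f(x):=F-U^\mu(x)-Q(x)$ satisfies $f(x)=0$ for $x\in\operatorname{supp}(\mu)$ and $f(x)\le 0$ for $x\in\Sigma$. The function $f$ is defined by this formula also outside $\Sigma$ (here $Q=U^{\rho/k}$ everywhere). $\|h\|_S=\max_{x\in S}|h(x)|$. $g_{S}(\cdot,\zeta)$ denotes the Green function of $\overline{\mathbb C}\setminus S$ with pole at $\zeta\in\overline{\mathbb C}\setminus S$; for an interval $S$ it is taken to be $0$ on $S$. *)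

(* Defs.v *)
From HB Require Import structures.
From mathcomp Require Import all_boot all_order all_algebra.
From mathcomp Require Import all_classical all_reals all_analysis.

Set Implicit Arguments.
Unset Strict Implicit.
Unset Printing Implicit Defensive.

Import Order.TTheory GRing.Theory Num.Theory.
Import numFieldNormedType.Exports.

Local Open Scope classical_set_scope.
Local Open Scope ring_scope.

Section LogarithmicPotential.
Context {R : realType}.
Implicit Types (nu : {measure set (measurableTypeR R) -> \bar R}).
Implicit Types (S : set R) (Q : R -> \bar R) (x t : R) (F : R).
Implicit Types (mu : probability (measurableTypeR R) R).

Definition supp nu : set R :=
  [set x | forall U : set R, open U -> U x -> (0 < nu U)%E].

(* In \bar R, 0^-1 = +oo and lne +oo = +oo, so the kernel is +oo at x = t. *)
Definition log_kernel x t : \bar R := lne (`|x - t|%:E^-1)%E.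

Definition log_potential nu x : \bar R := (\int[nu]_t log_kernel x t)%E.

Definition log_energy nu : \bar R :=
  (\int[nu]_x \int[nu]_t log_kernel x t)%E.

Definition weighted_energy Q nu : \bar R :=
  (log_energy nu + 2%:E * \int[nu]_x Q x)%E.

Definition is_extremal S Q mu : Prop :=
  supp mu `<=` S /\
  forall nu : probability (measurableTypeR R) R, supp nu `<=` S ->
    (weighted_energy Q mu <= weighted_energy Q nu)%E.

Definition extremal_fun Q mu F x : \bar R :=
  (F%:E - log_potential mu x - Q x)%E.

Definition is_extremal_constant S Q mu F : Prop :=
  (forall x, supp mu x -> extremal_fun Q mu F x = 0%E) /\
  (forall x, S x -> (extremal_fun Q mu F x <= 0)%E).

Definition max_norm S (h : R -> \bar R) : \bar R :=
  ereal_sup [set `|h x|%E | x in S].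

End LogarithmicPotential.

Section GreenFunction.
Context {R : realType}.

(* The complex plane, with coordinates (Re z, Im z). The library norm of this
   product is the max norm, hence the separate Euclidean modulus. *)
Local Notation plane := (R * R)%type.
Implicit Types (K U : set plane) (g h : plane -> R) (z : plane).

Definition modulus z : R := Num.sqrt (z.1 ^+ 2 + z.2 ^+ 2).

Definition axis (i : bool) : plane := if i then (0, 1) else (1, 0).

Definition C2_on U h : Prop :=
  forall z, U z ->
    [/\ {for z, continuous h},
        forall i, derivable h z (axis i) /\
                  {for z, continuous ('D_(axis i) h)}
      & forall i j, derivable ('D_(axis i) h) z (axis j) /\
                    {for z, continuous ('D_(axis j) ('D_(axis i) h))}].

Definition harmonic_on U h : Prop :=
  C2_on U h /\
  forall z, U z -> \sum_(i : bool) 'D_(axis i) ('D_(axis i) h) z = 0.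

(* Points of the Riemann sphere are of type option plane, None being the point
   at infinity. *)
Implicit Types zeta : option plane.

Definition sphere_disc zeta (r : R) : set plane :=
  match zeta with
  | Some p => [set z | modulus (z - p) < r]
  | None => [set z | r^-1 < modulus z]
  end.

Definition log_pole zeta z : R :=
  match zeta with
  | Some p => - ln (modulus (z - p))
  | None => ln (modulus z)
  end.

(* Green function of the complement in the sphere of a compact set K with
   regular boundary, extended by 0 to K. When the pole is finite, harmonicity
   at infinity is expressed by boundedness there, part of the third clause
   (removable singularity). The value of g at a finite pole is unconstrained. *)
Definition is_green K zeta g : Prop :=
  [/\ harmonic_on (~` K `&` [set z | Some z <> zeta]) g,
      exists r M : R, 0 < r /\
        forall z, sphere_disc zeta r z -> Some z <> zeta ->
          `|g z - log_pole zeta z| <= M,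
      forall r : R, 0 < r -> exists M : R,
        forall z, ~ sphere_disc zeta r z -> ~ K z -> `|g z| <= M
    & forall z, K z -> g z = 0 /\ {for z, continuous g}].

(* If zeta lies on K, no g satisfies is_green and green is 0 off zeta. *)
Definition green K zeta z : \bar R :=
  if pselect (K z) then 0%E
  else if pselect (Some z = zeta) then +oo%E
  else (xget (fun=> 0) [set g | is_green K zeta g] z)%:E.

Definition real_pt (x : R) : plane := (x, 0).

Definition green_itv (a b : R) zeta (x : R) : \bar R :=
  green (real_pt @` `[a, b]) zeta (real_pt x).

End GreenFunction.

Section PotentialField.
Context {R : realType}.
Variables (k : nat) (alpha b : R).
Variable rho : {finite_measure set (measurableTypeR R) -> \bar R}.

Definition admissible_charge : Prop :=
  compact (supp rho) /\ supp rho `<=` `]-oo, alpha].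

Definition total_charge : \bar R := (k%:R%:E + rho setT)%E.

(* The division is the one of \bar R: for a < b the integrand is +oo at y = a. *)
Definition eta (a : R) : \bar R :=
  (\int[rho]_y sqrte ((b - y)%:E / (a - y)%:E))%E.

Definition is_left_endpoint (a : R) : Prop :=
  if (eta alpha <= total_charge)%E then a = alpha
  else a \in `[alpha, b] /\ eta a = total_charge.

Definition ext_field : R -> \bar R :=
  log_potential (mscale (k%:R^-1)%:nng rho).

Definition weight (x : R) : \bar R := expeR (- ext_field x)%E.

Definition extremal_data (a : R) (mu : probability (measurableTypeR R) R)
    (F : R) : Prop :=
  [/\ is_left_endpoint a,
      is_extremal `[alpha, b] ext_field mu
    & is_extremal_constant `[alpha, b] ext_field mu F].

End PotentialField.

(* Main.v *)
(* Put X(t) = a + (b - a) sin^2 t for 0 <= t <= pi/2, N = k + |rho| and, for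
   y < a, lam_y = sqrt ((a - y) / (b - y)). The harmonic measure of [a, b] seen
   from y is the image under X of the density (2/pi) lam / (lam^2 cos^2 + sin^2)
   with lam = lam_y (lam = 1 for the point at infinity); its potential is found
   from the duplication formula sin^2 (2 t) = 4 sin^2 t (1 - sin^2 t), and the
   Green function with pole y is log |(v + lam) / (v - lam)| where
   v = sqrt ((z - a) / (z - b)). Hence the measure which is 1/k times the image
   of s = (2/pi) (N - sum of these densities against rho) has the announced
   field f. The density s is nonnegative because eta(a), the rho-integral of
   1 / lam_y, is at most N. When alpha < a we have eta(a) = N, and f <= 0 on
   [alpha, a) follows from g(x, y) >= g(x, oo) / lam_y.

   Up to a constant, log 1/|x - t| is on [alpha, b]^2 a positive mixture of
   kernels phi(x) phi(t), and the resulting lower bound for the energy of a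
   difference of two probabilities controls the L^2 distance of their
   distribution functions. This gives the extremality and its uniqueness.

   For the polynomials, cut [0, pi/2] into k cells of s-mass 1 and take as zeros
   the means of X over the cells. By concavity of log, |P_k| >= exp (- k U)
   outside [a, b]. At a point of [a, b] the cells around it lose a bounded
   amount, because s is at most 8 / |J| on a cell J, and the other cells a
   multiple of (|J| / distance)^2; these squares are summable because s is
   nondecreasing and s(t) <= 4 s(t/2). *)
Require Import Defs.
From HB Require Import structures.
From mathcomp Require Import all_boot all_order all_algebra.
From mathcomp Require Import all_classical all_reals all_analysis.
From mathcomp Require Import measurable_realfun complex ring lra.

Set Implicit Arguments.
Unset Strict Implicit.
Unset Printing Implicit Defensive.

Import Order.TTheory GRing.Theory Num.Theory.
Import numFieldNormedType.Exports.

Local Open Scope classical_set_scope.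
Local Open Scope ring_scope.

(** * Logarithmic integrals over the quarter circle *)

(** The measure [k] times [mu] is [N] times the equilibrium measure of [a, b] minus the balayage of
    [rho] onto [a, b]. All harmonic densities with lam <= 1 are largest at t = 0, where they equal 1
    / lam; this is why a single number, eta(a), decides positivity. Three obstacles shape the proof.
    The kernel changes sign and is infinite on the diagonal, so each potential is treated after
    adding a constant that makes the kernel nonnegative on a compact interval; identities are kept
    as sums, which survive the value +oo, and subtraction comes last. The Green function is
    specified by its behaviour in the plane, so an explicit candidate must be proved harmonic and
    then identified by a maximum principle. Finally the constant must not depend on the data: the
    discretization uses the density only through its unit cell masses, its monotonicity and s(t) <=
    4 s(t/2), and the last two come from the single harmonic densities with constants free of
    lam. *)

Lemma ex_pushforward d d' (T1 : measurableType d) (T2 : measurableType d')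
    (R : realType) (m : {measure set T1 -> \bar R}) (X : T1 -> T2) :
  measurable_fun [set: T1] X ->
  exists n : {measure set T2 -> \bar R}, forall f : T2 -> \bar R,
    measurable_fun [set: T2] f -> (forall x, (0 <= f x)%E) ->
    (\int[n]_x f x = \int[m]_t f (X t))%E.
Proof.
move=> mX; exists (pushforward m X) => f mf f0.
by rewrite ge0_integral_pushforward//= preimage_setT.
Unshelve. exact: mX.
Qed.

Lemma ge0_integral_mrestr d (T : measurableType d) (R : realType)
    (m : {measure set T -> \bar R}) (D : set T) (mD : measurable D)
    (f : T -> \bar R) :
  measurable_fun [set: T] f -> (forall x, (0 <= f x)%E) ->
  (\int[mrestr m mD]_x f x = \int[m]_(x in D) f x)%E.
Proof.
move=> mf f0.
transitivity (\int[mrestr m mD]_(x in D) (f x))%E; last first.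
  by apply: eq_measure_integral => A mA AD; rewrite /= /mrestr setIidl.
rewrite -[in LHS](setUv D) ge0_integral_setU//=; first last.
- by rewrite disj_set2E setICr.
- by rewrite setUv.
- exact: measurableC.
rewrite [X in (_ + X)%E](_ : _ = 0%E) ?adde0//.
apply: null_set_integral => //.
- exact: measurableC.
- exact: measurable_funTS.
- by rewrite /= /mrestr setICl measure0.
Qed.

(** * Change of variables for the Lebesgue integral *)

Section density.
Context {R : realType}.
Local Notation mu := (@lebesgue_measure R).
Local Open Scope ereal_scope.

Lemma measurable_subgraph (s : R -> R) : measurable_fun [set: R] s ->
  measurable [set p : measurableTypeR R * measurableTypeR R | (p.2 < s p.1)%R].
Proof.
move=> ms.
have mB : measurable_fun [set: R * R] (fun p : R * R => (p.2 < s p.1)%R).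
  apply: measurable_fun_ltr; first exact: measurable_snd.
  by apply: measurableT_comp => //; exact: measurable_fst.
have := mB measurableT [set true].
rewrite setTI; exact.
Qed.

(** The measure s dt is realised as plane Lebesgue measure restricted to the region under the graph
    of [s]; its image under [X] of the first coordinate then has the required integrals by
    Tonelli. *)
Lemma density_pushforward (I : set R) (s X : R -> R) : measurable I ->
  measurable_fun [set: R] s -> measurable_fun [set: R] X ->
  (forall t, 0 <= s t)%R ->
  exists m : {measure set (measurableTypeR R) -> \bar R},
    forall f : R -> \bar R, measurable_fun [set: R] f -> (forall x, 0 <= f x) ->
    \int[m]_x f x = \int[mu]_(t in I) (f (X t) * (s t)%:E).
Proof.
move=> mI ms mX s0.
pose D : set (measurableTypeR R * measurableTypeR R) :=
  ((I : set (measurableTypeR R)) `*` `[0%R, +oo[%classic) `&` [set p | (p.2 < s p.1)%R].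
have mD : measurable D.
  by apply: measurableI; [exact: measurableX|exact: measurable_subgraph].
pose Y (p : measurableTypeR R * measurableTypeR R) : measurableTypeR R := X p.1.
have mY : measurable_fun setT Y by apply: measurableT_comp => //; exact: measurable_fst.
pose m1 := mrestr (mu \x mu) mD.
have [m mE] := ex_pushforward m1 mY.
exists m => f mf f0; rewrite mE//.
have mfX : measurable_fun setT (fun p : measurableTypeR R * measurableTypeR R => f (X p.1)).
  by apply: (measurableT_comp mf); exact: mY.
rewrite ge0_integral_mrestr//.
rewrite integral_mkcond.
rewrite fubini_tonelli1//=; first last.
- by move=> p; rewrite erestrict_ge0.
- apply/(measurable_restrictT _ mD); exact: measurable_funTS.
rewrite [RHS]integral_mkcond; apply: eq_integral => x _.
rewrite /fubini_F patchE; case: ifPn => xI.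
  transitivity (\int[mu]_(y in `[0%R, s x[) f (X x)).
    rewrite [RHS]integral_mkcond; apply: eq_integral => y _.
    rewrite !patchE; congr (if _ then _ else _); apply/idP/idP.
      rewrite inE => -[[/= _]]; rewrite in_itv/= andbT => y0 ys.
      by rewrite inE/= in_itv/= y0.
    rewrite inE/= in_itv/= => /andP[y0 ys]; rewrite inE; split => //=.
    by split => //=; [exact/set_mem|rewrite in_itv/= y0].
  rewrite integral_cst//= lebesgue_measure_itv/= lte_fin.
  case: ltP => [_|s0']; first by rewrite sube0.
  by rewrite (_ : s x = 0%R) ?mule0//; apply/le_anti; rewrite s0' s0.
apply: integral0_eq => y _; rewrite patchE; case: ifPn => //.
rewrite inE => -[[/= xI' _] _]; case/negP: xI; exact/mem_set.
Qed.

(** The image of f dt under [F] and Lebesgue measure on [F p, F q] agree on the rays ]-oo, c[ by the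
    fundamental theorem of calculus. These rays form a generating pi-system, so the two measures
    agree. *)
Lemma ge0_substitution (F f : R -> R) (p q : R) (g : R -> \bar R) :
  (p < q)%R -> (forall x : R, is_derive x 1%R F (f x)) -> continuous f ->
  (forall x, 0 < f x)%R -> measurable_fun [set: R] g -> (forall x, 0 <= g x) ->
  \int[mu]_(x in `[F p, F q]) g x =
  \int[mu]_(x in `[p, q]) (g (F x) * (f x)%:E).
Proof.
move=> pq dF cf f0 mg g0.
have cF : continuous F.
  by move=> x; apply/differentiable_continuous/derivable1_diffP; have [] := dF x.
have F'E : F^`()%classic = f by apply/funext => x; rewrite derive1E; have [] := dF x.
have iF x y : (x < y)%R -> (F x < F y)%R.
  move=> xy.
  have [c _ FE] := @derive.MVT R F f x y xy (fun z _ => dF z) (continuous_subspaceT cF).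
  by rewrite -subr_gt0 FE mulr_gt0// subr_gt0.
have leF : {mono F : x y / (x <= y)%R} by exact: (le_mono iF).
have mF : measurable_fun [set: R] F := continuous_measurable_fun cF.
have mf : measurable_fun [set: R] f := continuous_measurable_fun cf.
have [m mE] := density_pushforward (measurable_itv `[p, q]) mf mF (fun x => ltW (f0 x)).
rewrite -mE//.
have mD : measurable (`[F p, F q]%classic : set (measurableTypeR R)).
  exact: measurable_itv.
transitivity (\int[mrestr mu mD]_x g x); first by rewrite ge0_integral_mrestr.
have FTC x : (p < x)%R -> \int[mu]_(t in `[p, x]) (f t)%:E = (F x - F p)%:E.
  move=> px; rewrite (@continuous_FTC2 _ f F)//.
  - exact: continuous_subspaceT.
  - split.
    + by move=> z _; have [] := dF z.
    + exact/cvg_at_right_filter/cF.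
    + exact/cvg_at_left_filter/cF.
  - by move=> z _; rewrite F'E.
have mA A : measurable A ->
    m A = \int[mu]_(t in `[p, q] `&` F @^-1` A) (f t)%:E.
  move=> mA; rewrite -[LHS]mul1e -integral_cst// integral_mkcond mE; first last.
  - by move=> x; rewrite erestrict_ge0.
  - by apply/(measurable_restrictT _ mA).
  rewrite [RHS]integral_mkcondr; apply: eq_integral => x _.
  rewrite !patchE/=; have -> : (x \in F @^-1` A) = (F x \in A) by [].
  by case: ifPn; rewrite ?mul1e ?mul0e.
have mm c : m `]-oo, c[%classic = mrestr mu mD `]-oo, c[%classic.
  rewrite mA//= /mrestr/=.
  have [cp|pc] := leP c (F p).
    rewrite (_ : _ `&` _ = set0) ?integral_set0; last first.
      apply/seteqP; split => // x [/=]; rewrite !in_itv/= => /andP[px _].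
      by rewrite ltNge (le_trans cp)// leF.
    rewrite (_ : _ `&` _ = set0) ?measure0//.
    apply/seteqP; split => // x [/=]; rewrite !in_itv/= => xc /andP[px _].
    by move: (lt_le_trans xc cp); rewrite ltNge px.
  have [qc|cq] := ltP (F q) c.
    rewrite (_ : _ `&` _ = `[p, q]%classic); last first.
      apply/seteqP; split => [x []//|x /= xpq]; split => //=.
      rewrite in_itv/=; move: xpq; rewrite in_itv/= => /andP[_ xq].
      by rewrite (le_lt_trans _ qc)// leF.
    rewrite FTC// (_ : _ `&` _ = `[F p, F q]%classic); last first.
      apply/seteqP; split => [x []//|x /= xpq]; split => //=.
      rewrite in_itv/=; move: xpq; rewrite in_itv/= => /andP[_ xq].
      by rewrite (le_lt_trans _ qc).
    by rewrite lebesgue_measure_itv/= lte_fin iF.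
  have [x xpq Fx] : exists2 x, x \in `[p, q] & F x = c.
    apply: IVT; [exact: ltW|exact: continuous_subspaceT|].
    by rewrite min_l ?max_r ?leF ?(ltW pq)// (ltW pc).
  move: xpq; rewrite in_itv/= => /andP[px xq].
  have px' : (p < x)%R by rewrite lt_neqAle px andbT; apply: contraTneq pc => ->; rewrite Fx ltxx.
  rewrite (_ : _ `&` _ = `[p, x[%classic); last first.
    apply/seteqP; split => [y []/=|y /=]; rewrite !in_itv/=.
      move=> /andP[-> _]; rewrite -Fx; case: (ltP y x) => //; rewrite -leF => h1 h2.
      by move: (lt_le_trans h2 h1); rewrite ltxx.
    by move=> /andP[-> yx]; split; rewrite /= ?(le_trans (ltW yx))// -Fx iF.
  rewrite [X in mu X](_ : _ = `[F p, c[%classic); last first.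
    apply/seteqP; split => [y []/=|y /=]; rewrite !in_itv/=.
      by move=> -> /andP[->].
    by move=> /andP[-> yc]; rewrite yc; split => //=; rewrite (ltW (lt_le_trans yc cq)).
  rewrite lebesgue_measure_itv/= lte_fin pc.
  rewrite integral_itv_bndo_bndc ?FTC ?Fx//.
  by apply: measurable_funTS; exact/measurable_EFinP.
apply: eq_measure_integral => A mA' _.
apply: (@measure_unique _ R (measurableTypeR R) (@RGenInftyO.G R)
  (fun k => `]-oo, k%:R[%classic)) => //.
- exact: RGenInftyO.measurableE.
- move=> _ _ [x ->] [y ->]; exists (Num.min x y).
  by apply/seteqP; split => z /=; rewrite !in_itv/= lt_min; [move=> [-> ->]|move=> /andP[]].
- by move=> i; exists i%:R.
- apply/seteqP; split => // x _; exists (Num.truncn `|x|).+1 => //=.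
  by rewrite in_itv/= (le_lt_trans (ler_norm _))// truncnS_gt.
- by move=> _ [x ->].
- move=> k; rewrite /= /mrestr (@le_lt_trans _ _ (mu `[F p, F q]%classic))//.
    by apply: le_measure; rewrite ?inE//=; exact: measurableI.
  by rewrite lebesgue_measure_itv/=; case: ifP => _; rewrite ltry.
Qed.

(** Reflection preserves Lebesgue measure, since it exchanges ]u, v] with [c - v, c - u[, an
    interval of equal length. *)
Lemma ge0_reflection (c p q : R) (g : R -> \bar R) :
  measurable_fun [set: R] g -> (forall x, 0 <= g x) ->
  \int[mu]_(x in `[(c - q)%R, (c - p)%R]) g x =
  \int[mu]_(x in `[p, q]) g (c - x)%R.
Proof.
move=> mg g0.
have mr : measurable_fun [set: R] (fun x : R => c - x)%R.
  by apply: measurable_funB => //; exact: measurable_cst.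
have mr' : measurable_fun [set: measurableTypeR R] (fun x : R => (c - x)%R : measurableTypeR R) := mr.
have [m mE] := ex_pushforward mu mr'.
have mP A : measurable A -> mu A = m A.
  move=> mA; apply: lebesgue_measure_unique => // _ [[u v] _ <-].
  rewrite -[RHS]mul1e -integral_cst// integral_mkcond mE; first last.
  - by move=> x; rewrite erestrict_ge0.
  - by apply/(measurable_restrictT _ (measurable_itv `]u, v])).
  transitivity (\int[mu]_(t in `[(c - v)%R, (c - u)%R[) cst 1 t).
    rewrite integral_cst//= mul1e !lebesgue_measure_itv/= !lte_fin ltrD2l ltrN2.
    by case: ifP => // _; rewrite -!EFinB; congr (_%:E); lra.
  rewrite [LHS]integral_mkcond; apply: eq_integral => x _; rewrite !patchE.
  congr (if _ then _ else _); apply/idP/idP; rewrite !inE/= !in_itv/= => /andP[h1 h2]; lra.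
transitivity (\int[m]_(x in `[(c - q)%R, (c - p)%R]) g x).
  by apply: eq_measure_integral => A mA _; exact: mP.
rewrite [LHS]integral_mkcond mE; first last.
- by move=> x; rewrite erestrict_ge0.
- by apply/(measurable_restrictT _ (measurable_itv `[(c - q)%R, (c - p)%R])); exact: measurable_funTS.
rewrite [RHS]integral_mkcond; apply: eq_integral => x _; rewrite !patchE.
congr (if _ then _ else _); apply/idP/idP; rewrite !inE/= !in_itv/= => /andP[h1 h2]; lra.
Qed.

Lemma substitution (F f : R -> R) (p q : R) (g : R -> \bar R) :
  (p < q)%R -> (forall x : R, is_derive x 1%R F (f x)) -> continuous f ->
  (forall x, 0 < f x)%R -> measurable_fun [set: R] g ->
  \int[mu]_(x in `[F p, F q]) g x =
  \int[mu]_(x in `[p, q]) (g (F x) * (f x)%:E).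
Proof.
move=> pq dF cf f0 mg.
rewrite integralE [RHS]integralE; congr (_ - _).
  rewrite (ge0_substitution pq dF cf f0)//; last exact: measurable_funepos.
  apply: eq_integral => x _; rewrite !funeposE.
  by rewrite maxe_pMl ?mul0e// lee_fin ltW.
rewrite (ge0_substitution pq dF cf f0)//; last exact: measurable_funeneg.
apply: eq_integral => x _; rewrite !funenegE.
by rewrite maxe_pMl ?mul0e ?mulNe// lee_fin ltW.
Qed.

Lemma reflection (c p q : R) (g : R -> \bar R) :
  measurable_fun [set: R] g ->
  \int[mu]_(x in `[(c - q)%R, (c - p)%R]) g x =
  \int[mu]_(x in `[p, q]) g (c - x)%R.
Proof.
move=> mg; rewrite integralE [RHS]integralE; congr (_ - _).
  rewrite (@ge0_reflection c p q (g^\+))//; last exact: measurable_funepos.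
  by apply: eq_integral => x _; rewrite !funeposE.
rewrite (@ge0_reflection c p q (g^\-))//; last exact: measurable_funeneg.
by apply: eq_integral => x _; rewrite !funenegE.
Qed.
End density.

(** * The integrable singularity that dominates the logarithm *)

Section invsqrt.
Context {R : realType}.
Local Notation mu := (@lebesgue_measure R).
Local Open Scope ereal_scope.

(* +oo at x = t *)
Definition isqrt_dist (t x : R) : \bar R := (Num.sqrt `|x - t|)%:E^-1.

Lemma isqrt_dist_ge0 t x : 0 <= isqrt_dist t x.
Proof. by rewrite inve_ge0 lee_fin sqrtr_ge0. Qed.

Lemma isqrt_distE t x : x != t -> isqrt_dist t x = (Num.sqrt `|x - t|)^-1%:E.
Proof.
move=> xt; rewrite /isqrt_dist inver ifF//.
by rewrite sqrtr_eq0 leNgt normr_gt0 subr_eq0 xt.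
Qed.

Lemma measurable_inver : measurable_fun [set: R] (fun x : R => x%:E^-1).
Proof.
rewrite (_ : (fun _ => _) = (fun x : R => if x == 0%R then +oo else (x^-1)%:E)); last first.
  by apply/funext => x; rewrite inver.
apply: measurable_fun_ifT => //.
  by apply: measurable_fun_eqr => //; exact: measurable_cst.
apply/measurable_EFinP.
rewrite (_ : GRing.inv = (fun x : R => Num.sg x * expR (- ln `|x|))%R); last first.
  apply/funext => x; have [->|x0] := eqVneq x 0%R; first by rewrite invr0 sgr0 mul0r.
  rewrite expRN lnK ?posrE ?normr_gt0// {1}(numEsg x) invfM; congr (_ * _)%R.
  by case: (ltgtP x 0%R) x0 => // h _; rewrite ?(ltr0_sg h) ?(gtr0_sg h) ?invrN ?invr1.
apply: measurable_funM.
  rewrite (_ : Num.sg = (fun x : R => if x == 0 then 0 else if x < 0 then -1 else 1)%R); last first.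
    by apply/funext => x; rewrite /Num.sg.
  apply: measurable_fun_ifT => //.
    by apply: measurable_fun_eqr => //; exact: measurable_cst.
  apply: measurable_fun_ifT => //; try exact: measurable_cst.
  by apply: measurable_fun_ltr => //; exact: measurable_cst.
apply: measurableT_comp; first exact: measurable_expR.
apply: measurable_funN; apply: measurableT_comp; first exact: measurable_ln.
exact: normr_measurable.
Qed.

Lemma measurable_sqrt : measurable_fun [set: R] (@Num.sqrt R).
Proof. by apply: continuous_measurable_fun; exact: sqrt_continuous. Qed.

Lemma measurable_isqrt_dist t : measurable_fun [set: R] (isqrt_dist t).
Proof.
apply: (measurableT_comp measurable_inver).
apply: measurableT_comp; first exact: measurable_sqrt.
apply: measurableT_comp; first exact: normr_measurable.
by apply: measurable_funB => //; exact: measurable_cst.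
Qed.

Lemma sqrt_subadd (x y : R) : (0 <= x)%R -> (0 <= y)%R ->
  (Num.sqrt (x + y) <= Num.sqrt x + Num.sqrt y)%R.
Proof.
move=> x0 y0; rewrite -[leRHS]ger0_norm ?addr_ge0 ?sqrtr_ge0// -sqrtr_sqr.
rewrite ler_sqrt ?sqr_ge0// sqrrD !sqr_sqrtr// -addrA lerD2l ler_wpDl//.
Qed.

(** An improper integral when t = c: on [c + 1/(n+1), d] the function 2 sqrt (x - t) is a primitive,
    and monotone convergence passes to the limit. Subadditivity of the square root removes [t] from
    the bound. *)
Lemma integral_isqrt_dist_right (t c d : R) : (t <= c)%R -> (c <= d)%R ->
  \int[mu]_(x in `[c, d]) isqrt_dist t x <= (2 * Num.sqrt (d - c))%:E.
Proof.
move=> tc; rewrite le_eqVlt => /predU1P[<-|cd].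
  by rewrite set_itv1 integral_set1 subrr sqrtr0 mulr0.
rewrite -integral_itv_obnd_cbnd; last first.
  by apply: measurable_funTS; exact: measurable_isqrt_dist.
pose F (n : nat) : set R := `[(c + n.+1%:R^-1)%R, d]%classic.
have FE : `]c, d]%classic = \bigcup_n F n.
  apply/seteqP; split => [x/=|x [n _] /=]; rewrite !in_itv/=.
    move=> /andP[cx xd]; have := cx; rewrite -subr_gt0 => /ltr_add_invr[n].
    rewrite add0r => nx; exists n => //; rewrite /F/= in_itv/= xd andbT.
    by rewrite -lerBrDl ltW.
  rewrite /F/= in_itv/= => /andP[nx ->]; rewrite andbT (lt_le_trans _ nx)//.
  by rewrite ltrDl invr_gt0 ltr0n.
rewrite FE.
have ndF : {homo F : n m / (n <= m)%N >-> (n <= m)%O}.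
  move=> n m nm; apply/subsetPset => x; rewrite /F/= !in_itv/= => /andP[nx ->].
  rewrite andbT (le_trans _ nx)// lerD2l lef_pV2 ?posrE ?ltr0n// ler_nat.
  by rewrite ltnS.
have h := @ge0_nondecreasing_set_cvg_integral _ (measurableTypeR R) R F (isqrt_dist t) mu ndF.
have {}h := h (fun i => measurable_itv _)
  (fun i => measurable_funTS (measurable_isqrt_dist t))
  (fun i x _ => isqrt_dist_ge0 t x).
rewrite -(cvg_lim _ h)//.
apply: lime_le.
  apply: ereal_nondecreasing_is_cvgn => n m nm.
  apply: ge0_subset_integral => //; try exact: measurable_itv.
  - by apply: measurable_funTS; exact: measurable_isqrt_dist.
  - by move=> x _; exact: isqrt_dist_ge0.
  - by apply/subsetPset; exact: ndF.
apply: nearW => n; rewrite /F.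
have e0 : (0 < n.+1%:R^-1 :> R)%R by rewrite invr_gt0 ltr0n.
set e := (n.+1%:R^-1)%R in e0 *.
have [dc|cd'] := leP d (c + e)%R.
  have [->|dce] : d = (c + e)%R \/ (d < c + e)%R.
    by move: dc; rewrite le_eqVlt => /predU1P[]; [left|right].
    by rewrite set_itv1 integral_set1 lee_fin mulr_ge0 ?sqrtr_ge0.
  by rewrite set_itv_ge ?integral_set0 ?lee_fin ?mulr_ge0 ?sqrtr_ge0// bnd_simp -ltNge.
pose f x : R := (Num.sqrt (x - t))^-1%R.
pose G x : R := (2 * Num.sqrt (x - t))%R.
have dG x : (t < x)%R -> is_derive x 1%R G (f x).
  move=> tx; have xt : (0 < x - t)%R by rewrite subr_gt0.
  have h1 : is_derive x 1%R (fun y : R => y - t)%R 1%R.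
    by apply: is_derive_eq; rewrite subr0.
  have h2 := is_derive1_sqrt xt.
  have h3 := @is_derive1_comp _ Num.sqrt (fun y : R => y - t)%R x _ _ h2 h1.
  have h4 : is_derive x 1%R (2 \*: (Num.sqrt \o (fun y : R => y - t)%R))%R _ :=
    @is_deriveZ _ _ _ _ _ _ _ _ h3.
  apply: is_derive_eq.
  rewrite /f /GRing.scale/= mulr1 invfM mulrA mulfV ?mul1r//.
have cf : {within `[(c + e)%R, d], continuous f}.
  apply: continuous_in_subspaceT => x; rewrite inE/= in_itv/= => /andP[cx xd].
  have xt : (0 < x - t)%R by rewrite subr_gt0 (le_lt_trans tc)// (lt_le_trans _ cx)// ltrDl.
  rewrite /continuous_at /f; apply: cvgV; first by rewrite gt_eqF// sqrtr_gt0.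
  apply: (cvg_comp (fun y : R => y - t)%R Num.sqrt); last exact: sqrt_continuous.
  by apply: cvgB; [exact: cvg_id|exact: cvg_cst].
have cG x : (t < x)%R -> {for x, continuous G}.
  by move=> tx; apply/differentiable_continuous/derivable1_diffP; have [] := dG x tx.
have tce : (t < c + e)%R by rewrite (le_lt_trans tc)// ltrDl.
rewrite (_ : \int[mu]_(x in _) _ = \int[mu]_(x in `[(c + e)%R, d]) (f x)%:E); last first.
  apply: eq_integral => x; rewrite inE/= in_itv/= => /andP[cx xd].
  have tx : (t < x)%R by rewrite (lt_le_trans tce).
  by rewrite isqrt_distE ?gt_eqF// gtr0_norm// subr_gt0.
rewrite (@continuous_FTC2 _ f G)//.
- rewrite lee_fin /G -mulrBr ler_pM2l// lerBlDr.
  rewrite (_ : d - t = (d - c) + (c - t))%R; last lra.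
  rewrite (le_trans (sqrt_subadd _ _)) ?subr_ge0 ?(ltW cd)// lerD2l.
  by rewrite ler_sqrt ?lerD2r ?lerDl ?(ltW e0)// subr_ge0 ltW.
- split.
  + move=> x; rewrite in_itv/= => /andP[cx _].
    by have [] := dG x (lt_trans tce cx).
  + by apply/cvg_at_right_filter/cG.
  + by apply/cvg_at_left_filter/cG; exact: (lt_trans tce).
- move=> x; rewrite in_itv/= => /andP[cx _].
  by rewrite derive1E; have [] := dG x (lt_trans tce cx).
Qed.

(** The bound is uniform in the position of [t], which is what makes the later estimates independent
    of the point considered. The part on the left of [t] is reflected. *)
Lemma integral_isqrt_dist (t c d : R) : (c <= d)%R ->
  \int[mu]_(x in `[c, d]) isqrt_dist t x <= (4 * Num.sqrt (d - c))%:E.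
Proof.
have lft (t' c' d' : R) : (d' <= t')%R -> (c' <= d')%R ->
  \int[mu]_(x in `[c', d']) isqrt_dist t' x <= (2 * Num.sqrt (d' - c'))%:E.
  move=> dt cd'.
  have -> : \int[mu]_(x in `[c', d']) isqrt_dist t' x =
      \int[mu]_(x in `[c', d']) isqrt_dist (- t') (0 - x)%R.
    by apply: eq_integral => x _; rewrite /isqrt_dist sub0r opprK [(_ + t')%R]addrC distrC.
  rewrite -(@reflection _ 0%R c' d' (isqrt_dist (- t')))//; last exact: measurable_isqrt_dist.
  rewrite !sub0r (le_trans (integral_isqrt_dist_right _ _)) ?lerN2//.
  by rewrite opprK addrC.
move=> cd; have le24 x y : (0 <= x)%R -> (x <= y)%R -> (2 * Num.sqrt x <= 4 * Num.sqrt y)%R.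
  move=> x0 xy; apply: ler_pM => //; rewrite ?sqrtr_ge0 ?ler_nat// ler_sqrt//.
  exact: (le_trans x0).
have [tc|ct] := leP t c.
  rewrite (le_trans (integral_isqrt_dist_right _ _))// lee_fin le24// subr_ge0//.
have [dt|td] := leP d t.
  rewrite (le_trans (lft _ _ _ _ _))// lee_fin le24// subr_ge0//.
rewrite (_ : `[c, d]%classic = `[c, t]%classic `|` `]t, d]%classic); last first.
  by rewrite (itv_bndbnd_setU (_ : _ <= BRight t)%O (_ : _ <= _)%O)// bnd_simp ltW.
rewrite ge0_integral_setU//=; first last.
- apply/eqP/seteqP; split => // x [/=]; rewrite !in_itv/= => /andP[_ xt] /andP[tx _].
  by move: (lt_le_trans tx xt); rewrite ltxx.
- by move=> x _; exact: isqrt_dist_ge0.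
- by apply: measurable_funTS; exact: measurable_isqrt_dist.
rewrite integral_itv_obnd_cbnd; last first.
  by apply: measurable_funTS; exact: measurable_isqrt_dist.
rewrite (le_trans (leeD (lft _ _ _ _ (ltW ct)) (integral_isqrt_dist_right _ (ltW td))))//.
rewrite -EFinD lee_fin.
have h1 : (Num.sqrt (t - c) <= Num.sqrt (d - c))%R by rewrite ler_sqrt ?subr_ge0//; lra.
have h2 : (Num.sqrt (d - t) <= Num.sqrt (d - c))%R by rewrite ler_sqrt ?subr_ge0//; lra.
lra.
Qed.
End invsqrt.

(** * Elementary inequalities for the sine *)

Section trig.
Context {R : realType}.
Implicit Types x y u : R.

Lemma sin_le u : 0 <= u -> sin u <= u.
Proof.
rewrite le_eqVlt => /predU1P[<-|u0]; first by rewrite sin0.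
have [c _] := @derive.MVT R sin cos 0 u u0 (fun z _ => is_derive_sin z)
  (continuous_subspaceT (@continuous_sin R)).
rewrite sin0 !subr0 => ->; rewrite -[leRHS]mul1r ler_wpM2r ?cos_le1//.
exact: ltW.
Qed.

Lemma norm_sin_le u : `|sin u| <= `|u|.
Proof.
wlog u0 : u / 0 <= u => [h|].
  have [/h//|u0] := leP 0 u.
  by rewrite -normrN -sinN -(normrN u) h// oppr_ge0 ltW.
have [u2|u2] := leP u 2; last first.
  by rewrite (le_trans (sin_max u))// ger0_norm//; lra.
rewrite (ger0_norm u0) ger0_norm ?sin_le// sin_ge0_pi// u0/= (le_trans u2)//.
exact: pi_ge2.
Qed.

Lemma cos_ge u : 1 - u ^+ 2 / 2 <= cos u.
Proof.
have -> : cos u = 1 - (sin (u / 2)) ^+ 2 *+ 2.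
  by rewrite {1}[u]splitr -mulr2n cos_mulr2n cos2sin2; lra.
rewrite lerD2l lerN2.
have : (sin (u / 2)) ^+ 2 <= (u / 2) ^+ 2.
  by rewrite -[leLHS]real_normK ?num_real// -[leRHS]real_normK ?num_real// lerXn2r ?nnegrE ?normr_ge0 ?norm_sin_le.
move=> h; rewrite -mulr_natr; rewrite expr_div_n in h; lra.
Qed.

Lemma pihalf_le2 : pi / 2 <= 2 :> R.
Proof. by have := @pihalf_lt2 R; lra. Qed.

(** A crude Jordan inequality. Up to 1 the cosine is at least 1/2; beyond 1 the sine is at least sin
    1 >= 1/2, while u <= 2. *)
Lemma sin_ge u : 0 <= u <= pi / 2 -> u / 4 <= sin u.
Proof.
move=> /andP[u0 upi].
have sin_ge1 (v : R) : 0 <= v <= 1 -> v / 2 <= sin v.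
  move=> /andP[]; rewrite le_eqVlt => /predU1P[<-|v0 v1]; first by rewrite sin0 mul0r.
  have [c] := @derive.MVT R sin cos 0 v v0 (fun z _ => is_derive_sin z)
    (continuous_subspaceT (@continuous_sin R)).
  rewrite in_itv/= sin0 !subr0 => /andP[c0 cv] ->; rewrite mulrC ler_wpM2r ?(ltW v0)//.
  have c1 : c ^+ 2 <= 1 by rewrite expr_le1 ?(ltW c0)//; lra.
  by have := cos_ge c; lra.
have [u1|u1] := leP u 1; first by have := @sin_ge1 u; rewrite u0 u1 => /(_ isT); lra.
have : sin 1 <= sin u.
  have p1 := @pihalf_ge1 R.
  rewrite leNgt ltr_sin ?in_itv/= ?upi ?p1 ?andbT -?leNgt; lra.
have := @sin_ge1 1; rewrite ler01 lexx => /(_ isT).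
have := pihalf_le2; lra.
Qed.

Lemma sinXsubX x y : sin x ^+ 2 - sin y ^+ 2 = sin (x - y) * sin (x + y).
Proof. rewrite sinB sinD; have := cos2Dsin2 x; have := cos2Dsin2 y; nra. Qed.

Lemma sin_norm_le_sinD x y : 0 <= x <= pi / 2 -> 0 <= y <= pi / 2 ->
  sin `|x - y| <= sin (x + y).
Proof.
wlog xy : x y / y <= x => [h|].
  have [/h//|/ltW yx] := leP y x.
  by move=> hx hy; rewrite distrC [x + y]addrC; exact: h.
move=> /andP[x0 xp] /andP[y0 yp]; rewrite ger0_norm ?subr_ge0// sinB sinD.
rewrite lerD2l lerNl; apply: (@le_trans _ _ 0).
  rewrite oppr_le0 mulr_ge0// ?cos_ge0_pihalf// ?sin_ge0_pi//; have := @pi_gt0 R; lra.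
rewrite mulr_ge0// ?cos_ge0_pihalf// ?sin_ge0_pi//; have := @pi_gt0 R; lra.
Qed.

(** Both factors of sin (x - y) sin (x + y) are at least sin |x - y| in modulus. The bound has to be
    quadratic, because sin^2 is critical at both ends of the quarter circle. *)
Lemma sqrsin_dist_ge x y : 0 <= x <= pi / 2 -> 0 <= y <= pi / 2 ->
  (`|x - y| / 4) ^+ 2 <= `|sin x ^+ 2 - sin y ^+ 2|.
Proof.
move=> hx hy; have hd : 0 <= `|x - y| <= pi / 2.
  rewrite normr_ge0/= ler_norml; lra.
have h1 := sin_ge hd; have h2 := sin_norm_le_sinD hx hy.
rewrite sinXsubX normrM expr2; apply: ler_pM; try by rewrite divr_ge0.
  rewrite (le_trans h1)//; have [xy|xy] := leP y x.
    by rewrite (@ger0_norm _ (x - y)) ?subr_ge0// ler_norm.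
  by rewrite (@ltr0_norm _ (x - y)) ?subr_lt0// sinN -normrN ler_norm.
by rewrite (le_trans h1)// (le_trans h2)// ler_norm.
Qed.

Lemma sin_double x : sin (2 * x) = 2 * sin x * cos x.
Proof. by rewrite mulr_natl sin_mulr2n -mulr_natr; ring. Qed.
End trig.

Section log_kernel.
Context {R : realType}.
Implicit Types x y t c : R.
Local Open Scope ereal_scope.

Lemma log_kernelE x t : x != t -> log_kernel x t = (- ln `|x - t|)%:E.
Proof.
move=> xt; have d0 : (0 < `|x - t|)%R by rewrite normr_gt0 subr_eq0.
by rewrite /log_kernel inver gt_eqF// lne_EFin ?invr_gt0// lnV.
Qed.

Lemma log_kernelxx x : log_kernel x x = +oo.
Proof. by rewrite /log_kernel subrr normr0 inve0. Qed.

Lemma log_kernel_sub x t : log_kernel x t = log_kernel (x - t)%R 0%R.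
Proof. by rewrite /log_kernel subr0. Qed.

Lemma log_kernel_ge M x t : (0 < M)%R -> (`|x - t| <= M)%R ->
  (- ln M)%:E <= log_kernel x t.
Proof.
move=> M0 xM; have [->|xt] := eqVneq x t; first by rewrite log_kernelxx leey.
by rewrite log_kernelE// lee_fin lerN2 ler_ln ?posrE// normr_gt0 subr_eq0.
Qed.

Lemma log_kernel_le m x t : (0 < m)%R -> (m <= `|x - t|)%R ->
  log_kernel x t <= (- ln m)%:E.
Proof.
move=> m0 xm; have d0 := lt_le_trans m0 xm.
have xt : x != t by rewrite -subr_eq0 -normr_gt0.
by rewrite log_kernelE// lee_fin lerN2 ler_ln.
Qed.

(** It holds at zero too: the kernel never equals -oo, so +oo absorbs the other term. *)
Lemma log_kernelM x y :
  log_kernel (x * y)%R 0%R = log_kernel x 0%R + log_kernel y 0%R.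
Proof.
have gtNy (z : R) : log_kernel z 0%R != -oo.
  by have [->|z0] := eqVneq z 0%R; rewrite ?log_kernelxx// log_kernelE.
have [->|x0] := eqVneq x 0%R.
  by rewrite mul0r log_kernelxx addye.
have [->|y0] := eqVneq y 0%R.
  by rewrite mulr0 log_kernelxx addey.
rewrite !log_kernelE ?mulf_neq0// !subr0 normrM lnM ?posrE ?normr_gt0//.
by rewrite opprD EFinD.
Qed.

Lemma measurable_log_kernel d (T : measurableType d) (f g : T -> R) :
  measurable_fun [set: T] f -> measurable_fun [set: T] g ->
  measurable_fun [set: T] (fun z => log_kernel (f z) (g z)).
Proof.
move=> mf mg.
rewrite (_ : (fun _ => _) = (fun z => if f z == g z then +oo else
    (- ln `|f z - g z|)%:E)); last first.
  by apply/funext => x; case: eqVneq => [->|fg]; rewrite ?log_kernelxx ?log_kernelE.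
apply: measurable_fun_ifT; [exact: measurable_fun_eqr|exact: measurable_cst|].
apply/measurable_EFinP; apply: measurable_funN.
apply: (measurableT_comp (@measurable_ln R)).
apply: (measurableT_comp (@normr_measurable R setT)).
exact: measurable_funB.
Qed.
End log_kernel.

(* [Num.sqrt] vanishes on negative numbers, so that the last term only
   contributes when [A] and [B] have the same sign. *)
Definition sqsum {R : realType} (A B : R) : R := `|A| + `|B| + 2 * Num.sqrt (A * B).

Section sqsum.
Context {R : realType}.
Implicit Types A B x c : R.

Lemma sqsum_ge A B : `|A| + `|B| <= sqsum A B.
Proof. by rewrite lerDl mulr_ge0 ?sqrtr_ge0. Qed.

Lemma sqsum_le A B : sqsum A B <= 2 * (`|A| + `|B|).
Proof.
rewrite /sqsum mulrDl -/(sqsum _ _) mulrDr.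
have : Num.sqrt (A * B) <= Num.sqrt (((`|A| + `|B|) / 2) ^+ 2).
  rewrite ler_sqrt ?sqr_ge0//.
  have : A * B <= `|A| * `|B| by rewrite -normrM ler_norm.
  have := sqr_ge0 (`|A| - `|B|); nra.
rewrite sqrtr_sqr ger0_norm; last by rewrite divr_ge0 ?addr_ge0.
lra.
Qed.

Lemma sqsumZ c A B : sqsum (c * A) (c * B) = `|c| * sqsum A B.
Proof.
rewrite /sqsum !normrM mulrACA -expr2 sqrtrM ?sqr_ge0// sqrtr_sqr.
ring.
Qed.

Lemma sqsum_gt0 A B : (A != 0) || (B != 0) -> 0 < sqsum A B.
Proof.
move=> AB; apply: lt_le_trans (sqsum_ge A B).
by rewrite lt_neqAle addr_ge0// andbT eq_sym paddr_eq0// !normr_eq0 negb_and.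
Qed.

(** [sqsum x (x - 1)] is the modulus of the exterior conformal map of [0, 1]. Since [0, 1] is its
    own preimage under the quadratic map T, composing with T squares this modulus. *)
Lemma sqsum_logistic x : let T := 4 * x * (1 - x) in
  sqsum T (T - 1) = sqsum x (x - 1) ^+ 2.
Proof.
move=> T; have T1 : T - 1 = - (2 * x - 1) ^+ 2 by rewrite /T; ring.
have [xx|xx] := leP (x * (x - 1)) 0.
  have x01 : 0 <= x <= 1 by apply/andP; split; nra.
  have T0 : 0 <= T by rewrite /T; nra.
  have -> : sqsum x (x - 1) = 1.
    rewrite /sqsum (ler0_sqrtr xx) mulr0 addr0 ger0_norm ?ler0_norm; lra.
  have TT : T * (T - 1) <= 0 by rewrite T1; have := sqr_ge0 (2 * x - 1); nra.
  rewrite /sqsum (ler0_sqrtr TT) mulr0 addr0 ger0_norm// T1 normrN.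
  by rewrite (ger0_norm (sqr_ge0 _)) /T; ring.
have q0 := sqrtr_ge0 (x * (x - 1)).
have qq : Num.sqrt (x * (x - 1)) ^+ 2 = x * (x - 1) by rewrite sqr_sqrtr// ltW.
have -> : sqsum x (x - 1) = `|2 * x - 1| + 2 * Num.sqrt (x * (x - 1)).
  rewrite /sqsum; congr (_ + _).
  have [x1|x0] : 1 < x \/ x < 0.
    by have [?|?] := leP x 0; [right|left]; nra.
    by rewrite !ger0_norm; lra.
  by rewrite !ltr0_norm; lra.
have TE : T = - 4 * Num.sqrt (x * (x - 1)) ^+ 2 by rewrite qq /T; ring.
have TT : T * (T - 1) = (2 * Num.sqrt (x * (x - 1)) * `|2 * x - 1|) ^+ 2.
  by rewrite T1 TE !exprMn real_normK ?num_real//; ring.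
have P0 : 0 <= 2 * Num.sqrt (x * (x - 1)) * `|2 * x - 1| by rewrite !mulr_ge0.
have TN : `|T| = 4 * Num.sqrt (x * (x - 1)) ^+ 2.
  by rewrite TE normrM normrN (ger0_norm (sqr_ge0 _)) ger0_norm.
rewrite /sqsum TT sqrtr_sqr (ger0_norm P0) TN T1 normrN (ger0_norm (sqr_ge0 _)).
rewrite -(real_normK (num_real (2 * x - 1))); ring.
Qed.
End sqsum.

Section quarter_integrals.
Context {R : realType}.
Local Notation mu := (@lebesgue_measure R).
Local Notation I := (`[0%R, (pi / 2 : R)%R]%classic).
Local Open Scope ereal_scope.

Lemma measurable_sin : measurable_fun [set: R] (@sin R).
Proof. by apply: continuous_measurable_fun; exact: continuous_sin. Qed.

Lemma measurable_cos : measurable_fun [set: R] (@cos R).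
Proof. by apply: continuous_measurable_fun; exact: continuous_cos. Qed.

Lemma measurable_sinX n : measurable_fun [set: R] (fun t => sin t ^+ n)%R.
Proof. exact: (measurable_funX n measurable_sin). Qed.

Lemma measurable_cosX n : measurable_fun [set: R] (fun t => cos t ^+ n)%R.
Proof. exact: (measurable_funX n measurable_cos). Qed.

Lemma lebesgue_measure_quarter : mu I = (pi / 2 : R)%:E.
Proof.
rewrite lebesgue_measure_itv/= lte_fin ifT ?sube0//.
by have := @pi_gt0 R; lra.
Qed.

Lemma cos_sin_pihalf (t : R) : cos (pi / 2 - t)%R = sin t.
Proof. by rewrite -cosN opprB cosBpihalf. Qed.

Lemma integral_cos2_sin2 (f : R -> \bar R) : measurable_fun [set: R] f ->
  \int[mu]_(t in I) f (cos t ^+ 2)%R = \int[mu]_(t in I) f (sin t ^+ 2)%R.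
Proof.
move=> mf.
have := @reflection R (pi / 2) 0 (pi / 2) (fun t => f (cos t ^+ 2)%R).
rewrite subrr subr0 => ->; last first.
  by apply: (measurableT_comp mf); exact: measurable_cosX.
by apply: eq_integral => t _; rewrite cos_sin_pihalf.
Qed.

(** As [t] runs over the quarter circle, 2 t runs over [0, pi]; the two halves contribute equally
    because t -> pi / 2 - t leaves sin^2 (2 t) unchanged. *)
Lemma ge0_integral_sin2_double (f : R -> \bar R) : measurable_fun [set: R] f ->
  (forall x, 0 <= f x) ->
  \int[mu]_(t in I) f (sin (2 * t) ^+ 2)%R = \int[mu]_(t in I) f (sin t ^+ 2)%R.
Proof.
move=> mf f0.
have p0 := @pi_gt0 R.
have mg : measurable_fun [set: R] (fun t => f (sin t ^+ 2)%R).
  by apply: (measurableT_comp mf); exact: measurable_sinX.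
have mg2 : measurable_fun [set: R] (fun t => f (sin (2 * t) ^+ 2)%R).
  by apply: (measurableT_comp mg); exact: mulrl_measurable.
have p4 : (0 < pi / 4 :> R)%R by lra.
have d2 (x : R) : is_derive x 1%R (fun y : R => 2 * y)%R 2%R.
  by apply: is_derive_eq; rewrite /GRing.scale/= mulr1.
have := @substitution R (fun x => 2 * x)%R (fun=> 2%R) 0%R (pi / 4)%R
  (fun t => f (sin t ^+ 2)%R) p4 d2 (fun x => cvg_cst _) (fun=> ltr0Sn _ 1) mg.
rewrite mulr0 (_ : 2 * (pi / 4) = pi / 2)%R; last lra.
move=> ->.
rewrite (_ : I = `[0%R, (pi / 4)%R]%classic `|` `](pi / 4)%R, (pi / 2)%R]%classic); last first.
  by rewrite (itv_bndbnd_setU (_ : _ <= BRight (pi / 4)%R)%O (_ : _ <= _)%O)// bnd_simp; lra.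
rewrite ge0_integral_setU//=; first last.
- apply/eqP/seteqP; split => // x [/=]; rewrite !in_itv/= => /andP[_ xt] /andP[tx _].
  by move: (lt_le_trans tx xt); rewrite ltxx.
- exact: measurable_funTS.
rewrite integral_itv_obnd_cbnd; last exact: measurable_funTS.
have := @reflection R (pi / 2)%R 0%R (pi / 4)%R (fun t => f (sin (2 * t) ^+ 2)%R) mg2.
rewrite subr0 (_ : pi / 2 - pi / 4 = pi / 4)%R; last lra.
move=> ->.
have -> : \int[mu]_(x in `[0%R, (pi / 4)%R]) f (sin (2 * (pi / 2 - x)) ^+ 2)%R =
          \int[mu]_(x in `[0%R, (pi / 4)%R]) f (sin (2 * x) ^+ 2)%R.
  apply: eq_integral => t _; congr (f (_ ^+ 2))%R.
  by rewrite (_ : 2 * (pi / 2 - t) = - (2 * t) + pi)%R ?sinDpi ?sinN ?opprK//; lra.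
rewrite ge0_integralZr//; [|exact: measurable_funTS].
by rewrite -mule2n muleC mule_natl.
Qed.

Lemma integral_sin2_double (f : R -> \bar R) : measurable_fun [set: R] f ->
  \int[mu]_(t in I) f (sin (2 * t) ^+ 2)%R = \int[mu]_(t in I) f (sin t ^+ 2)%R.
Proof.
move=> mf; rewrite integralE [RHS]integralE; congr (_ - _).
  transitivity (\int[mu]_(t in I) f^\+ (sin (2 * t) ^+ 2)%R).
    by apply: eq_integral => x _; rewrite !funeposE.
  rewrite ge0_integral_sin2_double//; last exact: measurable_funepos.
  by apply: eq_integral => x _; rewrite !funeposE.
transitivity (\int[mu]_(t in I) f^\- (sin (2 * t) ^+ 2)%R).
  by apply: eq_integral => x _; rewrite !funenegE.
rewrite ge0_integral_sin2_double//; last exact: measurable_funeneg.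
by apply: eq_integral => x _; rewrite !funenegE.
Qed.

Lemma abse_le (M y : \bar R) : - M <= y -> y <= M -> `|y| <= M.
Proof.
case: M y => [M||] [y||]//=; rewrite ?leey// ?lee_fin => h1 h2.
by rewrite ler_norml h1.
Qed.
End quarter_integrals.

(** * The logarithmic potential of the arcsine law on [0, 1] *)

Section log_sin_integral.
Context {R : realType}.
Local Notation mu := (@lebesgue_measure R).
Local Notation I := (`[0%R, (pi / 2 : R)%R]%classic).
Local Open Scope ereal_scope.
Implicit Types x y : R.

Lemma ln_le_sqrt y : (0 < y)%R -> (ln y <= 2 * Num.sqrt y)%R.
Proof.
move=> y0; have s0 : (0 < Num.sqrt y)%R by rewrite sqrtr_gt0.
have -> : ln y = (2 * ln (Num.sqrt y))%R.
  by rewrite mulr_natl -lnXn// sqr_sqrtr// ltW.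
by rewrite ler_wpM2l// ltW// ln_sublinear.
Qed.

(* |x - sin^2 t| is smallest, up to a square, at the projection of x to [0, 1] *)
Lemma ex_sin_proj x : exists2 u, (0 <= u <= pi / 2)%R &
  forall t, (0 <= t <= pi / 2)%R -> ((`|t - u| / 4) ^+ 2 <= `|x - sin t ^+ 2|)%R.
Proof.
pose y := Num.min 1%R (Num.max 0%R x).
have y01 : (0 <= y <= 1)%R by rewrite /y le_min ge_min ler01 le_max !lexx.
have s01 : (-1 <= Num.sqrt y <= 1)%R.
  rewrite (le_trans _ (sqrtr_ge0 _)) ?lerN10//= -sqrtr1 ler_sqrt//.
  by case/andP: y01.
have p0 := @pi_gt0 R.
have su : sin (asin (Num.sqrt y)) = Num.sqrt y by rewrite asinK// in_itv.
have uI : (0 <= asin (Num.sqrt y) <= pi / 2)%R.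
  rewrite asin_lepi2// andbT leNgt; apply/negP => u0.
  have := sqrtr_ge0 y; rewrite leNgt -su -[X in (_ < X)%R](@sin0 R) ltr_sin ?u0//.
    by rewrite in_itv/= asin_geNpi2// asin_lepi2.
  by rewrite in_itv/=; lra.
exists (asin (Num.sqrt y)) => // t tI; apply: (le_trans (sqrsin_dist_ge tI uI)).
rewrite su sqr_sqrtr; last by case/andP: y01.
have s0 := sqr_ge0 (sin t).
have s1 : (sin t ^+ 2 <= 1)%R by rewrite sin2cos2; have := sqr_ge0 (cos t); lra.
rewrite /y; case: (leP 0%R x) => x0; case: (leP 1%R _) => x1.
- by rewrite [leRHS]ger0_norm ?ler0_norm; lra.
- by rewrite distrC.
- lra.
- by rewrite subr0 ger0_norm// distrC ger0_norm; lra.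
Qed.

Lemma norm_add_norm1_ge1 x : (1 <= `|x| + `|x - 1|)%R.
Proof. by have := ler_norm x; have := ler_norm (1 - x)%R; rewrite distrC; lra. Qed.

Lemma sqr_sin_le1 (t : R) : (sin t ^+ 2 <= 1)%R.
Proof. by rewrite sin2cos2; have := sqr_ge0 (cos t); lra. Qed.

(** The integral of this majorant differs from that of - ln (|x| + |x - 1|) by an amount bounded
    uniformly in [x]. If M <= 5, then 2 ln (4 / |t - u|) <= 8 / sqrt |t - u| and 4 - ln M >= 0,
    because ln M <= M - 1. If M > 5, the point is far from [0, 1] and the constant term suffices. *)
Lemma log_kernel_sin_le x : exists2 u, (0 <= u <= pi / 2)%R &
  forall t, (0 <= t <= pi / 2)%R ->
  log_kernel x (sin t ^+ 2)%R <=
    (4 - ln (`|x| + `|x - 1|))%:E + 8%:E * isqrt_dist u t.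
Proof.
have M1 := norm_add_norm1_ge1 x.
set M : R := (`|x| + `|x - 1|)%R in M1 *.
have M0 : (0 < M)%R by rewrite (lt_le_trans ltr01).
have [u uI hu] := ex_sin_proj x; exists u => // t tI.
have [->|tu] := eqVneq t u.
  by rewrite /isqrt_dist subrr normr0 sqrtr0 inve0 gt0_muley// ?lte_fin// addey// leey.
have d0 : (0 < `|t - u|)%R by rewrite normr_gt0 subr_eq0.
rewrite isqrt_distE// -EFinM -EFinD.
have iq : (0 <= (Num.sqrt `|t - u|)^-1)%R by rewrite invr_ge0 sqrtr_ge0.
have s0 := sqr_ge0 (sin t); have s1 := sqr_sin_le1 t.
have [M5|M5] := leP M 5%R.
  have m0 : (0 < (`|t - u| / 4) ^+ 2)%R by rewrite exprn_gt0// divr_gt0.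
  apply: (le_trans (log_kernel_le m0 (hu t tI))); rewrite lee_fin.
  have -> : (- ln ((`|t - u| / 4) ^+ 2) = 2 * ln (4 / `|t - u|))%R.
    by rewrite lnXn ?divr_gt0// -(invf_div _ 4) lnV ?posrE ?divr_gt0// mulrN mulr_natl.
  have h1 : (ln (4 / `|t - u|) <= 2 * Num.sqrt (4 / `|t - u|))%R.
    by apply: ln_le_sqrt; rewrite divr_gt0.
  have h2 : (Num.sqrt (4 / `|t - u|) = 2 * (Num.sqrt `|t - u|)^-1)%R.
    by rewrite sqrtrM// sqrtrV// -[X in Num.sqrt X]/((2 ^ 2)%:R : R) natrX sqrtr_sqr ger0_norm.
  have h3 : (ln M <= M - 1)%R by rewrite -{1}(subrKC 1%R M) le_ln1Dx//; lra.
  by rewrite h2 in h1; lra.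
have m0 : (0 < M / 4)%R by rewrite divr_gt0.
have : (M / 4 <= `|x - sin t ^+ 2|)%R.
  rewrite /M in M5 *; have [x0|x0] := leP 0%R x; have [x1|x1] := leP 0%R (x - 1)%R;
    [| | |].
  - by move: M5; rewrite (ger0_norm x0) (ger0_norm x1) ger0_norm; lra.
  - by move: M5; rewrite (ger0_norm x0) (ltr0_norm x1); lra.
  - lra.
  - by move: M5; rewrite (ltr0_norm x0) (ltr0_norm x1) ler0_norm; lra.
move=> /(log_kernel_le m0) /le_trans; apply; rewrite lee_fin ln_div ?posrE//.
have h : (ln 4 <= 4 :> R)%R by apply/ltW/ln_sublinear.
lra.
Qed.

Lemma log_kernel_sin_ge x t : (- ln (`|x| + `|x - 1|))%:E <= log_kernel x (sin t ^+ 2)%R.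
Proof.
apply: log_kernel_ge.
  by rewrite (@lt_le_trans _ _ 1%R)// norm_add_norm1_ge1.
have -> : (x - sin t ^+ 2 = x * cos t ^+ 2 + (x - 1) * sin t ^+ 2)%R.
  by rewrite cos2sin2; ring.
rewrite (le_trans (ler_normD _ _))// normrM [X in (_ + X)%R]normrM !(ger0_norm (sqr_ge0 _)).
by apply: lerD; rewrite ler_piMr// -?sin2cos2 ?cos2sin2 ?sqr_sin_le1// lerBlDr lerDl sqr_ge0.
Qed.

Lemma integrable_isqrt_dist (u : R) : mu.-integrable I (isqrt_dist u).
Proof.
apply/integrableP; split; first by apply: measurable_funTS; exact: measurable_isqrt_dist.
under eq_integral do rewrite gee0_abs ?isqrt_dist_ge0//.
rewrite (le_lt_trans (integral_isqrt_dist _ _)) ?ltry//.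
by have := @pi_gt0 R; lra.
Qed.

Lemma measurable_log_kernel_sin x :
  measurable_fun [set: R] (fun t => log_kernel x (sin t ^+ 2)%R).
Proof. by apply: measurable_log_kernel; [exact: measurable_cst|exact: measurable_sinX]. Qed.

Lemma integrable_quarter_cst (c : R) : mu.-integrable I (cst c%:E).
Proof.
apply/integrableP; split; first exact: measurable_cst.
by rewrite integral_cst//= lebesgue_measure_quarter -EFinM ltry.
Qed.

Lemma integral_quarter_cst (c : R) : \int[mu]_(t in I) c%:E = (pi / 2 * c)%:E.
Proof.
rewrite (integral_cst _ _ c%:E)//= lebesgue_measure_quarter -EFinM mulrC//.
Qed.

Lemma integrable_log_kernel_sin x :
  mu.-integrable I (fun t => log_kernel x (sin t ^+ 2)%R).
Proof.
have [u uI h] := log_kernel_sin_le x.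
set M := (ln (`|x| + `|x - 1|))%R in h *.
have : mu.-integrable I (cst (`|4 - M| + `|M|)%:E \+ (fun t => 8%:E * isqrt_dist u t)).
  apply: integrableD => //; first exact: integrable_quarter_cst.
  by apply: integrableZl => //; exact: integrable_isqrt_dist.
apply: le_integrable => //.
  by apply: measurable_funTS; exact: measurable_log_kernel_sin.
move=> t; rewrite /= in_itv/= => tI.
have P0 : 0 <= 8%:E * isqrt_dist u t by rewrite mule_ge0// isqrt_dist_ge0.
rewrite [leRHS]gee0_abs; last first.
  by rewrite adde_ge0// lee_fin addr_ge0.
apply: abse_le.
  apply: (@le_trans _ _ (- M)%:E); last exact: log_kernel_sin_ge.
  rewrite leeNl -EFinN opprK -[leLHS]adde0 leeD// lee_fin.
  by have := ler_norm M; have := normr_ge0 (4 - M)%R; lra.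
apply: (le_trans (h t tI)); rewrite leeD2r// lee_fin.
by have := ler_norm (4 - M); have := normr_ge0 M; lra.
Qed.

Let l x : \bar R := \int[mu]_(t in I) log_kernel x (sin t ^+ 2)%R.

Let l_fin x : l x \is a fin_num.
Proof. by apply: integrable_fin_num => //; exact: integrable_log_kernel_sin. Qed.

Let ilk2 x : mu.-integrable I (fun t => log_kernel x (sin (2 * t) ^+ 2)%R).
Proof.
apply/integrableP; split.
  apply: measurable_funTS; apply: (measurableT_comp (measurable_log_kernel_sin x)).
  exact: mulrl_measurable.
rewrite (@integral_sin2_double _ (fun y => `|log_kernel x y|)); last first.
  apply: measurableT_comp; first exact: abse_measurable.
  by apply: measurable_log_kernel => //; exact: measurable_cst.
by have /integrableP[] := integrable_log_kernel_sin x.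
Qed.

Let ilkc x : mu.-integrable I (fun t => log_kernel x (cos t ^+ 2)%R).
Proof.
have := integrable_log_kernel_sin (1 - x)%R; apply: eq_integrable => //.
move=> t _; rewrite /log_kernel -normrN opprB cos2sin2.
by congr (lne (`| _ |%:E^-1)); lra.
Qed.

(** The product (x - sin^2 t) (x - cos^2 t) is -1/4 times 4 x (1 - x) - sin^2 (2 t), and both cos^2
    t and sin^2 (2 t) are distributed like sin^2 t on the quarter circle. *)
Let l_double x : l (4 * x * (1 - x))%R = (2 * fine (l x) - pi / 2 * ln 4)%:E.
Proof.
have h : 2%:E * l x = \int[mu]_(t in I) (log_kernel x (sin t ^+ 2)%R + log_kernel x (cos t ^+ 2)%R).
  rewrite integralD//=; last exact: integrable_log_kernel_sin.
  rewrite (@integral_cos2_sin2 _ (log_kernel x)); last first.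
    by apply: measurable_log_kernel => //; exact: measurable_cst.
  by rewrite -mule2n mule_natl.
have e t : log_kernel x (sin t ^+ 2)%R + log_kernel x (cos t ^+ 2)%R =
    log_kernel (4 * x * (1 - x))%R (sin (2 * t) ^+ 2)%R + (ln 4)%:E.
  rewrite log_kernel_sub [X in _ + X]log_kernel_sub -log_kernelM.
  rewrite [X in _ = X + _]log_kernel_sub.
  have -> : (4 * x * (1 - x) - sin (2 * t) ^+ 2 =
            (- 4) * ((x - sin t ^+ 2) * (x - cos t ^+ 2)))%R.
    by rewrite sin_double !exprMn cos2sin2; ring.
  have k4 : log_kernel (- 4)%R 0%R = (- ln 4 : R)%:E.
    by rewrite log_kernelE ?subr0 ?ltr0_norm ?opprK.
  by rewrite [X in _ = X + _]log_kernelM k4 addeAC -EFinD addNr add0e.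
have : 2%:E * l x = l (4 * x * (1 - x))%R + (pi / 2 * ln 4)%:E.
  rewrite h; under eq_integral do rewrite e.
  rewrite integralD; [|exact: measurable_itv|exact: ilk2|exact: integrable_quarter_cst].
  rewrite (@integral_sin2_double _ (log_kernel (4 * x * (1 - x))%R)); last first.
    by apply: measurable_log_kernel => //; exact: measurable_cst.
  by rewrite integral_quarter_cst.
rewrite -(fineK (l_fin (4 * x * (1 - x))%R)) -(fineK (l_fin x)) -EFinM -EFinD.
by move=> -[] ->; rewrite addrK.
Qed.

(** The bound 72 is 64 + 8: the singular term gives at most 8 * 4 * sqrt (pi / 2) <= 64, and the
    constant 4 integrates to at most 8. *)
Let l_bound x : (`|fine (l x) + pi / 2 * ln (sqsum x (x - 1) / 4)| <= 72)%R.
Proof.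
have p0 := @pi_gt0 R; have p2 := @pihalf_le2 R.
have M1 := norm_add_norm1_ge1 x.
set M : R := (`|x| + `|x - 1|)%R in M1 *.
have M0 : (0 < M)%R by rewrite (lt_le_trans ltr01).
have ln40 : (0 <= ln (4 : R))%R by rewrite ln_ge0// ler1n.
have ln44 : (ln (4 : R) <= 4)%R by rewrite ltW// ln_sublinear.
have lM : (0 <= ln M)%R by rewrite ln_ge0.
have G1 : (M <= sqsum x (x - 1))%R := sqsum_ge x (x - 1)%R.
have G2 : (sqsum x (x - 1) <= 2 * M)%R := sqsum_le x (x - 1)%R.
have G0 : (0 < sqsum x (x - 1))%R by rewrite (lt_le_trans M0).
have lG1 : (ln M - ln 4 <= ln (sqsum x (x - 1) / 4))%R.
  by rewrite ln_div ?posrE// lerD2r ler_ln.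
have lG2 : (ln (sqsum x (x - 1) / 4) <= ln M)%R.
  by rewrite ler_ln ?posrE ?divr_gt0//; lra.
have l1 : (- (pi / 2 * ln M) <= fine (l x))%R.
  rewrite -lee_fin fineK//.
  rewrite (_ : _%:E = \int[mu]_(t in I) (- ln M)%:E); last first.
    by rewrite integral_quarter_cst mulrN.
  apply: le_integral => //; [exact: integrable_quarter_cst|exact: integrable_log_kernel_sin|].
  by move=> t _; exact: log_kernel_sin_ge.
have l2 : (fine (l x) <= pi / 2 * (4 - ln M) + 64)%R.
  rewrite -lee_fin fineK//; have [u uI h] := log_kernel_sin_le x.
  have iq : mu.-integrable I (fun t => 8%:E * isqrt_dist u t).
    by apply: integrableZl => //; exact: integrable_isqrt_dist.
  apply: (@le_trans _ _ (\int[mu]_(t in I) ((4 - ln M)%:E + 8%:E * isqrt_dist u t))).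
    apply: le_integral => //; first exact: integrable_log_kernel_sin.
      by apply: integrableD => //; exact: integrable_quarter_cst.
    by move=> t; rewrite inE/= in_itv/= => /h.
  rewrite integralD//; last exact: integrable_quarter_cst.
  rewrite integral_quarter_cst [leRHS]EFinD leeD2l//.
  rewrite integralZl//; last exact: integrable_isqrt_dist.
  have p20 : (0 <= pi / 2 :> R)%R by lra.
  have := integral_isqrt_dist u p20.
  rewrite subr0 => h2; apply: (@le_trans _ _ (8%:E * (4 * Num.sqrt (pi / 2))%:E)).
    by rewrite lee_wpmul2l// lee_fin.
  rewrite -EFinM lee_fin.
  have : (Num.sqrt (pi / 2) <= Num.sqrt (2 ^+ 2) :> R)%R by rewrite ler_sqrt//; lra.
  by rewrite sqrtr_sqr ger0_norm//; lra.
by rewrite ler_norml; apply/andP; split; nra.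
Qed.

(** Let [d] be the defect of the formula. It doubles under x -> 4 x (1 - x), since both terms
    satisfy the same duplication law, and it is bounded by 72 everywhere. Along the orbit of [x] it
    would grow like 2^n unless it vanished at [x]. *)
Lemma integral_log_kernel_sin x :
  \int[mu]_(t in I) log_kernel x (sin t ^+ 2)%R =
  (- (pi / 2 * ln (sqsum x (x - 1) / 4)))%:E.
Proof.
rewrite -/(l x) -(fineK (l_fin x)); congr EFin; apply/eqP.
pose d y := (fine (l y) + pi / 2 * ln (sqsum y (y - 1) / 4))%R.
rewrite -subr_eq0 opprK -/(d x).
pose T y : R := (4 * y * (1 - y))%R.
have dT y : d (T y) = (2 * d y)%R.
  have G0 (z : R) : (0 < sqsum z (z - 1))%R.
    by apply: sqsum_gt0; rewrite subr_eq0; have [->|//] := eqVneq z 0%R; rewrite eq_sym oner_eq0.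
  have sq : sqsum (T y) (T y - 1) = (sqsum y (y - 1) ^+ 2)%R := sqsum_logistic y.
  rewrite /d sq l_double/= ln_div ?posrE ?exprn_gt0// ln_div ?posrE// lnXn//.
  by rewrite -[(_ *+ 2)%R]mulr_natl; ring.
have dn n : d (iter n T x) = (2 ^+ n * d x)%R.
  by elim: n => [|n ih]; rewrite ?expr0 ?mul1r// iterS dT ih exprS mulrA.
apply/negPn/negP => d0; have nd0 : (0 < `|d x|)%R by rewrite normr_gt0.
pose n := Num.bound (72 / `|d x|).
have := @upper_nthrootP R (72 / `|d x|)%R n (leqnn _).
rewrite ltr_pdivrMr// ltNge => /negP; apply.
have := l_bound (iter n T x); rewrite -/(d _) dn normrM ger0_norm//.
Qed.
End log_sin_integral.

(** * Potentials of harmonic measures of an interval *)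

Section poisson.
Context {R : realType}.
Local Notation mu := (@lebesgue_measure R).
Local Notation I := (`[0%R, (pi / 2 : R)%R]%classic).
Implicit Types x y a b lam : R.

Definition arc a b (t : R) : R := a + (b - a) * sin t ^+ 2.

Definition poisson lam (t : R) : R := lam / (lam ^+ 2 * cos t ^+ 2 + sin t ^+ 2).

(* tan t = lam * tan (poisson_angle lam t) *)
Definition poisson_angle lam (t : R) : R :=
  t + atan ((1 - lam) * sin t * cos t / (lam * cos t ^+ 2 + sin t ^+ 2)).

Lemma arc_sub a b x t : x - arc a b t = (x - a) * cos t ^+ 2 + (x - b) * sin t ^+ 2.
Proof. by rewrite /arc cos2sin2; ring. Qed.

Lemma measurable_arc a b : measurable_fun [set: R] (arc a b).
Proof.
apply: measurable_funD; first exact: measurable_cst.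
apply: (measurableT_comp (mulrl_measurable (b - a))).
exact: measurable_sinX.
Qed.

Lemma trig_comb_gt0 (u v t : R) : 0 < u -> 0 < v ->
  0 < u * cos t ^+ 2 + v * sin t ^+ 2.
Proof.
move=> u0 v0; have [c0|c0] := eqVneq (cos t) 0.
  have := cos2Dsin2 t; rewrite c0 expr0n/= add0r mulr0 add0r => ->.
  by rewrite mulr1.
apply: ltr_wpDr; first by rewrite mulr_ge0 ?sqr_ge0// ltW.
by rewrite mulr_gt0// exprn_even_gt0.
Qed.

Lemma poisson_den_gt0 lam t : 0 < lam -> 0 < lam ^+ 2 * cos t ^+ 2 + sin t ^+ 2.
Proof.
by move=> l0; rewrite -[sin t ^+ 2]mul1r trig_comb_gt0// exprn_gt0.
Qed.

Lemma poisson_gt0 lam t : 0 < lam -> 0 < poisson lam t.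
Proof. by move=> l0; rewrite divr_gt0// poisson_den_gt0. Qed.

Lemma continuous_poisson lam : 0 < lam -> continuous (poisson lam).
Proof.
move=> l0 t; apply: cvgM; first exact: cvg_cst.
apply: cvgV; first by rewrite gt_eqF// poisson_den_gt0.
apply: cvgD.
  by apply: cvgM; [exact: cvg_cst|apply: cvgM; exact: continuous_cos].
by apply: cvgM; exact: continuous_sin.
Qed.

(** The angle is [t] plus the arctangent of n / m with m > 0, so it is smooth on the whole line and
    t = pi / 2 needs no separate treatment. The denominator of [poisson] appears as m^2 + n^2. *)
Lemma poisson_angle_derive lam (t : R) : 0 < lam ->
  is_derive t 1 (poisson_angle lam) (poisson lam t).
Proof.
move=> l0.
set c := cos t; set s := sin t.
have cs : c ^+ 2 = 1 - s ^+ 2 by rewrite /c cos2sin2.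
have m0 : 0 < lam * c ^+ 2 + s ^+ 2.
  by rewrite -[s ^+ 2]mul1r trig_comb_gt0.
have d0 := poisson_den_gt0 t l0; rewrite -/c -/s in d0.
pose n := (fun u : R => (1 - lam) * sin u * cos u).
pose m := (fun u : R => lam * cos u ^+ 2 + sin u ^+ 2).
have dn : is_derive t 1 n ((1 - lam) * (c ^+ 2 - s ^+ 2)).
  have h : is_derive t 1 ((1 - lam) \*: (sin * cos : R -> R)) _ :=
    @is_deriveZ _ _ _ _ _ _ _ _ (is_deriveM (is_derive_sin t) (is_derive_cos t)).
  rewrite (_ : n = (1 - lam) \*: (sin * cos : R -> R)); last first.
    by apply/funext => u; rewrite /n /= -mulrA.
  by apply: is_derive_eq; rewrite /GRing.scale/= -/c -/s; ring.
have dm : is_derive t 1 m (2 * s * c * (1 - lam)).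
  have h : is_derive t 1 ((lam \*: (cos ^+ 2 : R -> R)) + (sin ^+ 2 : R -> R)) _ :=
    is_deriveD (@is_deriveZ _ _ _ _ _ _ _ _ (is_deriveX 2 (is_derive_cos t)))
               (is_deriveX 2 (is_derive_sin t)).
  rewrite (_ : m = lam \*: (cos ^+ 2 : R -> R) + (sin ^+ 2 : R -> R)); last first.
    by apply/funext => u; rewrite /m fctE /= !exprfctE.
  by apply: is_derive_eq; rewrite /GRing.scale/= -/c -/s; ring.
have mt : m t != 0 by rewrite gt_eqF.
have dV := is_deriveV mt dm.
have dq : is_derive t 1 (fun u => n u / m u)
   ((n t * (- m t ^- 2 * (2 * s * c * (1 - lam))) + (m t)^-1 * ((1 - lam) * (c ^+ 2 - s ^+ 2)))).
  by have := is_deriveM dn dV; apply.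
have da := @is_derive1_comp R (@atan R) (fun u => n u / m u) t _ _
  (is_derive1_atan (n t / m t)) dq.
have h : is_derive t 1 (id + (atan \o (fun u => n u / m u))) _ := is_deriveD (is_derive_id t 1) da.
have -> : poisson_angle lam = id + (atan \o (fun u => n u / m u)) by [].
apply: is_derive_eq; rewrite /poisson -/c -/s.
have cs1 : c ^+ 2 + s ^+ 2 = 1 by rewrite cs subrK.
have e : m t ^+ 2 + n t ^+ 2 = lam ^+ 2 * c ^+ 2 + s ^+ 2.
  by rewrite -[RHS]mulr1 -cs1 /m /n -/c -/s; ring.
have e0 : m t ^+ 2 + n t ^+ 2 != 0 by rewrite e gt_eqF.
have num : m t ^+ 2 + n t ^+ 2 + ((1 - lam) * (c ^+ 2 - s ^+ 2)) * m t -
    n t * (2 * s * c * (1 - lam)) = lam.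
  transitivity (lam * (c ^+ 2 + s ^+ 2) ^+ 2); last by rewrite cs1 expr1n mulr1.
  by rewrite /m /n -/c -/s; ring.
rewrite -e -[X in _ = X / _]num.
by field; rewrite e0 mt.
Qed.

(** Squares are enough, because [arc] depends on sin^2 only; this makes the substitution rational in
    cos^2 t and sin^2 t. *)
Lemma poisson_angleE lam (t : R) : 0 < lam ->
  let k := (lam ^+ 2 * cos t ^+ 2 + sin t ^+ 2)^-1 in
  cos (poisson_angle lam t) ^+ 2 = k * (lam ^+ 2 * cos t ^+ 2) /\
  sin (poisson_angle lam t) ^+ 2 = k * sin t ^+ 2.
Proof.
move=> l0 k.
set c := cos t; set s := sin t.
have cs1 : c ^+ 2 + s ^+ 2 = 1 by exact: cos2Dsin2.
set m := lam * c ^+ 2 + s ^+ 2; set n := (1 - lam) * s * c.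
have m0 : 0 < m by rewrite /m -[s ^+ 2]mul1r trig_comb_gt0.
have e : m ^+ 2 + n ^+ 2 = lam ^+ 2 * c ^+ 2 + s ^+ 2.
  by rewrite -[RHS]mulr1 -cs1 /m /n; ring.
have e0 : 0 < m ^+ 2 + n ^+ 2 by rewrite e poisson_den_gt0.
set v := atan (n / m).
have cv : cos v ^+ 2 = m ^+ 2 / (m ^+ 2 + n ^+ 2).
  rewrite /v cos_atan exprVn sqr_sqrtr ?addr_ge0 ?sqr_ge0//.
  by field; rewrite !gt_eqF.
have cv0 : cos v != 0.
  by rewrite -sqrf_eq0 cv mulf_neq0// ?invr_eq0 ?gt_eqF// exprn_gt0.
have tv : sin v = n / m * cos v by rewrite -[n / m]atanK /tan -/v divfK.
have ke : k = (m ^+ 2 + n ^+ 2)^-1 by rewrite e.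
have mn0 : m != 0 by rewrite gt_eqF.
have en0 : m ^+ 2 + n ^+ 2 != 0 by rewrite gt_eqF.
have cE : c * m - s * n = lam * c by rewrite -[RHS]mulr1 -cs1 /m /n; ring.
have sE : s * m + c * n = s by rewrite -[RHS]mulr1 -cs1 /m /n; ring.
rewrite /poisson_angle -/c -/s -/m -/n -/v cosD sinD -/c -/s tv; split.
  have -> : c * cos v - s * (n / m * cos v) = (c * m - s * n) / m * cos v by field.
  by rewrite cE exprMn cv ke; field; rewrite mn0 en0.
have -> : s * cos v + c * (n / m * cos v) = (s * m + c * n) / m * cos v by field.
by rewrite sE exprMn cv ke; field; rewrite mn0 en0.
Qed.

Local Open Scope ereal_scope.

Lemma log_kernel_trig_eq (A B t : R) : A != B ->
  log_kernel (A * cos t ^+ 2 + B * sin t ^+ 2)%R 0%R =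
  (- ln `|A - B|)%:E + log_kernel (A / (A - B))%R (sin t ^+ 2)%R.
Proof.
move=> AB; have AB0 : (A - B != 0)%R by rewrite subr_eq0.
have -> : (A * cos t ^+ 2 + B * sin t ^+ 2 = (A - B) * (A / (A - B) - sin t ^+ 2))%R.
  by rewrite cos2sin2; field.
by rewrite log_kernelM [X in X + _]log_kernelE// subr0 -log_kernel_sub.
Qed.

Lemma integrable_log_kernel_trig (A B : R) : (A != 0%R) || (B != 0%R) ->
  mu.-integrable I (fun t => log_kernel (A * cos t ^+ 2 + B * sin t ^+ 2)%R 0%R).
Proof.
move=> AB0; have [AB|AB] := eqVneq A B.
  have A0 : A != 0%R by move: AB0; rewrite -AB orbb.
  have := integrable_quarter_cst (- ln `|A|); apply: eq_integrable => //.
  by move=> t _ /=; rewrite -AB -mulrDr cos2Dsin2 mulr1 log_kernelE// subr0.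
have : mu.-integrable I (cst (- ln `|A - B|)%:E \+ (fun t => log_kernel (A / (A - B))%R (sin t ^+ 2)%R)).
  apply: integrableD => //; first exact: integrable_quarter_cst.
  exact: integrable_log_kernel_sin.
by apply: eq_integrable => // t _; rewrite log_kernel_trig_eq.
Qed.

Lemma integral_log_kernel_trig (A B : R) : (A != 0%R) || (B != 0%R) ->
  \int[mu]_(t in I) log_kernel (A * cos t ^+ 2 + B * sin t ^+ 2)%R 0%R =
  (- (pi / 2 * ln (sqsum A B / 4)))%:E.
Proof.
move=> AB0; have [AB|AB] := eqVneq A B.
  have A0 : A != 0%R by move: AB0; rewrite -AB orbb.
  transitivity (\int[mu]_(t in I) (- ln `|A|)%:E).
    apply: eq_integral => t _ /=.
    by rewrite -AB -mulrDr cos2Dsin2 mulr1 log_kernelE// subr0.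
  rewrite integral_quarter_cst -AB mulrN /sqsum -expr2 sqrtr_sqr.
  by congr (- (_ * ln _))%:E; field.
have AB' : (A - B != 0)%R by rewrite subr_eq0.
under eq_integral do rewrite log_kernel_trig_eq//.
rewrite integralD; [|exact: measurable_itv|exact: integrable_quarter_cst|exact: integrable_log_kernel_sin].
rewrite integral_quarter_cst integral_log_kernel_sin -EFinD; congr EFin.
have -> : sqsum A B = (`|A - B| * sqsum (A / (A - B)) (A / (A - B) - 1))%R.
  by rewrite -sqsumZ; congr sqsum; field.
rewrite -(mulrA `|A - B|%R) [ln (`|(A - B)%R| * _)%R]lnM ?posrE ?normr_gt0//; first ring.
apply: divr_gt0 => //; apply: sqsum_gt0.
by rewrite subr_eq0; have [->|//] := eqVneq (A / (A - B))%R 0%R; rewrite eq_sym oner_eq0.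
Qed.

(** In the variable [poisson_angle] the measure poisson dt becomes the uniform one, and x - arc
    becomes a quotient of two linear forms in cos^2 and sin^2, each covered by
    [integral_log_kernel_trig]. The constant [C] is the shift that later makes the kernel
    nonnegative. *)
Lemma integral_log_kernel_poisson a b lam x (C : R) : (a < b)%R -> (0 < lam)%R ->
  \int[mu]_(t in I) ((log_kernel x (arc a b t) + C%:E) * (poisson lam t)%:E) =
  (pi / 2 * (C - ln (sqsum (x - a) (lam ^+ 2 * (x - b)) / (1 + lam) ^+ 2)))%:E.
Proof.
move=> ab l0; have p0 : (0 < pi / 2 :> R)%R by have := @pi_gt0 R; lra.
have l20 : (0 < lam ^+ 2)%R by rewrite exprn_gt0.
pose den (t : R) : R := (1 * cos t ^+ 2 + lam ^+ 2 * sin t ^+ 2)%R.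
have den0 t : (0 < den t)%R by rewrite trig_comb_gt0.
pose k1 (t : R) := log_kernel ((x - a) * cos t ^+ 2 + (lam ^+ 2 * (x - b)) * sin t ^+ 2)%R 0%R.
pose k2 (t : R) := log_kernel (den t) 0%R.
pose g t := k1 t - k2 t + C%:E.
have k2E t : k2 t = (- ln (den t))%:E.
  by rewrite /k2 log_kernelE ?gt_eqF// subr0 gtr0_norm.
have mtrig (u v : R) : measurable_fun [set: R] (fun t : R => u * cos t ^+ 2 + v * sin t ^+ 2)%R.
  apply: measurable_funD.
    by apply: (measurableT_comp (mulrl_measurable u)); exact: measurable_cosX.
  by apply: (measurableT_comp (mulrl_measurable v)); exact: measurable_sinX.
have mg : measurable_fun [set: R] g.
  apply: emeasurable_funD; last exact: measurable_cst.
  apply: emeasurable_funB.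
    by apply: measurable_log_kernel; [exact: mtrig|exact: measurable_cst].
  by apply: measurable_log_kernel; [exact: mtrig|exact: measurable_cst].
have := @substitution R (poisson_angle lam) (poisson lam) 0%R (pi / 2)%R g p0
  (fun t => poisson_angle_derive t l0) (continuous_poisson l0)
  (fun t => poisson_gt0 t l0) mg.
have -> : poisson_angle lam 0 = 0%R.
  by rewrite /poisson_angle sin0 !(mulr0, mul0r) atan0 addr0.
have -> : poisson_angle lam (pi / 2) = (pi / 2)%R.
  by rewrite /poisson_angle cos_pihalf !(mulr0, mul0r) atan0 addr0.
have xab : ((x - a)%R != 0%R) || (lam ^+ 2 * (x - b) != 0)%R.
  rewrite mulf_eq0 (gt_eqF l20)/= !subr_eq0.
  by have [->|//] := eqVneq x a; rewrite lt_eqF.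
have l1 : (1 != 0 :> R)%R || (lam ^+ 2 != 0)%R by rewrite oner_eq0.
have ik1 := integrable_log_kernel_trig xab.
have ik2 := integrable_log_kernel_trig l1.
move=> h.
transitivity (\int[mu]_(t in I) g t).
  rewrite h; apply: eq_integral => t _; congr (_ * _); rewrite /g; congr (_ + _).
  have [hc hs] := poisson_angleE t l0.
  set k := (_)^-1%R in hc hs.
  have k0 : (0 < k)%R by rewrite invr_gt0 poisson_den_gt0.
  rewrite /k1 /k2 /den hc hs.
  have -> : (1 * (k * (lam ^+ 2 * cos t ^+ 2)) + lam ^+ 2 * (k * sin t ^+ 2) = k * lam ^+ 2)%R.
    by rewrite mul1r -[RHS]mulr1 -(cos2Dsin2 t); ring.
  have -> : ((x - a) * (k * (lam ^+ 2 * cos t ^+ 2)) +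
       lam ^+ 2 * (x - b) * (k * sin t ^+ 2) = (k * lam ^+ 2) * (x - arc a b t))%R.
    by rewrite arc_sub; ring.
  have kl : (k * lam ^+ 2 != 0)%R by rewrite mulf_neq0 ?gt_eqF.
  by rewrite log_kernelM -log_kernel_sub (log_kernelE kl) addeAC -EFinN -EFinD subrr add0e.
rewrite /g integralD; [|exact: measurable_itv|by apply: integrableB|exact: integrable_quarter_cst].
rewrite integralB//.
rewrite integral_log_kernel_trig// integral_log_kernel_trig// integral_quarter_cst.
rewrite -EFinN -!EFinD; congr EFin.
have -> : sqsum 1 (lam ^+ 2) = ((1 + lam) ^+ 2)%R.
  by rewrite /sqsum mul1r sqrtr_sqr normr1 !ger0_norm ?(ltW l0) ?(ltW l20)//; ring.
have q0 : (0 < sqsum (x - a) (lam ^+ 2 * (x - b)))%R := sqsum_gt0 xab.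
have l10 : (0 < (1 + lam) ^+ 2)%R by rewrite exprn_gt0// addr_gt0.
by rewrite !ln_div ?posrE//; ring.
Qed.
End poisson.

(** * Green functions of the complement of an interval *)

Section complex_derivative.
Context {R : realType}.
Local Notation plane := (R * R)%type.
Local Notation C := (R[i]).
Local Notation Re := (@complex.Re R).
Local Notation Im := (@complex.Im R).
Implicit Types (F G : plane -> C) (z : plane) (d e : C) (U : set plane) (n : nat).

Definition ccont F z : Prop :=
  {for z, continuous (fun w => Re (F w))} /\ {for z, continuous (fun w => Im (F w))}.

(* The Cauchy-Riemann equations are built into the partial derivatives. *)
Definition cder F d z : Prop :=
  [/\ is_derive z (axis false) (fun w => Re (F w)) (Re d),
      is_derive z (axis false) (fun w => Im (F w)) (Im d),
      is_derive z (axis true) (fun w => Re (F w)) (- Im d)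
    & is_derive z (axis true) (fun w => Im (F w)) (Re d)].

(** Complex differentiability of order [n] with continuous derivatives, each derivative being only
    asserted to exist. Closure under field operations and square roots then gives C2 regularity by
    induction, with no formula for second derivatives. *)
Fixpoint chol U n F : Prop :=
  (forall z, U z -> ccont F z) /\
  if n is m.+1 then exists2 D, (forall z, U z -> cder F (D z) z) & chol U m D
  else True.

Definition affix (z : plane) : C := Complex z.1 z.2.

Lemma ReM (x y : C) : Re (x * y) = Re x * Re y - Im x * Im y.
Proof. by case: x y => ? ? [? ?]. Qed.
Lemma ImM (x y : C) : Im (x * y) = Re x * Im y + Im x * Re y.
Proof. by case: x y => ? ? [? ?] /=; rewrite [X in _ + X]mulrC [RHS]addrC addrC [X in _ + X]mulrC. Qed.
Lemma ReD (x y : C) : Re (x + y) = Re x + Re y.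
Proof. by case: x y => ? ? [? ?]. Qed.
Lemma ImD (x y : C) : Im (x + y) = Im x + Im y.
Proof. by case: x y => ? ? [? ?]. Qed.
Lemma ReN (x : C) : Re (- x) = - Re x.
Proof. by case: x. Qed.
Lemma ImN (x : C) : Im (- x) = - Im x.
Proof. by case: x. Qed.

Definition csqnorm (x : C) : R := Re x ^+ 2 + Im x ^+ 2.

Lemma csqnorm_gt0 (x : C) : (0 < csqnorm x) = (x != 0).
Proof.
rewrite lt_neqAle addr_ge0 ?sqr_ge0// andbT eq_sym paddr_eq0 ?sqr_ge0// !sqrf_eq0.
by rewrite eq_complex.
Qed.

Lemma csqnormM (x y : C) : csqnorm (x * y) = csqnorm x * csqnorm y.
Proof. by rewrite /csqnorm ReM ImM; ring. Qed.

Lemma ReV (x : C) : Re x^-1 = Re x / csqnorm x.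
Proof. by case: x. Qed.
Lemma ImV (x : C) : Im x^-1 = - Im x / csqnorm x.
Proof. by case: x => a b /=; rewrite /csqnorm/= mulNr. Qed.

Lemma ccontD F G z : ccont F z -> ccont G z -> ccont (fun w => F w + G w) z.
Proof.
move=> [F1 F2] [G1 G2]; split.
  under [X in {for _, continuous X}]funext do rewrite ReD.
  exact: cvgD F1 G1.
under [X in {for _, continuous X}]funext do rewrite ImD.
exact: cvgD F2 G2.
Qed.

Lemma ccontN F z : ccont F z -> ccont (fun w => - F w) z.
Proof.
move=> [F1 F2]; split.
  under [X in {for _, continuous X}]funext do rewrite ReN.
  exact: cvgN F1.
under [X in {for _, continuous X}]funext do rewrite ImN.
exact: cvgN F2.
Qed.

Lemma ccontM F G z : ccont F z -> ccont G z -> ccont (fun w => F w * G w) z.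
Proof.
move=> [F1 F2] [G1 G2]; split.
  under [X in {for _, continuous X}]funext do rewrite ReM.
  by apply: cvgB; apply: cvgM.
under [X in {for _, continuous X}]funext do rewrite ImM.
by apply: cvgD; apply: cvgM.
Qed.

Lemma ccont_csqnorm F z : ccont F z -> {for z, continuous (fun w => csqnorm (F w))}.
Proof. by move=> [F1 F2]; apply: cvgD; apply: cvgM. Qed.

Lemma ccontV F z : F z != 0 -> ccont F z -> ccont (fun w => (F w)^-1) z.
Proof.
move=> Fz cF; have [F1 F2] := cF.
have cV : {for z, continuous (fun w => (csqnorm (F w))^-1)}.
  apply: cvgV; last exact: ccont_csqnorm.
  by rewrite gt_eqF// csqnorm_gt0.
split.
  under [X in {for _, continuous X}]funext do rewrite ReV.
  by apply: cvgM.
under [X in {for _, continuous X}]funext do rewrite ImV.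
by apply: cvgM => //; exact: cvgN.
Qed.

Lemma ccont_cst d z : ccont (fun=> d) z.
Proof. by split; exact: cvg_cst. Qed.

Lemma cder_cst d z : cder (fun=> d) 0 z.
Proof. by split => /=; rewrite ?oppr0; exact: is_derive_cst. Qed.

Lemma cderD F G d e z : cder F d z -> cder G e z -> cder (fun w => F w + G w) (d + e) z.
Proof.
move=> [F1 F2 F3 F4] [G1 G2 G3 G4]; rewrite /cder.
have -> : (fun w => Re (F w + G w)) = (fun w => Re (F w)) + (fun w => Re (G w)).
  by apply/funext => w; rewrite ReD.
have -> : (fun w => Im (F w + G w)) = (fun w => Im (F w)) + (fun w => Im (G w)).
  by apply/funext => w; rewrite ImD.
by rewrite ReD ImD opprD; split; exact: is_deriveD.
Qed.

Lemma cderN F d z : cder F d z -> cder (fun w => - F w) (- d) z.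
Proof.
move=> [F1 F2 F3 F4]; rewrite /cder.
have -> : (fun w => Re (- F w)) = - (fun w => Re (F w)).
  by apply/funext => w; rewrite ReN.
have -> : (fun w => Im (- F w)) = - (fun w => Im (F w)).
  by apply/funext => w; rewrite ImN.
by rewrite ReN ImN; split; exact: is_deriveN.
Qed.

Lemma cderM F G d e z : cder F d z -> cder G e z ->
  cder (fun w => F w * G w) (d * G z + F z * e) z.
Proof.
move=> [F1 F2 F3 F4] [G1 G2 G3 G4]; rewrite /cder.
have -> : (fun w => Re (F w * G w)) =
    (fun w => Re (F w)) * (fun w => Re (G w)) - (fun w => Im (F w)) * (fun w => Im (G w)).
  by apply/funext => w; rewrite ReM.
have -> : (fun w => Im (F w * G w)) =
    (fun w => Re (F w)) * (fun w => Im (G w)) + (fun w => Im (F w)) * (fun w => Re (G w)).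
  by apply/funext => w; rewrite ImM.
rewrite ReD ImD !ReM !ImM; split;
  [apply: (is_derive_eq (is_deriveB (is_deriveM F1 G1) (is_deriveM F2 G2)))|
   apply: (is_derive_eq (is_deriveD (is_deriveM F1 G2) (is_deriveM F2 G1)))|
   apply: (is_derive_eq (is_deriveB (is_deriveM F3 G3) (is_deriveM F4 G4)))|
   apply: (is_derive_eq (is_deriveD (is_deriveM F3 G4) (is_deriveM F4 G3)))];
  rewrite /GRing.scale/=;
  move: (Re (F z)) (Im (F z)) (Re (G z)) (Im (G z)) (Re d) (Im d) (Re e) (Im e);
  by move=> *; ring.
Qed.

Lemma is_derive_inv (V : normedModType R) (f : V -> R) (x v : V) (df : R) :
  f x != 0 -> is_derive x v f df ->
  is_derive x v (fun y => (f y)^-1) (- f x ^- 2 * df).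
Proof.
move=> fx [dfx <-]; split; first exact: derivableV.
by rewrite deriveV.
Qed.

Lemma cderV F d z : F z != 0 -> cder F d z -> cder (fun w => (F w)^-1) (- d / F z ^+ 2) z.
Proof.
move=> Fz [F1 F2 F3 F4].
have n0 : csqnorm (F z) != 0 by rewrite gt_eqF// csqnorm_gt0.
have dn v a b : is_derive z v (fun w => Re (F w)) a -> is_derive z v (fun w => Im (F w)) b ->
    is_derive z v (fun w => (csqnorm (F w))^-1)
      (- csqnorm (F z) ^- 2 * (2 * (Re (F z) * a + Im (F z) * b))).
  move=> h1 h2; apply: (@is_derive_inv _ (fun w => csqnorm (F w))) => //.
  have -> : (fun w => csqnorm (F w)) = (fun w => Re (F w)) * (fun w => Re (F w)) +
     (fun w => Im (F w)) * (fun w => Im (F w)) by apply/funext.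
  apply: (is_derive_eq (is_deriveD (is_deriveM h1 h1) (is_deriveM h2 h2))).
  rewrite /GRing.scale/=; move: (Re (F z)) (Im (F z)) => x y; ring.
have d1 := dn _ _ _ F1 F2; have d2 := dn _ _ _ F3 F4.
rewrite /cder.
have -> : (fun w => Re (F w)^-1) =
    (fun w => Re (F w)) * (fun w => (csqnorm (F w))^-1).
  by apply/funext => w; rewrite ReV.
have -> : (fun w => Im (F w)^-1) =
    - ((fun w => Im (F w)) * (fun w => (csqnorm (F w))^-1)).
  by apply/funext => w; rewrite ImV mulNr.
split; [apply: (is_derive_eq (is_deriveM F1 d1))|
  apply: (is_derive_eq (is_deriveN (is_deriveM F2 d1)))|
  apply: (is_derive_eq (is_deriveM F3 d2))|
  apply: (is_derive_eq (is_deriveN (is_deriveM F4 d2)))];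
  rewrite /GRing.scale/= (expr2 (F z)) !(ReM, ImM, ReV, ImV, ReN, ImN, csqnormM);
  move: n0; rewrite /csqnorm;
  move: (Re (F z)) (Im (F z)) (Re d) (Im d) => a b c e n0; field; exact: n0.
Qed.

Lemma chol_cont U n F z : chol U n F -> U z -> ccont F z.
Proof. by case: n => [|n] [h _]; exact: h. Qed.

Lemma cholW U n F : chol U n.+1 F -> chol U n F.
Proof.
elim: n F => [F [] //|n ih F [cF [D FD Dn]]]; split => //.
by exists D => //; exact: ih.
Qed.

Lemma chol_cst U n d : chol U n (fun=> d).
Proof.
elim: n d => [|n ih] d; split => //; try by move=> *; exact: ccont_cst.
by exists (fun=> 0) => // z _; exact: cder_cst.
Qed.

Lemma cholD U n F G : chol U n F -> chol U n G -> chol U n (fun w => F w + G w).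
Proof.
elim: n F G => [|n ih] F G [cF FD] [cG GE]; split => //;
  try by move=> z Uz; apply: ccontD; [exact: cF|exact: cG].
case: FD GE => D FD Dn [E GE En].
exists (fun z => D z + E z); last exact: ih.
by move=> z Uz; apply: cderD; [exact: FD|exact: GE].
Qed.

Lemma cholN U n F : chol U n F -> chol U n (fun w => - F w).
Proof.
elim: n F => [|n ih] F [cF FD]; split => //;
  try by move=> z Uz; apply: ccontN; exact: cF.
case: FD => D FD Dn.
exists (fun z => - D z); last exact: ih.
by move=> z Uz; apply: cderN; exact: FD.
Qed.

Lemma cholM U n F G : chol U n F -> chol U n G -> chol U n (fun w => F w * G w).
Proof.
elim: n F G => [|n ih] F G HF HG.
  by split => // z Uz; apply: ccontM; [exact: (chol_cont HF Uz)|exact: (chol_cont HG Uz)].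
have := HF => -[cF [D FD Dn]]; have := HG => -[cG [E GE En]].
split; first by move=> z Uz; apply: ccontM; [exact: cF|exact: cG].
exists (fun z => D z * G z + F z * E z).
  by move=> z Uz; apply: cderM; [exact: FD|exact: GE].
by apply: cholD; apply: ih => //; exact: cholW.
Qed.

Lemma cholV U n F : (forall z, U z -> F z != 0) -> chol U n F ->
  chol U n (fun w => (F w)^-1).
Proof.
move=> F0; elim: n => [|n ih] HF.
  split => // z Uz; apply: ccontV; [exact: F0|exact: (chol_cont HF Uz)].
have := HF => -[cF [D FD Dn]].
split; first by move=> z Uz; apply: ccontV; [exact: F0|exact: cF].
exists (fun z => - D z * ((F z)^-1 * (F z)^-1)).
  by move=> z Uz; rewrite -expr2 exprVn; apply: cderV; [exact: F0|exact: FD].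
have h := ih (cholW HF).
by apply: cholM; [exact: cholN|exact: cholM].
Qed.

Lemma is_derive_axis_coord (i : bool) z :
  is_derive z (axis i) (fun w : plane => w.1) (~~ i)%:R /\
  is_derive z (axis i) (fun w : plane => w.2) i%:R.
Proof.
have cv (f : plane -> R) (d : R) : (forall h w, f (h *: axis i + w) = h * d + f w) ->
    is_derive z (axis i) f d.
  move=> fE.
  suff : (h^-1 *: ((f \o shift z) (h *: axis i) - f z)) @[h --> (0:R)^'] --> d.
    by move=> h; split; [apply/cvg_ex; exists d|exact/cvg_lim].
  apply: (@cvg_trans _ (d @[_ --> (0:R)^'])); last exact: cvg_cst.
  apply: near_eq_cvg; near=> h.
  rewrite /= fE addrK /GRing.scale/= mulrA mulVf ?mul1r//.
  by near: h; exact: nbhs_dnbhs_neq.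
by split; apply: cv => h [w1 w2] /=; case: i => //=; rewrite /GRing.scale/= ?mulr0 ?mulr1.
Unshelve. all: by end_near. Qed.

Lemma chol_affix U n : chol U n affix.
Proof.
have cA z : ccont affix z by split; [exact: cvg_fst|exact: cvg_snd].
case: n => [|n]; split => //.
exists (fun=> 1); last exact: chol_cst.
move=> z _; have [h1 h2] := is_derive_axis_coord false z.
by have [h3 h4] := is_derive_axis_coord true z; split => //=; rewrite oppr0.
Qed.

End complex_derivative.

(** * Directional derivatives as derivatives in one variable *)

Section slice.
Context {R : realType}.

Lemma is_derive_slice (V : normedModType R) (f : V -> R) (z e : V) (d : R) :
  is_derive z e f d <-> is_derive (0:R) 1 (fun t : R => f (t *: e + z)) d.
Proof.
have E : (fun h : R => h^-1 *: (((fun t : R => f (t *: e + z)) \o shift 0) (h *: (1:R)) -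
      (fun t : R => f (t *: e + z)) 0)) =
    (fun h => h^-1 *: ((f \o shift z) (h *: e) - f z)).
  by apply/funext => h /=; rewrite scale0r add0r addr0 [h *: 1]mulr1.
by split=> -[dz <-]; split; move: dz; rewrite /derivable /derive ?E.
Qed.

Lemma is_derive_comp1 (V : normedModType R) (f : V -> R) (g : R -> R) (z e : V) (d c : R) :
  is_derive (f z) 1 g c -> is_derive z e f d -> is_derive z e (fun w => g (f w)) (c * d).
Proof.
move=> gc /is_derive_slice fd; apply/is_derive_slice.
apply: (@is_derive1_comp _ g (fun t : R => f (t *: e + z))) => //.
by rewrite scale0r add0r.
Qed.

Lemma is_derive_shift (V : normedModType R) (f : V -> R) (z e : V) (t d : R) :
  is_derive (t *: e + z) e f d -> is_derive t 1 (fun s : R => f (s *: e + z)) d.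
Proof.
move=> /is_derive_slice h.
have E : (fun s : R => f (s *: e + z)) = (fun u => f (u *: e + (t *: e + z))) \o (fun s : R => s - t).
  by apply/funext => s /=; rewrite addrA -scalerDl subrK.
rewrite E -[d]mulr1; apply: is_derive1_comp; first by rewrite subrr.
by apply: (is_derive_eq (is_deriveB (is_derive_id _ _) (is_derive_cst _ _ _))); rewrite subr0.
Qed.

End slice.

(** * The principal square root *)

Section csqrt.
Context {R : realType}.
Local Notation plane := (R * R)%type.
Local Notation C := (R[i]).
Local Notation Re := (@complex.Re R).
Local Notation Im := (@complex.Im R).
Implicit Types (F G : plane -> C) (z : plane) (d e : C) (U : set plane) (n : nat).

(** The real part of the principal branch, from |w| = x^2 + y^2 and Re w = x^2 - y^2 for a root x +
    i y. It is positive exactly off the cut ]-oo, 0], where dividing by it makes sense. *)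
Definition csqrt_re (w : C) : R := Num.sqrt ((Num.sqrt (csqnorm w) + Re w) / 2).
Definition csqrt (w : C) : C := Complex (csqrt_re w) (Im w / (2 * csqrt_re w)).
Definition cslit (w : C) : Prop := 0 < Re w \/ Im w != 0.

Lemma cslit_gt0 (w : C) : cslit w -> 0 < Num.sqrt (csqnorm w) + Re w.
Proof.
case=> h.
  by rewrite ltr_wpDl// sqrtr_ge0.
have : `|Re w| < Num.sqrt (csqnorm w).
  rewrite -sqrtr_sqr ltr_sqrt ?ltrDl ?exprn_even_gt0//.
  by rewrite /csqnorm ltr_wpDl ?sqr_ge0// exprn_even_gt0.
by rewrite ltr_norml => /andP[+ _]; rewrite -subr_gt0 opprK addrC.
Qed.

Lemma csqrt_re_gt0 (w : C) : cslit w -> 0 < csqrt_re w.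
Proof. by move=> /cslit_gt0 h; rewrite sqrtr_gt0 divr_gt0. Qed.

Lemma csqrtK (w : C) : cslit w -> csqrt w * csqrt w = w.
Proof.
move=> hw; have v0 := csqrt_re_gt0 hw.
have v2 : csqrt_re w * csqrt_re w = (Num.sqrt (csqnorm w) + Re w) / 2.
  by rewrite -expr2 sqr_sqrtr// ltW// divr_gt0// cslit_gt0.
have n2 : Num.sqrt (csqnorm w) ^+ 2 = csqnorm w.
  by rewrite sqr_sqrtr// addr_ge0 ?sqr_ge0.
have {n2}n2 : (Num.sqrt (csqnorm w) + Re w) * (Num.sqrt (csqnorm w) - Re w) = Im w ^+ 2.
  by rewrite mulrC -subr_sqr n2 /csqnorm; ring.
have := cslit_gt0 hw.
case: w {hw} v0 v2 n2 => x y /= v0 v2 n2 n0.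
apply/eqP; rewrite eq_complex/=; apply/andP; split; apply/eqP; last by field; rewrite gt_eqF.
have -> : y / (2 * csqrt_re (x +i* y)%C) * (y / (2 * csqrt_re (x +i* y)%C)) =
   y ^+ 2 / (4 * (csqrt_re (x +i* y)%C * csqrt_re (x +i* y)%C)).
  by field; rewrite gt_eqF.
rewrite v2 -n2; move: n0; move: (Num.sqrt _) => s s0; field; rewrite gt_eqF//.
Qed.

Lemma csqrt_neq0 (w : C) : cslit w -> csqrt w != 0.
Proof. by move=> /csqrt_re_gt0 h; rewrite eq_complex/= gt_eqF. Qed.

Lemma ccont_csqrt F z : cslit (F z) -> ccont F z -> ccont (fun w => csqrt (F w)) z.
Proof.
move=> sF cF; have [F1 F2] := cF.
have c1 : {for z, continuous (fun w => csqrt_re (F w))}.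
  apply: (continuous_comp (f := fun w => (Num.sqrt (csqnorm (F w)) + Re (F w)) / 2)); last exact: sqrt_continuous.
  apply: cvgM; last exact: cvg_cst.
  apply: cvgD => //.
  by apply: (continuous_comp (ccont_csqnorm cF)); exact: sqrt_continuous.
split => //=; apply: cvgM => //; apply: cvgV; first by rewrite mulf_neq0// gt_eqF// csqrt_re_gt0.
by apply: cvgM => //; exact: cvg_cst.
Qed.

Lemma is_derive_csqrt F z (e : plane) (p q : R) : cslit (F z) ->
  is_derive z e (fun w => Re (F w)) p -> is_derive z e (fun w => Im (F w)) q ->
  is_derive z e (fun w => Re (csqrt (F w))) (Re (Complex p q / (csqrt (F z) * 2))) /\
  is_derive z e (fun w => Im (csqrt (F w))) (Im (Complex p q / (csqrt (F z) * 2))).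
Proof.
move=> sF hp hq.
have v0 := csqrt_re_gt0 sF.
have FE := csqrtK sF.
have dn : is_derive z e (fun w => csqnorm (F w)) (2 * (Re (F z) * p + Im (F z) * q)).
  have -> : (fun w => csqnorm (F w)) = (fun w => Re (F w)) * (fun w => Re (F w)) +
     (fun w => Im (F w)) * (fun w => Im (F w)) by apply/funext.
  apply: (is_derive_eq (is_deriveD (is_deriveM hp hp) (is_deriveM hq hq))).
  rewrite /GRing.scale/=; move: (Re (F z)) (Im (F z)) => x y; ring.
pose x := csqrt_re (F z).
have {}v0 : 0 < x := v0.
pose y := Im (F z) / (2 * x).
have ReE : Re (F z) = x * x - y * y by rewrite -[in LHS]FE ReM.
have ImE : Im (F z) = 2 * (x * y) by rewrite /y; field; rewrite gt_eqF.
have n0 : 0 < csqnorm (F z) by rewrite -FE csqnorm_gt0 mulf_neq0 ?csqrt_neq0.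
have nE : Num.sqrt (csqnorm (F z)) = csqnorm (csqrt (F z)).
  rewrite -{1}FE csqnormM -expr2 sqrtr_sqr ger0_norm//.
  by rewrite addr_ge0 ?sqr_ge0.
have n1 : 0 < csqnorm (csqrt (F z)) by rewrite csqnorm_gt0 csqrt_neq0.
have csE : csqnorm (csqrt (F z)) = x ^+ 2 + y ^+ 2 by [].
have n1' : x ^+ 2 + y ^+ 2 != 0 by rewrite -csE gt_eqF.
have ds := is_derive_comp1 (f := fun w => csqnorm (F w)) (is_derive1_sqrt n0) dn.
have d1 : is_derive z e (fun w => csqrt_re (F w))
    (Re (Complex p q / (csqrt (F z) * 2))).
  have h0 : 0 < (Num.sqrt (csqnorm (F z)) + Re (F z)) / 2 by rewrite divr_gt0 ?cslit_gt0.
  have H := is_derive_comp1 (f := fun w => (Num.sqrt (csqnorm (F w)) + Re (F w)) * 2^-1)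
    (is_derive1_sqrt h0) (is_deriveM (is_deriveD ds hp) (is_derive_cst (2^-1 : R) z e)).
  apply: (is_derive_eq H).
  rewrite -/(csqrt_re (F z)) nE !(ReM,ImM,ReV,ImV,csqnormM) /GRing.scale/= ReE ImE.
  rewrite mulr0 add0r csE -/x; have -> : csqnorm (2 : C) = 4 by rewrite /csqnorm/=; ring.
  by field; rewrite n1' gt_eqF.
split => //.
have x2 : 2 * csqrt_re (F z) != 0 by rewrite gt_eqF// mulr_gt0.
apply: (is_derive_eq (is_deriveM hq
  (is_derive_inv (f := fun w => 2 * csqrt_re (F w)) x2 (is_deriveM (is_derive_cst (2:R) z e) d1)))).
rewrite !(ReM,ImM,ReV,ImV,csqnormM) /GRing.scale/= ImE.
rewrite mulr0 addr0 csE -/x; have -> : csqnorm (2 : C) = 4 by rewrite /csqnorm/=; ring.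
by field; rewrite n1' gt_eqF.
Qed.

End csqrt.

(** * The second derivative test at a local maximum *)

Section second_derivative_test.
Context {R : realType}.

Lemma near_line (V : normedModType R) (P : set V) (z e : V) :
  (\near z, P z) -> \forall t \near (0:R), P (t *: e + z).
Proof.
move=> hP.
have : (fun t : R => t *: e + z) @ (0:R) --> z.
  rewrite -[X in _ --> X]add0r -[X in X + _](scale0r e).
  by apply: cvgD; [apply: cvgZr_tmp; exact: cvg_id|exact: cvg_cst].
by apply.
Qed.

Lemma local_max_second_derive (V : normedModType R) (f : V -> R) (z e : V) :
  (\forall w \near z, derivable f w e) -> derivable ('D_e f) z e ->
  (\forall w \near z, f w <= f z) -> 'D_e ('D_e f) z <= 0.
Proof.
move=> df d2 mx; rewrite leNgt; apply/negP => pos.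
pose g (t : R) := f (t *: e + z); pose g' (t : R) : R := 'D_e f (t *: e + z).
have [r r0 hr] : exists2 r : R, 0 < r & forall t : R, `|t| < r ->
    is_derive t 1 g (g' t) /\ g t <= g 0.
  have /nbhs_ballP[r r0 hr] : \forall t \near (0:R), is_derive (t : R) 1 g (g' t) /\ g t <= g 0.
    have dm : \forall w \near z, derivable f w e /\ f w <= f z by near do split.
    have := near_line e dm.
    apply: filterS => t [d m]; split; last by rewrite /g scale0r add0r.
    by apply: is_derive_shift; exact: derivableP.
  by exists r => // t tr; apply: hr; rewrite /ball/= sub0r normrN.
have g'0 : g' 0 = 0.
  have [h _] := hr 0 ltac:(by rewrite normr0).
  have h0 : is_derive (0:R) 1 g 0.
    have rr : - r <= r by rewrite -subr_ge0 opprK addr_ge0// ltW.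
    have r00 : (0:R) \in `]- r, r[ by rewrite in_itv/= oppr_lt0 r0.
    have hi (t : R) : t \in `]- r, r[ -> is_derive t 1 g (g' t) /\ g t <= g 0.
      by rewrite in_itv/= -ltr_norml; exact: hr.
    have d1 (t : R) : t \in `]- r, r[ -> derivable g t 1 by move=> /hi[[]].
    have d3 (t : R) : t \in `]- r, r[ -> g t <= g 0 by move=> /hi[].
    exact: derive1_at_max rr d1 r00 d3.
  by rewrite -(derive_val (is_derive := h)) (derive_val (is_derive := h0)).
have /is_derive_slice h2 : is_derive z e ('D_e f) ('D_e ('D_e f) z) := derivableP d2.
have : \forall t \near (0:R)^'+, 0 < g' t.
  have [dg' dg'E] : is_derive (0:R) 1 g' ('D_e ('D_e f) z) := h2.
  have : (h^-1 *: ((g' \o shift 0) (h *: (1:R)) - g' 0)) @[h --> (0:R)^'] --> 'D_e ('D_e f) z.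
    by rewrite -dg'E.
  move=> /(cvgr_gt _) /(_ _ pos) /=; rewrite near_withinE => hh.
  rewrite near_withinE; apply: filterS hh => t ht t0.
  have := ht (lt0r_neq0 t0); rewrite g'0 subr0 [t *: 1]mulr1 addr0.
  have ti : 0 < t^-1 by rewrite invr_gt0.
  by rewrite -(pmulr_rgt0 (g' t) ti).
rewrite near_withinE => /nbhs_ballP[s s0 hs].
pose t := Num.min r s / 2.
have t0 : 0 < t by rewrite divr_gt0// lt_min r0.
have tr : t < r by rewrite /t ltr_pdivrMr// gt_min ltr_pMr// ltr1n.
have ts : t < s by rewrite /t ltr_pdivrMr// gt_min [in X in _ || X]ltr_pMr// ltr1n orbT.
have [c /[!in_itv]/= /andP[c0 ct] gE] : exists2 c, c \in `]0, t[ & g t - g 0 = g' c * (t - 0).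
  apply: (@derive.MVT _ g g') => //.
    by move=> c; rewrite in_itv/= => /andP[c0 ct]; apply: (hr _ _).1; rewrite gtr0_norm// (lt_trans ct).
  apply: derivable_within_continuous => c; rewrite in_itv/= => /andP[c0 ct].
  by have [] := (hr c ltac:(by rewrite ger0_norm// (le_lt_trans ct))).1.
have [_] := hr t ltac:(by rewrite gtr0_norm).
rewrite leNgt => /negP; apply; rewrite -subr_gt0 gE subr0 mulr_gt0//.
by apply: hs => //; rewrite /ball/= sub0r normrN gtr0_norm// (lt_trans ct).
Unshelve. all: by end_near. Qed.

End second_derivative_test.

(** * Harmonic functions with a holomorphic gradient *)

Section harmonic.
Context {R : realType}.
Local Notation plane := (R * R)%type.
Local Notation C := (R[i]).
Local Notation Re := (@complex.Re R).
Local Notation Im := (@complex.Im R).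
Implicit Types (F G : plane -> C) (h : plane -> R) (z : plane) (d e : C) (U : set plane) (n : nat).

Lemma chol_csqrt U n F : (forall z, U z -> cslit (F z)) -> chol U n F ->
  chol U n (fun w => csqrt (F w)).
Proof.
move=> F0; elim: n => [|n ih] HF.
  by split => // z Uz; apply: ccont_csqrt; [exact: F0|exact: (chol_cont HF Uz)].
have := HF => -[cF [D FD Dn]].
split; first by move=> z Uz; apply: ccont_csqrt; [exact: F0|exact: cF].
exists (fun z => D z * (csqrt (F z) * 2)^-1).
  move=> z Uz; have [F1 F2 F3 F4] := FD z Uz.
  have [h1 h2] := is_derive_csqrt (F0 z Uz) F1 F2.
  have [h3 h4] := is_derive_csqrt (F0 z Uz) F3 F4.
  have iE : (- Im (D z) +i* Re (D z))%C = Complex 0 1 * D z.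
    by apply/eqP; rewrite eq_complex; case: (D z) => x y /=; rewrite !mul0r !mul1r sub0r add0r !eqxx.
  have E : (Re (D z) +i* Im (D z))%C = D z by case: (D z).
  rewrite E in h1 h2; rewrite iE -mulrA in h3 h4.
  split => //.
    by apply: (is_derive_eq h3); rewrite ReM/= mul0r mul1r sub0r.
  by apply: (is_derive_eq h4); rewrite ImM/= mul0r mul1r add0r.
apply: cholM => //; apply: cholV.
  by move=> z Uz; rewrite mulf_neq0 ?csqrt_neq0 ?pnatr_eq0//; exact: F0.
by apply: cholM; [apply: ih; exact: cholW|exact: chol_cst].
Qed.

(** [psi] is the complex gradient h_x - i h_y, which is holomorphic for harmonic [h]; hence the
    minus sign in the second coordinate. *)
Definition is_gradient h (psi : C) z : Prop :=
  [/\ {for z, continuous h}, is_derive z (axis false) h (Re psi) &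
      is_derive z (axis true) h (- Im psi)].

(** Here ln (csqnorm F) / 2 is log |F|, locally the real part of a logarithm of [F], whose
    derivative is F' / F. *)
Lemma is_gradient_log F d z : F z != 0 -> ccont F z -> cder F d z ->
  is_gradient (fun w => ln (csqnorm (F w)) / 2) (d / F z) z.
Proof.
move=> Fz cF [F1 F2 F3 F4].
have n0 : 0 < csqnorm (F z) by rewrite csqnorm_gt0.
have dl (e : plane) (p q : R) : is_derive z e (fun w => Re (F w)) p ->
    is_derive z e (fun w => Im (F w)) q ->
    is_derive z e (fun w => ln (csqnorm (F w)) / 2)
      ((Re (F z) * p + Im (F z) * q) / csqnorm (F z)).
  move=> hp hq.
  have dn : is_derive z e (fun w => csqnorm (F w)) (2 * (Re (F z) * p + Im (F z) * q)).
    have -> : (fun w => csqnorm (F w)) = (fun w => Re (F w)) * (fun w => Re (F w)) +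
       (fun w => Im (F w)) * (fun w => Im (F w)) by apply/funext.
    apply: (is_derive_eq (is_deriveD (is_deriveM hp hp) (is_deriveM hq hq))).
    rewrite /GRing.scale/=; move: (Re (F z)) (Im (F z)) => x y; ring.
  have dln := is_derive_comp1 (f := fun w => csqnorm (F w)) (is_derive1_ln n0) dn.
  apply: (is_derive_eq (is_deriveM dln (is_derive_cst (2^-1 : R) z e))).
  rewrite /GRing.scale/= mulr0 add0r.
  move: n0 (Re (F z)) (Im (F z)); move: (csqnorm _) => n n0 x y.
  by field; rewrite gt_eqF.
split.
- apply: cvgM; last exact: cvg_cst.
  by apply: (continuous_comp (ccont_csqnorm cF)); exact: continuous_ln.
- by apply: (is_derive_eq (dl _ _ _ F1 F2)); rewrite ReM ReV ImV; ring.
- by apply: (is_derive_eq (dl _ _ _ F3 F4)); rewrite ImM ReV ImV; ring.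
Qed.

Lemma is_gradientB h1 h2 d e z : is_gradient h1 d z -> is_gradient h2 e z ->
  is_gradient (fun w => h1 w - h2 w) (d - e) z.
Proof.
move=> [c1 x1 y1] [c2 x2 y2]; split; first exact: cvgB c1 c2.
- by apply: (is_derive_eq (is_deriveB x1 x2)); rewrite ReD ReN.
- by apply: (is_derive_eq (is_deriveB y1 y2)); rewrite ImD ImN opprD.
Qed.

Lemma near_is_gradient h1 h2 d z : (\forall w \near z, h1 w = h2 w) ->
  is_gradient h1 d z -> is_gradient h2 d z.
Proof.
move=> n12 [c1 x1 y1]; split.
- rewrite /prop_for /continuous_at -(nbhs_singleton n12).
  by apply: cvg_trans c1; apply: near_eq_cvg; apply: filterS n12.
- exact: near_eq_is_derive x1.
- exact: near_eq_is_derive y1.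
Qed.

(** The Cauchy-Riemann equations for [psi] give h_xx = - h_yy, and continuity of its derivative
    gives C2. Working with the gradient avoids a harmonic conjugate, hence a single-valued
    logarithm. *)
Lemma harmonic_on_gradient U h psi : open U -> (forall z, U z -> is_gradient h (psi z) z) ->
  chol U 1 psi -> harmonic_on U h.
Proof.
move=> oU grad [cp [D pD [cD _]]].
have nU z : U z -> \forall w \near z, U w by move=> Uz; exact: open_nbhs_nbhs.
pose g (i : bool) z := if i then - Im (psi z) else Re (psi z).
pose gg (i j : bool) z := if i then (if j then - Re (D z) else - Im (D z))
  else (if j then - Im (D z) else Re (D z)).
have dh i z : U z -> is_derive z (axis i) h (g i z).
  by move=> Uz; have [_ hx hy] := grad z Uz; case: i.
have cg i z : U z -> {for z, continuous (g i)}.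
  by move=> Uz; have [c1 c2] := cp z Uz; case: i => //; exact: cvgN c2.
have dg i j z : U z -> is_derive z (axis j) (g i) (gg i j z).
  move=> Uz; have [p1 p2 p3 p4] := pD z Uz; case: i j => -[] //=;
  exact: is_deriveN.
have cgg i j z : U z -> {for z, continuous (gg i j)}.
  by move=> Uz; have [c1 c2] := cD z Uz; case: i j => -[] /=;
    [exact: cvgN c1|exact: cvgN c2|exact: cvgN c2|exact: c1].
have D1 i z : U z -> \forall w \near z, g i w = 'D_(axis i) h w.
  by move=> Uz; apply: filterS (nU z Uz) => w Uw; rewrite (derive_val (is_derive := dh i w Uw)).
have dD i j z : U z -> is_derive z (axis j) ('D_(axis i) h) (gg i j z).
  by move=> Uz; apply: near_eq_is_derive (dg i j z Uz); exact: D1.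
have D2 i j z : U z -> \forall w \near z, gg i j w = 'D_(axis j) ('D_(axis i) h) w.
  by move=> Uz; apply: filterS (nU z Uz) => w Uw; rewrite (derive_val (is_derive := dD i j w Uw)).
have nc (u v : plane -> R) z : (\forall w \near z, u w = v w) -> {for z, continuous u} ->
    {for z, continuous v}.
  move=> uv cu; rewrite /prop_for /continuous_at -(nbhs_singleton uv).
  by apply: cvg_trans cu; apply: near_eq_cvg; apply: filterS uv.
split=> [z Uz|z Uz].
  split; first by have [] := grad z Uz.
  - by move=> i; split; [case: (dh i z Uz)|exact: nc (D1 i z Uz) (cg i z Uz)].
  - by move=> i j; split; [case: (dD i j z Uz)|exact: nc (D2 i j z Uz) (cgg i j z Uz)].
rewrite (eq_bigr (fun i => gg i i z)); last first.
  by move=> i _; rewrite (nbhs_singleton (D2 i i z Uz)).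
by rewrite big_bool/= addNr.
Qed.

End harmonic.

(** * The Euclidean modulus of the plane *)

Section modulus.
Context {R : realType}.
Local Notation plane := (R * R)%type.
Implicit Types (z w : plane).

Lemma modulus_ge0 z : 0 <= modulus z.
Proof. exact: sqrtr_ge0. Qed.

Lemma sqr_modulus z : modulus z ^+ 2 = z.1 ^+ 2 + z.2 ^+ 2.
Proof. by rewrite sqr_sqrtr// addr_ge0 ?sqr_ge0. Qed.

Lemma modulusN z : modulus (- z) = modulus z.
Proof. by rewrite /modulus/= !sqrrN. Qed.

Lemma modulus_real_pt (c : R) : modulus (real_pt c) = `|c|.
Proof. by rewrite /modulus/= expr0n addr0 sqrtr_sqr. Qed.

Lemma ler_modulusD z w : modulus (z + w) <= modulus z + modulus w.
Proof.
rewrite -(@ler_pXn2r _ 2)// ?nnegrE ?addr_ge0 ?modulus_ge0//.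
rewrite sqrrD !sqr_modulus/=.
suff : z.1 * w.1 + z.2 * w.2 <= modulus z * modulus w by rewrite -mulr_natl; lra.
apply: (le_trans (ler_norm _)).
rewrite -(@ler_pXn2r _ 2)// ?nnegrE ?mulr_ge0 ?modulus_ge0//.
rewrite exprMn !sqr_modulus real_normK ?num_real//.
rewrite -subr_ge0.
have -> : (z.1 ^+ 2 + z.2 ^+ 2) * (w.1 ^+ 2 + w.2 ^+ 2) - (z.1 * w.1 + z.2 * w.2) ^+ 2
  = (z.1 * w.2 - z.2 * w.1) ^+ 2 by ring.
exact: sqr_ge0.
Qed.

Lemma ler_modulusB z w : modulus z - modulus w <= modulus (z - w).
Proof. by rewrite lerBlDr -{1}(subrK w z) ler_modulusD. Qed.

Lemma modulus_eq0 z : (modulus z == 0) = (z == 0).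
Proof.
rewrite -sqrf_eq0 sqr_modulus paddr_eq0 ?sqr_ge0// !sqrf_eq0.
by case: z.
Qed.

Lemma continuous_modulus : continuous (@modulus R).
Proof.
move=> z; apply: (continuous_comp (f := fun z : plane => z.1 ^+ 2 + z.2 ^+ 2));
  last exact: sqrt_continuous.
by apply: cvgD; apply: cvgM; (exact: cvg_fst || exact: cvg_snd).
Qed.

Lemma continuous_modulusB (p : plane) : continuous (fun z => modulus (z - p)).
Proof.
move=> z; apply: (continuous_comp (f := fun z : plane => z - p)); last exact: continuous_modulus.
by apply: cvgB; [exact: cvg_id|exact: cvg_cst].
Qed.

Lemma closed_modulus (T : R) : closed [set z : plane | modulus z <= T].
Proof.
have -> : [set z : plane | modulus z <= T] = @modulus R @^-1` [set x | x <= T] by [].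
by apply: closed_comp; [move=> ? _; exact: continuous_modulus|exact: closed_le].
Qed.

Lemma compact_modulus (T : R) : compact [set z | modulus z <= T].
Proof.
apply: (@subclosed_compact _ _ (`[- T, T]%classic `*` `[- T, T]%classic)).
- exact: closed_modulus.
- by apply: compact_setX; exact: segment_compact.
- move=> z /= zT; have m0 := modulus_ge0 z; have m2 := sqr_modulus z.
  by rewrite !in_itv/=; split; apply/andP; split; nra.
Qed.

End modulus.

Section near_point.
Context {T : topologicalType}.
Implicit Types (P Q : T -> Prop) (x : T).

Lemma near_forall P x : (forall w, P w) -> \forall w \near x, P w.
Proof. by move=> h; apply: nearW. Qed.

Lemma near_imp2 P1 P2 Q x : (forall w, P1 w -> P2 w -> Q w) ->
  (\forall w \near x, P1 w) -> (\forall w \near x, P2 w) -> \forall w \near x, Q w.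
Proof. by move=> h; apply: filterS2. Qed.

End near_point.

(** * The Laplacian at a point and the maximum principle *)

Section laplacian.
Context {R : realType}.
Local Notation plane := (R * R)%type.
Implicit Types (z w : plane) (h : plane -> R).

(** This records just what the second derivative test consumes: first derivatives near [z] and pure
    second derivatives at [z]. *)
Definition laplacian_at h z (l : R) : Prop :=
  [/\ forall i, \forall w \near z, derivable h w (axis i),
      forall i, derivable ('D_(axis i) h) z (axis i) &
      \sum_(i : bool) 'D_(axis i) ('D_(axis i) h) z = l].

Lemma laplacian_harmonic (U : set plane) h z : open U -> harmonic_on U h -> U z ->
  laplacian_at h z 0.
Proof.
move=> oU [c2 l0] Uz; split; last exact: l0.
  move=> i; have := open_nbhs_nbhs (conj oU Uz); apply: filterS => w Uw.
  by have [_ /(_ i)[]] := c2 w Uw.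
by move=> i; have [_ _ /(_ i i)[]] := c2 z Uz.
Qed.

Lemma laplacianD h1 h2 z l1 l2 : laplacian_at h1 z l1 -> laplacian_at h2 z l2 ->
  laplacian_at (fun w => h1 w + h2 w) z (l1 + l2).
Proof.
move=> [d1 dd1 e1] [d2 dd2 e2].
have D i : \forall w \near z, ('D_(axis i) h1 + 'D_(axis i) h2) w =
    'D_(axis i) (fun w => h1 w + h2 w) w.
  by apply: near_imp2 (d1 i) (d2 i) => w hw1 hw2; rewrite deriveD.
split.
- by move=> i; apply: near_imp2 (d1 i) (d2 i) => w; exact: derivableD.
- by move=> i; apply: near_eq_derivable (D i) _; apply: derivableD.
- rewrite -e1 -e2 -big_split/=; apply: eq_bigr => i _.
  by rewrite -(near_eq_derive _ (D i)) deriveD.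
Qed.

Lemma laplacianZ h z l (c : R) : laplacian_at h z l ->
  laplacian_at (fun w => c * h w) z (c * l).
Proof.
move=> [d1 dd1 e1].
have D i : \forall w \near z, (c *: 'D_(axis i) h) w = 'D_(axis i) (fun w => c * h w) w.
  by apply: near_imp2 (d1 i) (d1 i) => w hw _; exact/esym/(deriveZ c hw).
split.
- by move=> i; apply: near_imp2 (d1 i) (d1 i) => w hw _; exact: (@derivableZ R _ _ h c w _ hw).
- by move=> i; apply: near_eq_derivable (D i) _; apply: derivableZ.
- rewrite -e1 mulr_sumr; apply: eq_bigr => i _.
  by rewrite -(near_eq_derive _ (D i)) deriveZ.
Qed.

Lemma laplacian_sqr_modulus z : laplacian_at (fun w => modulus w ^+ 2) z 4.
Proof.
pose co (i : bool) (w : plane) : R := if i then w.2 else w.1.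
have dc i w : is_derive w (axis i) (co i) 1.
  by have [] := is_derive_axis_coord i w; case: i.
have dh i w : is_derive w (axis i) (fun w => modulus w ^+ 2) (2 * co i w).
  have -> : (fun w : plane => modulus w ^+ 2) = (fun w => w.1) * (fun w => w.1) +
      (fun w => w.2) * (fun w => w.2) by apply/funext => v; rewrite sqr_modulus.
  have [d1 d2] := is_derive_axis_coord i w.
  apply: (is_derive_eq (is_deriveD (is_deriveM d1 d1) (is_deriveM d2 d2))).
  by rewrite /GRing.scale/= /co; case: i {d1 d2}; rewrite /= ?mulr0 ?mulr1; ring.
have Dh i : 'D_(axis i) (fun w => modulus w ^+ 2) = 2 *: co i.
  by apply/funext => w; rewrite (derive_val (is_derive := dh i w)).
have dd i : is_derive z (axis i) ('D_(axis i) (fun w => modulus w ^+ 2)) 2.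
  rewrite Dh; apply: (is_derive_eq (is_deriveZ (2:R) (dc i z))).
  by rewrite /GRing.scale/= mulr1.
split.
- by move=> i; apply: near_forall => w; case: (dh i w).
- by move=> i; case: (dd i).
- rewrite (eq_bigr (fun=> 2)); last by move=> i _; rewrite (derive_val (is_derive := dd i)).
  by rewrite big_bool/=; ring.
Qed.

Lemma laplacian_local_max h z l : laplacian_at h z l ->
  (\forall w \near z, h w <= h z) -> l <= 0.
Proof.
move=> [d dd <-] mx; apply: sumr_le0 => i _.
by apply: local_max_second_derive => //; exact: d.
Qed.

End laplacian.

(** * Uniqueness of the Green function *)

Section green_unique.
Context {R : realType}.
Local Notation plane := (R * R)%type.
Implicit Types (z w : plane) (g G : plane -> R) (K : set plane) (zeta : option plane).

(** For the pole at infinity the value is a positive constant, so that the alternative of large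
    modulus or small [pole_dist] describes both kinds of pole. *)
Definition pole_dist zeta z : R := if zeta is Some p then modulus (z - p) else 1.

Lemma continuous_pole_dist zeta : continuous (pole_dist zeta).
Proof. by case: zeta => [p|] /=; [exact: continuous_modulusB|move=> z; exact: cvg_cst]. Qed.

Lemma pole_dist_gt0 zeta z : Some z <> zeta -> 0 < pole_dist zeta z.
Proof.
case: zeta => [p|//] zp; rewrite /pole_dist lt_neqAle modulus_ge0 andbT eq_sym modulus_eq0.
by rewrite subr_eq0; apply/eqP => E; apply: zp; rewrite E.
Qed.

Definition off_pole K zeta : set plane := ~` K `&` [set z | Some z <> zeta].

Lemma open_off_pole K zeta : closed K -> open (off_pole K zeta).
Proof.
move=> cK; apply: openI; first exact: closed_openC.
have -> : [set z | Some z <> zeta] = pole_dist zeta @^-1` [set x | 0 < x].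
  apply/seteqP; split => z /=; first exact: pole_dist_gt0.
  by case: zeta => [p|//] /= + [zp]; rewrite zp subrr /modulus/= expr0n addr0 sqrtr0 ltxx.
by apply: open_comp; [move=> ? _; exact: continuous_pole_dist|exact: open_gt].
Qed.

(** The barrier tends to +oo at the pole and also at infinity. Both are needed: a difference of two
    Green functions is only known to be bounded there, and a finite pole leaves infinity as a
    removable singularity. *)
Definition green_barrier K zeta G : Prop :=
  [/\ harmonic_on (off_pole K zeta) G,
      forall z, K z -> G z = 0 /\ {for z, continuous G} &
      forall M : R, exists T tau : R, 0 < tau /\ forall z, off_pole K zeta z ->
        T <= modulus z \/ pole_dist zeta z <= tau -> M <= G z].

Lemma sphere_discW zeta (r s : R) z : 0 < r -> r <= s -> sphere_disc zeta r z -> sphere_disc zeta s z.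
Proof.
move=> r0 rs; case: zeta => [p|] /=; first by move=> h; exact: lt_le_trans rs.
by apply: le_lt_trans; rewrite lef_pV2// posrE// (lt_le_trans r0).
Qed.

Lemma is_green_bounded K zeta g1 g2 : is_green K zeta g1 -> is_green K zeta g2 ->
  exists B : R, forall z, off_pole K zeta z -> g1 z - g2 z <= B.
Proof.
move=> [_ [r1 [M1 [r10 h1]]] b1 _] [_ [r2 [M2 [r20 h2]]] b2 _].
pose r := Num.min r1 r2.
have r0 : 0 < r by rewrite lt_min r10.
have rl : r <= r1 by rewrite ge_min lexx.
have rr : r <= r2 by rewrite ge_min lexx orbT.
have [B1 hB1] := b1 r r0; have [B2 hB2] := b2 r r0.
exists (Num.max (M1 + M2) (B1 + B2)) => z [zK zp].
rewrite le_max; apply/orP; have [zr|zr] := pselect (sphere_disc zeta r z).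
  left; have /= := h1 z (sphere_discW r0 rl zr) zp.
  have /= := h2 z (sphere_discW r0 rr zr) zp.
  by rewrite !ler_norml; lra.
right; have := hB1 z zr zK; have := hB2 z zr zK.
by rewrite !ler_norml; lra.
Qed.

(** If g1 - g2 were positive at [z0], so would be u = g1 - g2 - eps G for small eps, while u <= 0
    near the pole and near infinity and u = 0 on [K]. Then u + del |z|^2 has an interior maximum on
    a compact set, where its Laplacian 4 del is positive, a contradiction. *)
Lemma green_le K zeta g1 g2 G : closed K -> is_green K zeta g1 -> is_green K zeta g2 ->
  green_barrier K zeta G -> forall z, off_pole K zeta z -> g1 z <= g2 z.
Proof.
move=> cK G1 G2 [Gh G0 Ginf] z0 Uz0; rewrite leNgt -subr_gt0; apply/negP => h0.
have [B hB] := is_green_bounded G1 G2.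
have [gh1 _ _ k1] := G1; have [gh2 _ _ k2] := G2.
have oU : open (off_pole K zeta) by exact: open_off_pole.
(* Small enough that eps G z0 takes away at most half of the gap at [z0], and bounded without
   knowing the sign of G z0. *)
pose eps := (g1 z0 - g2 z0) / (2 * (`|G z0| + 1)).
have eps0 : 0 < eps by rewrite divr_gt0// mulr_gt0// ltr_pwDr.
pose u z := g1 z + (-1) * g2 z + (- eps) * G z.
have u0 : 0 < u z0.
  have : eps * G z0 <= (g1 z0 - g2 z0) / 2.
    apply: (@le_trans _ _ (eps * (`|G z0| + 1))).
      by rewrite ler_pM2l// (le_trans (ler_norm _))// lerDl.
    by rewrite /eps le_eqVlt; apply/orP; left; apply/eqP; field; rewrite gt_eqF// ltr_pwDr.
  by rewrite /u; lra.
have [T [tau [tau0 hT]]] := Ginf (B / eps).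
have uneg z : off_pole K zeta z -> T <= modulus z \/ pole_dist zeta z <= tau -> u z <= 0.
  move=> Uz /(hT z Uz); rewrite ler_pdivrMr// => h; have := hB z Uz; rewrite /u; lra.
pose T' := Num.max T (modulus z0) + 1.
pose tau' := Num.min tau (pole_dist zeta z0) / 2.
have m0 : 0 < Num.min tau (pole_dist zeta z0) by rewrite lt_min tau0 pole_dist_gt0//; case: Uz0.
have tau'0 : 0 < tau' by rewrite divr_gt0.
have tau'l : tau' < Num.min tau (pole_dist zeta z0) by rewrite ltr_pdivrMr// ltr_pMr// ltr1n.
pose D := [set z | modulus z <= T'] `&` [set z | tau' <= pole_dist zeta z].
have cD : compact D.
  apply: (subclosed_compact _ (@compact_modulus R T')) => [|z []//].
  apply: closedI; first exact: closed_modulus.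
  have -> : [set z | tau' <= pole_dist zeta z] = pole_dist zeta @^-1` [set x | tau' <= x] by [].
  by apply: closed_comp; [move=> ? _; exact: continuous_pole_dist|exact: closed_ge].
(* On [D] the quadratic term is then at most u z0 / 2, which forces u > 0 at a maximum of [v] and
   keeps that point off [K] and off the boundary. *)
pose del := u z0 / (2 * T' ^+ 2).
have T'0 : 0 < T' by rewrite ltr_wpDl// le_max modulus_ge0 orbT.
have del0 : 0 < del by rewrite divr_gt0// mulr_gt0// exprn_gt0.
pose v z := u z + del * modulus z ^+ 2.
have cont z (g : plane -> R) : harmonic_on (off_pole K zeta) g ->
   (forall z, K z -> g z = 0 /\ {for z, continuous g}) -> D z -> {for z, continuous g}.
  move=> [gc2 _] gk [_ /= zt]; have [/gk[]//|nKz] := pselect (K z).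
  suff /gc2[] : off_pole K zeta z by [].
  split => //= E; move: zt; rewrite -E /= subrr /modulus/= expr0n addr0 sqrtr0.
  by rewrite leNgt tau'0.
have [] := @compact_EVT_max _ R v D _ cD.
- by exists z0; split => /=; [rewrite /T' ler_wpDr// le_max lexx orbT|
    rewrite ltW// (lt_le_trans tau'l)// ge_min lexx orbT].
- apply: continuous_in_subspaceT => z /set_mem Dz.
  have c1 := cont z g1 gh1 k1 Dz; have c2 := cont z g2 gh2 k2 Dz; have c3 := cont z G Gh G0 Dz.
  apply: cvgD.
    by apply: cvgD; [apply: cvgD => //|]; apply: cvgM => //; exact: cvg_cst.
  by apply: cvgM; [exact: cvg_cst|apply: cvgM; exact: continuous_modulus].
move=> z1 /set_mem Dz1 mx.
have z0D : z0 \in D.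
  by apply/mem_set; split => /=; [rewrite /T' ler_wpDr// le_max lexx orbT|
    rewrite ltW// (lt_le_trans tau'l)// ge_min lexx orbT].
have u1 : 0 < u z1.
  have := mx _ z0D; rewrite /v.
  have : del * modulus z1 ^+ 2 <= u z0 / 2.
    apply: (@le_trans _ _ (del * T' ^+ 2)).
      by rewrite ler_pM2l// ler_pXn2r// ?nnegrE ?modulus_ge0 ?(ltW T'0)//; case: Dz1.
    by rewrite /del le_eqVlt; apply/orP; left; apply/eqP; field; rewrite gt_eqF.
  have : 0 <= del * modulus z0 ^+ 2 by rewrite mulr_ge0 ?sqr_ge0// ltW.
  lra.
have Uz1 : off_pole K zeta z1.
  split => [/= Kz1|/= E].
    by move: u1; rewrite /u (k1 _ Kz1).1 (k2 _ Kz1).1 (G0 _ Kz1).1 !mulr0 !addr0 ltxx.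
  by case: Dz1 => _ /=; rewrite -E/= subrr /modulus/= expr0n addr0 sqrtr0 leNgt tau'0.
have z1T : modulus z1 < T'.
  rewrite ltNge; apply/negP => h; have : u z1 <= 0.
    by apply: uneg => //; left; apply: le_trans h; rewrite /T' ler_wpDr// le_max lexx.
  by rewrite leNgt u1.
have z1t : tau' < pole_dist zeta z1.
  rewrite ltNge; apply/negP => h; have : u z1 <= 0.
    by apply: uneg => //; right; apply: (le_trans h); rewrite ltW// (lt_le_trans tau'l)// ge_min lexx.
  by rewrite leNgt u1.
have lv : laplacian_at v z1 (0 + (-1) * 0 + (- eps) * 0 + del * 4).
  apply: laplacianD; [apply: laplacianD|]; [apply: laplacianD| |]; rewrite ?mulr0.
  - exact: laplacian_harmonic gh1 Uz1.
  - by rewrite -(mulr0 (-1)); apply: laplacianZ; exact: laplacian_harmonic gh2 Uz1.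
  - by rewrite -(mulr0 (- eps)); apply: laplacianZ; exact: laplacian_harmonic Gh Uz1.
  - by apply: laplacianZ; exact: laplacian_sqr_modulus.
have : \forall w \near z1, v w <= v z1.
  apply: (near_imp2 _ (cvgr_lt _ (@continuous_modulus R z1) _ z1T)
    (cvgr_gt _ (@continuous_pole_dist zeta z1) _ z1t)) => w wT wt.
  by apply: mx; apply/mem_set; split; exact: ltW.
move=> /(laplacian_local_max lv); rewrite !mulr0 !add0r.
by apply/negP; rewrite -ltNge mulr_gt0.
Qed.

Lemma green_eq K zeta g1 g2 G : closed K -> is_green K zeta g1 -> is_green K zeta g2 ->
  green_barrier K zeta G -> forall z, off_pole K zeta z -> g1 z = g2 z.
Proof.
move=> cK h1 h2 hG z Uz; apply/eqP; rewrite eq_le.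
by rewrite (green_le cK h1 h2 hG)//= (green_le cK h2 h1 hG).
Qed.

End green_unique.

Section gradient_sum.
Context {R : realType}.
Local Notation plane := (R * R)%type.
Local Notation C := (R[i]).

Lemma is_gradientD (h1 h2 : plane -> R) (d e : C) (z : plane) :
  is_gradient h1 d z -> is_gradient h2 e z -> is_gradient (fun w => h1 w + h2 w) (d + e) z.
Proof.
move=> [c1 x1 y1] [c2 x2 y2]; split; first exact: cvgD c1 c2.
- by apply: (is_derive_eq (is_deriveD x1 x2)); rewrite ReD.
- by apply: (is_derive_eq (is_deriveD y1 y2)); rewrite ImD opprD.
Qed.

Lemma chol_sub (U V : set plane) n (F : plane -> C) : V `<=` U -> chol U n F -> chol V n F.
Proof.
move=> VU; elim: n F => [|n ih] F [cF]; first by move=> _; split => // z /VU; exact: cF.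
move=> [D FD Dn]; split; first by move=> z /VU; exact: cF.
by exists D; [move=> z /VU; exact: FD|exact: ih].
Qed.

End gradient_sum.

(** * The explicit Green function of an interval *)

Section interval_green.
Context {R : realType}.
Local Notation plane := (R * R)%type.
Local Notation C := (R[i]).
Local Notation Re := (@complex.Re R).
Local Notation Im := (@complex.Im R).
Variables (a b : R).
Hypothesis ab : a < b.
Implicit Types (z w p : plane) (lam : R).

Let mid (x : R) : (x - a) * (x - b) <= 0 -> x \in `[a, b].
Proof.
move=> h; rewrite in_itv/=; apply/andP; split; rewrite leNgt; apply/negP => hx.
  have : 0 < (a - x) * (b - x) by rewrite mulr_gt0 ?subr_gt0// (lt_trans hx).
  by move: h; lra.
have : 0 < (x - a) * (x - b) by rewrite mulr_gt0 ?subr_gt0// (lt_trans ab).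
by move: h; lra.
Qed.

Let K : set plane := real_pt @` `[a, b].
Let da z : R := modulus (z - real_pt a).
Let db z : R := modulus (z - real_pt b).
Let dot z : R := (z.1 - a) * (z.1 - b) + z.2 ^+ 2.

(** With v = sqrt ((z - a) / (z - b)) this is |z - b| Re v: the quantity [dot] is the real part of
    (z - a) times the conjugate of z - b. It vanishes exactly on [K]. *)
Definition itv_kappa z : R := Num.sqrt ((da z * db z + dot z) / 2).
Local Notation kap := itv_kappa.

(* With [v = sqrt ((z - a) / (z - b))] this is [|v + lam|^2 |z - b|]. *)
Definition itv_nn lam z : R := da z + 2 * lam * kap z + lam ^+ 2 * db z.
Local Notation nn := itv_nn.

Definition itv_green lam z : R := (ln (nn lam z) - ln (nn (- lam) z)) / 2.

(** The point where v = lam; it is infinity when lam = 1. *)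
Definition itv_pole lam : option plane :=
  if lam == 1 then None else Some (real_pt ((a - lam ^+ 2 * b) / (1 - lam ^+ 2))).

Let sqda z : da z ^+ 2 = (z.1 - a) ^+ 2 + z.2 ^+ 2.
Proof. by rewrite sqr_modulus/= subr0. Qed.
Let sqdb z : db z ^+ 2 = (z.1 - b) ^+ 2 + z.2 ^+ 2.
Proof. by rewrite sqr_modulus/= subr0. Qed.
Let da0 z : 0 <= da z. Proof. exact: modulus_ge0. Qed.
Let db0 z : 0 <= db z. Proof. exact: modulus_ge0. Qed.

Let sqdd z : (da z * db z) ^+ 2 = dot z ^+ 2 + (z.2 * (b - a)) ^+ 2.
Proof. by rewrite exprMn sqda sqdb /dot; ring. Qed.

Let dot_le z : `|dot z| <= da z * db z.
Proof.
rewrite -(@ler_pXn2r _ 2)// ?nnegrE ?mulr_ge0//.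
by rewrite real_normK ?num_real// sqdd lerDl sqr_ge0.
Qed.

Let kap2 z : kap z ^+ 2 = (da z * db z + dot z) / 2.
Proof.
rewrite sqr_sqrtr// divr_ge0//.
by have := dot_le z; rewrite ler_norml => /andP[]; lra.
Qed.

Let kap_ge0 z : 0 <= kap z. Proof. exact: sqrtr_ge0. Qed.

Lemma itv_kappa_eq0 z : kap z = 0 <-> K z.
Proof.
split=> [k0|[x /=]].
  have dE : da z * db z = - dot z by have := kap2 z; rewrite k0 expr0n /=; lra.
  have : (z.2 * (b - a)) ^+ 2 = 0 by have := sqdd z; rewrite dE; lra.
  move/eqP; rewrite sqrf_eq0 mulf_eq0 [X in _ || X]gt_eqF ?subr_gt0// orbF => /eqP z2.
  have : (z.1 - a) * (z.1 - b) <= 0.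
    have : 0 <= da z * db z by rewrite mulr_ge0.
    by rewrite dE /dot z2 expr0n addr0; lra.
  move=> h; exists z.1; last by case: z z2 {k0 dE h} => x y /= ->.
  exact: mid.
rewrite in_itv/= => /andP[ax xb] <-.
rewrite /kap /da /db /dot /modulus/= subr0 expr0n !addr0 !sqrtr_sqr/=.
rewrite ger0_norm ?subr_ge0// ler0_norm ?subr_le0//.
rewrite (_ : _ + _ = 0) ?mul0r ?sqrtr0//; ring.
Qed.

(** Both sides are |v^2 - lam^2|^2 |z - b|^2. The right one is a polynomial in the coordinates, so
    the zeros can be read off. *)
Lemma itv_nnM lam z : nn lam z * nn (- lam) z =
  ((z.1 - a) - lam ^+ 2 * (z.1 - b)) ^+ 2 + (z.2 * (1 - lam ^+ 2)) ^+ 2.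
Proof.
have -> : nn lam z * nn (- lam) z = (da z + lam ^+ 2 * db z) ^+ 2 - 4 * lam ^+ 2 * kap z ^+ 2.
  by rewrite /nn; ring.
by rewrite kap2 sqrrD exprMn sqda sqdb /dot; field.
Qed.

Let dab z : b - a <= da z + db z.
Proof.
have := ler_modulusD (z - real_pt a) (real_pt b - z).
rewrite -[modulus (real_pt b - z)]modulusN opprB -/(da z) -/(db z).
rewrite [X in X <= _](_ : _ = modulus (- real_pt a + real_pt b)); last first.
  by congr modulus; rewrite [z - _]addrC -addrA [z + _]addrC subrK.
suff -> : modulus (- real_pt a + real_pt b) = b - a by [].
by rewrite /modulus/= oppr0 addr0 expr0n addr0 sqrtr_sqr ger0_norm addrC// subr_ge0 ltW.
Qed.

Lemma itv_nn_ge lam z : 0 <= lam -> Num.min 1 (lam ^+ 2) * (b - a) <= nn lam z.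
Proof.
move=> l0; have h := dab z; have k0 := kap_ge0 z.
have m1 : Num.min 1 (lam ^+ 2) <= 1 by rewrite ge_min lexx.
have m2 : Num.min 1 (lam ^+ 2) <= lam ^+ 2 by rewrite ge_min lexx orbT.
have m0 : 0 <= Num.min 1 (lam ^+ 2) by rewrite le_min ler01 sqr_ge0.
have := da0 z; have := db0 z.
have : 0 <= lam * kap z by rewrite mulr_ge0.
rewrite /nn; move: m1 m2 m0; move: (Num.min _ _) => m; nra.
Qed.

Let m_gt0 lam : 0 < lam -> 0 < Num.min 1 (lam ^+ 2) * (b - a).
Proof. by move=> l0; rewrite mulr_gt0 ?subr_gt0// lt_min ltr01 exprn_gt0. Qed.

Lemma itv_nn_gt0 lam z : 0 < lam -> 0 < nn lam z.
Proof. by move=> l0; rewrite (lt_le_trans _ (itv_nn_ge _ (ltW l0)))// m_gt0. Qed.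

Lemma itv_nnN_ge0 lam z : 0 < lam -> 0 <= nn (- lam) z.
Proof.
move=> l0; rewrite -(pmulr_rge0 _ (itv_nn_gt0 z l0)) itv_nnM.
by rewrite addr_ge0 ?sqr_ge0.
Qed.

Lemma itv_nnN_gt0 lam z : 0 < lam -> (0 < nn (- lam) z) = (Some z != itv_pole lam).
Proof.
move=> l0; rewrite -(pmulr_rgt0 _ (itv_nn_gt0 z l0)) itv_nnM /itv_pole.
case: ifPn => [/eqP ->|l1].
  rewrite expr1n subrr mulr0 expr0n addr0 mul1r exprn_even_gt0//=.
  by rewrite (_ : _ - _ = b - a) ?gt_eqF ?subr_gt0//; ring.
have l2 : 1 - lam ^+ 2 != 0.
  by rewrite subr_eq0 eq_sym -[X in _ != X](expr1n _ 2) eqf_sqr negb_or l1 gt_eqF// (lt_trans _ l0)// oppr_lt0.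
rewrite lt_neqAle addr_ge0 ?sqr_ge0// andbT eq_sym paddr_eq0 ?sqr_ge0// !sqrf_eq0.
congr negb; case: z => x y /=.
rewrite mulf_eq0 (negPf l2) orbF; apply/andP/eqP => [[/eqP h /eqP ->]|[-> ->]].
  congr (Some (_, _)); apply: (mulIf l2); rewrite mulfVK//; lra.
by rewrite eqxx; split => //; apply/eqP; field.
Qed.

Let nnD lam z : nn lam z + nn (- lam) z = 2 * (da z + lam ^+ 2 * db z).
Proof. by rewrite /nn; ring. Qed.

Lemma itv_nn_le lam z : 0 < lam -> nn lam z <= 2 * (da z + lam ^+ 2 * db z).
Proof. by move=> l0; rewrite -nnD lerDl itv_nnN_ge0. Qed.

Lemma itv_green_ge0 lam z : 0 < lam -> Some z != itv_pole lam -> 0 <= itv_green lam z.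
Proof.
move=> l0 zp; rewrite divr_ge0// subr_ge0 ler_ln ?posrE ?itv_nnN_gt0//; last exact: itv_nn_gt0.
rewrite /nn; have : 0 <= lam * kap z by rewrite mulr_ge0// ltW.
by rewrite sqrrN; lra.
Qed.

Lemma itv_green_itv lam z : K z -> itv_green lam z = 0.
Proof.
by move=> /itv_kappa_eq0 k0; rewrite /itv_green /nn k0 sqrrN !mulr0 subrr mul0r.
Qed.

Let cda : continuous da. Proof. exact: continuous_modulusB. Qed.
Let cdb : continuous db. Proof. exact: continuous_modulusB. Qed.

Let continuous_kappa : continuous kap.
Proof.
move=> z; apply: (continuous_comp (f := fun z => (da z * db z + dot z) / 2)); last exact: sqrt_continuous.
have c1 : {for z, continuous (fun z : plane => z.1)} by exact: cvg_fst.
have c2 : {for z, continuous (fun z : plane => z.2)} by exact: cvg_snd.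
have ca : {for z, continuous (fun z : plane => z.1 - a)} by apply: cvgB c1 (cvg_cst _).
have cb : {for z, continuous (fun z : plane => z.1 - b)} by apply: cvgB c1 (cvg_cst _).
apply: cvgM; last exact: cvg_cst.
by apply: cvgD; [exact: cvgM (@cda z) (@cdb z)|apply: cvgD; [exact: cvgM ca cb|apply: cvgM; exact: c2]].
Qed.

Lemma continuous_itv_nn lam : continuous (nn lam).
Proof.
move=> z; apply: cvgD.
  by apply: cvgD; [exact: cda|apply: cvgM; [exact: cvg_cst|exact: continuous_kappa]].
by apply: cvgM; [exact: cvg_cst|exact: cdb].
Qed.

Lemma continuous_itv_green lam z : 0 < lam -> Some z != itv_pole lam ->
  {for z, continuous (itv_green lam)}.
Proof.
move=> l0 zp; apply: cvgM; last exact: cvg_cst.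
apply: cvgB.
  by apply: (continuous_comp (@continuous_itv_nn lam z)); apply: continuous_ln; exact: itv_nn_gt0.
by apply: (continuous_comp (@continuous_itv_nn (- lam) z)); apply: continuous_ln; rewrite itv_nnN_gt0.
Qed.

Lemma closed_itv_plane : closed K.
Proof.
have -> : K = kap @^-1` [set 0].
  by apply/seteqP; split => z /itv_kappa_eq0.
by apply: closed_comp; [move=> ? _; exact: continuous_kappa|exact: closed_eq].
Qed.

Definition itv_quot z : C := (affix z - Complex a 0) * (affix z - Complex b 0)^-1.
Definition itv_root z : C := csqrt (itv_quot z).
Definition itv_lin lam z : C := itv_root z + Complex lam 0.

Let csqda z : csqnorm (affix z - Complex a 0) = da z ^+ 2.
Proof. by rewrite sqda /csqnorm/= subr0. Qed.
Let csqdb z : csqnorm (affix z - Complex b 0) = db z ^+ 2.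
Proof. by rewrite sqdb /csqnorm/= subr0. Qed.

Let notb z : ~ K z -> affix z - Complex b 0 != 0.
Proof.
move=> zK; rewrite subr_eq0 eq_complex /=; apply/negP => /andP[/eqP z1 /eqP z2].
apply: zK; exists b; first by rewrite /= in_itv/= lexx ltW.
by case: z z1 z2 => x y /= -> ->.
Qed.

Let db_gt0 z : ~ K z -> 0 < db z.
Proof.
move=> /notb; rewrite -csqnorm_gt0 csqdb.
by rewrite exprn_even_gt0//= lt_neqAle eq_sym db0 andbT.
Qed.

Let quotE z : Re (itv_quot z) = dot z / db z ^+ 2 /\
  Im (itv_quot z) = z.2 * (a - b) / db z ^+ 2.
Proof.
by rewrite /itv_quot ReM ImM ReV ImV csqdb /dot/= subr0; split; ring.
Qed.

(** The quotient (z - a) / (z - b) meets the cut ]-oo, 0] only for z in [a, b], so its principal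
    root is holomorphic off [K]. *)
Let quot_slit z : ~ K z -> cslit (itv_quot z).
Proof.
move=> zK; have d0 := db_gt0 zK.
have [q1 q2] := quotE z.
have [z2|z2] := eqVneq z.2 0; [left|right]; rewrite ?q1 ?q2.
  rewrite divr_gt0 ?exprn_gt0// /dot z2 expr0n addr0.
  rewrite ltNge; apply/negP => h; apply: zK; exists z.1; last by case: z z2 {h d0 q1 q2} => x y /= ->.
  exact: mid.
by rewrite !mulf_neq0 ?invr_neq0 ?expf_neq0//; [rewrite subr_eq0 lt_eqF|rewrite gt_eqF].
Qed.

Let root_re z : ~ K z -> Re (itv_root z) = kap z / db z.
Proof.
move=> zK; have d0 := db_gt0 zK.
rewrite /itv_root /= /csqrt_re.
rewrite (quotE z).1 /itv_quot csqnormM csqda.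
have -> : csqnorm (affix z - Complex b 0)^-1 = db z ^- 2.
  have n0 : csqnorm (affix z - Complex b 0) != 0 by rewrite gt_eqF// csqnorm_gt0 notb.
  rewrite -csqdb; apply: (mulIf n0); rewrite mulVf// -csqnormM mulVf ?notb//.
  by rewrite /csqnorm/= expr1n expr0n addr0.
rewrite -exprVn -exprMn sqrtr_sqr ger0_norm; last by rewrite divr_ge0.
have kd : 0 <= kap z / db z by rewrite divr_ge0.
rewrite -[RHS]ger0_norm// -sqrtr_sqr expr_div_n kap2.
by congr (Num.sqrt _); field; rewrite gt_eqF.
Qed.

Let root_norm z : ~ K z -> csqnorm (itv_root z) = da z / db z.
Proof.
move=> zK; have d0 := db_gt0 zK.
have q := csqrtK (quot_slit zK).
have h0 : 0 <= csqnorm (itv_root z) by rewrite addr_ge0 ?sqr_ge0.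
have h1 : 0 <= da z / db z by rewrite divr_ge0.
apply/eqP; rewrite -(@eqrXn2 _ 2)//; apply/eqP.
rewrite expr2 -csqnormM -/(itv_root z) q /itv_quot expr_div_n -csqda -csqdb csqnormM; congr (_ * _).
have n0 : csqnorm (affix z - Complex b 0) != 0 by rewrite gt_eqF// csqnorm_gt0 notb.
apply: (mulIf n0); rewrite mulVf// -csqnormM mulVf ?notb//.
by rewrite /csqnorm/= expr1n expr0n addr0.
Qed.

Let lin_norm lam z : ~ K z -> csqnorm (itv_lin lam z) = nn lam z / db z.
Proof.
move=> zK; have d0 := db_gt0 zK.
have -> : csqnorm (itv_lin lam z) = csqnorm (itv_root z) + 2 * lam * Re (itv_root z) + lam ^+ 2.
  by rewrite /itv_lin /csqnorm ReD ImD/=; ring.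
by rewrite root_norm// root_re// /nn; field; rewrite gt_eqF.
Qed.

Let chol_root n : chol (~` K) n itv_root.
Proof.
apply: chol_csqrt; first by move=> z /quot_slit.
apply: cholM; first by apply: cholD; [exact: chol_affix|exact: chol_cst].
apply: cholV; first by move=> z /notb.
by apply: cholD; [exact: chol_affix|exact: chol_cst].
Qed.

Let open_U lam : open (off_pole K (itv_pole lam)).
Proof. by apply: open_off_pole; exact: closed_itv_plane. Qed.

Let lin_neq0 lam z : ~ K z -> 0 < nn lam z -> itv_lin lam z != 0.
Proof. by move=> zK n0; rewrite -csqnorm_gt0 lin_norm// divr_gt0// db_gt0. Qed.

Lemma itv_green_gradient lam : 0 < lam -> exists psi : plane -> C,
  (forall z, off_pole K (itv_pole lam) z -> is_gradient (itv_green lam) (psi z) z) /\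
  chol (off_pole K (itv_pole lam)) 1 psi.
Proof.
move=> l0; pose U := off_pole K (itv_pole lam).
have [cR [D RD [cD [E DE cE]]]] := chol_root 2.
have UK z : U z -> ~ K z by case.
have lp z : U z -> itv_lin lam z != 0.
  by move=> Uz; apply: lin_neq0; [exact: UK|exact: itv_nn_gt0].
have lm z : U z -> itv_lin (- lam) z != 0.
  move=> Uz; apply: lin_neq0; first exact: UK.
  by rewrite itv_nnN_gt0//; apply/eqP; case: Uz.
have holD : chol U 1 D.
  split => [z /UK|]; first exact: cD.
  by exists E => [z /UK|]; [exact: DE|split => // z /UK; case: cE => + _; exact].
have hollin c : chol U 1 (itv_lin c).
  apply: cholD; last exact: chol_cst.
  by split => [z /UK|]; [exact: cR|exists D => [z /UK|]; [exact: RD|exact: cholW]].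
have linD c z : U z -> cder (itv_lin c) (D z) z.
  by move=> /UK Uz; rewrite -[D z]addr0; apply: cderD; [exact: RD|exact: cder_cst].
exists (fun z => D z * (itv_lin lam z)^-1 - D z * (itv_lin (- lam) z)^-1); split; last first.
  by apply: cholD; [|apply: cholN]; apply: cholM => //; exact: cholV.
move=> z Uz.
have g1 := is_gradient_log (lp z Uz) (chol_cont (hollin lam) Uz) (linD lam z Uz).
have g2 := is_gradient_log (lm z Uz) (chol_cont (hollin (- lam)) Uz) (linD (- lam) z Uz).
apply: near_is_gradient (is_gradientB g1 g2).
have := open_nbhs_nbhs (conj (@open_U lam) Uz); apply: filterS => w Uw.
have nm : 0 < nn (- lam) w by rewrite itv_nnN_gt0//; apply/eqP; case: Uw.
have d0 := db_gt0 (UK _ Uw).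
rewrite !lin_norm; [|exact: UK|exact: UK].
have lnE c : 0 < nn c w -> ln (nn c w / db w) = ln (nn c w) - ln (db w).
  by move=> n0; rewrite ln_div ?posrE.
by rewrite lnE ?itv_nn_gt0// lnE// /itv_green; ring.
Qed.

Lemma harmonic_itv_green lam : 0 < lam -> harmonic_on (off_pole K (itv_pole lam)) (itv_green lam).
Proof.
move=> l0; have [psi [gr ch]] := itv_green_gradient l0.
exact: harmonic_on_gradient (@open_U lam) gr ch.
Qed.

(** This is |(z - a) - lam^2 (z - b)|, the square root of the product in [itv_nnM]. *)
Definition itv_pole_factor lam z : R :=
  if lam == 1 then b - a
  else `|1 - lam ^+ 2| * modulus (z - real_pt ((a - lam ^+ 2 * b) / (1 - lam ^+ 2))).

Let sqr_neq1 lam : 0 < lam -> lam != 1 -> 1 - lam ^+ 2 != 0.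
Proof.
move=> l0 l1; rewrite subr_eq0 eq_sym -[X in _ != X](expr1n _ 2) eqf_sqr negb_or l1.
by rewrite gt_eqF// (lt_trans _ l0)// oppr_lt0.
Qed.

(** Eliminating the factor that vanishes at the pole isolates the singularity: the first logarithm
    is bounded below, the second carries the distance to a finite pole. *)
Lemma itv_greenE lam z : 0 < lam -> Some z != itv_pole lam ->
  itv_green lam z = ln (nn lam z) - ln (itv_pole_factor lam z).
Proof.
move=> l0 zp; have n0 := itv_nn_gt0 z l0.
have nm : 0 < nn (- lam) z by rewrite itv_nnN_gt0.
have q0 : 0 < itv_pole_factor lam z.
  rewrite /itv_pole_factor; move: zp; rewrite /itv_pole.
  case: ifPn => [_ _|l1 zp]; first by rewrite subr_gt0.
  rewrite mulr_gt0 ?normr_gt0 ?sqr_neq1//.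
  rewrite lt_neqAle modulus_ge0 andbT eq_sym modulus_eq0 subr_eq0.
  by apply: contra zp => /eqP ->.
have : itv_pole_factor lam z ^+ 2 = nn lam z * nn (- lam) z.
  rewrite itv_nnM /itv_pole_factor; case: eqP => [->|/eqP l1].
    by rewrite expr1n; ring.
  rewrite exprMn sqr_modulus/= real_normK ?num_real// subr0.
  by field; exact: sqr_neq1.
move=> /(congr1 (@ln R)); rewrite lnM ?posrE// lnXn// -mulr_natl => E.
rewrite /itv_green; move: E; lra.
Qed.

Let nn_ge_da lam z : 0 < lam -> da z <= nn lam z.
Proof.
move=> l0; rewrite /nn -addrA lerDl addr_ge0 ?mulr_ge0 ?sqr_ge0//; exact: ltW.
Qed.

Let modB (c : R) z : modulus z - `|c| <= modulus (z - real_pt c) /\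
  modulus (z - real_pt c) <= modulus z + `|c|.
Proof.
rewrite -modulus_real_pt; split; first exact: ler_modulusB.
by rewrite -[modulus (real_pt c)]modulusN; exact: ler_modulusD.
Qed.

Let modP (p : plane) z (c : R) : modulus (z - real_pt c) <= modulus (z - p) + modulus (p - real_pt c).
Proof. by rewrite -[z - real_pt c](subrKA p); exact: ler_modulusD. Qed.

Lemma is_green_itv_infty : is_green K None (itv_green 1).
Proof.
have p1 : itv_pole 1 = None by rewrite /itv_pole eqxx.
have lE z : itv_green 1 z = ln (nn 1 z) - ln (b - a).
  by rewrite itv_greenE// ?p1// /itv_pole_factor eqxx.
have nn_le z : nn 1 z <= 2 * (2 * modulus z + `|a| + `|b|).
  have := itv_nn_le z (@ltr01 R); rewrite expr1n mul1r.
  by have [_] := modB a z; have [_] := modB b z; rewrite -/(da z) -/(db z); lra.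
split.
- by have := harmonic_itv_green (@ltr01 R); rewrite p1.
(* When |z| exceeds 2 (|a| + |b| + 1) the distances to [a] and [b] are comparable to |z|, and
   [itv_nn] lies between |z| / 8 and 8 |z|. *)
- exists (2 * (`|a| + `|b| + 1))^-1, (ln 8 + `|ln (b - a)|); split.
    by rewrite invr_gt0 mulr_gt0// ltr_wpDl// addr_ge0.
  move=> z /=; rewrite invrK => zr _; rewrite lE.
  have a0 := normr_ge0 a; have b0 := normr_ge0 b.
  have m0 : 0 < modulus z by lra.
  have h1 : modulus z / 8 <= nn 1 z.
    apply: le_trans (nn_ge_da z (@ltr01 R)).
    by have [+ _] := modB a z; rewrite -/(da z); lra.
  have h2 : nn 1 z <= 8 * modulus z by have := nn_le z; lra.
  have : ln (nn 1 z) <= ln 8 + ln (modulus z).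
    by rewrite -lnM ?posrE// ler_ln ?posrE ?itv_nn_gt0// mulr_gt0.
  have : ln (modulus z) - ln 8 <= ln (nn 1 z).
    by rewrite -ln_div ?posrE// ler_ln ?posrE ?itv_nn_gt0// divr_gt0.
  have := ler_norm (ln (b - a)); have := ler_norm (- ln (b - a)); rewrite normrN.
  by rewrite ler_norml; lra.
- move=> r r0; exists (ln (2 * (2 * r^-1 + `|a| + `|b|)) - ln (b - a)) => z /= /negP.
  rewrite -leNgt => zr zK; rewrite ger0_norm; last by rewrite itv_green_ge0// p1.
  rewrite lE lerD2r ler_ln ?posrE ?itv_nn_gt0//; first by have := nn_le z; lra.
  have a0 := normr_ge0 a; have b0 := normr_ge0 b.
  have ri : 0 < r^-1 by rewrite invr_gt0.
  lra.
- move=> z zK; split; first exact: itv_green_itv.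
  by apply: continuous_itv_green; rewrite ?p1.
Qed.

Lemma is_green_itv_finite lam : 0 < lam -> lam != 1 -> is_green K (itv_pole lam) (itv_green lam).
Proof.
move=> l0 l1.
pose p := real_pt ((a - lam ^+ 2 * b) / (1 - lam ^+ 2)).
have pE : itv_pole lam = Some p by rewrite /itv_pole (negPf l1).
pose d := `|1 - lam ^+ 2|.
have d0 : 0 < d by rewrite normr_gt0 sqr_neq1.
have lE z : Some z != Some p -> itv_green lam z = ln (nn lam z) - ln (d * modulus (z - p)).
  by move=> zp; rewrite itv_greenE ?pE// /itv_pole_factor (negPf l1).
have pK : ~ K p.
  move=> /itv_kappa_eq0 k0.
  have := itv_nnN_gt0 p l0; rewrite pE eqxx => /negbT/negP; apply.
  have := itv_nn_gt0 p l0; rewrite /nn k0 sqrrN; lra.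
have nn_le z : nn lam z <= 2 * (modulus (z - p) + da p + lam ^+ 2 * (modulus (z - p) + db p)).
  apply: (le_trans (itv_nn_le z l0)); rewrite ler_pM2l//; apply: lerD; first exact: modP.
  by apply: ler_wpM2l; [exact: sqr_ge0|exact: modP].
have dap := da0 p; have dbp := db0 p; have l2 : 0 <= lam ^+ 2 := sqr_ge0 _.
have mod0 z : Some z != Some p -> 0 < modulus (z - p).
  move=> zp; rewrite lt_neqAle modulus_ge0 andbT eq_sym modulus_eq0 subr_eq0.
  by apply: contra zp => /eqP ->.
split.
- exact: harmonic_itv_green.
- pose c := Num.min 1 (lam ^+ 2) * (b - a).
  pose e := 2 * (1 + da p + lam ^+ 2 * (1 + db p)).
  have c0 : 0 < c := m_gt0 l0.
  have e0 : 0 < e.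
    have : 0 <= lam ^+ 2 * (1 + db p) by rewrite mulr_ge0// addr_ge0.
    by rewrite /e; lra.
  exists 1, (`|ln c| + `|ln e| + `|ln d|); split => // z; rewrite pE /= => zr /eqP zp.
  have m0 := mod0 z zp.
  rewrite lE// lnM ?posrE//.
  have h1 : ln c <= ln (nn lam z).
    by rewrite ler_ln ?posrE ?itv_nn_gt0//; exact: itv_nn_ge (ltW l0).
  have h2 : ln (nn lam z) <= ln e.
    rewrite ler_ln ?posrE ?itv_nn_gt0//; apply: (le_trans (nn_le z)); rewrite ler_pM2l//.
    by apply: lerD; [rewrite lerD2r ltW|apply: ler_wpM2l => //; rewrite lerD2r ltW].
  have := ler_norm (ln c); have := ler_norm (- ln c); rewrite normrN.
  have := ler_norm (ln d); have := ler_norm (- ln d); rewrite normrN.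
  have := ler_norm (ln e); have := ler_norm (- ln e); rewrite normrN.
  by rewrite ler_norml; lra.
- move=> r r0; pose e := 2 * (1 + da p / r + lam ^+ 2 * (1 + db p / r)) / d.
  exists (ln e) => z; rewrite pE /= => /negP; rewrite -leNgt => zr zK.
  have m0 : 0 < modulus (z - p) by exact: lt_le_trans zr.
  have zp : Some z != Some p.
    by apply/eqP => -[zp]; move: m0; rewrite zp subrr /modulus/= expr0n addr0 sqrtr0 ltxx.
  rewrite ger0_norm; last by rewrite itv_green_ge0// pE.
  rewrite lE// -ln_div ?posrE ?itv_nn_gt0 ?mulr_gt0// ler_ln ?posrE ?divr_gt0 ?itv_nn_gt0 ?mulr_gt0//.
    rewrite ler_pdivrMr ?mulr_gt0//; apply: (le_trans (nn_le z)).
    have -> : e * (d * modulus (z - p)) = 2 * (modulus (z - p) + da p * (modulus (z - p) / r) +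
        lam ^+ 2 * (modulus (z - p) + db p * (modulus (z - p) / r))).
      by rewrite /e; field; rewrite !gt_eqF.
    have m1 : 1 <= modulus (z - p) / r by rewrite ler_pdivlMr// mul1r.
    rewrite ler_pM2l//; apply: lerD; first by rewrite lerD2l ler_peMr.
    by apply: ler_wpM2l => //; rewrite lerD2l ler_peMr.
  have t1 : 0 <= da p / r by rewrite divr_ge0// ltW.
  have t2 : 0 <= db p / r by rewrite divr_ge0// ltW.
  have t3 : 0 <= lam ^+ 2 * (1 + db p / r) by rewrite mulr_ge0// addr_ge0.
  lra.
- move=> z zK; split; first exact: itv_green_itv.
  apply: continuous_itv_green; rewrite ?pE//.
  by apply/eqP => -[zp]; apply: pK; rewrite -zp.
Qed.

Lemma is_green_itv lam : 0 < lam -> is_green K (itv_pole lam) (itv_green lam).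
Proof.
move=> l0; have [->|l1] := eqVneq lam 1; last exact: is_green_itv_finite.
by rewrite /itv_pole eqxx; exact: is_green_itv_infty.
Qed.

(** For a finite pole the barrier is the sum of two nonnegative Green functions: the one with pole
    at infinity is large far away, the other near the pole. *)
Lemma green_barrier_itv lam : 0 < lam -> exists G, green_barrier K (itv_pole lam) G.
Proof.
move=> l0.
have p1 : itv_pole 1 = None by rewrite /itv_pole eqxx.
have big z (M : R) : ~ K z -> `|a| + (b - a) * expR M <= modulus z -> M <= itv_green 1 z.
  move=> zK hz.
  rewrite itv_greenE// ?p1// /itv_pole_factor eqxx -ln_div ?posrE ?subr_gt0 ?itv_nn_gt0//.
  rewrite -[X in X <= _](expRK M) ler_ln ?posrE ?expR_gt0 ?divr_gt0 ?subr_gt0 ?itv_nn_gt0//.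
  rewrite ler_pdivlMr ?subr_gt0//; apply: le_trans (nn_ge_da z (@ltr01 R)).
  by have [+ _] := modB a z; rewrite -/(da z) mulrC; lra.
have [l1|l1] := eqVneq lam 1.
  exists (itv_green 1); rewrite l1; split; first exact: harmonic_itv_green.
    by have [_ _ _] := is_green_itv_infty.
  move=> M; exists (`|a| + (b - a) * expR M), (1 / 2); split; first by rewrite divr_gt0.
  move=> z [zK _] [/(big z M zK)//|]; rewrite p1 /= ; lra.
exists (fun z => itv_green 1 z + itv_green lam z).
pose p := real_pt ((a - lam ^+ 2 * b) / (1 - lam ^+ 2)).
have pE : itv_pole lam = Some p by rewrite /itv_pole (negPf l1).
have lE z : Some z != Some p -> itv_green lam z = ln (nn lam z) - ln (`|1 - lam ^+ 2| * modulus (z - p)).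
  by move=> zp; rewrite itv_greenE ?pE// /itv_pole_factor (negPf l1).
have [psi1 [gr1 ch1]] := itv_green_gradient (@ltr01 R).
have [psi2 [gr2 ch2]] := itv_green_gradient l0.
have U12 : off_pole K (itv_pole lam) `<=` off_pole K (itv_pole 1).
  by move=> z [zK _]; split => //=; rewrite p1.
split.
- apply: (@harmonic_on_gradient _ _ _ (fun z => psi1 z + psi2 z) (@open_U lam)).
    by move=> z Uz; apply: is_gradientD; [apply: gr1; exact: U12|exact: gr2].
  by apply: cholD ch2; exact: chol_sub ch1.
- move=> z zK; have [_ _ _ /(_ z zK)[e1 c1]] := is_green_itv (@ltr01 R).
  have [_ _ _ /(_ z zK)[e2 c2]] := is_green_itv l0.
  by rewrite e1 e2 addr0; split => //; exact: cvgD c1 c2.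
- move=> M; pose c := Num.min 1 (lam ^+ 2) * (b - a).
  have c0 : 0 < c := m_gt0 l0.
  have d0 : 0 < `|1 - lam ^+ 2| by rewrite normr_gt0 sqr_neq1.
  exists (`|a| + (b - a) * expR M), (c / (`|1 - lam ^+ 2| * expR M)); split.
    by rewrite divr_gt0// mulr_gt0// expR_gt0.
  move=> z [zK /eqP zp].
  have g1 : 0 <= itv_green 1 z by rewrite itv_green_ge0// p1.
  have g2 : 0 <= itv_green lam z by rewrite itv_green_ge0.
  move=> [/(big z M zK) h|]; first by lra.
  rewrite pE/= => h; suff : M <= itv_green lam z by lra.
  have m0 : 0 < modulus (z - p).
    rewrite lt_neqAle modulus_ge0 andbT eq_sym modulus_eq0 subr_eq0.
    by move: zp; rewrite pE; apply: contra => /eqP ->.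
  have zp' : Some z != Some p by rewrite -pE.
  rewrite lE// -ln_div ?posrE ?itv_nn_gt0 ?mulr_gt0//.
  rewrite -[X in X <= _](expRK M) ler_ln ?posrE ?expR_gt0 ?divr_gt0 ?itv_nn_gt0 ?mulr_gt0//.
  rewrite ler_pdivlMr ?mulr_gt0//.
  apply: le_trans (itv_nn_ge z (ltW l0)); rewrite -/c.
  move: h; rewrite ler_pdivlMr ?mulr_gt0 ?expR_gt0//; lra.
Qed.

Lemma greenE_itv lam z : 0 < lam -> ~ K z -> Some z != itv_pole lam ->
  green K (itv_pole lam) z = (itv_green lam z)%:E.
Proof.
move=> l0 zK /eqP zp; rewrite /green; case: pselect => //= nK; case: pselect => //= nz.
congr (_%:E); have [G bG] := green_barrier_itv l0.
have h : [set g | is_green K (itv_pole lam) g] (itv_green lam) by exact: is_green_itv.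
apply: (green_eq closed_itv_plane (xgetI _ h) (is_green_itv l0) bG).
by split.
Qed.

(** [xget] returns the default 0 unless some function satisfies [is_green]. None does for [p] on
    [K]: it would vanish continuously at [p] and yet stay within a bounded distance of - ln |z - p|,
    which blows up. *)
Lemma green_pole_itv p z : K p -> ~ K z -> green K (Some p) z = 0%E.
Proof.
move=> pK zK; rewrite /green; case: pselect => //= nK; case: pselect => /= [zp|nz].
  by case: zp => zp; case: zK; rewrite zp.
case: xgetP => [g _ [_ [r [M [r0 hM]]] _ /(_ p pK)[gp cg]]|//].
exfalso.
have : \forall z \near p, `|g z| < 1.
  have g1 : g p < 1 by rewrite gp.
  have gN1 : - 1 < g p by rewrite gp oppr_lt0.
  apply: near_imp2 (cvgr_lt _ cg _ g1) (cvgr_gt _ cg _ gN1) => w w1 w2.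
  by rewrite ltr_norml w1 w2.
have mc := @continuous_modulusB R p p.
have : \forall z \near p, modulus (z - p) < Num.min r (expR (- (M + 1))).
  by apply: (cvgr_lt _ mc); rewrite subrr /modulus/= expr0n addr0 sqrtr0 lt_min r0 expR_gt0.
move=> h1 h2.
have : \forall w \near p, modulus (w - p) < Num.min r (expR (- (M + 1))) /\ `|g w| < 1.
  by apply: near_imp2 h1 h2 => w.
move=> /nbhs_ballP[e e0 he].
pose w : plane := p + real_pt (e / 2).
have wp : modulus (w - p) = e / 2.
  by rewrite /w addrC addKr modulus_real_pt ger0_norm// ltW// divr_gt0.
have bw : ball p e w.
  split; rewrite /= /ball/= ?addr0 ?subrr ?normr0// opprD addrA subrr sub0r normrN gtr0_norm ?divr_gt0//.
  by rewrite ltr_pdivrMr// ltr_pMr// ltr1n.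
have [mw gw] := he w bw.
have wm : modulus (w - p) < r by rewrite (lt_le_trans mw)// ge_min lexx.
have wm2 : modulus (w - p) < expR (- (M + 1)) by rewrite (lt_le_trans mw)// ge_min lexx orbT.
have wp' : Some w <> Some p.
  move=> [] E; have e1 : 0 < e := e0; move: wp.
  by rewrite E subrr /modulus/= expr0n addr0 sqrtr0; lra.
have := hM w wm wp'; rewrite /= opprK.
have : ln (modulus (w - p)) < - (M + 1).
  by rewrite -[X in _ < X]expRK ltr_ln ?posrE ?expR_gt0// wp divr_gt0.
by move: gw; rewrite !ltr_norml ler_norml; lra.
Qed.

End interval_green.

(** * The equilibrium density and its field *)

Section support.
Context {R : realType}.
Implicit Types (nu : {measure set (measurableTypeR R) -> \bar R}).

(** A Lindelof argument: each point outside the support lies in a null interval with rational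
    endpoints, and there are countably many of these. *)
Lemma supp_negligible nu : nu.-negligible (~` supp nu).
Proof.
pose F (n : nat) : set (measurableTypeR R) := if @unpickle (rat * rat)%type n is Some (p, q) then
  if nu `]ratr p, ratr q[%classic == 0%E then `]ratr p, ratr q[%classic else set0 else set0.
apply: (@negligibleS _ _ _ nu (\bigcup_n F n)); last first.
  apply: negligible_bigcup => n; rewrite /F; case: unpickle => [[p q]|]; last exact: negligible_set0.
  by case: ifPn => [/eqP h|_]; [apply/negligibleP => //; exact: measurable_itv|exact: negligible_set0].
move=> x /= /existsNP[U] /not_implyP[oU] /not_implyP[Ux nU].
have nU0 : nu U = 0%E.
  by apply/eqP; rewrite eq_le measure_ge0 andbT leNgt; apply/negP.
have /nbhs_ballP[e e0 he] : nbhs x U by exact: open_nbhs_nbhs.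
have [p] := @rat_in_itvoo R (x - e) x ltac:(by rewrite ltrBlDr ltrDl).
have [q] := @rat_in_itvoo R x (x + e) ltac:(by rewrite ltrDl).
rewrite !in_itv/= => /andP[xq qe] /andP[ep px].
exists (pickle (p, q)); first exact: I.
rewrite /F (pickleK (p, q)).
have -> : nu `]ratr p, ratr q[%classic == 0%E; last by rewrite /= in_itv/= px xq.
apply/eqP; apply: (@measure_negligible _ _ _ nu); first exact: measurable_itv.
apply: (@negligibleS _ _ _ nu U); last by apply/negligibleP => //; exact: open_measurable.
move=> y /=; rewrite in_itv/= => /andP[py yq]; apply: he.
by rewrite /ball/= ltr_distl; move: ep qe py yq; lra.
Qed.

Lemma supp_itv_null nu (c d : R) : supp nu `<=` `[c, d] -> nu (~` `[c, d]) = 0%E.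
Proof.
move=> h; apply: measure_negligible; first exact: measurableC (measurable_itv _).
by apply: negligibleS (supp_negligible nu); exact: subsetC.
Qed.

Lemma null_supp_itv nu (c d : R) : nu (~` `[c, d]) = 0%E -> supp nu `<=` `[c, d].
Proof.
move=> h x sx; apply: contrapT => xcd.
have oC : open (~` `[c, d]%classic : set R) by apply: closed_openC; exact: interval_closed.
by have := sx _ oC xcd; rewrite h ltxx.
Qed.

End support.

Section null_integral.
Context d (T : measurableType d) (R : realType) (mu : {measure set T -> \bar R}).
Implicit Types (D : set T) (f : T -> \bar R).
Local Open Scope ereal_scope.

Lemma ge0_integral_null D f : measurable D -> measurable_fun setT f -> (forall x, 0 <= f x) ->
  mu (~` D) = 0 -> \int[mu]_x f x = \int[mu]_(x in D) f x.
Proof.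
move=> mD mf f0 D0; rewrite (ge0_negligible_integral (measurableC mD) measurableT mf _ D0)//.
by rewrite setTD setCK.
Qed.

Lemma integral_null D f : measurable D -> measurable_fun setT f ->
  mu (~` D) = 0 -> \int[mu]_x f x = \int[mu]_(x in D) f x.
Proof.
move=> mD mf D0; rewrite integralE [RHS]integralE.
by rewrite !(ge0_integral_null mD _ _ D0)//; [exact: measurable_funeneg|exact: measurable_funepos].
Qed.

(** The lower bound makes the negative part of [f] integrable. It can therefore be added and
    cancelled even when the integral of [f] is +oo. *)
Lemma integral_shift D f (L : R) : measurable D -> measurable_fun setT f ->
  mu (~` D) = 0 -> mu setT < +oo -> (0 <= L)%R -> (forall x, D x -> (- L)%:E <= f x) ->
  \int[mu]_(x in D) (f x + L%:E) = \int[mu]_x f x + L%:E * mu setT.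
Proof.
move=> mD mf D0 fin L0 fL.
have muD : mu D = mu setT.
  have := ge0_integral_null mD (measurable_cst (1%E : \bar R)) (fun=> lee01) D0.
  by rewrite !integral_cst// !mul1e.
have mfD : measurable_fun D f by exact: measurable_funS mf.
rewrite (integral_null mD mf D0) [X in _ = X + _]integralE.
have mneg : measurable_fun D (f^\-)%E by exact: measurable_funeneg.
have mpos : measurable_fun D (f^\+)%E by exact: measurable_funepos.
have mL : measurable_fun D (cst L%:E) by exact: measurable_cst.
have fnL x : D x -> (f^\-)%E x <= L%:E.
  by move=> Dx; rewrite funenegE ge_max lee_fin L0 andbT leeNl; exact: fL.
have finN : \int[mu]_(x in D) (f^\-)%E x \is a fin_num.
  rewrite ge0_fin_numE; last exact: integral_ge0.
  apply: (@le_lt_trans _ _ (\int[mu]_(x in D) L%:E)).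
    by apply: ge0_le_integral.
  by rewrite integral_cst// muD lte_mul_pinfty.
have h : \int[mu]_(x in D) (f x + L%:E) + \int[mu]_(x in D) (f^\-)%E x =
    \int[mu]_(x in D) (f^\+)%E x + L%:E * mu setT.
  rewrite -muD -integral_cst// -!ge0_integralD//.
  - apply: eq_integral => x /[!inE] Dx; have E : f x = (f^\+)%E x - (f^\-)%E x by rewrite [LHS](congr1 (@^~ x) (funeposneg f)).
    rewrite E.
    have : (f^\-)%E x \is a fin_num.
      by rewrite ge0_fin_numE ?funeneg_ge0// (le_lt_trans (fnL x Dx)) ?ltry.
    move: ((f^\-)%E x) ((f^\+)%E x) => u v ufin.
    by rewrite addeAC subeK.
  - by move=> x Dx; rewrite -leeBlDr// sub0e; exact: fL.
  - exact: emeasurable_funD.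
by rewrite addeAC -h addeK.
Qed.

End null_integral.

Section potential_shift.
Context {R : realType}.
Local Open Scope ereal_scope.

Lemma ex_log_kernel_lbound (c d : R) : exists2 L : R, (0 <= L)%R &
  forall x t : R, (c <= x <= d)%R -> (c <= t <= d)%R -> (- L)%:E <= log_kernel x t.
Proof.
exists (ln (`|d - c| + 1))%R; first by rewrite ln_ge0// lerDr.
move=> x t /andP[cx xd] /andP[ct td]; apply: log_kernel_ge.
  by rewrite ltr_wpDl.
rewrite ler_norml ger0_norm ?subr_ge0 ?(le_trans cx)//; move: cx xd ct td; lra.
Qed.

Lemma log_potential_shift (nu : {measure set (measurableTypeR R) -> \bar R}) (D : set R) (x L : R) :
  measurable D -> nu (~` D) = 0 -> nu setT < +oo -> (0 <= L)%R ->
  (forall t, D t -> (- L)%:E <= log_kernel x t) ->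
  \int[nu]_(t in D) (log_kernel x t + L%:E) = log_potential nu x + L%:E * nu setT.
Proof.
by move=> mD D0 fin L0 h; apply: integral_shift => //; apply: measurable_log_kernel.
Qed.

End potential_shift.

(** * Monotonicity and doubling of the harmonic densities *)

Section poisson_props.
Context {R : realType}.
Implicit Types (lam t : R).
Local Open Scope ring_scope.

Lemma integral_poisson lam : 0 < lam ->
  (\int[lebesgue_measure]_(t in `[0%R, (pi / 2)%R]) (poisson lam t)%:E = (pi / 2)%:E)%E.
Proof.
move=> l0; have p0 : 0 < pi / 2 :> R by rewrite divr_gt0 ?pi_gt0.
have := @substitution R (poisson_angle lam) (poisson lam) 0%R (pi / 2)%R (cst 1%E) p0
  (fun t => poisson_angle_derive t l0) (continuous_poisson l0)
  (fun t => poisson_gt0 t l0) (measurable_cst _).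
have -> : poisson_angle lam 0 = 0%R.
  by rewrite /poisson_angle sin0 !(mulr0, mul0r) atan0 addr0.
have -> : poisson_angle lam (pi / 2) = (pi / 2)%R.
  by rewrite /poisson_angle cos_pihalf !(mulr0, mul0r) atan0 addr0.
have -> : (\int[lebesgue_measure]_(x in `[0%R, (pi / 2)%R]) cst 1 x = (pi / 2 : R)%:E)%E.
  rewrite integral_cst; last exact: measurable_itv.
  by rewrite mul1e; exact: lebesgue_measure_quarter.
by move=> ->; apply: eq_integral => t _; rewrite mul1e.
Qed.

Lemma poissonE lam t : 0 < lam -> poisson lam t = lam^-1 - lam^-1 * (1 - lam ^+ 2) *
   (sin t ^+ 2 / (lam ^+ 2 * cos t ^+ 2 + sin t ^+ 2)).
Proof.
move=> l0; have d0 := poisson_den_gt0 t l0.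
have cs := cos2Dsin2 t.
have c2 : cos t ^+ 2 = 1 - sin t ^+ 2 by lra.
rewrite /poisson; move: d0; rewrite c2; move: (sin t) => s d0.
by field; rewrite !gt_eqF.
Qed.

Lemma sqr_sin_homo u t : 0 <= u -> u <= t -> t <= pi / 2 -> sin u ^+ 2 <= sin t ^+ 2.
Proof.
move=> u0 ut t2; have p0 := pi_gt0 R.
rewrite -subr_ge0 sinXsubX; apply: mulr_ge0; apply: sin_ge0_pi; apply/andP; split; lra.
Qed.

Lemma poisson_antitone lam u t : 0 < lam <= 1 -> 0 <= u -> u <= t -> t <= pi / 2 ->
  poisson lam t <= poisson lam u.
Proof.
move=> /andP[l0 l1] u0 ut t2.
have du := poisson_den_gt0 u l0; have dt := poisson_den_gt0 t l0.
have s := sqr_sin_homo u0 ut t2.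
have l2 : lam ^+ 2 <= 1 by rewrite expr_le1// ltW.
rewrite ler_pM2l// lef_pV2// ?posrE//.
have := cos2Dsin2 u; have := cos2Dsin2 t; nra.
Qed.

(** This quantifies the drop below the value 1 / lam taken at t = 0. Integrated against [rho], it
    gives strict positivity of the density for t > 0, hence the full support. *)
Lemma poisson_le lam t : 0 < lam <= 1 -> poisson lam t <= lam^-1 * (1 - (1 - lam ^+ 2) * sin t ^+ 2).
Proof.
move=> /andP[l0 l1]; have d0 := poisson_den_gt0 t l0.
have l2 : lam ^+ 2 <= 1 by rewrite expr_le1// ltW.
rewrite poissonE// -[X in X - _]mulr1 -mulrA -mulrBr ler_pM2l ?invr_gt0// lerD2l lerN2.
apply: ler_wpM2l; first by rewrite subr_ge0.
rewrite ler_pdivlMr//.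
rewrite ler_piMr ?sqr_ge0// -[leRHS](cos2Dsin2 t) lerD2r.
by rewrite ler_piMl ?sqr_ge0.
Qed.

(** The difference 1 / lam - poisson is a constant times sin^2 / (lam^2 cos^2 + sin^2). From t / 2
    to [t] the numerator at most quadruples, because sin t = 2 sin (t / 2) cos (t / 2), and the
    denominator grows; so the factor 4 is free of [lam]. *)
Lemma poisson_half lam t : 0 < lam <= 1 -> 0 <= t -> t <= pi / 2 ->
  lam^-1 - poisson lam t <= 4 * (lam^-1 - poisson lam (t / 2)).
Proof.
move=> /andP[l0 l1] t0 t2.
have du := poisson_den_gt0 (t / 2) l0; have dt := poisson_den_gt0 t l0.
have l2 : lam ^+ 2 <= 1 by rewrite expr_le1// ltW.
have s : sin (t / 2) ^+ 2 <= sin t ^+ 2 by apply: sqr_sin_homo => //; lra.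
have E v : lam^-1 - poisson lam v =
    lam^-1 * (1 - lam ^+ 2) * (sin v ^+ 2 / (lam ^+ 2 * cos v ^+ 2 + sin v ^+ 2)).
  by rewrite [poisson lam v]poissonE// opprB addrC subrK.
rewrite !E [leRHS]mulrCA; apply: ler_wpM2l; first by rewrite mulr_ge0 ?subr_ge0// invr_ge0 ltW.
have s4 : sin t ^+ 2 <= 4 * sin (t / 2) ^+ 2.
  have -> : sin t = 2 * sin (t / 2) * cos (t / 2) by rewrite -sin_double; congr sin; field.
  have c1 : cos (t / 2) ^+ 2 <= 1 by have := cos2Dsin2 (t / 2); have := sqr_ge0 (sin (t / 2)); lra.
  rewrite !exprMn; have := sqr_ge0 (sin (t / 2)); nra.
have dd : lam ^+ 2 * cos (t / 2) ^+ 2 + sin (t / 2) ^+ 2 <= lam ^+ 2 * cos t ^+ 2 + sin t ^+ 2.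
  by have := cos2Dsin2 t; have := cos2Dsin2 (t / 2); nra.
rewrite [leRHS]mulrA; apply: ler_pM => //; first exact: sqr_ge0.
  by rewrite invr_ge0 ltW.
by rewrite lef_pV2 ?posrE.
Qed.

End poisson_props.

Section tonelli_restrict.
Context d1 d2 (T1 : measurableType d1) (T2 : measurableType d2) (R : realType).
Variables (m1 : {sigma_finite_measure set T1 -> \bar R}).
Variables (m2 : {sigma_finite_measure set T2 -> \bar R}).
Local Open Scope ereal_scope.

Variables (D : set T1) (f : T1 -> T2 -> \bar R).
Hypotheses (mD : measurable D) (mf : measurable_fun [set: T1 * T2] (fun z => f z.1 z.2)).
Hypothesis f0 : forall x y, 0 <= f x y.

Let h (z : T1 * T2) := (fun z => f z.1 z.2) z * (\1_D z.1)%:E.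

Let mh : measurable_fun setT h.
Proof.
apply: emeasurable_funM => //; apply/measurable_EFinP.
by apply: measurableT_comp => //; exact: measurable_indic.
Qed.

Let h0 z : 0 <= h z. Proof. by rewrite mule_ge0// lee_fin. Qed.

Let hE y : \int[m1]_x (f x y * (\1_D x)%:E) = \int[m1]_(x in D) f x y.
Proof.
rewrite [RHS]integral_mkcond.
by apply: eq_integral => x _; rewrite patchE indicE; case: ifPn => _; rewrite ?mule1 ?mule0.
Qed.

Lemma measurable_integral_restrict :
  measurable_fun [set: T2] (fun y => \int[m1]_(x in D) f x y).
Proof.
by under eq_fun do rewrite -hE; exact: (measurable_fun_fubini_tonelli_G (m1 := m1) h).
Qed.

Lemma tonelli_restrict :
  \int[m1]_(x in D) \int[m2]_y f x y = \int[m2]_y \int[m1]_(x in D) f x y.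
Proof.
have := fubini_tonelli h mh h0; rewrite /h /= => E.
transitivity (\int[m1]_x \int[m2]_y (f x y * (\1_D x)%:E)).
  rewrite [LHS]integral_mkcond; apply: eq_integral => x _; rewrite patchE indicE.
  case: ifPn => xD; last by under eq_integral do rewrite mule0; rewrite integral0.
  by apply: eq_integral => y _; rewrite mule1.
by rewrite E; apply: eq_integral => y _; rewrite hE.
Qed.

End tonelli_restrict.

Section measurable_inverse.
Context d (T : measurableType d) {R : realType}.

Lemma measurable_inv : measurable_fun [set: R] (@GRing.inv R).
Proof.
have -> : @GRing.inv R = fine \o (fun x : R => x%:E^-1%E).
  by apply/funext => x /=; rewrite inver; case: eqVneq => [->|//]; rewrite invr0.
by apply: measurableT_comp; [exact: fine_measurable|exact: measurable_inver].
Qed.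

Lemma measurable_divr (f g : T -> R) : measurable_fun setT f -> measurable_fun setT g ->
  measurable_fun setT (fun x => f x / g x).
Proof.
by move=> mf mg; apply: measurable_funM => //; exact: measurableT_comp measurable_inv mg.
Qed.

End measurable_inverse.

(** * The equilibrium density *)

Section equilibrium_density.
Context {R : realType}.
Variables (k : nat) (a b c N : R) (rho : {finite_measure set (measurableTypeR R) -> \bar R}).
Hypothesis k1 : (1 <= k)%N.
Hypothesis ab : a < b.
Hypothesis ca : c < a.

Definition charge_ratio (y : R) : R := Num.sqrt ((a - y) / (b - y)).
Local Notation lam := charge_ratio.
Local Notation mu := (@lebesgue_measure R).
Local Notation I := (`[0%R, (pi / 2)%R : R]%classic).
Local Notation D := (`[c, a[%classic : set (measurableTypeR R)).

Hypothesis rhoD : rho (~` D) = 0%E.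
Hypothesis totN : (k%:R%:E + rho setT = N%:E)%E.
Hypothesis eta_le : (\int[rho]_(y in D) ((lam y)^-1)%:E <= N%:E)%E.

Lemma charge_ratio_ge0 y : 0 <= lam y. Proof. exact: sqrtr_ge0. Qed.

Lemma charge_ratio_itv y : D y -> 0 < lam y < 1.
Proof.
rewrite /= in_itv/= => /andP[cy ya].
have yb' : y < b by exact: lt_trans ab.
have yb : 0 < b - y by rewrite subr_gt0.
rewrite sqrtr_gt0 divr_gt0 ?subr_gt0//=.
by rewrite -[X in _ < X]sqrtr1 ltr_sqrt// ltr_pdivrMr// mul1r ltrD2r.
Qed.

Lemma charge_ratio_le y : D y -> lam y <= lam c.
Proof.
rewrite /= in_itv/= => /andP[cy ya].
have yb : 0 < b - y by rewrite subr_gt0 (lt_trans ya).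
have cb : 0 < b - c by rewrite subr_gt0 (lt_trans ca).
rewrite ler_sqrt; last by rewrite divr_ge0 ?subr_ge0 ?ltW// -subr_gt0.
rewrite ler_pdivrMr// mulrAC ler_pdivlMr//.
rewrite -subr_ge0; have -> : (a - c) * (b - y) - (a - y) * (b - c) = (b - a) * (y - c) by ring.
by rewrite mulr_ge0 ?subr_ge0// ltW.
Qed.

Lemma measurable_charge_ratio : measurable_fun [set: R] lam.
Proof.
apply: measurableT_comp; first exact: measurable_sqrt.
by apply: measurable_divr; apply: measurable_funB.
Qed.

Lemma poisson_ge0 (l t : R) : 0 <= l -> 0 <= poisson l t.
Proof. by move=> l0; rewrite divr_ge0// addr_ge0 ?sqr_ge0// mulr_ge0 ?sqr_ge0. Qed.

Lemma measurable_poisson2 d (T : measurableType d) (l u : T -> R) :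
  measurable_fun setT l -> measurable_fun setT u ->
  measurable_fun setT (fun z => poisson (l z) (u z)).
Proof.
move=> ml mu'; apply: measurable_divr => //.
by apply: measurable_funD; [apply: measurable_funM|]; apply: measurable_funX => //;
  [exact: measurableT_comp measurable_cos mu'|exact: measurableT_comp measurable_sin mu'].
Qed.

Definition charge_poisson (t : R) : \bar R := (\int[rho]_y (poisson (lam y) t)%:E)%E.
Local Notation G := charge_poisson.

Let mP t : measurable_fun [set: measurableTypeR R] (fun y => (poisson (lam y) t)%:E).
Proof.
apply/measurable_EFinP; apply: measurable_poisson2; first exact: measurable_charge_ratio.
exact: measurable_cst.
Qed.

Let P0 y t : (0 <= (poisson (lam y) t)%:E)%E.
Proof. by rewrite lee_fin poisson_ge0// charge_ratio_ge0. Qed.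

Let mV : measurable_fun [set: measurableTypeR R] (fun y => ((lam y)^-1)%:E).
Proof.
apply/measurable_EFinP.
exact: measurableT_comp measurable_inv measurable_charge_ratio.
Qed.

Let V0 y : (0 <= ((lam y)^-1)%:E)%E.
Proof. by rewrite lee_fin invr_ge0 charge_ratio_ge0. Qed.

Let mD : measurable D. Proof. exact: measurable_itv. Qed.

Let GD t : G t = (\int[rho]_(y in D) (poisson (lam y) t)%:E)%E.
Proof. exact: ge0_integral_null. Qed.

Let N0 : 0 < N.
Proof.
rewrite -lte_fin -totN; apply: (@lt_le_trans _ _ k%:R%:E); first by rewrite lte_fin ltr0n.
by rewrite leeDl.
Qed.

Let mulV_le (q : R) : 0 <= q -> (\int[rho]_(y in D) (q * (lam y)^-1)%:E <= (q * N)%:E)%E.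
Proof.
move=> q0; under eq_integral do rewrite EFinM.
rewrite ge0_integralZl_EFin//; last exact: measurable_funS mV.
by rewrite EFinM lee_wpmul2l.
Qed.

Let mVq (q : R) : measurable_fun D (fun y => (q * (lam y)^-1)%:E).
Proof.
apply/measurable_EFinP; apply: measurable_funM => //.
by apply: measurable_funS (measurableT_comp measurable_inv measurable_charge_ratio).
Qed.

(** The factor of [poisson_le] at the left end [c], where the ratio is largest: it bounds the
    factors of all charges, and it is below 1 for 0 < t <= pi / 2. *)
Let q_ t := 1 - (1 - lam c ^+ 2) * sin t ^+ 2.

Let cD : D c. Proof. by rewrite /= in_itv/= lexx. Qed.

Let q_ge0 t : 0 <= q_ t.
Proof.
have /andP[l0 l1] := charge_ratio_itv cD.
have : lam c ^+ 2 <= 1 by rewrite expr_le1// ltW.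
have := sqr_ge0 (lam c); have := cos2Dsin2 t; have := sqr_ge0 (cos t); have := sqr_ge0 (sin t).
by rewrite /q_; nra.
Qed.

Let G_leq t : (G t <= (q_ t * N)%:E)%E.
Proof.
rewrite GD; apply: le_trans (mulV_le (q_ge0 t)).
apply: ge0_le_integral => //; first exact: measurable_funS (mP t).
move=> y Dy; rewrite lee_fin.
have /andP[l0 l1] := charge_ratio_itv Dy.
apply: (le_trans (poisson_le t _)); first by rewrite l0 ltW.
rewrite [leLHS]mulrC; apply: ler_wpM2r; first by rewrite invr_ge0 ltW.
rewrite /q_ lerD2l lerN2.
apply: ler_wpM2r; first exact: sqr_ge0.
by rewrite lerD2l lerN2 ler_pXn2r ?nnegrE ?charge_ratio_ge0 ?charge_ratio_le.
Qed.

Let q_le1 t : q_ t <= 1.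
Proof.
have /andP[l0 l1] := charge_ratio_itv cD.
by rewrite /q_ gerBl mulr_ge0 ?sqr_ge0// subr_ge0 expr_le1// ltW.
Qed.

Let G0 t : (0 <= G t)%E. Proof. exact: integral_ge0. Qed.

Let Gfin t : G t = (fine (G t))%:E.
Proof.
rewrite fineK// ge0_fin_numE//; apply: le_lt_trans (G_leq t) _; exact: ltry.
Qed.

Definition equi_density t : R := 2 / pi * (N - fine (G t)).
Local Notation s := equi_density.

Let pin0 : pi != 0 :> R. Proof. by rewrite gt_eqF ?pi_gt0. Qed.
Let p0 : 0 < 2 / pi :> R. Proof. by rewrite divr_gt0 ?pi_gt0. Qed.

Lemma equi_density_ge0 t : 0 <= s t.
Proof.
rewrite mulr_ge0 ?(ltW p0)// subr_ge0 -lee_fin -Gfin (le_trans (G_leq t))// lee_fin.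
by rewrite ger_pMl ?q_le1.
Qed.

Lemma equi_density_le t : s t <= 2 / pi * N.
Proof. by rewrite ler_pM2l// gerBl fine_ge0. Qed.

Lemma equi_density_gt0 t : 0 < t -> t <= pi / 2 -> 0 < s t.
Proof.
move=> t0 t2; rewrite mulr_gt0// subr_gt0 -lte_fin -Gfin (le_lt_trans (G_leq t))// lte_fin.
rewrite gtr_pMl// /q_ ltrBlDr ltrDl mulr_gt0//.
  have /andP[l0 l1] := charge_ratio_itv cD.
  by rewrite subr_gt0 expr_lt1// ltW.
rewrite exprn_gt0// sin_gt0_pi// t0/= (le_lt_trans t2)//.
by have := pi_gt0 R; lra.
Qed.

Lemma equi_density_homo u t : 0 <= u -> u <= t -> t <= pi / 2 -> s u <= s t.
Proof.
move=> u0 ut t2; rewrite ler_pM2l// lerD2l lerN2 -lee_fin -!Gfin !GD.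
apply: ge0_le_integral => //; try exact: measurable_funS (mP _).
move=> y Dy; rewrite lee_fin poisson_antitone//.
by have /andP[-> /ltW->] := charge_ratio_itv Dy.
Qed.

Lemma equi_density_half t : 0 <= t -> t <= pi / 2 -> s t <= 4 * s (t / 2).
Proof.
move=> t0 t2.
(* As [s] is proportional to N - G, the claim reads N - G(t) <= 4 N - 4 G(t / 2). Integrating
   [poisson_half] produces 3 / lam, whose integral is at most 3 N. *)
suff : 4 * fine (G (t / 2)) <= 3 * N + fine (G t).
  by move=> h; rewrite /s mulrCA ler_pM2l//; lra.
rewrite -lee_fin EFinD EFinM -!Gfin.
apply: (@le_trans _ _ (\int[rho]_(y in D) (3 * (lam y)^-1)%:E + G t)%E); last first.
  by rewrite leeD2r// mulV_le.
rewrite !GD -ge0_integralZl_EFin//; last exact: measurable_funS (mP _).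
rewrite -ge0_integralD//; [|by move=> y _; rewrite lee_fin mulr_ge0// invr_ge0 charge_ratio_ge0|
  exact: measurable_funS (mP _)].
apply: ge0_le_integral => //.
- by move=> y _; rewrite mule_ge0.
- by apply: measurable_funeM; exact: measurable_funS (mP _).
- by apply: emeasurable_funD; [exact: mVq|exact: measurable_funS (mP _)].
move=> y Dy; rewrite -EFinM -EFinD lee_fin.
have /andP[l0 l1] := charge_ratio_itv Dy.
have := @poisson_half _ (lam y) t; rewrite l0 (ltW l1) t0 t2 => /(_ isT isT isT); lra.
Qed.

Let mP2 : measurable_fun [set: R * measurableTypeR R]
  (fun z : R * measurableTypeR R => (poisson (lam z.2) z.1)%:E).
Proof.
apply/measurable_EFinP; apply: measurable_poisson2 => //.
exact: measurableT_comp measurable_charge_ratio measurable_snd.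
Qed.

Lemma measurable_charge_poisson : measurable_fun [set: R] G.
Proof.
apply: (measurable_fun_fubini_tonelli_F (m2 := rho)
  (fun z : measurableTypeR R * measurableTypeR R => (poisson (lam z.2) z.1)%:E)) => //.
Qed.

Lemma measurable_equi_density : measurable_fun [set: R] s.
Proof.
apply: measurable_funM => //; apply: measurable_funB => //.
exact: measurableT_comp (fine_measurable measurableT) measurable_charge_poisson.
Qed.

Let sG t : ((s t)%:E + (2 / pi)%:E * G t = (2 / pi * N)%:E)%E.
Proof. by rewrite Gfin -EFinM -EFinD /s; congr EFin; ring. Qed.

(* Tonelli, with the subtraction in [s] moved to the left-hand side. *)
Lemma integral_equi_density (f : R -> \bar R) (J : R -> R) : measurable_fun [set: R] f ->
  (forall t, (0 <= f t)%E) ->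
  (forall l, 0 < l -> (\int[mu]_(t in I) (f t * (poisson l t)%:E) = (pi / 2 * J l)%:E)%E) ->
  (\int[mu]_(t in I) (f t * (s t)%:E) + \int[rho]_(y in D) (J (lam y))%:E = (N * J 1)%:E)%E.
Proof.
move=> mf f0 fJ.
have J1 : (\int[mu]_(t in I) f t = (pi / 2 * J 1)%:E)%E.
  rewrite -(fJ 1)//; apply: eq_integral => t _.
  by rewrite /poisson expr1n mul1r cos2Dsin2 divr1 mule1.
have mfI : measurable_fun I f by exact: measurable_funS mf.
have msI : measurable_fun I (fun t => (s t)%:E).
  by apply/measurable_EFinP; exact: measurable_funS measurable_equi_density.
have mGI : measurable_fun I G by exact: measurable_funS measurable_charge_poisson.
have -> : (\int[rho]_(y in D) (J (lam y))%:E =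
    (2 / pi)%:E * \int[mu]_(t in I) (f t * G t))%E.
  have -> : (\int[mu]_(t in I) (f t * G t) =
      \int[mu]_(t in I) \int[rho]_y (f t * (poisson (lam y) t)%:E))%E.
    by apply: eq_integral => t _; rewrite ge0_integralZl.
  pose F (t : measurableTypeR R) (y : measurableTypeR R) := (f t * (poisson (lam y) t)%:E)%E.
  have mF : measurable_fun [set: measurableTypeR R * measurableTypeR R] (fun z => F z.1 z.2).
    by apply: emeasurable_funM => //; exact: measurableT_comp mf measurable_fst.
  have F0 t y : (0 <= F t y)%E by rewrite mule_ge0.
  have mI : measurable (I : set (measurableTypeR R)) by exact: measurable_itv.
  rewrite (tonelli_restrict mu rho mI mF F0).
  have mh := measurable_integral_restrict mu mI mF F0.
  rewrite (ge0_integral_null mD mh _ rhoD); last first.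
    by move=> y; apply: integral_ge0 => t _; rewrite mule_ge0.
  rewrite -ge0_integralZl//; last 3 first.
  - exact: measurable_funS mh.
  - by move=> y _; apply: integral_ge0 => t _; rewrite mule_ge0.
  - by rewrite lee_fin ltW.
  apply: eq_integral => y /[!inE] Dy; have /andP[l0 _] := charge_ratio_itv Dy.
  rewrite [X in (_ * X)%E](fJ _ l0) -EFinM; congr EFin.
  by rewrite mulrA mulf_div (mulrC 2) divff ?mul1r// mulf_neq0// pnatr_eq0.
rewrite -ge0_integralZl//; last 3 first.
- exact: emeasurable_funM.
- by move=> t _; rewrite mule_ge0.
- by rewrite lee_fin ltW.
rewrite -ge0_integralD//; last 4 first.
- by move=> t _; rewrite mule_ge0// lee_fin equi_density_ge0.
- exact: emeasurable_funM.
- by move=> t _; rewrite mule_ge0 ?mule_ge0// lee_fin ltW.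
- by apply: measurable_funeM; exact: emeasurable_funM.
have -> : (N * J 1)%:E = ((2 / pi * N)%:E * \int[mu]_(t in I) f t)%E.
  by rewrite J1 -EFinM; congr EFin; rewrite mulrACA mulf_div (mulrC 2) divff ?mul1r// mulf_neq0// pnatr_eq0.
rewrite -ge0_integralZl//; last by rewrite lee_fin mulr_ge0// ltW.
apply: eq_integral => t _.
by rewrite muleCA -ge0_muleDr ?sG 1?muleC// ?lee_fin ?equi_density_ge0// mule_ge0// lee_fin ltW.
Qed.

End equilibrium_density.

Section log_ratio.
Context {R : realType}.

(** Multiply the difference of the two sides by [lam]: it vanishes at s = 0 and its derivative is 2
    (1 - lam^2) v^2 / ((lam^2 - v^2) (1 - v^2)) >= 0. *)
Lemma log_ratio_le (lam s : R) : 0 < lam <= 1 -> 0 <= s -> s < lam ->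
  lam^-1 * (ln (1 + s) - ln (1 - s)) <= ln (lam + s) - ln (lam - s).
Proof.
move=> /andP[l0 l1] s0 sl; rewrite mulrC ler_pdivrMr//.
move: s0; rewrite le_eqVlt => /predU1P[<-|s0].
  by rewrite !addr0 !subr0 !subrr mul0r.
pose h (u : R) : R := (ln (lam + u) - ln (lam - u)) * lam - (ln (1 + u) - ln (1 - u)).
pose h' (u : R) : R := ((lam + u)^-1 + (lam - u)^-1) * lam - ((1 + u)^-1 + (1 - u)^-1).
have dl (r u : R) : 0 <= u -> u < r -> is_derive u 1 (fun v : R => ln (r + v) - ln (r - v)) ((r + u)^-1 + (r - u)^-1).
  move=> u0 ur.
  have p1 : 0 < r + u by rewrite ltr_wpDr// (le_lt_trans u0).
  have p2 : 0 < r - u by rewrite subr_gt0.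
  have d1 : is_derive u 1 (fun v : R => r + v) 1.
    by apply: (is_derive_eq (is_deriveD (is_derive_cst r u 1) (is_derive_id u 1))); rewrite add0r.
  have d2 : is_derive u 1 (fun v : R => r - v) (- 1).
    by apply: (is_derive_eq (is_deriveB (is_derive_cst r u 1) (is_derive_id u 1))); rewrite sub0r.
  have e1 := is_derive1_comp (g := fun v : R => r + v) (is_derive1_ln p1) d1.
  have e2 := is_derive1_comp (g := fun v : R => r - v) (is_derive1_ln p2) d2.
  by apply: (is_derive_eq (is_deriveB e1 e2)); ring.
have dh (u : R) : 0 <= u -> u < lam -> is_derive u 1 h (h' u).
  move=> u0 ul.
  apply: (is_derive_eq (is_deriveB (is_deriveM (dl lam u u0 ul) (is_derive_cst lam u 1)) (dl 1 u u0 (lt_le_trans ul l1)))).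
  by rewrite /GRing.scale/= /h'; ring.
have [v /[!in_itv]/= /andP[v0 vs] hv] : exists2 v, v \in `]0, s[ & h s - h 0 = h' v * (s - 0).
  apply: (@derive.MVT _ h h') => //.
    by move=> v; rewrite in_itv/= => /andP[v0 vs]; apply: dh; [exact: ltW|exact: lt_trans sl].
  apply: derivable_within_continuous => v; rewrite in_itv/= => /andP[v0 vs].
  by have [] := dh v v0 (le_lt_trans vs sl).
have h0 : h 0 = 0 by rewrite /h !addr0 !subr0 !subrr mul0r subr0.
have hs : h s = h' v * s by rewrite -[LHS]subr0 -[X in _ - X]h0 hv subr0.
rewrite -subr_ge0 -/(h s) hs mulr_ge0 ?(ltW s0)//.
have vl : v < lam by exact: lt_trans sl.
have v1 : v < 1 by exact: lt_le_trans l1.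
have q1 : 0 < lam ^+ 2 - v ^+ 2 by rewrite subr_gt0 ltr_pXn2r ?nnegrE ?ltW.
have q2 : 0 < 1 - v ^+ 2 by rewrite subr_gt0 expr_lt1 ?ltW.
have -> : h' v = 2 * ((1 - lam ^+ 2) * v ^+ 2) / ((lam ^+ 2 - v ^+ 2) * (1 - v ^+ 2)).
  have n1 : lam + v != 0 by rewrite gt_eqF// addr_gt0.
  have n2 : lam - v != 0 by rewrite gt_eqF// subr_gt0.
  have n3 : 1 + v != 0 by rewrite gt_eqF// addr_gt0.
  have n4 : 1 - v != 0 by rewrite gt_eqF// subr_gt0.
  rewrite /h' (_ : lam ^+ 2 - v ^+ 2 = (lam - v) * (lam + v)); last by ring.
  rewrite (_ : 1 - v ^+ 2 = (1 - v) * (1 + v)); last by ring.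
  by field; rewrite n1 n2 n3 n4.
apply: divr_ge0; last by rewrite ltW// mulr_gt0.
by rewrite mulr_ge0// mulr_ge0 ?sqr_ge0// subr_ge0 expr_le1// ltW.
Qed.

End log_ratio.

(** * Green functions of an interval on the real line *)

Section green_real_line.
Context {R : realType}.
Variables (a b : R).
Hypothesis ab : a < b.
Local Notation K := (real_pt @` `[a, b]).

Lemma real_pt_itv (x : R) : K (real_pt x) <-> x \in `[a, b].
Proof. by split=> [[y + [<-]]//|xab]; exists x. Qed.

Lemma itv_nn_real (l x : R) : 0 <= l -> itv_nn a b l (real_pt x) = sqsum (x - a) (l ^+ 2 * (x - b)).
Proof.
move=> l0; rewrite /itv_nn /itv_kappa /modulus /= subr0 expr0n !addr0 !sqrtr_sqr /sqsum normrM.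
rewrite (ger0_norm (sqr_ge0 l)).
have -> : (x - a) * (l ^+ 2 * (x - b)) = l ^+ 2 * ((x - a) * (x - b)) by ring.
rewrite [Num.sqrt (l ^+ 2 * _)]sqrtrM ?sqr_ge0// sqrtr_sqr [`|l|]ger0_norm// -normrM.
have [h|h] := lerP 0 ((x - a) * (x - b)).
  rewrite (ger0_norm h).
  have -> : ((x - a) * (x - b) + (x - a) * (x - b)) / 2 = (x - a) * (x - b) by field.
  by ring.
rewrite (ltr0_norm h) addNr mul0r sqrtr0 [Num.sqrt ((x - a) * _)]ler0_sqrtr 1?ltW//.
ring.
Qed.

Lemma itv_nnN_real (l x : R) : 0 < l -> x < a ->
  itv_nn a b l (real_pt x) = (b - x) * (l + charge_ratio a b x) ^+ 2 /\
  itv_nn a b (- l) (real_pt x) = (b - x) * (l - charge_ratio a b x) ^+ 2.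
Proof.
move=> l0 xa; have xb : x < b by exact: lt_trans ab.
rewrite /itv_nn /itv_kappa /modulus /= subr0 expr0n !addr0 !sqrtr_sqr.
rewrite !ltr0_norm ?subr_lt0//.
have -> : (- (x - a) * - (x - b) + (x - a) * (x - b)) / 2 = (b - x) ^+ 2 * ((a - x) / (b - x)).
  by field; rewrite subr_eq0 gt_eqF.
rewrite sqrtrM ?sqr_ge0// sqrtr_sqr ger0_norm ?subr_ge0 ?ltW// -/(charge_ratio a b x).
have : charge_ratio a b x ^+ 2 = (a - x) / (b - x).
  by rewrite sqr_sqrtr// divr_ge0 ?subr_ge0 ?ltW.
move=> /(congr1 ( *%R^~ (b - x))); rewrite mulfVK ?subr_eq0 ?gt_eqF// => E.
by split; have := E; lra.
Qed.

(** On [a, b] [sqsum] reduces to b - a and the formula gives 0, so one expression serves the whole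
    line. *)
Lemma green_itv_infty (x : R) :
  green_itv a b None x = (ln (sqsum (x - a) (x - b)) - ln (b - a))%:E.
Proof.
have p1 : @itv_pole R a b 1 = None by rewrite /itv_pole eqxx.
have E : itv_green a b 1 (real_pt x) = ln (sqsum (x - a) (x - b)) - ln (b - a).
  by rewrite itv_greenE// ?p1// /itv_pole_factor eqxx itv_nn_real// expr1n mul1r.
rewrite -E /green_itv.
have [/real_pt_itv xK|xK] := boolP (x \in `[a, b]).
  by rewrite /green; case: pselect => // h; rewrite itv_green_itv.
by rewrite -p1 greenE_itv ?p1// => /real_pt_itv; apply/negP.
Qed.

Lemma charge_ratio_pole (y : R) : y \notin `[a, b] ->
  [/\ 0 < charge_ratio a b y, charge_ratio a b y != 1 &
   itv_pole a b (charge_ratio a b y) = Some (real_pt y)].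
Proof.
move=> yab; have q0 : 0 < (a - y) / (b - y).
  move: yab; rewrite in_itv/= negb_and -!ltNge => /orP[ya|yb].
    by rewrite divr_gt0// subr_gt0// (lt_trans ya).
  by rewrite -mulrNN -invrN divr_gt0// oppr_gt0 subr_lt0// (lt_trans ab).
have yb : b - y != 0.
  by apply: contraTneq q0 => ->; rewrite invr0 mulr0 ltxx.
have l1 : charge_ratio a b y != 1.
  rewrite -(inj_eq (@mulIf _ 1 _)) ?oner_eq0// !mulr1.
  apply/eqP => /(congr1 (fun z => z ^+ 2)); rewrite sqr_sqrtr ?ltW// expr1n => /eqP.
  rewrite -subr_eq0 -[X in _ - X](divff yb) -mulrBl mulf_eq0 invr_eq0 (negPf yb) orbF.
  by apply/negP; move: ab; lra.
split; rewrite ?sqrtr_gt0//.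
rewrite /itv_pole (negPf l1) sqr_sqrtr ?ltW//; congr (Some (_, _)).
have ba : b - a != 0 by rewrite subr_eq0 gt_eqF.
have -> : 1 - (a - y) / (b - y) = (b - a) / (b - y) by field.
by field; rewrite yb ba.
Qed.

(** The singular part is split off as [log_kernel], so that both sides are +oo at x = y and the
    formula can be integrated in [y] without excluding that point. *)
Lemma green_itv_finite (x y : R) : y \notin `[a, b] ->
  green_itv a b (Some (real_pt y)) x =
  ((ln (sqsum (x - a) (charge_ratio a b y ^+ 2 * (x - b))) -
    ln `|1 - charge_ratio a b y ^+ 2|)%:E + log_kernel x y)%E.
Proof.
move=> yab; have [l0 l1 pE] := charge_ratio_pole yab.
set l := charge_ratio a b y in l0 l1 pE *.
have [xy|xy] := eqVneq x y.
  rewrite -xy log_kernelxx addey// /green_itv /green; case: pselect => /= [/real_pt_itv h|nK].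
    by move: yab; rewrite -xy h.
  by case: pselect.
have zp : Some (real_pt x) != itv_pole a b l.
  by rewrite pE; apply: contra_neq xy => -[].
have d0 : 0 < `|1 - l ^+ 2|.
  rewrite normr_gt0 subr_eq0 eq_sym -[X in _ != X](expr1n _ 2) eqf_sqr negb_or l1.
  by rewrite gt_eqF// (lt_trans _ l0)// oppr_lt0.
have E : itv_green a b l (real_pt x) = ln (sqsum (x - a) (l ^+ 2 * (x - b))) -
    ln `|1 - l ^+ 2| - ln `|x - y|.
  rewrite itv_greenE// /itv_pole_factor (negPf l1) itv_nn_real ?ltW//.
  move: pE; rewrite /itv_pole (negPf l1) => -[->].
  have -> : modulus (real_pt x - real_pt y) = `|x - y|.
    by rewrite /modulus/= subr0 expr0n addr0 sqrtr_sqr.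
  have xy0 : 0 < `|x - y| by rewrite normr_gt0 subr_eq0.
  by rewrite lnM ?posrE// opprD addrA.
rewrite log_kernelE// -EFinD -E /green_itv.
have [/real_pt_itv xK|xK] := boolP (x \in `[a, b]).
  by rewrite /green; case: pselect => // h; rewrite itv_green_itv.
by rewrite -pE greenE_itv// => /real_pt_itv; apply/negP.
Qed.

Lemma green_itv_ge0 (x y : R) : y \notin `[a, b] -> (0 <= green_itv a b (Some (real_pt y)) x)%E.
Proof.
move=> yab; have [l0 l1 pE] := charge_ratio_pole yab.
have [/real_pt_itv xK|/negP xK] := boolP (x \in `[a, b]).
  by rewrite /green_itv /green; case: pselect.
have nK : ~ K (real_pt x) by move=> /real_pt_itv.
have [<-|xy] := eqVneq x y.
  by rewrite /green_itv /green; case: pselect => //= nK'; case: pselect => //= _; rewrite leey.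
have zp : Some (real_pt x) != itv_pole a b (charge_ratio a b y).
  by rewrite pE; apply: contra_neq xy => -[].
by rewrite /green_itv -pE greenE_itv// lee_fin itv_green_ge0.
Qed.

Lemma green_itv_in (x : R) zeta : x \in `[a, b] -> green_itv a b zeta x = 0%E.
Proof. by move=> /real_pt_itv xK; rewrite /green_itv /green; case: pselect. Qed.

Lemma green_itv_pole_in (x y : R) : y \in `[a, b] -> green_itv a b (Some (real_pt y)) x = 0%E.
Proof.
move=> /real_pt_itv yK; have [xK|/negP xK] := boolP (x \in `[a, b]); first exact: green_itv_in.
by rewrite /green_itv green_pole_itv// => /real_pt_itv.
Qed.

Lemma measurable_sqsum d (T : measurableType d) (f g : T -> R) :
  measurable_fun setT f -> measurable_fun setT g -> measurable_fun setT (fun z => sqsum (f z) (g z)).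
Proof.
move=> mf mg; apply: measurable_funD.
  by apply: measurable_funD; apply: measurableT_comp => //.
apply: measurable_funM => //; apply: measurableT_comp; first exact: measurable_sqrt.
exact: measurable_funM.
Qed.

Lemma measurable_green_itv (x : R) :
  measurable_fun [set: measurableTypeR R] (fun y => green_itv a b (Some (real_pt y)) x).
Proof.
have -> : (fun y => green_itv a b (Some (real_pt y)) x) = (fun y : measurableTypeR R =>
    if y \in `[a, b] then 0%E else
  ((ln (sqsum (x - a) (charge_ratio a b y ^+ 2 * (x - b))) -
    ln `|1 - charge_ratio a b y ^+ 2|)%:E + log_kernel x y)%E).
  apply/funext => y; case: ifPn => [|/green_itv_finite]; first exact: green_itv_pole_in.
  exact.
apply: measurable_fun_ifT.
- under eq_fun do rewrite in_itv/=.
  by apply: measurable_and; apply: measurable_fun_ler.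
- exact: measurable_cst.
apply: emeasurable_funD; last by apply: measurable_log_kernel.
have mr : measurable_fun [set: measurableTypeR R] (fun y => charge_ratio a b y ^+ 2).
  by apply: measurable_funX; exact: measurable_charge_ratio.
apply/measurable_EFinP; apply: measurable_funB; apply: measurableT_comp => //.
  by apply: measurable_sqsum => //; exact: measurable_funM.
by apply: measurableT_comp => //; exact: measurable_funB.
Qed.

(* Both sides are values of [u |-> ln ((1 + u) / (1 - u))], which is convex and vanishes at 0. *)
Lemma green_itv_superhomogeneous (x y : R) : y <= x -> x < a ->
  (((charge_ratio a b y)^-1)%:E * green_itv a b None x <= green_itv a b (Some (real_pt y)) x)%E.
Proof.
move=> yx xa.
have xab : x \notin `[a, b] by rewrite in_itv/= negb_and -ltNge xa.
have yab : y \notin `[a, b] by rewrite in_itv/= negb_and -ltNge (le_lt_trans yx).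
have nK : ~ K (real_pt x) by move=> /real_pt_itv; apply/negP.
have p1 : @itv_pole R a b 1 = None by rewrite /itv_pole eqxx.
have [l0 l1 pE] := charge_ratio_pole yab.
have [s0 s1 _] := charge_ratio_pole xab.
move: yx; rewrite le_eqVlt => /predU1P[yx|yx].
  rewrite yx {2}/green_itv /green; case: pselect => //= h; case: pselect => //= _; exact: leey.
have xb : 0 < b - x by rewrite subr_gt0 (lt_trans xa).
have yb : 0 < b - y by rewrite subr_gt0 (lt_trans yx)// -subr_gt0.
have sl : charge_ratio a b x < charge_ratio a b y.
  rewrite ltr_sqrt; last by rewrite divr_gt0// subr_gt0 (lt_trans yx).
  rewrite ltr_pdivrMr// mulrAC ltr_pdivlMr// -subr_gt0.
  have -> : (a - y) * (b - x) - (a - x) * (b - y) = (b - a) * (x - y) by ring.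
  by rewrite mulr_gt0 ?subr_gt0.
have ly1 : charge_ratio a b y <= 1.
  rewrite -[leRHS]sqrtr1 ler_sqrt// ler_pdivrMr// mul1r lerD2r; exact: ltW.
have g l : 0 < l -> charge_ratio a b x < l ->
    itv_green a b l (real_pt x) = ln (l + charge_ratio a b x) - ln (l - charge_ratio a b x).
  move=> l0' sl'; have [e1 e2] := itv_nnN_real l0' xa.
  have t1 : 0 < l + charge_ratio a b x by rewrite addr_gt0.
  have t2 : 0 < l - charge_ratio a b x by rewrite subr_gt0.
  have lnE (u v : R) : 0 < u -> 0 < v -> ln (u * v ^+ 2) = ln u + 2 * ln v.
    by move=> u0 v0; rewrite lnM ?posrE ?exprn_gt0// lnXn// mulr_natl.
  by rewrite /itv_green e1 e2 !lnE//; field.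
have zp : Some (real_pt x) != itv_pole a b (charge_ratio a b y).
  by rewrite pE; apply/eqP => -[xy]; move: yx; rewrite xy ltxx.
rewrite /green_itv -{1}p1 greenE_itv ?p1// -pE greenE_itv// -EFinM lee_fin !g//; last first.
  exact: lt_le_trans ly1.
by apply: log_ratio_le; rewrite ?l0 ?ly1 ?ltW.
Qed.

End green_real_line.

Lemma ex_probability (R : realType) (m : measure (measurableTypeR R) R) : m setT = 1%E ->
  exists P : probability (measurableTypeR R) R, forall A, P A = m A.
Proof.
move=> m1; exists (mnormalize m \d_(0 : measurableTypeR R)) => A.
have E : mnormalize m \d_(0 : measurableTypeR R) =
    (fun U : set (measurableTypeR R) => (m U * ((fine (m setT))^-1)%:E)%E).
  by rewrite /mnormalize m1 eqe oner_eq0.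
apply: (eq_trans (congr1 (fun f => f A) E)).
by rewrite m1 /= invr1 mule1.
Qed.

Section scaled_integral.
Context d (T : measurableType d) (R : realType) (m : {measure set T -> \bar R}).
Local Open Scope ereal_scope.

Lemma integral_mscale (q : {nonneg R}) (f : T -> \bar R) : (0 < q%:num)%R -> measurable_fun setT f ->
  \int[mscale q m]_x f x = q%:num%:E * \int[m]_x f x.
Proof.
move=> q0 mf; rewrite [X in X = _]integralE [X in _ * X]integralE.
rewrite !ge0_integral_mscale//; [|exact: measurable_funeneg|exact: measurable_funepos].
have qe : 0 < q%:num%:E by rewrite lte_fin.
move: (\int[m]_x (f^\+) x) (\int[m]_x (f^\-) x) => [u| |] [v| |] //=.
all: rewrite -?EFinM ?(gt0_muley qe) ?(gt0_muleNy qe)//=.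
all: rewrite ?(gt0_muley qe) ?(gt0_muleNy qe)//.
by rewrite -EFinD mulrBr.
Qed.

End scaled_integral.

(** * The equilibrium measure and its field *)

Section equilibrium_measure.
Context {R : realType}.
Variables (k : nat) (a b c N : R) (rho : {finite_measure set (measurableTypeR R) -> \bar R}).
Hypothesis k1 : (1 <= k)%N.
Hypothesis ab : a < b.
Hypothesis ca : c < a.
Local Notation lam := (charge_ratio a b).
Local Notation mu := (@lebesgue_measure R).
Local Notation I := (`[0%R, (pi / 2)%R : R]%classic).
Local Notation D := (`[c, a[%classic : set (measurableTypeR R)).
Hypothesis rhoD : rho (~` D) = 0%E.
Hypothesis totN : (k%:R%:E + rho setT = N%:E)%E.
Hypothesis eta_le : (\int[rho]_(y in D) ((lam y)^-1)%:E <= N%:E)%E.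
Local Notation s := (equi_density a b N rho).

Let k0 : 0 < k%:R :> R. Proof. by rewrite ltr0n. Qed.
Let kn0 : k%:R != 0 :> R. Proof. by rewrite gt_eqF. Qed.
Let mD : measurable D. Proof. exact: measurable_itv. Qed.
Let rhoDT : rho D = rho setT.
Proof.
have := ge0_integral_null mD (measurable_cst (1%E : \bar R)) (fun=> lee01) rhoD.
by rewrite !integral_cst// !mul1e.
Qed.
Let rhofin : (rho setT < +oo)%E.
Proof. by rewrite -ge0_fin_numE ?measure_ge0// fin_num_measure. Qed.

Let ms : measurable_fun [set: R] s. Proof. exact: measurable_equi_density. Qed.
Let s0 t : 0 <= s t. Proof. exact: (@equi_density_ge0 _ k _ _ c). Qed.

(** Apply the mixture formula to f = 1 with J = 1: every harmonic measure has mass one, which leaves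
    N - |rho| = k. *)
Lemma integral_equi_density1 : (\int[mu]_(t in I) (s t)%:E = k%:R%:E)%E.
Proof.
have := integral_equi_density k1 ab ca rhoD totN eta_le (f := cst 1%E) (J := fun=> 1)
  (measurable_cst _) (fun=> lee01).
have -> : (\int[rho]_(_ in D) (1:R)%:E = rho setT)%E by rewrite integral_cst// mul1e; exact: rhoDT.
rewrite !mulr1 => h.
have {}h : (\int[mu]_(t in I) (cst 1%E t * (s t)%:E) + rho setT = N%:E)%E.
  by apply: h => l l0; rewrite -(integral_poisson l0); apply: eq_integral => t _; rewrite mul1e.
have -> : (\int[mu]_(t in I) (s t)%:E = \int[mu]_(t in I) (cst 1%E t * (s t)%:E))%E.
  by apply: eq_integral => t _; rewrite mul1e.
by move: h; rewrite -totN => /(congr1 (fun z => z - rho setT)%E); rewrite !addeK// fin_num_measure.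
Qed.

Lemma ex_equilibrium_measure : exists m : probability (measurableTypeR R) R,
  forall f : R -> \bar R, measurable_fun [set: R] f -> (forall x, (0 <= f x)%E) ->
  (k%:R%:E * \int[m]_x f x = \int[mu]_(t in I) (f (arc a b t) * (s t)%:E))%E.
Proof.
have mI : measurable (I : set R) by exact: measurable_itv.
have ms' : measurable_fun [set: R] (fun t => s t / k%:R) by exact: measurable_funM.
have s'0 t : 0 <= s t / k%:R by rewrite divr_ge0.
have [m hm] := density_pushforward mI ms' (measurable_arc a b) s'0.
have E f : measurable_fun [set: R] f -> (forall x, (0 <= f x)%E) ->
    (k%:R%:E * \int[m]_x f x = \int[mu]_(t in I) (f (arc a b t) * (s t)%:E))%E.
  move=> mf f0; rewrite hm// -ge0_integralZl//.
  - by apply: eq_integral => t _; rewrite muleCA -EFinM mulrC divfK.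
  - apply: emeasurable_funM.
      exact: measurable_funS (measurableT_comp mf (measurable_arc a b)).
    by apply/measurable_EFinP; exact: measurable_funS ms'.
  - by move=> t _; rewrite mule_ge0// lee_fin.
have m1 : m setT = 1%E.
  have := E (cst 1%E) (measurable_cst _) (fun=> lee01).
  rewrite integral_cst// mul1e; under eq_integral do rewrite mul1e.
  rewrite integral_equi_density1 => /(congr1 (fun z => (k%:R^-1)%:E * z)%E).
  by rewrite muleA -!EFinM mulVf// mul1e.
have [P hP] := ex_probability m1; exists P => f mf f0; rewrite -E//; congr (_ * _)%E.
by apply: eq_measure_integral => A mA _; exact: hP.
Qed.

Variable mu0 : probability (measurableTypeR R) R.
Hypothesis mu0E : forall f : R -> \bar R, measurable_fun [set: R] f -> (forall x, (0 <= f x)%E) ->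
  (k%:R%:E * \int[mu0]_x f x = \int[mu]_(t in I) (f (arc a b t) * (s t)%:E))%E.

Lemma arc_itv t : a <= arc a b t <= b.
Proof.
have h : 0 <= sin t ^+ 2 <= 1 by rewrite sqr_ge0 sqr_sin_le1.
rewrite /arc; move: h; move: (sin t ^+ 2) => u /andP[u0 u1]; apply/andP; split.
  by rewrite lerDl mulr_ge0// subr_ge0 ltW.
by rewrite -lerBrDl ler_piMr// subr_ge0 ltW.
Qed.

Lemma equilibrium_itv_null : mu0 (~` `[a, b]) = 0%E.
Proof.
have mC : measurable (~` `[a, b] : set R) by exact: measurableC (measurable_itv _).
have := mu0E (f := fun x => (\1_(~` `[a, b]%classic) x)%:E).
rewrite integral_indic// setIT => h.
have {}h : (k%:R%:E * mu0 (~` `[a, b]) = 0)%E.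
  rewrite h//; first last.
    by apply/measurable_EFinP; exact: measurable_indic.
  apply: integral0_eq => t _; rewrite indicE memNset ?mul0e//.
  by apply; rewrite /= in_itv/=; exact: arc_itv.
by move/eqP: h; rewrite mule_eq0 eqe (negPf kn0)/= => /eqP.
Qed.

Lemma continuous_arc : continuous (arc a b).
Proof.
move=> t; apply: cvgD; first exact: cvg_cst.
apply: cvgM; first exact: cvg_cst.
by rewrite expr2; apply: cvgM; exact: continuous_sin.
Qed.

Lemma supp_equilibrium : supp mu0 = `[a, b]%classic.
Proof.
apply/seteqP; split; first exact: null_supp_itv equilibrium_itv_null.
move=> x /= xab U oU Ux.
have mU : measurable (U : set R) by exact: open_measurable.
have pi0 := pi_gt0 R.
have [t0 /andP[t00 t02] xE] : exists2 t0, 0 <= t0 <= pi / 2 & arc a b t0 = x.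
  have piS : 0 <= pi / 2 :> R by rewrite divr_ge0// ltW.
  have cw : {within `[0, pi / 2], continuous (arc a b)}.
    by apply: continuous_subspaceT; exact: continuous_arc.
  have [] := @IVT _ (arc a b) 0 (pi / 2) x piS cw.
    rewrite /arc sin0 sin_pihalf expr0n/= expr1n mulr0 addr0 mulr1 addrC subrK.
    by rewrite (min_idPl (ltW ab)) (max_idPr (ltW ab)); move: xab; rewrite in_itv.
  by move=> t0; rewrite in_itv/= => t0I <-; exists t0.
have /nbhs_ballP[e e0 he] : nbhs t0 (arc a b @^-1` U).
  by apply: continuous_arc; rewrite xE; exact: open_nbhs_nbhs.
pose e' := Num.min e (pi / 4) / 2.
have e'0 : 0 < e' by rewrite divr_gt0// lt_min e0 divr_gt0.
have e'e : e' < e by rewrite /e' ltr_pdivrMr// gt_min ltr_pMr// ltr1n.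
have e'p : e' <= pi / 8.
  by rewrite /e' ler_pdivrMr// ge_min; apply/orP; right; lra.
(* An interval near [t0] that avoids 0, where the density may vanish, and stays inside the quarter
   circle: to the right of [t0] in the left half, to the left of it otherwise. *)
have [t1 [t2 [t1p t12 t2p hU]]] : exists t1 t2, [/\ 0 < t1, t1 < t2, t2 <= pi / 2 &
    forall t, t1 <= t <= t2 -> U (arc a b t)].
  have [h|h] := lerP t0 (pi / 4).
    exists (t0 + e' / 2), (t0 + e'); split; [lra|lra|lra|].
    move=> t /andP[h1 h2]; apply: he; rewrite /ball/= ltr_distl; lra.
  exists (t0 - e'), (t0 - e' / 2); split; [lra|lra|lra|].
  move=> t /andP[h1 h2]; apply: he; rewrite /ball/= ltr_distl; lra.
have st1 : 0 < s t1 by apply: (@equi_density_gt0 _ k _ _ c) => //; lra.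
have mUs : measurable_fun [set: R] (fun t => (\1_U (arc a b t))%:E * (s t)%:E)%E.
  apply: emeasurable_funM; apply/measurable_EFinP => //.
  by apply: measurableT_comp (measurable_arc a b); exact: measurable_indic.
have : (0 < k%:R%:E * mu0 U)%E.
  have := mu0E (f := fun x => (\1_U x)%:E).
  rewrite integral_indic// setIT => ->//; last first.
    by apply/measurable_EFinP; exact: measurable_indic.
  apply: (@lt_le_trans _ _ (\int[mu]_(t in `[t1, t2]%classic) (s t1)%:E)%E).
    have lm : mu (`[t1, t2]%classic : set R) = (t2 - t1)%:E by rewrite lebesgue_measure_itv/= lte_fin t12.
    rewrite integral_cst; last exact: measurable_itv.
    by rewrite [X in (_ * X)%E]lm -EFinM lte_fin mulr_gt0// subr_gt0.
  apply: (@le_trans _ _ (\int[mu]_(t in `[t1, t2]%classic) ((\1_U (arc a b t))%:E * (s t)%:E))%E).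
    apply: ge0_le_integral.
    - exact: measurable_itv.
    - by move=> t _; rewrite lee_fin.
    - exact: measurable_cst.
    - exact: measurable_funS mUs.
    - move=> t /=; rewrite in_itv/= => tI; have Ut := hU t tI.
      rewrite indicE mem_set// mul1e lee_fin; apply: (equi_density_homo ab ca rhoD eta_le) => //; lra.
  apply: ge0_subset_integral.
  - exact: measurable_itv.
  - exact: measurable_itv.
  - exact: measurable_funS mUs.
  - by move=> t _; rewrite mule_ge0// lee_fin.
  - move=> t /=; rewrite !in_itv/= => /andP[h1 h2]; apply/andP; split; lra.
by rewrite pmule_rgt0// lte_fin.
Qed.

(** The shifted potential at [x] of one harmonic measure, that is 2 / pi times the value in
    [integral_log_kernel_poisson]. *)
Let J x L (l : R) : R := L - ln (sqsum (x - a) (l ^+ 2 * (x - b)) / (1 + l) ^+ 2).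

Let lbound x : exists2 L : R, 0 <= L &
  forall t, c <= t <= b -> ((- L)%:E <= log_kernel x t)%E.
Proof.
have [L L0 hL] := @ex_log_kernel_lbound R (Num.min x c) (Num.max x b).
exists L => // t /andP[ct tb]; apply: hL.
  by rewrite ge_min lexx le_max lexx.
by rewrite ge_min ct orbT le_max tb orbT.
Qed.

Let J_ge0 x L l : 0 < l -> (forall t, c <= t <= b -> ((- L)%:E <= log_kernel x t)%E) -> 0 <= J x L l.
Proof.
move=> l0 hL; have := integral_log_kernel_poisson x L ab l0.
rewrite -/(J x L l) => h.
have : (0 <= (pi / 2 * J x L l)%:E)%E.
  rewrite -h; apply: integral_ge0 => t _; rewrite mule_ge0//.
    rewrite -leeBlDr// sub0e; apply: hL; have /andP[h1 ->] := arc_itv t.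
    by rewrite (le_trans (ltW ca)).
  by rewrite lee_fin ltW// poisson_gt0.
by rewrite lee_fin pmulr_rge0// divr_gt0 ?pi_gt0.
Qed.

Let equilibrium_potential x L : 0 <= L ->
  (forall t, c <= t <= b -> ((- L)%:E <= log_kernel x t)%E) ->
  (k%:R%:E * (log_potential mu0 x + L%:E) + \int[rho]_(y in D) (J x L (lam y))%:E =
   (N * J x L 1)%:E)%E.
Proof.
move=> L0 hL.
have hLab t : a <= t <= b -> ((- L)%:E <= log_kernel x t)%E.
  by move=> /andP[h1 h2]; apply: hL; rewrite h2 (le_trans (ltW ca)).
(* The truncation changes nothing on [a, b] and makes the function nonnegative everywhere, as [mu0E]
   demands. *)
pose f t : \bar R := maxe (log_kernel x t + L%:E)%E 0%E.
have f0 t : (0 <= f t)%E by rewrite le_max lexx orbT.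
have mf : measurable_fun [set: R] f.
  apply: measurable_maxe; last exact: measurable_cst.
  by apply: emeasurable_funD; [exact: measurable_log_kernel|exact: measurable_cst].
have fE t : a <= t <= b -> f t = (log_kernel x t + L%:E)%E.
  by move=> h; apply/max_idPl; rewrite -leeBlDr// sub0e; exact: hLab.
have -> : (log_potential mu0 x + L%:E = \int[mu0]_t f t)%E.
  have mab : measurable (`[a, b]%classic : set (measurableTypeR R)) by exact: measurable_itv.
  rewrite (ge0_integral_null mab mf f0 equilibrium_itv_null).
  have mfin : (mu0 setT < +oo)%E by rewrite probability_setT ltry.
  transitivity (log_potential mu0 x + L%:E * mu0 setT)%E.
    by rewrite probability_setT mule1.
  rewrite -(log_potential_shift mab equilibrium_itv_null mfin L0); last first.
    by move=> t; rewrite /= in_itv/= => /hLab.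
  by apply: eq_integral => t /[!inE]; rewrite /= in_itv/= => /fE.
rewrite mu0E//; apply: (integral_equi_density k1 ab ca rhoD totN eta_le (f := f \o arc a b)).
- exact: measurableT_comp mf (measurable_arc a b).
- by move=> t /=.
- move=> l l0; rewrite -integral_log_kernel_poisson//.
  by apply: eq_integral => t _ /=; rewrite fE// arc_itv.
Qed.

Let mJ x L : measurable_fun [set: measurableTypeR R] (fun y => (J x L (lam y))%:E).
Proof.
have ml := @measurable_charge_ratio R a b.
have mr : measurable_fun [set: measurableTypeR R] (fun y => lam y ^+ 2) by exact: measurable_funX.
apply/measurable_EFinP; apply: measurable_funB => //; apply: measurableT_comp => //.
apply: measurable_divr; first by apply: measurable_sqsum => //; exact: measurable_funM.
by apply: measurable_funX; exact: measurable_funD.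
Qed.

(** The value at [y] of the Green function with pole at infinity. Its integral against [rho] enters
    the constant of the field. *)
Let W y := ln (1 + lam y) - ln (1 - lam y).

Let mW : measurable_fun [set: measurableTypeR R] (fun y => (W y)%:E).
Proof.
have ml := @measurable_charge_ratio R a b.
apply/measurable_EFinP; apply: measurable_funB; apply: measurableT_comp => //.
  exact: measurable_funD.
exact: measurable_funB.
Qed.

Let cD : D c. Proof. by rewrite /= in_itv/= lexx. Qed.

Let W_ge0 y : D y -> 0 <= W y.
Proof.
move=> Dy; have /andP[l0 l1] := charge_ratio_itv ab Dy.
rewrite subr_ge0 ler_ln ?posrE ?subr_gt0 ?addr_gt0//.
by rewrite lerD2l ge0_cp// ltW.
Qed.

Let W_le y : D y -> W y <= W c.
Proof.
move=> Dy; have /andP[l0 l1] := charge_ratio_itv ab Dy.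
have /andP[m0 m1] := charge_ratio_itv ab cD.
have lm := charge_ratio_le ab ca Dy.
apply: lerB; rewrite ler_ln ?posrE ?subr_gt0 ?addr_gt0//; first by rewrite lerD2l.
by rewrite lerD2l lerN2.
Qed.

Let E0 := fine (\int[rho]_(y in D) (W y)%:E)%E.

Let E0E : (\int[rho]_(y in D) (W y)%:E = E0%:E)%E.
Proof.
rewrite fineK// ge0_fin_numE; last by apply: integral_ge0 => y Dy; rewrite lee_fin W_ge0.
apply: (@le_lt_trans _ _ (\int[rho]_(y in D) (W c)%:E)%E).
  by apply: ge0_le_integral => //; exact: measurable_funS mW.
have -> : (\int[rho]_(y in D) (W c)%:E = (W c)%:E * rho setT)%E.
  by rewrite integral_cst//; congr (_ * _)%E; exact: rhoDT.
by rewrite lte_mul_pinfty// lee_fin W_ge0.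
Qed.

(** Pointwise in [y], g(x, y) + J is the shifted kernel plus W(y). Every term is nonnegative on [D],
    so the identity may be integrated even where g(x, y) is +oo. *)
Let green_potential x L : 0 <= L ->
  (forall t, c <= t <= b -> ((- L)%:E <= log_kernel x t)%E) ->
  (\int[rho]_y green_itv a b (Some (real_pt y)) x + \int[rho]_(y in D) (J x L (lam y))%:E =
   log_potential rho x + L%:E * rho setT + E0%:E)%E.
Proof.
move=> L0 hL; have mg := measurable_green_itv ab x.
have Dab y : D y -> y \notin `[a, b].
  by rewrite /= !in_itv/= negb_and => /andP[_ ya]; rewrite -ltNge ya.
have Dcb y : D y -> c <= y <= b.
  by rewrite /= in_itv/= => /andP[-> ya]; rewrite ltW// (lt_trans ya).
rewrite (integral_null mD mg rhoD) -E0E.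
rewrite -(log_potential_shift mD rhoD rhofin L0); last by move=> t /Dcb/hL.
have mgD : measurable_fun D (fun y => green_itv a b (Some (real_pt y)) x).
  exact: measurable_funS mg.
have g0 y : D y -> (0 <= green_itv a b (Some (real_pt y)) x)%E.
  by move=> Dy; rewrite green_itv_ge0// Dab.
have j0 y : D y -> (0 <= (J x L (lam y))%:E)%E.
  by move=> Dy; rewrite lee_fin J_ge0//; have /andP[] := charge_ratio_itv ab Dy.
have mJD : measurable_fun D (fun y => (J x L (lam y))%:E) by exact: measurable_funS (mJ x L).
have k0' y : D y -> (0 <= log_kernel x y + L%:E)%E.
  by move=> /Dcb Dy; rewrite -leeBlDr// sub0e hL.
have mk : measurable_fun D (fun y => (log_kernel x y + L%:E)%E).
  apply: emeasurable_funD; last exact: measurable_cst.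
  by apply: (@measurable_funS _ _ _ _ setT) => //; exact: measurable_log_kernel.
have w0 y : D y -> (0 <= (W y)%:E)%E by move=> Dy; rewrite lee_fin W_ge0.
have mWD : measurable_fun D (fun y => (W y)%:E) by exact: measurable_funS mW.
rewrite -ge0_integralD// -ge0_integralD//.
apply: eq_integral => y /[!inE] Dy; rewrite green_itv_finite ?Dab//.
rewrite addeAC -EFinD addeC -addeA -EFinD; congr (_ + _%:E)%E.
have /andP[l0 l1] := charge_ratio_itv ab Dy.
have q0 : 0 < sqsum (x - a) (lam y ^+ 2 * (x - b)).
  by rewrite -itv_nn_real ?itv_nn_gt0// ltW.
have l10 : 0 < 1 + lam y by rewrite addr_gt0.
have l11 : 0 < 1 - lam y by rewrite subr_gt0.
rewrite /J ln_div ?posrE ?exprn_gt0// lnXn// mulr2n.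
have -> : 1 - lam y ^+ 2 = (1 - lam y) * (1 + lam y) by ring.
rewrite ger0_norm ?mulr_ge0 ?ltW// lnM ?posrE// /W; ring.
Qed.

(** Both [equilibrium_potential] and [green_potential] contain the integral of [J] against [rho]; it
    is finite, and eliminating it leaves the formula. Where the potential of [rho] is +oo, both
    sides are -oo. *)
Lemma equilibrium_field : exists F : R,
  (forall x, log_potential mu0 x \is a fin_num) /\
  forall x, (k%:R%:E * extremal_fun (ext_field k rho) mu0 F x =
     total_charge k rho * green_itv a b None x -
     \int[rho]_y green_itv a b (Some (real_pt y)) x)%E.
Proof.
(* ln 4 - ln (b - a) is the Robin constant of [a, b], whose capacity is (b - a) / 4. *)
exists ((N * (ln 4 - ln (b - a)) - E0) / k%:R).
have rfin : (rho setT = (N - k%:R)%:E)%E.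
  have := totN; rewrite -[rho setT]fineK ?fin_num_measure// -EFinD => -[<-].
  by rewrite addrC addKr.
have ufin x L : 0 <= L -> (forall t, c <= t <= b -> ((- L)%:E <= log_kernel x t)%E) ->
  exists u j : R, [/\ log_potential mu0 x = u%:E, 
    (\int[rho]_(y in D) (J x L (lam y))%:E = j%:E)%E & k%:R * (u + L) + j = N * J x L 1].
  move=> L0 hL; have := equilibrium_potential L0 hL.
  have : (0 <= \int[rho]_(y in D) (J x L (lam y))%:E)%E.
    apply: integral_ge0 => y Dy; rewrite lee_fin J_ge0//.
    by have /andP[] := charge_ratio_itv ab Dy.
  have kp : (0 < k%:R%:E :> \bar R)%E by rewrite lte_fin.
  case: (\int[rho]_(y in D) (J x L (lam y))%:E)%E => [j| |] //= j0;
  case: (log_potential mu0 x) => [u| |] //=;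
  rewrite ?addye// ?addNye// ?(gt0_muley kp) ?(gt0_muleNy kp) ?addye ?addNye ?addey//.
  move=> h; have : (k%:R * (u + L) + j)%:E = (N * J x L 1)%:E by rewrite -h.
  by move=> [E]; exists u, j.
split=> x; have [L L0 hL] := lbound x; have [u [j [uE jE E]]] := ufin x L L0 hL.
  by rewrite uE.
have := green_potential L0 hL; rewrite jE rfin.
have -> : total_charge k rho = N%:E by rewrite -totN.
rewrite /extremal_fun uE /ext_field /log_potential integral_mscale//; last 2 first.
- by rewrite /= invr_gt0.
- exact: measurable_log_kernel.
rewrite -/(log_potential rho x) green_itv_infty//=.
have G0 : (0 <= \int[rho]_y green_itv a b (Some (real_pt y)) x)%E.
  apply: integral_ge0 => y _; have [h|h] := boolP (y \in `[a, b]).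
    by rewrite green_itv_pole_in.
  exact: green_itv_ge0.
have q0 : 0 < sqsum (x - a) (x - b).
  by have := itv_nn_gt0 ab (real_pt x) (@ltr01 R); rewrite itv_nn_real// expr1n mul1r.
move: E; rewrite /J expr1n mul1r ln_div ?posrE ?exprn_gt0//.
have -> : (1 + 1) ^+ 2 = 4 :> R by ring.
move=> E.
have kp : (0 < k%:R%:E :> \bar R)%E by rewrite lte_fin.
have kp' : (0 < k%:R^-1%:E :> \bar R)%E by rewrite lte_fin invr_gt0.
move: G0; case: (\int[rho]_y green_itv a b (Some (real_pt y)) x)%E => [g| |] //= g0;
  case: (log_potential rho x) => [v| |] //= h.
- move: h; rewrite -!(EFinD, EFinM, EFinN) => -[h].
  congr EFin.
  have cancel_k X : k%:R * (X / k%:R - u - k%:R^-1 * v) = X - k%:R * u - v by field.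
  rewrite cancel_k.
  have -> : v = g + j - L * (N - k%:R) - E0 by rewrite h; ring.
  have -> : k%:R * u = N * (L - (ln (sqsum (x - a) (x - b)) - ln 4)) - j - k%:R * L.
    by rewrite -E; ring.
  ring.
- by rewrite (gt0_muley kp') /= addeNy (gt0_muleNy kp).
Qed.

End equilibrium_measure.

(** * Positive definiteness of the logarithmic energy *)

Section cdf_unique.
Context {R : realType}.

Lemma prob_eq_cdf (P Q : probability (measurableTypeR R) R) :
  (forall r : R, P (`]-oo, r]%classic : set R) = Q (`]-oo, r]%classic : set R)) ->
  forall A, measurable A -> P A = Q A.
Proof.
move=> h A mA; rewrite -(lebesgue_stieltjes_cdf_id P mA).
apply: lebesgue_stieltjes_measure_unique => //.
move=> X oX.
have mX : measurable (X : set (measurableTypeR R)).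
  by apply: sub_sigma_algebra.
rewrite [LHS](lebesgue_stieltjes_cdf_id P mX).
case: oX => -[x y] /= _ <-.
have [yx|xy] := leP y x.
  by rewrite set_itv_ge ?bnd_simp -?leNgt// !measure0.
have E (M : probability (measurableTypeR R) R) :
    (M (`]x, y]%classic : set R) = M (`]-oo, y]%classic : set R) - M (`]-oo, x]%classic : set R))%E.
  have -> : `]x, y]%classic = `]-oo, y]%classic `\` `]-oo, x]%classic :> set R.
    apply/seteqP; split => z /=; rewrite !in_itv/=.
      by move=> /andP[h1 h2]; split => //; apply/negP; rewrite -ltNge.
    by move=> [-> /negP]; rewrite -ltNge => ->.
  rewrite measureD//; last by rewrite (le_lt_trans (probability_le1 M _)) ?ltry.
  congr (_ - M _)%E; rewrite setIC; apply/setIidl => z /=; rewrite !in_itv/=.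
  by move=> /le_trans; apply; exact: ltW.
by rewrite !E !h.
Qed.

End cdf_unique.

(** * Energy gaps and positive mixtures of kernels *)

Section energy_form.
Context d (T : measurableType d) (R : realType).
Implicit Types (nu mu : probability T R) (K : T -> T -> \bar R).
Local Open Scope ereal_scope.

Definition energy_form K nu mu : \bar R := \int[nu]_x \int[mu]_t K x t.

(** It says that the energy of nu - mu is at least [Delta], written with sums only because the
    separate energies may be +oo. *)
Definition energy_gap K nu mu (Delta : \bar R) : Prop :=
  energy_form K nu mu + energy_form K mu nu + Delta <=
  energy_form K nu nu + energy_form K mu mu.

Lemma energy_form_ge0 K nu mu : (forall x t, 0 <= K x t) -> 0 <= energy_form K nu mu.
Proof. by move=> K0; apply: integral_ge0 => x _; exact: integral_ge0. Qed.

Lemma measurable_kernel_section K x : measurable_fun [set: T * T] (fun z => K z.1 z.2) ->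
  measurable_fun [set: T] (K x).
Proof.
move=> m; have -> : K x = (fun z => K z.1 z.2) \o (fun t => (x, t)) by [].
by apply: measurableT_comp m _; apply: measurable_fun_pair.
Qed.

Lemma energy_form_mulr (f : T -> R) nu mu : measurable_fun setT f -> (forall x, 0 <= f x)%R ->
  energy_form (fun x t => (f x * f t)%:E) nu mu = \int[nu]_x (f x)%:E * \int[mu]_x (f x)%:E.
Proof.
move=> mf f0; have mfE : measurable_fun setT (fun x => (f x)%:E) by exact/measurable_EFinP.
rewrite /energy_form.
transitivity (\int[nu]_x ((\int[mu]_t (f t)%:E) * (f x)%:E)).
  apply: eq_integral => x _; under eq_integral do rewrite EFinM.
  by rewrite ge0_integralZl//; [rewrite muleC|move=> t _; rewrite lee_fin|rewrite lee_fin].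
rewrite ge0_integralZl//; first by rewrite muleC.
- by move=> x _; rewrite lee_fin.
- by apply: integral_ge0 => x _; rewrite lee_fin.
Qed.

(** For a product kernel the energy of nu - mu is exactly the square of the difference of the two
    integrals, which are finite because f <= 1. *)
Lemma energy_gap_mulr (f : T -> R) nu mu : measurable_fun setT f -> (forall x, 0 <= f x <= 1)%R ->
  energy_gap (fun x t => (f x * f t)%:E) nu mu
    ((fine (\int[nu]_x (f x)%:E) - fine (\int[mu]_x (f x)%:E)) ^+ 2)%:E.
Proof.
move=> mf f01; have f0 x : (0 <= f x)%R by have /andP[] := f01 x.
have fin (P : probability T R) : \int[P]_x (f x)%:E = (fine (\int[P]_x (f x)%:E))%:E.
  rewrite fineK// ge0_fin_numE; last by apply: integral_ge0 => x _; rewrite lee_fin.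
  apply: (@le_lt_trans _ _ (\int[P]_x (1:R)%:E)).
    apply: ge0_le_integral => //.
    - by move=> x _; rewrite lee_fin.
    - exact/measurable_EFinP.
    - by move=> x _; rewrite lee_fin; have /andP[] := f01 x.
  rewrite integral_cst// mul1e.
  exact: le_lt_trans (probability_le1 P measurableT) (ltry _).
rewrite /energy_gap !energy_form_mulr// (fin nu) (fin mu) -!EFinM -!EFinD lee_fin /=.
set u := fine _; set v := fine _.
by rewrite le_eqVlt; apply/orP; left; apply/eqP; ring.
Qed.

Lemma energy_formD K1 K2 nu mu :
  measurable_fun [set: T * T] (fun z => K1 z.1 z.2) ->
  measurable_fun [set: T * T] (fun z => K2 z.1 z.2) ->
  (forall x t, 0 <= K1 x t) -> (forall x t, 0 <= K2 x t) ->
  energy_form (fun x t => K1 x t + K2 x t) nu mu = energy_form K1 nu mu + energy_form K2 nu mu.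
Proof.
move=> m1 m2 p1 p2; rewrite /energy_form -ge0_integralD//.
- apply: eq_integral => x _; rewrite ge0_integralD//.
    exact: measurable_kernel_section.
  exact: measurable_kernel_section.
- by move=> x _; exact: integral_ge0.
- exact: (measurable_fun_fubini_tonelli_F (m2 := mu) (fun z => K1 z.1 z.2)).
- by move=> x _; exact: integral_ge0.
- exact: (measurable_fun_fubini_tonelli_F (m2 := mu) (fun z => K2 z.1 z.2)).
Qed.

Lemma energy_formZ K (q : R) nu mu :
  measurable_fun [set: T * T] (fun z => K z.1 z.2) ->
  (forall x t, 0 <= K x t) -> (0 <= q)%R ->
  energy_form (fun x t => q%:E * K x t) nu mu = q%:E * energy_form K nu mu.
Proof.
move=> m p q0; rewrite /energy_form -ge0_integralZl//.
- apply: eq_integral => x _; rewrite ge0_integralZl//.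
  exact: measurable_kernel_section.
- exact: (measurable_fun_fubini_tonelli_F (m2 := mu) (fun z => K z.1 z.2)).
- by move=> x _; exact: integral_ge0.
Qed.

Lemma energy_formC K nu mu :
  measurable_fun [set: T * T] (fun z => K z.1 z.2) ->
  (forall x t, 0 <= K x t) -> (forall x t, K x t = K t x) ->
  energy_form K nu mu = energy_form K mu nu.
Proof.
move=> m p s; rewrite /energy_form.
rewrite (fubini_tonelli (fun z => K z.1 z.2))//=.
by apply: eq_integral => x _; apply: eq_integral => t _; rewrite s.
Qed.

Section mixture.
Context d' (Th : measurableType d') (m : {sigma_finite_measure set Th -> \bar R}).
Variables (D : set Th) (F : Th -> T -> T -> \bar R).
Hypothesis mD : measurable D.
Hypothesis mF : measurable_fun [set: Th * (T * T)] (fun z => F z.1 z.2.1 z.2.2).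
Hypothesis F0 : forall th x t, 0 <= F th x t.

Lemma measurable_mixture :
  measurable_fun [set: T * T] (fun z => \int[m]_(th in D) F th z.1 z.2).
Proof. exact: (measurable_integral_restrict m mD (f := fun th z => F th z.1 z.2)). Qed.

Let mG mu : measurable_fun [set: Th * T] (fun z => \int[mu]_t F z.1 z.2 t).
Proof.
apply: (measurable_fun_fubini_tonelli_F (m2 := mu) (fun z : (Th * T) * T => F z.1.1 z.1.2 z.2)) => //.
apply: (measurableT_comp (f := fun z : Th * (T * T) => F z.1 z.2.1 z.2.2)
  (g := fun z : (Th * T) * T => (z.1.1, (z.1.2, z.2)))) => //.
apply: measurable_fun_pair; first exact: measurableT_comp measurable_fst measurable_fst.
apply: measurable_fun_pair; last exact: measurable_snd.
exact: measurableT_comp measurable_snd measurable_fst.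
Qed.

Lemma energy_form_mixture nu mu :
  energy_form (fun x t => \int[m]_(th in D) F th x t) nu mu =
  \int[m]_(th in D) energy_form (F th) nu mu.
Proof.
rewrite /energy_form (tonelli_restrict m nu mD (mG mu)); last first.
  by move=> *; exact: integral_ge0.
apply: eq_integral => x _; rewrite (tonelli_restrict m mu mD)//.
apply: (measurableT_comp (f := fun z : Th * (T * T) => F z.1 z.2.1 z.2.2)
  (g := fun z : Th * T => (z.1, (x, z.2)))) => //.
by apply: measurable_fun_pair => //; exact: measurable_fun_pair.
Qed.

Lemma measurable_energy_form nu mu : measurable_fun [set: Th] (fun th => energy_form (F th) nu mu).
Proof.
apply: (measurable_fun_fubini_tonelli_F (m2 := nu) (fun z : Th * T => \int[mu]_t F z.1 z.2 t)).
  exact: mG.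
by move=> z; exact: integral_ge0.
Qed.

Lemma energy_gap_mixture nu mu (Delta : Th -> \bar R) :
  measurable_fun [set: Th] Delta -> (forall th, 0 <= Delta th) ->
  (forall th, D th -> energy_gap (F th) nu mu (Delta th)) ->
  energy_gap (fun x t => \int[m]_(th in D) F th x t) nu mu (\int[m]_(th in D) Delta th).
Proof.
move=> mDe De0 gap; rewrite /energy_gap !energy_form_mixture.
have me P Q : measurable_fun D (fun th => energy_form (F th) P Q).
  exact: measurable_funS (measurable_energy_form P Q).
have e0 P Q th : 0 <= energy_form (F th) P Q by exact: energy_form_ge0.
have mDeD : measurable_fun D Delta by exact: measurable_funS mDe.
have mD2 P Q P' Q' : measurable_fun D (fun th => energy_form (F th) P Q + energy_form (F th) P' Q').
  exact: emeasurable_funD.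
have e2 P Q P' Q' th : 0 <= energy_form (F th) P Q + energy_form (F th) P' Q' by rewrite adde_ge0.
have -> : \int[m]_(th in D) energy_form (F th) nu mu + \int[m]_(th in D) energy_form (F th) mu nu +
    \int[m]_(th in D) Delta th =
    \int[m]_(th in D) (energy_form (F th) nu mu + energy_form (F th) mu nu + Delta th).
  by rewrite [RHS]ge0_integralD// [in RHS]ge0_integralD.
have -> : \int[m]_(th in D) energy_form (F th) nu nu + \int[m]_(th in D) energy_form (F th) mu mu =
    \int[m]_(th in D) (energy_form (F th) nu nu + energy_form (F th) mu mu).
  by rewrite [RHS]ge0_integralD//.
apply: ge0_le_integral => //.
- by move=> th _; rewrite adde_ge0.
- exact: emeasurable_funD.
Qed.

End mixture.

Lemma energy_gapD K1 K2 nu mu (D1 D2 : \bar R) :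
  measurable_fun [set: T * T] (fun z => K1 z.1 z.2) ->
  measurable_fun [set: T * T] (fun z => K2 z.1 z.2) ->
  (forall x t, 0 <= K1 x t) -> (forall x t, 0 <= K2 x t) ->
  energy_gap K1 nu mu D1 -> energy_gap K2 nu mu D2 ->
  energy_gap (fun x t => K1 x t + K2 x t) nu mu (D1 + D2).
Proof.
move=> m1 m2 p1 p2 g1 g2; rewrite /energy_gap !energy_formD//.
apply: le_trans (le_trans (leeD g1 g2) _); last by rewrite addeACA.
by rewrite le_eqVlt; apply/orP; left; apply/eqP; rewrite [RHS]addeACA; congr (_ + _); rewrite addeACA.
Qed.

Lemma energy_gapZ K (q : R) nu mu (Delta : \bar R) :
  measurable_fun [set: T * T] (fun z => K z.1 z.2) ->
  (forall x t, 0 <= K x t) -> (0 <= q)%R -> 0 <= Delta ->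
  energy_gap K nu mu Delta ->
  energy_gap (fun x t => q%:E * K x t) nu mu (q%:E * Delta).
Proof.
move=> m p q0 D0 g; rewrite /energy_gap !energy_formZ//.
have e0 P Q : 0 <= energy_form K P Q by exact: energy_form_ge0.
have -> : q%:E * energy_form K nu mu + q%:E * energy_form K mu nu + q%:E * Delta =
    q%:E * (energy_form K nu mu + energy_form K mu nu + Delta).
  have h2 : 0 <= energy_form K nu mu + energy_form K mu nu by rewrite adde_ge0.
  by rewrite (ge0_muleDr _ h2 D0) (ge0_muleDr _ (e0 nu mu) (e0 mu nu)).
have -> : q%:E * energy_form K nu nu + q%:E * energy_form K mu mu =
    q%:E * (energy_form K nu nu + energy_form K mu mu).
  by rewrite (ge0_muleDr _ (e0 nu nu) (e0 mu mu)).
by apply: lee_wpmul2l => //; rewrite lee_fin.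
Qed.

End energy_form.

(** * The logarithm as a positive mixture of product kernels *)

Section kernel_mixture.
Context {R : realType}.
Variables (al b : R).
Hypothesis alb : al < b.
Local Notation leb := (@lebesgue_measure R).
Local Notation TR := (measurableTypeR R).
Let w := b - al.
Let w0 : 0 < w. Proof. by rewrite subr_gt0. Qed.
Local Open Scope ereal_scope.

Definition near_ind (r u x : R) : R := (r * `|x - u| < 1)%R%:R.
(** For r > 0, the length of the overlap of the intervals of radius 1 / r about [x] and [t]. *)
Definition scale_kernel (r x t : TR) : \bar R :=
  \int[leb]_u (near_ind r u x * near_ind r u t)%:E.
(** The overlap behaves like 2 / r for small [r], so the range of scales is cut off at 1 / w. The
    cutoff leaves a term linear in |x - t|, which the two ray kernels compensate. *)
Definition wide_kernel (x t : TR) : \bar R := \int[leb]_(r in `[w^-1%R, +oo[%classic) scale_kernel r x t.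
Definition left_kernel (x t : TR) : \bar R :=
  \int[leb]_(u in `[al, b]%classic) ((x <= u)%R%:R * (t <= u)%R%:R)%:E.
Definition right_kernel (x t : TR) : \bar R :=
  \int[leb]_(u in `[al, b]%classic) ((u < x)%R%:R * (u < t)%R%:R)%:E.

Lemma integral_itv_indic (i : interval R) :
  \int[leb]_u (\1_([set` i] : set R) u)%:E = leb ([set` i] : set R).
Proof. by rewrite integral_indic ?setIT; [|exact: measurableT|exact: measurable_itv]. Qed.

Lemma measurable_bool_natr d (T : measurableType d) (f : T -> bool) :
  measurable_fun setT f -> measurable_fun setT (fun x => (f x)%:R : R).
Proof.
move=> mf; have -> : (fun x => (f x)%:R : R) = (fun x => if f x then 1%R else 0%R).
  by apply/funext => x; case: (f x).
by apply: measurable_fun_ifT => //; exact: measurable_cst.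
Qed.

Lemma measurable_near_ind d (T : measurableType d) (r u x : T -> R) :
  measurable_fun setT r -> measurable_fun setT u -> measurable_fun setT x ->
  measurable_fun setT (fun z => near_ind (r z) (u z) (x z)).
Proof.
move=> mr mu mx; apply: measurable_bool_natr; apply: measurable_fun_ltr => //.
apply: measurable_funM => //; apply: measurableT_comp => //; exact: measurable_funB.
Qed.

Lemma scale_kernelE (r x t : R) : (0 < r)%R ->
  scale_kernel r x t = (Num.max 0 (2 / r - `|x - t|))%:E.
Proof.
move=> r0; rewrite /scale_kernel.
wlog xt : x t / (x <= t)%R => [h|].
  have [|tx] := leP x t; first exact: h.
  rewrite distrC -h ?ltW//; apply: eq_integral => u _; by rewrite mulrC.
have E u : ((r * `|x - u| < 1) && (r * `|t - u| < 1) = (u \in `]t - r^-1, x + r^-1[))%R.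
  rewrite !(mulrC r) -!ltr_pdivlMr// mul1r !ltr_distl in_itv/=.
  apply/andP/andP => [[/andP[h1 h2] /andP[h3 h4]]|[h1 h2]]; first by split; lra.
  by split; apply/andP; split; lra.
transitivity (\int[leb]_u (\1_(`]t - r^-1, x + r^-1[%classic : set R) u)%:E).
  apply: eq_integral => u _; rewrite /near_ind -natrM mulnb E indicE.
  by congr (_%:R)%:E; rewrite mem_setE.
rewrite integral_itv_indic lebesgue_measure_itv/= lte_fin (ler0_norm (_ : x - t <= 0)%R) ?subr_le0//.
have -> : (2 / r - - (x - t) = (x + r^-1) - (t - r^-1))%R by rewrite mulrDl mul1r; ring.
case: ltP => h; first by rewrite -EFinB; congr EFin; rewrite max_r// subr_ge0 ltW.
by congr EFin; rewrite max_l// subr_le0.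
Qed.

Lemma near_ind_ge0 r u x : (0 <= near_ind r u x)%R.
Proof. by []. Qed.

Lemma scale_kernel_ge0 r x t : 0 <= scale_kernel r x t.
Proof. by apply: integral_ge0 => u _; rewrite lee_fin mulr_ge0 ?near_ind_ge0. Qed.

Let mplane := (measurableTypeR R * measurableTypeR R)%type.

Lemma measurable_scale_kernel : measurable_fun [set: measurableTypeR R * mplane]
  (fun z => scale_kernel z.1 z.2.1 z.2.2).
Proof.
apply: (measurable_fun_fubini_tonelli_F (m2 := leb)
  (fun z : (measurableTypeR R * mplane) * measurableTypeR R =>
    (near_ind z.1.1 z.2 z.1.2.1 * near_ind z.1.1 z.2 z.1.2.2)%:E)).
  apply/measurable_EFinP; apply: measurable_funM; apply: measurable_near_ind => //.
  - exact: measurableT_comp measurable_fst measurable_fst.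
  - exact: measurableT_comp measurable_fst (measurableT_comp measurable_snd measurable_fst).
  - exact: measurableT_comp measurable_fst measurable_fst.
  - exact: measurableT_comp measurable_snd (measurableT_comp measurable_snd measurable_fst).
by move=> z; rewrite lee_fin mulr_ge0 ?near_ind_ge0.
Qed.

Lemma measurable_tent (dd : R) : measurable_fun [set: R] (fun r : R => (Num.max 0 (2 / r - dd))%:E).
Proof.
apply/measurable_EFinP; apply: measurable_maxr => //.
by apply: measurable_funB => //; exact: measurable_divr.
Qed.

Let wi0 : (0 < w^-1)%R. Proof. by rewrite invr_gt0. Qed.

Lemma integral_tent (dd : R) : (0 < dd <= w)%R ->
  \int[leb]_(r in `[w^-1%R, +oo[%classic) (Num.max 0 (2 / r - dd))%:E =
  (2 * ln (2 * w / dd) - 2 + dd / w)%:E.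
Proof.
move=> /andP[d0 dw].
have q : (w^-1 < 2 / dd)%R.
  rewrite ltr_pdivlMr// mulrC ltr_pdivrMr//; lra.
have mf := measurable_tent dd.
have f0 r : 0 <= (Num.max 0 (2 / r - dd))%:E by rewrite lee_fin le_max lexx.
have -> : `[w^-1%R, +oo[%classic = `[w^-1%R, (2 / dd)%R] `|` `](2 / dd)%R, +oo[ :> set R.
  apply/seteqP; split => r /=; rewrite !in_itv/= ?andbT.
    by move=> wr; have [h|h] := leP r (2 / dd)%R; [left; rewrite wr|right].
  by move=> [/andP[]//|h]; rewrite (le_trans (ltW q))// ltW.
rewrite ge0_integral_setU//; last 2 first.
- exact: measurable_funS mf.
- rewrite /disj_set; apply/eqP/seteqP; split => r //=; rewrite !in_itv/= andbT.
  by move=> [/andP[_ h]]; rewrite ltNge h.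
rewrite [X in _ + X]integral0_eq ?adde0; last first.
  move=> r; rewrite /= in_itv/= andbT => hr; congr EFin; rewrite max_l// subr_le0.
  have r0 : (0 < r)%R by rewrite (lt_trans _ hr)// divr_gt0.
  by rewrite ler_pdivrMr// mulrC -ler_pdivrMr// ltW.
pose f (r : R) : R := (2 / r - dd)%R.
pose F (r : R) : R := (2 * ln r - dd * r)%R.
have dF (r : R) : (0 < r)%R -> is_derive r 1%R F (f r).
  move=> r0; apply: (is_derive_eq (is_deriveB (is_deriveZ (2:R) (is_derive1_ln r0)) (is_deriveZ dd (is_derive_id r 1%R)))).
  by rewrite /GRing.scale/= mulr1.
have cf (r : R) : (0 < r)%R -> {for r, continuous f}.
  move=> r0; apply: cvgB; last exact: cvg_cst.
  by apply: cvgM; [exact: cvg_cst|apply: cvgV; [rewrite gt_eqF|exact: cvg_id]].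
transitivity (\int[leb]_(r in `[w^-1%R, (2 / dd)%R]%classic) (f r)%:E).
  apply: eq_integral => r /[!inE]; rewrite /= in_itv/= => /andP[h1 h2].
  have r0 : (0 < r)%R by exact: lt_le_trans h1.
  by congr EFin; rewrite max_r// subr_ge0 ler_pdivlMr// mulrC -ler_pdivlMr.
rewrite (continuous_FTC2 (F := F) q).
- rewrite /F -EFinB; congr EFin.
  have -> : (2 * w / dd = 2 / dd / w^-1)%R by rewrite invrK mulrAC.
  have -> : (ln (2 / dd / w^-1) = ln (2 / dd) - ln w^-1)%R by rewrite ln_div ?posrE ?divr_gt0.
  field.
  by rewrite !gt_eqF.
- apply: continuous_in_subspaceT => r /set_mem; rewrite /= in_itv/= => /andP[h1 _].
  by apply: cf; exact: lt_le_trans h1.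
- have cF (r : R) : (0 < r)%R -> {for r, continuous F}.
    move=> r0; apply: differentiable_continuous; apply/derivable1_diffP.
    by case: (dF r r0).
  split.
  + move=> r; rewrite in_itv/= => /andP[h1 _].
    by case: (dF r (lt_trans wi0 h1)).
  + by apply: cvg_at_right_filter; exact: cF.
  + by apply: cvg_at_left_filter; apply: cF; rewrite divr_gt0.
- move=> r; rewrite in_itv/= => /andP[h1 _].
  by rewrite derive1E (derive_val (is_derive := dF r (lt_trans wi0 h1))).
Qed.

Lemma wide_kernelE (x t : R) : x != t -> (`|x - t| <= w)%R ->
  wide_kernel x t = (2 * ln (2 * w / `|x - t|) - 2 + `|x - t| / w)%:E.
Proof.
move=> xt xw; rewrite -integral_tent ?normr_gt0 ?subr_eq0 ?xt//.
apply: eq_integral => r /[!inE]; rewrite /= in_itv/= andbT => wr.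
by rewrite scale_kernelE// (lt_le_trans wi0).
Qed.

(** On the diagonal the integrand 2 / r dominates the integrand belonging to any positive distance
    [dd], and by [integral_tent] those integrals are unbounded as [dd] tends to 0. *)
Lemma wide_kernelxx (x : R) : wide_kernel x x = +oo.
Proof.
apply/eqyP => M M0.
pose dd : R := (2 * w * Num.min (1 / 2) (expR (- (M + 2))))%R.
have m0 : (0 < Num.min (1 / 2) (expR (- (M + 2))))%R by rewrite lt_min expR_gt0 divr_gt0.
have d0 : (0 < dd)%R by rewrite !mulr_gt0.
have dw : (dd <= w)%R.
  have : (Num.min (1 / 2) (expR (- (M + 2))) <= 1 / 2)%R by rewrite ge_min lexx.
  by rewrite /dd; move: w0; move: (Num.min _ _) => m; nra.
have E := integral_tent (dd := dd); rewrite d0 dw in E.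
apply: (@le_trans _ _ (2 * ln (2 * w / dd) - 2 + dd / w)%:E).
  rewrite lee_fin.
  have : (M + 2 <= ln (2 * w / dd))%R.
    rewrite -[leLHS]expRK ler_ln ?posrE ?expR_gt0 ?divr_gt0 ?mulr_gt0//.
    rewrite ler_pdivlMr// /dd mulrCA ger_pMr ?mulr_gt0//.
    apply: (@le_trans _ _ (expR (M + 2) * expR (- (M + 2)))%R).
      by rewrite ler_pM2l ?expR_gt0// ge_min lexx orbT.
    by rewrite -expRD subrr expR0.
  have : (0 <= dd / w)%R by rewrite divr_ge0 ?ltW.
  move=> h1 h2; move: M0; lra.
rewrite -(E isT); apply: ge0_le_integral.
- exact: measurable_itv.
- by move=> r _; rewrite lee_fin le_max lexx.
- apply: (@measurable_funS _ _ _ _ setT) => //; exact: measurable_tent.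
- apply: (@measurable_funS _ _ _ _ setT) => //.
  apply: (measurableT_comp (f := fun z : measurableTypeR R * mplane => scale_kernel z.1 z.2.1 z.2.2)
    (g := fun r => (r, (x, x))) measurable_scale_kernel).
  by apply: measurable_fun_pair => //; exact: measurable_cst.
move=> r; rewrite /= in_itv/= andbT => wr; have r0 : (0 < r)%R by exact: lt_le_trans wr.
rewrite scale_kernelE// subrr normr0 subr0 lee_fin.
by rewrite ge_max le_max lexx/= le_max; apply/orP; right; rewrite lerBlDr lerDl ltW.
Qed.

Lemma left_kernelE (x t : R) : (al <= x <= b)%R -> (al <= t <= b)%R ->
  left_kernel x t = (b - Num.max x t)%:E.
Proof.
move=> /andP[ax xb] /andP[at_ tb]; rewrite /left_kernel integral_mkcond.
transitivity (\int[leb]_u (\1_(`[Num.max x t, b]%classic : set R) u)%:E).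
  apply: eq_integral => u _; rewrite patchE indicE -natrM mulnb.
  rewrite !mem_setE !in_itv/= ge_max.
  have [xu|] := leP x u; have [tu|] := leP t u; rewrite /= ?if_same//.
  by rewrite (le_trans ax xu)/=; case: (u <= b)%R.
rewrite integral_itv_indic lebesgue_measure_itv/= lte_fin.
case: ltP => h; first by rewrite -EFinB.
by congr EFin; apply/esym/eqP; rewrite subr_eq0 eq_le h ge_max xb tb.
Qed.

Lemma right_kernelE (x t : R) : (al <= x <= b)%R -> (al <= t <= b)%R ->
  right_kernel x t = (Num.min x t - al)%:E.
Proof.
move=> /andP[ax xb] /andP[at_ tb]; rewrite /right_kernel integral_mkcond.
transitivity (\int[leb]_u (\1_(`[al, Num.min x t[%classic : set R) u)%:E).
  apply: eq_integral => u _; rewrite patchE indicE -natrM mulnb.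
  rewrite !mem_setE !in_itv/= lt_min.
  have [xu|] := ltP u x; have [tu|] := ltP u t; rewrite /= ?if_same ?andbF//.
  by rewrite (ltW (lt_le_trans xu xb)) !andbT; case: (al <= u)%R.
rewrite integral_itv_indic lebesgue_measure_itv/= lte_fin.
case: ltP => h; first by rewrite -EFinB.
by congr EFin; apply/esym/eqP; rewrite subr_eq0 eq_le h le_min ax at_.
Qed.

Lemma wide_kernel_ge0 x t : 0 <= wide_kernel x t.
Proof. by apply: integral_ge0 => r _; exact: scale_kernel_ge0. Qed.

Lemma left_kernel_ge0 x t : 0 <= left_kernel x t.
Proof. by apply: integral_ge0 => u _; rewrite lee_fin mulr_ge0. Qed.

Lemma right_kernel_ge0 x t : 0 <= right_kernel x t.
Proof. by apply: integral_ge0 => u _; rewrite lee_fin mulr_ge0. Qed.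

Let mw : measurable (`[w^-1%R, +oo[%classic : set (measurableTypeR R)).
Proof. exact: measurable_itv. Qed.
Let mab : measurable (`[al, b]%classic : set (measurableTypeR R)).
Proof. exact: measurable_itv. Qed.

Lemma measurable_wide_kernel : measurable_fun [set: mplane] (fun z => wide_kernel z.1 z.2).
Proof. exact: (measurable_mixture leb mw measurable_scale_kernel scale_kernel_ge0). Qed.

Let m3 (i j : mplane -> measurableTypeR R) (g : R -> R -> bool) :
  measurable_fun setT i -> measurable_fun setT j ->
  (forall d (T : measurableType d) (u v : T -> R), measurable_fun setT u -> measurable_fun setT v ->
    measurable_fun setT (fun z => g (u z) (v z))) ->
  measurable_fun [set: measurableTypeR R * mplane]
   (fun z => ((g z.1 (i z.2))%:R * (g z.1 (j z.2))%:R : R)%:E).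
Proof.
move=> mi mj mg; apply/measurable_EFinP; apply: measurable_funM; apply: measurable_bool_natr; apply: mg.
- exact: measurable_fst.
- exact: measurableT_comp mi measurable_snd.
- exact: measurable_fst.
- exact: measurableT_comp mj measurable_snd.
Qed.

Lemma measurable_left3 : measurable_fun [set: measurableTypeR R * mplane]
  (fun z => ((z.2.1 <= z.1)%R%:R * (z.2.2 <= z.1)%R%:R : R)%:E).
Proof.
apply: (m3 (i := fst) (j := snd) (g := fun u x => (x <= u)%R)) => //; try exact: measurable_fst; try exact: measurable_snd.
by move=> d T u v mu mv; exact: measurable_fun_ler.
Qed.

Lemma measurable_right3 : measurable_fun [set: measurableTypeR R * mplane]
  (fun z => ((z.1 < z.2.1)%R%:R * (z.1 < z.2.2)%R%:R : R)%:E).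
Proof.
apply: (m3 (i := fst) (j := snd) (g := fun u x => (u < x)%R)) => //; try exact: measurable_fst; try exact: measurable_snd.
by move=> d T u v mu mv; exact: measurable_fun_ltr.
Qed.

Lemma measurable_left_kernel : measurable_fun [set: mplane] (fun z => left_kernel z.1 z.2).
Proof.
apply: (measurable_mixture leb mab (F := fun u x t : TR => ((x <= u)%R%:R * (t <= u)%R%:R : R)%:E) measurable_left3).
by move=> *; rewrite lee_fin mulr_ge0.
Qed.

Lemma measurable_right_kernel : measurable_fun [set: mplane] (fun z => right_kernel z.1 z.2).
Proof.
apply: (measurable_mixture leb mab (F := fun u x t : TR => ((u < x)%R%:R * (u < t)%R%:R : R)%:E) measurable_right3).
by move=> *; rewrite lee_fin mulr_ge0.
Qed.

(* With [d = |x - t|], [wide_kernel] is [2 ln (2 w / d) - 2 + d / w] and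
   [left_kernel + right_kernel] is [w - d]. All three are positive mixtures of
   kernels [phi x * phi t], and the terms linear in [d] cancel. *)
Definition psd_kernel (x t : TR) : \bar R :=
  (2^-1)%:E * wide_kernel x t + (2 * w)^-1%:E * (left_kernel x t + right_kernel x t).

Definition log_kernel_shift : R := 2^-1 - ln (2 * w).

Lemma log_kernel_psd (x t : R) : (al <= x <= b)%R -> (al <= t <= b)%R ->
  log_kernel x t = psd_kernel x t + log_kernel_shift%:E.
Proof.
move=> xS tS; rewrite /psd_kernel left_kernelE// right_kernelE//.
have [<-|xt] := eqVneq x t.
  by rewrite log_kernelxx wide_kernelxx gt0_muley ?lte_fin ?invr_gt0// addye// addye.
have xw : (`|x - t| <= w)%R.
  move: xS tS => /andP[h1 h2] /andP[h3 h4]; rewrite ler_distl /w; apply/andP; split; lra.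
rewrite log_kernelE// wide_kernelE// -!(EFinD, EFinM); congr EFin.
have d0 : (0 < `|x - t|)%R by rewrite normr_gt0 subr_eq0.
rewrite ln_div ?posrE ?mulr_gt0// /log_kernel_shift.
have -> : (b - Num.max x t + (Num.min x t - al) = w - `|x - t|)%R.
  rewrite /w; have [h|h] := leP x t.
    by rewrite ler0_norm ?subr_le0//; ring.
  by rewrite gtr0_norm ?subr_gt0//; ring.
by field; rewrite gt_eqF.
Qed.

Let w2i : (0 <= (2 * w)^-1)%R. Proof. by rewrite invr_ge0 mulr_ge0// ltW. Qed.

Lemma psd_kernel_ge0 x t : 0 <= psd_kernel x t.
Proof.
apply: adde_ge0; apply: mule_ge0; rewrite ?lee_fin ?invr_ge0//; first exact: wide_kernel_ge0.
  by rewrite mulr_ge0// ltW.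
by apply: adde_ge0; [exact: left_kernel_ge0|exact: right_kernel_ge0].
Qed.

Let mLR : measurable_fun [set: mplane] (fun z => left_kernel z.1 z.2 + right_kernel z.1 z.2).
Proof. exact: emeasurable_funD measurable_left_kernel measurable_right_kernel. Qed.

Lemma measurable_psd_kernel : measurable_fun [set: mplane] (fun z => psd_kernel z.1 z.2).
Proof.
by apply: emeasurable_funD; apply: measurable_funeM; [exact: measurable_wide_kernel|exact: mLR].
Qed.

Lemma psd_kernelC x t : psd_kernel x t = psd_kernel t x.
Proof.
have h1 : wide_kernel x t = wide_kernel t x.
  by apply: eq_integral => r _; apply: eq_integral => u _; rewrite mulrC.
have h2 : left_kernel x t = left_kernel t x by apply: eq_integral => r _; rewrite mulrC.
have h3 : right_kernel x t = right_kernel t x by apply: eq_integral => r _; rewrite mulrC.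
by rewrite /psd_kernel h1 h2 h3.
Qed.

Section gap.
Variables nu mu : probability (measurableTypeR R) R.

Definition cdf_gap (u : R) : R :=
  ((fine (nu (`]-oo, u]%classic : set R)) - fine (mu (`]-oo, u]%classic : set R))) ^+ 2)%R.

Let zero_gap (K : TR -> TR -> \bar R) (D : \bar R) : 0 <= D -> energy_gap K nu mu D -> energy_gap K nu mu 0.
Proof. by move=> D0; apply: le_trans; rewrite adde0 leeDl. Qed.

Let gap_near (f : measurableTypeR R -> R) : measurable_fun setT f -> (forall x, 0 <= f x <= 1)%R ->
  energy_gap (fun x t => (f x * f t)%:E) nu mu 0.
Proof. by move=> mf f01; apply: zero_gap (energy_gap_mulr nu mu mf f01); rewrite lee_fin sqr_ge0. Qed.

Let bool01 (c : bool) : (0 <= (c%:R : R) <= 1)%R.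
Proof. by rewrite ler0n lern1 leq_b1. Qed.

Let gap_scale r : energy_gap (scale_kernel r) nu mu 0.
Proof.
have := @energy_gap_mixture _ (measurableTypeR R) R _ (measurableTypeR R) leb setT
  (fun u x t => (near_ind r u x * near_ind r u t)%:E) measurableT.
move=> /(_ _ _ nu mu (cst 0)) h; have := h; rewrite integral_cst// mul0e => {}h; apply: h => //.
- apply/measurable_EFinP; apply: measurable_funM; apply: measurable_near_ind => //;
  [exact: measurableT_comp measurable_fst measurable_snd|exact: measurableT_comp measurable_snd measurable_snd].
- by move=> *; rewrite lee_fin mulr_ge0 ?near_ind_ge0.
- by move=> u _; apply: gap_near => [|x]; [exact: measurable_near_ind|exact: bool01].
Qed.

Let gap_wide : energy_gap wide_kernel nu mu 0.
Proof.
have := energy_gap_mixture leb mw measurable_scale_kernel scale_kernel_ge0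
  (nu := nu) (mu := mu) (measurable_cst 0) (fun=> lexx 0) (fun r _ => gap_scale r).
by rewrite integral0.
Qed.

Let integral_ray (P : probability (measurableTypeR R) R) u :
  \int[P]_x ((x <= u)%R%:R : R)%:E = P (`]-oo, u]%classic : set R).
Proof.
have -> : P (`]-oo, u]%classic : set R) = \int[P]_x (\1_(`]-oo, u]%classic : set R) x)%:E.
  by rewrite integral_indic ?setIT//; exact: measurable_itv.
by apply: eq_integral => x _; rewrite indicE mem_setE in_itv.
Qed.

Lemma measurable_cdf_gap : measurable_fun [set: R] (fun u => (cdf_gap u)%:E).
Proof.
have mP (P : probability (measurableTypeR R) R) :
    measurable_fun [set: measurableTypeR R] (fun u : R => fine (P (`]-oo, u]%classic : set R))).
  apply: (measurableT_comp (fine_measurable measurableT)).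
  under eq_fun do rewrite -integral_ray.
  apply: (measurable_fun_fubini_tonelli_F (m2 := P)
    (fun z : measurableTypeR R * measurableTypeR R => ((z.2 <= z.1)%R%:R : R)%:E)).
    by apply/measurable_EFinP; apply: measurable_bool_natr; apply: measurable_fun_ler.
  by move=> z; rewrite lee_fin.
apply/measurable_EFinP; rewrite /cdf_gap.
by apply: measurable_funX; apply: measurable_funB; exact: mP.
Qed.

Let gap_left : energy_gap left_kernel nu mu (\int[leb]_(u in `[al, b]%classic) (cdf_gap u)%:E).
Proof.
have F0 (u x t : TR) : 0 <= ((x <= u)%R%:R * (t <= u)%R%:R : R)%:E by rewrite lee_fin mulr_ge0.
apply: (energy_gap_mixture leb mab (F := fun u x t : TR => ((x <= u)%R%:R * (t <= u)%R%:R : R)%:E) measurable_left3 F0).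
- exact: measurable_cdf_gap.
- by move=> u; rewrite lee_fin sqr_ge0.
move=> u _; rewrite /cdf_gap -!integral_ray.
apply: (energy_gap_mulr (f := fun x : TR => (x <= u)%R%:R : R)) => [|x]; last exact: bool01.
by apply: measurable_bool_natr; apply: measurable_fun_ler.
Qed.

Let gap_right : energy_gap right_kernel nu mu 0.
Proof.
have F0 (u x t : TR) : 0 <= ((u < x)%R%:R * (u < t)%R%:R : R)%:E by rewrite lee_fin mulr_ge0.
have := energy_gap_mixture leb mab
  (F := fun u x t : TR => ((u < x)%R%:R * (u < t)%R%:R : R)%:E) measurable_right3 F0
  (nu := nu) (mu := mu) (Delta := cst 0) (measurable_cst 0) (fun=> lexx 0).
rewrite integral0; apply.
move=> u _; apply: (gap_near (f := fun x : TR => (u < x)%R%:R : R)) => [|x]; last exact: bool01.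
by apply: measurable_bool_natr; apply: measurable_fun_ltr.
Qed.

(** Only the rays ]-oo, u] of [left_kernel] are made to contribute, since they see the distribution
    functions; for the other kernels a gap of 0 is kept. *)
Lemma psd_kernel_gap :
  energy_gap psd_kernel nu mu ((2 * w)^-1%:E * \int[leb]_(u in `[al, b]%classic) (cdf_gap u)%:E).
Proof.
have I0 : 0 <= \int[leb]_(u in `[al, b]%classic) (cdf_gap u)%:E.
  by apply: integral_ge0 => u _; rewrite lee_fin sqr_ge0.
have LR := energy_gapD measurable_left_kernel measurable_right_kernel left_kernel_ge0 right_kernel_ge0
  gap_left gap_right.
rewrite adde0 in LR.
have LR0 x t : 0 <= left_kernel x t + right_kernel x t by rewrite adde_ge0 ?left_kernel_ge0 ?right_kernel_ge0.
have g2 := energy_gapZ (q := (2 * w)^-1) mLR LR0 w2i I0 LR.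
have i2 : (0 <= 2^-1 :> R)%R by rewrite invr_ge0.
have g1 := energy_gapZ (q := 2^-1) measurable_wide_kernel wide_kernel_ge0 i2 (lexx 0) gap_wide.
rewrite mule0 in g1; rewrite -[X in energy_gap _ _ _ X]add0e.
apply: energy_gapD g1 g2.
- by apply: measurable_funeM; exact: measurable_wide_kernel.
- by apply: measurable_funeM; exact: mLR.
- by move=> x t; rewrite mule_ge0 ?lee_fin ?wide_kernel_ge0.
- by move=> x t; rewrite mule_ge0 ?lee_fin.
Qed.

End gap.

End kernel_mixture.

Lemma right_continuous_prob_ray (R : realType) (M : probability (measurableTypeR R) R) (u : R) :
  M (`]-oo, v]%classic : set R) @[v --> u^'+] --> M (`]-oo, u]%classic : set R).
Proof.
have mid : measurable_fun [set: measurableTypeR R] (idfun : measurableTypeR R -> R).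
  exact: measurable_id.
pose X : {RV M >-> R} := HB.pack (idfun : measurableTypeR R -> R)
  (isMeasurableFun.Build _ _ (measurableTypeR R) R idfun mid).
exact: (@cdf_right_continuous _ _ _ M X u).
Qed.

(** * Extremality and uniqueness from the field conditions *)

Section extremal_unique.
Context {R : realType}.
Variables (al b : R).
Hypothesis alb : al < b.
Local Notation leb := (@lebesgue_measure R).
Local Notation TR := (measurableTypeR R).
Local Notation S := (`[al, b]%classic : set (measurableTypeR R)).
Local Notation K := (psd_kernel al b).
Local Open Scope ereal_scope.
Implicit Types (P : probability TR R).

Let mS : measurable S. Proof. exact: measurable_itv. Qed.
Let PT P : P setT = 1. Proof. exact: probability_setT. Qed.
Let finP P : P setT < +oo. Proof. by rewrite PT ltry. Qed.

Lemma prob_null_setT P (D : set TR) : measurable D -> P (~` D) = 0 -> P D = 1.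
Proof.
move=> mD D0; have := ge0_integral_null mD (measurable_cst (1%E : \bar R)) (fun=> lee01) D0.
rewrite !integral_cst// !mul1e => <-; exact: PT.
Qed.

Lemma integral_prob_cst P (D : set TR) (r : R) : measurable D -> P (~` D) = 0 ->
  \int[P]_(x in D) r%:E = r%:E.
Proof.
move=> mD D0; rewrite integral_cst// -[RHS]mule1; congr (_ * _).
exact: prob_null_setT.
Qed.

(** Adding |c| to both sides makes both integrands nonnegative, whatever the sign of [c]. *)
Lemma integral_affine P (f g : TR -> \bar R) (c : R) : measurable_fun setT f ->
  measurable_fun setT g -> (forall x, 0 <= g x) -> P (~` S) = 0 ->
  (forall x, S x -> f x = g x + c%:E) -> \int[P]_x f x = \int[P]_x g x + c%:E.
Proof.
move=> mf mg g0 PS fg.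
have c0 : (0 <= `|c|)%R by [].
have cc : (0 <= c + `|c|)%R by have := ler_norm (- c); rewrite normrN; lra.
have mgS : measurable_fun S g by exact: measurable_funS mg.
have h := integral_shift mS mf PS (finP P) c0.
have {}h : \int[P]_(x in S) (f x + `|c|%:E) = \int[P]_x f x + `|c|%:E.
  transitivity (\int[P]_x f x + `|c|%:E * P setT); last by congr (_ + _); rewrite -[RHS]mule1; congr (_ * _); exact: PT.
  apply: h => x /fg ->.
  rewrite -[leLHS]add0e leeD// lee_fin; have := ler_norm (- c); rewrite normrN; lra.
have : \int[P]_(x in S) (f x + `|c|%:E) = \int[P]_x g x + (c + `|c|)%:E.
  transitivity (\int[P]_(x in S) (g x + (c + `|c|)%:E)).
    by apply: eq_integral => x /[!inE] Sx; rewrite fg// EFinD addeA.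
  rewrite ge0_integralD// integral_prob_cst//.
  by rewrite (ge0_integral_null mS mg g0 PS).
rewrite h EFinD addeA => E.
have := congr1 (fun z => z - `|c|%:E) E; rewrite !addeK//.
Qed.

Lemma measurable_log_potential (P : {finite_measure set TR -> \bar R}) : measurable_fun [set: TR] (log_potential P).
Proof.
have mk : measurable_fun [set: TR * TR] (fun z : TR * TR => log_kernel z.1 z.2).
  by apply: measurable_log_kernel.
rewrite (_ : log_potential P = fun x => \int[P]_t (fun z : TR * TR => log_kernel z.1 z.2)^\+ (x, t) -
   \int[P]_t (fun z : TR * TR => log_kernel z.1 z.2)^\- (x, t)); last first.
  apply/funext => x; rewrite /log_potential integralE; congr (_ - _);
  by apply: eq_integral => t _; rewrite ?funeposE ?funenegE.
apply: emeasurable_funB.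
  apply: (measurable_fun_fubini_tonelli_F (m2 := P)) => //.
  exact: measurable_funepos.
apply: (measurable_fun_fubini_tonelli_F (m2 := P)) => //.
exact: measurable_funeneg.
Qed.

Let PU P (x : TR) := \int[P]_t K x t.
Let c := log_kernel_shift al b.

Let mK : measurable_fun [set: TR * TR] (fun z : TR * TR => K z.1 z.2).
Proof. exact: measurable_psd_kernel. Qed.
Let K0 x t : 0 <= K x t. Proof. exact: psd_kernel_ge0. Qed.

Let mPU P : measurable_fun setT (PU P).
Proof. exact: (measurable_fun_fubini_tonelli_F (m2 := P) (fun z => K z.1 z.2)). Qed.

Let PU0 P x : 0 <= PU P x. Proof. by apply: integral_ge0 => t _; exact: K0. Qed.

Let potentialE P x : P (~` S) = 0 -> S x -> log_potential P x = PU P x + c%:E.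
Proof.
move=> PS Sx; apply: integral_affine => //.
- exact: measurable_log_kernel.
- exact: (measurable_kernel_section x mK).
- by move=> t St; apply: log_kernel_psd => //; move: Sx St; rewrite /= !in_itv.
Qed.

Let energyE P : P (~` S) = 0 -> log_energy P = energy_form K P P + c%:E.
Proof.
move=> PS; apply: integral_affine => //.
- exact: measurable_log_potential.
- exact: mPU.
- exact: PU0.
- by move=> x Sx; exact: potentialE.
Qed.


Variables (Q : R -> \bar R) (L : R).
Hypothesis mQ : measurable_fun [set: R] Q.
Hypothesis QL : forall x, x \in `[al, b] -> (- L)%:E <= Q x.

Let q (x : TR) : \bar R := maxe (Q x + L%:E) 0.
Let q0 x : 0 <= q x. Proof. by rewrite le_max lexx orbT. Qed.
Let mq : measurable_fun setT q.
Proof.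
by apply: measurable_maxe; [apply: emeasurable_funD => //|]; exact: measurable_cst.
Qed.
Let qE x : S x -> Q x = q x + (- L)%:E.
Proof.
move=> Sx; rewrite /q (max_idPl _); last by rewrite -leeBlDr// sub0e; exact: QL.
by rewrite EFinN addeK.
Qed.

Let weightedE P : P (~` S) = 0 ->
  weighted_energy Q P = energy_form K P P + 2%:E * \int[P]_x q x + (c - 2 * L)%:E.
Proof.
move=> PS; rewrite /weighted_energy energyE//.
rewrite (integral_affine mQ mq q0 PS qE).
have i0 : 0 <= \int[P]_x q x by apply: integral_ge0 => x _; exact: q0.
have e0 : 0 <= energy_form K P P by exact: energy_form_ge0.
have p2 : 0 < 2%:E :> \bar R by rewrite lte_fin.
move: e0 i0; case: (energy_form K P P) => [e| |] //; case: (\int[P]_x q x) => [v| |] //= _ _;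
  rewrite ?(gt0_muley p2)//.
by rewrite -!(EFinD, EFinM); congr EFin; ring.
Qed.

Variables (S0 : set TR) (mu : probability TR R) (F : R).
Hypothesis mS0 : measurable S0.
Hypothesis S0S : S0 `<=` S.
Hypothesis muS0 : mu (~` S0) = 0.
Hypothesis Ufin : forall x, log_potential mu x \is a fin_num.
Hypothesis F_eq : forall x, S0 x -> extremal_fun Q mu F x = 0.
Hypothesis F_le : forall x, S x -> extremal_fun Q mu F x <= 0.

Let muS : mu (~` S) = 0.
Proof.
apply/eqP; rewrite eq_le measure_ge0 andbT -muS0.
by apply: le_measure; rewrite ?inE; [exact: measurableC|exact: measurableC|exact: subsetC].
Qed.

Let F' := (F - c + L)%R.

Let field_ge x : S x -> F'%:E <= PU mu x + q x.
Proof.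
move=> Sx; have := F_le Sx; have := Ufin x.
rewrite /extremal_fun (qE Sx) (potentialE muS Sx).
have := PU0 mu x; have := q0 x.
case: (PU mu x) => [u| |] //; case: (q x) => [v| |] //=; rewrite ?leey//.
by rewrite -!(EFinD, EFinN) !lee_fin /F' => _ _ _; lra.
Qed.

Let field_eq x : S0 x -> PU mu x + q x = F'%:E.
Proof.
move=> S0x; have Sx := S0S S0x; have := F_eq S0x; have := Ufin x.
rewrite /extremal_fun (qE Sx) (potentialE muS Sx).
have := PU0 mu x; have := q0 x.
case: (PU mu x) => [u| |] //; case: (q x) => [v| |] //=.
rewrite -!(EFinD, EFinN) => _ _ _ [E]; congr EFin; rewrite /F'; lra.
Qed.

Let energy_field P : \int[P]_x (PU mu x + q x) = energy_form K P mu + \int[P]_x q x.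
Proof. by rewrite ge0_integralD//; exact: mPU. Qed.

Let mu_field : energy_form K mu mu + \int[mu]_x q x = F'%:E.
Proof.
rewrite -energy_field (@ge0_integral_null _ _ _ _ S0)//; last 2 first.
- by apply: emeasurable_funD => //; exact: mPU.
- by move=> x; rewrite adde_ge0.
transitivity (\int[mu]_(x in S0) F'%:E).
  by apply: eq_integral => x /[!inE]; exact: field_eq.
by rewrite integral_prob_cst//.
Qed.

Let F'0 : (0 <= F')%R.
Proof.
by rewrite -lee_fin -mu_field adde_ge0 ?energy_form_ge0//; apply: integral_ge0 => x _; exact: q0.
Qed.

Let P_field P : P (~` S) = 0 -> F'%:E <= energy_form K P mu + \int[P]_x q x.
Proof.
move=> PS; rewrite -energy_field (ge0_integral_null mS _ _ PS); last 2 first.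
- by apply: emeasurable_funD => //; exact: mPU.
- by move=> x; rewrite adde_ge0.
have <- : \int[P]_(x in S) F'%:E = F'%:E by rewrite integral_prob_cst//.
apply: ge0_le_integral => //.
- apply: (@measurable_funS _ _ _ _ setT) => //.
  by apply: emeasurable_funD => //; exact: mPU.
Qed.

Let gap P := ((2 * (b - al))^-1%:E * \int[leb]_(u in `[al, b]%classic) (cdf_gap P mu u)%:E).

Let gap0 P : 0 <= gap P.
Proof.
have w0 : (0 <= (2 * (b - al))^-1)%R by rewrite invr_ge0 mulr_ge0// subr_ge0 ltW.
apply: mule_ge0; first by rewrite lee_fin.
by apply: integral_ge0 => u _; rewrite lee_fin sqr_ge0.
Qed.

Let mu_fin : exists e0 v0 : R, [/\ energy_form K mu mu = e0%:E, \int[mu]_x q x = v0%:E &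
  (e0 + v0 = F')%R].
Proof.
have : 0 <= energy_form K mu mu by apply: energy_form_ge0 => *; exact: K0.
have : 0 <= \int[mu]_x q x by apply: integral_ge0 => x _; exact: q0.
move: mu_field.
case: (energy_form K mu mu) => [e0| |] //; case: (\int[mu]_x q x) => [v0| |] //= [E] _ _.
by exists e0, v0.
Qed.

(** Write E for the energy form. The field inequality integrated against [P] gives F' <= E(P, mu) +
    int q dP, with equality when P = mu. Insert this into 2 E(P, mu) + gap <= E(P, P) + E(mu,
    mu). *)
Let main P : P (~` S) = 0 ->
  energy_form K mu mu + 2%:E * \int[mu]_x q x + gap P <= energy_form K P P + 2%:E * \int[P]_x q x.
Proof.
move=> PS; have g := psd_kernel_gap alb P mu; rewrite /energy_gap -/(gap P) in g.
have mf := P_field PS.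
have sym : energy_form K mu P = energy_form K P mu.
  by apply: energy_formC => //; exact: psd_kernelC.
move: g mf; rewrite sym.
have := gap0 P.
have : 0 <= energy_form K P mu by apply: energy_form_ge0 => *; exact: K0.
have : 0 <= energy_form K P P by apply: energy_form_ge0 => *; exact: K0.
have : 0 <= \int[P]_x q x by apply: integral_ge0 => x _; exact: q0.
have p2 : 0 < 2%:E :> \bar R by rewrite lte_fin.
have [e0 [v0 [-> -> E]]] := mu_fin.
case: (energy_form K P P) => [e| |] //; case: (\int[P]_x q x) => [v| |] //;
  case: (energy_form K P mu) => [m| |] //; case: (gap P) => [D| |] //=;
  rewrite ?(gt0_muley p2) ?leey//.
by rewrite -!(EFinD, EFinM) !lee_fin => *; lra.
Qed.

Lemma extremal_of_field : is_extremal S Q mu.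
Proof.
split; first exact: null_supp_itv.
move=> P /supp_itv_null PS; rewrite !weightedE//.
apply: leeD => //; apply: le_trans (main PS); rewrite leeDl//.
Qed.

(** Equal energies force a zero gap, so the distribution functions agree almost everywhere on
    [al, b]. If they differed at some [u], right continuity would make them differ on an interval
    ]u, v[ of positive measure. *)
Lemma extremal_unique P : is_extremal S Q P -> forall A, measurable A -> P A = mu A.
Proof.
move=> [/supp_itv_null PS minP].
have {}minP := minP mu (null_supp_itv muS).
rewrite !weightedE// leeD2rE// in minP.
have := le_trans (main PS) minP.
have [e0 [v0 [-> -> E]]] := mu_fin; rewrite -EFinM -EFinD => h.
have {}h : gap P = 0.
  apply/eqP; rewrite eq_le gap0 andbT.
  by move: h; rewrite -leeBrDl// subee.
have I0 : \int[leb]_(u in `[al, b]%classic) (cdf_gap P mu u)%:E = 0.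
  move/eqP: h; rewrite mule_eq0 eqe invr_eq0 mulf_eq0 pnatr_eq0/= subr_eq0 gt_eqF//=.
  by move/eqP.
pose p (M : probability TR R) (u : R) : R := fine (M (`]-oo, u]%classic : set R)).
have mray u : measurable (`]-oo, u]%classic : set TR) by exact: measurable_itv.
have pE (M : probability TR R) u : M (`]-oo, u]%classic : set R) = (p M u)%:E.
  by rewrite fineK// fin_num_measure.
have rc (M : probability TR R) u : p M v @[v --> u^'+] --> p M u.
  apply: (@fine_cvg _ _ _ _ (fun v => M (`]-oo, v]%classic : set R))).
  by rewrite -pE; exact: right_continuous_prob_ray.
have out (M : probability TR R) : M (~` S) = 0 -> forall u, (~~ (al <= u < b))%R -> p M u = (b <= u)%R%:R.
  move=> MS u; rewrite negb_and -ltNge -leNgt => /orP[ua|bu].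
    rewrite leNgt (lt_trans ua alb)/= /p (subset_measure0 _ _ _ MS)//.
      exact: measurableC.
    by move=> x /=; rewrite !in_itv/= => xu; apply/negP; rewrite negb_and -!ltNge (le_lt_trans xu ua).
  rewrite bu /p (_ : M _ = 1)//; apply/eqP; rewrite eq_le probability_le1//=.
  rewrite -(prob_null_setT mS MS); apply: le_measure; rewrite ?inE//.
  by move=> x /=; rewrite !in_itv/= => /andP[_ xb]; exact: le_trans bu.
apply: prob_eq_cdf => u; rewrite !pE; congr EFin.
have [/andP[au ub]|o] := boolP (al <= u < b)%R; last by rewrite !out.
apply/eqP; rewrite -subr_eq0; apply/negP => /negP d0.
have cv : (p P v - p mu v)%R @[v --> u^'+] --> (p P u - p mu u)%R by apply: cvgB; exact: rc.
have [e /= eg0 He] := cvgr_neq0 _ cv d0.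
have mcg : measurable_fun S (fun u => (cdf_gap P mu u)%:E).
  exact: measurable_funS (measurable_cdf_gap P mu).
have : \int[leb]_(u in S) `|(cdf_gap P mu u)%:E| = 0.
  by rewrite -[RHS]I0; apply: eq_integral => v _; rewrite gee0_abs// lee_fin sqr_ge0.
move=> /(ae_eq_integral_abs leb mS mcg) [N [mN N0 NS]].
pose v := Num.min b (u + e)%R.
have uv : (u < v)%R by rewrite lt_min ub ltrDl.
have : leb `]u, v[%classic <= leb N.
  have m1 : measurable (`]u, v[%classic : set TR) by exact: measurable_itv.
  apply: le_measure; rewrite ?inE//.
  move=> x /=; rewrite in_itv/= lt_min => /andP[ux /andP[xb xe]]; apply: NS => /= h0.
  have : (`]al, b[%classic : set R) x by rewrite /= in_itv/= (le_lt_trans au ux).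
  move=> /subset_itv_oo_cc => /h0 [] /eqP; rewrite /cdf_gap expf_eq0/=; apply/negP.
  by apply: He => //=; rewrite ltr_distlC; apply/andP; split; lra.
rewrite N0 lebesgue_measure_itv/= lte_fin uv -EFinB lee_fin subr_le0.
by rewrite leNgt uv.
Qed.

End extremal_unique.

(** * Discretization of the equilibrium measure *)

Section scalar.
Context {R : realType}.
Implicit Types (u v w l y : R).

(** The tangent of ln at [u]. When [u] is the mean of [v] over a cell, the linear term integrates to
    zero and this becomes the inequality of Jensen. *)
Lemma ln_jensen u v : 0 < u -> 0 < v -> ln v <= ln u + (v / u - 1).
Proof.
move=> u0 v0; have h : -1 < v / u - 1 by have := divr_gt0 v0 u0; lra.
have := le_ln1Dx h; rewrite addrC subrK ln_div ?posrE//; lra.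
Qed.

(** The reverse of [ln_jensen]: the tangent at [v] is rewritten with the linear term at [u], and the
    difference is exactly (u - v)^2 / (u v). *)
Lemma ln_jensen_quadratic u v w l : 0 < w -> w <= u -> w <= v -> `|u - v| <= l ->
  - ln v <= - ln u + (1 - v / u) + (l / w) ^+ 2.
Proof.
move=> w0 wu wv uvl; have u0 := lt_le_trans w0 wu; have v0 := lt_le_trans w0 wv.
have h := ln_jensen v0 u0.
have E : u / v - 1 = (1 - v / u) + (u - v) ^+ 2 / (u * v).
  by field; rewrite !gt_eqF.
have : (u - v) ^+ 2 / (u * v) <= (l / w) ^+ 2.
  rewrite expr_div_n; apply: ler_pM; rewrite ?sqr_ge0 ?invr_ge0 ?mulr_ge0 ?(ltW u0) ?(ltW v0)//.
    rewrite -(@real_normK _ (u - v)) ?num_real// ler_sqr ?nnegrE//.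
    exact: le_trans (normr_ge0 _) uvl.
  rewrite lef_pV2 ?posrE ?mulr_gt0 ?exprn_gt0// expr2.
  by apply: ler_pM => //; exact: ltW.
lra.
Qed.

Lemma ln1D_le_sqrt y : 0 <= y -> ln (1 + y) <= 2 * Num.sqrt y.
Proof.
move=> y0; have s0 := sqrtr_ge0 y.
have h : (-1 : R) < Num.sqrt y by lra.
have := le_ln1Dx h.
have : ln (1 + y) <= ln ((1 + Num.sqrt y) ^+ 2).
  rewrite ler_ln ?posrE ?exprn_gt0//; try lra.
  by have := sqr_sqrtr y0; rewrite !expr2; nra.
rewrite lnXn; last lra.
by rewrite -mulr_natl; lra.
Qed.

End scalar.

Section integral_itv_split.
Context {R : realType}.
Local Notation mu := (@lebesgue_measure R).

Lemma integral_itv_split (f : R -> \bar R) (c d e : R) : (c <= d)%R -> (d <= e)%R ->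
  measurable_fun `[c, e] f ->
  (\int[mu]_(t in `[c, e]) f t = \int[mu]_(t in `[c, d]) f t + \int[mu]_(t in `[d, e]) f t)%E.
Proof.
move=> cd de mf.
have E : `[c, e]%classic = `[c, d[%classic `|` `[d, e]%classic.
  by apply: itv_bndbnd_setU; rewrite bnd_simp.
have mf1 : measurable_fun `[c, d[ f.
  by apply: measurable_funS mf => //; rewrite E; exact: subsetUl.
rewrite {1}E integral_setU//.
- by rewrite integral_itv_bndo_bndc.
- by rewrite -E.
- apply/disj_setPS => x /= []; rewrite !in_itv/= => /andP[_ xd] /andP[dx _].
  by move: (lt_le_trans xd dx); rewrite ltxx.
Qed.

End integral_itv_split.

Section integrable_density.
Context {R : realType}.
Local Notation mu := (@lebesgue_measure R).
Local Notation I := (`[0%R, (pi / 2 : R)%R]%classic).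
Local Open Scope ereal_scope.

Lemma integrable_mul_bounded (D : set (measurableTypeR R)) (f : R -> \bar R) (s : R -> R) (M : R) :
  measurable D -> measurable_fun [set: R] s -> (forall t, 0 <= s t)%R -> (forall t, s t <= M)%R ->
  mu.-integrable D f -> mu.-integrable D (fun t => f t * (s t)%:E).
Proof.
move=> mD ms s0 sM intf; have M0 : (0 <= M)%R by exact: le_trans (s0 0%R) (sM 0%R).
apply: (@le_integrable _ _ _ mu D mD _ (fun t => M%:E * f t)).
- apply: emeasurable_funM; first by case/integrableP: intf.
  by apply/measurable_EFinP; exact: measurable_funS ms.
- move=> t _; rewrite !abseM [leRHS]muleC; apply: lee_pmul => //.
  by rewrite lee_fin !ger0_norm.
- exact: integrableZl.
Qed.

Lemma integrable_log_kernel_arc (a b x : R) : (a < b)%R ->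
  mu.-integrable I (fun t => log_kernel x (arc a b t)).
Proof.
move=> ab; have AB : ((x - a)%R != 0%R) || ((x - b)%R != 0%R).
  by rewrite -negb_and !subr_eq0; apply/negP => /andP[/eqP -> /eqP E]; move: ab; rewrite E ltxx.
have := integrable_log_kernel_trig AB; apply: eq_integrable => //.
by move=> t _; rewrite [RHS]log_kernel_sub arc_sub.
Qed.

End integrable_density.

(** * One cell: unit mass against a point at its mean *)

Section cell.
Context {R : realType}.
Local Notation mu := (@lebesgue_measure R).
Local Notation I := (`[0%R, (pi / 2 : R)%R]%classic).
Variables (a b M : R) (s : R -> R) (c d : R).
Hypothesis ab : a < b.
Hypothesis ms : measurable_fun [set: R] s.
Hypothesis s0 : forall t, 0 <= s t.
Hypothesis sM : forall t, s t <= M.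
Hypothesis c0 : 0 <= c.
Hypothesis cd : c < d.
Hypothesis dI : d <= pi / 2.
Hypothesis s1 : (\int[mu]_(t in `[c, d]) (s t)%:E = 1)%E.
Local Notation X := (arc a b).
Local Notation J := (`[c, d]%classic : set R).
Local Open Scope ereal_scope.

(** No division occurs, the cell having [s]-mass one. *)
Definition barycenter : R := fine (\int[mu]_(t in J) (X t * s t)%R%:E).
Local Notation xi := barycenter.

Let mJ : measurable (J : set (measurableTypeR R)). Proof. exact: measurable_itv. Qed.

Let JI : J `<=` I.
Proof.
by move=> t /=; rewrite !in_itv/= => /andP[ct td]; rewrite (le_trans c0 ct) (le_trans td dI).
Qed.

Let integrable_density (f : R -> \bar R) : mu.-integrable I f -> mu.-integrable J (fun t => f t * (s t)%:E).
Proof.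
move=> intf; apply: (integrable_mul_bounded mJ ms s0 sM).
by apply: integrableS intf => //; exact: measurable_itv.
Qed.

Let integrable_bounded (f : R -> R) (B : R) : measurable_fun [set: R] f -> (forall t, `|f t| <= B)%R ->
  mu.-integrable J (fun t => (f t * s t)%:E).
Proof.
move=> mf fB; have := @integrable_density (EFin \o f); apply.
apply: (@le_integrable _ _ _ mu I _ _ (cst B%:E)) => //.
- by apply/measurable_EFinP; exact: measurable_funS mf.
- by move=> t _ /=; rewrite lee_fin [leRHS]ger0_norm ?fB// (le_trans _ (fB t)).
- exact: integrable_quarter_cst.
Qed.

Let mX : measurable_fun [set: R] X. Proof. exact: measurable_arc. Qed.

Let XB t : (`|X t| <= `|a| + `|b|)%R.
Proof.
have := @arc_itv _ _ _ ab t; rewrite ler_norml => /andP[? ?].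
have := ler_norm a; have := ler_norm (- a); have := ler_norm b; have := ler_norm (- b).
by rewrite !normrN; lra.
Qed.

Let intX : mu.-integrable J (fun t => (X t * s t)%:E).
Proof. exact: (integrable_bounded mX XB). Qed.

Let ints : mu.-integrable J (fun t => (s t)%:E).
Proof.
have := @integrable_bounded (cst 1%R) 1 (measurable_cst _) (fun=> ltac:(rewrite normr1//)).
by apply: eq_integrable => // t _; rewrite mul1r.
Qed.

Let xiE : \int[mu]_(t in J) (X t * s t)%R%:E = xi%:E.
Proof. by rewrite fineK//; exact: integrable_fin_num. Qed.

Let int_affine (p q : R) : mu.-integrable J (fun t => ((p + q * X t) * s t)%:E).
Proof.
have h : mu.-integrable J (fun t => p%:E * (s t)%:E + q%:E * (X t * s t)%:E).
  by apply: integrableD => //; apply: integrableZl.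
by apply: eq_integrable h => // t _; rewrite -!EFinM -EFinD; congr EFin; ring.
Qed.

Let integral_affine_density (p q : R) :
  \int[mu]_(t in J) ((p + q * X t) * s t)%R%:E = (p + q * xi)%:E.
Proof.
under eq_integral do rewrite mulrDl -mulrA EFinD [(p * _)%:E]EFinM [(q * _)%:E]EFinM.
rewrite integralD//; [|exact: integrableZl|exact: integrableZl].
by rewrite !integralZl// xiE s1 mule1 -EFinM -EFinD.
Qed.

Let affine_le (p q : R) (f : R -> \bar R) : mu.-integrable J f ->
  (forall t, J t -> ((p + q * X t) * s t)%:E <= f t) -> (p + q * xi)%:E <= \int[mu]_(t in J) f t.
Proof.
move=> intf h; rewrite -integral_affine_density; have iA := int_affine p q.
by apply: le_integral => // t /[!inE]; exact: h.
Qed.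

Let le_affine (p q : R) (f : R -> \bar R) : mu.-integrable J f ->
  (forall t, J t -> f t <= ((p + q * X t) * s t)%:E) -> \int[mu]_(t in J) f t <= (p + q * xi)%:E.
Proof.
move=> intf h; rewrite -integral_affine_density; have iA := int_affine p q.
by apply: le_integral => // t /[!inE]; exact: h.
Qed.

Lemma barycenter_itv p q : (forall t, J t -> p <= X t <= q)%R -> (p <= xi <= q)%R.
Proof.
move=> h; apply/andP; split; rewrite -lee_fin -xiE.
  rewrite -[p]addr0 -(mul0r xi); apply: affine_le => // t /h /andP[? _].
  by rewrite lee_fin mul0r addr0 ler_wpM2r.
rewrite -[q]addr0 -(mul0r xi); apply: le_affine => // t /h /andP[_ ?].
by rewrite lee_fin mul0r addr0 ler_wpM2r.
Qed.

Let int_log x : mu.-integrable J (fun t => log_kernel x (X t) * (s t)%:E).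
Proof.
exact/integrable_density/integrable_log_kernel_arc.
Qed.

Lemma cell_lower x : x \notin `[a, b] ->
  (- ln `|x - xi|)%:E <= \int[mu]_(t in J) (log_kernel x (X t) * (s t)%:E).
Proof.
move=> xab.
have xiab : (a <= xi <= b)%R by apply: barycenter_itv => t _; exact: arc_itv.
(* Off [a, b] the sign is constant, so |x - y| equals sg (y - x) for all y in [a, b] and is affine
   in [y]. *)
pose sg : R := if (x < a)%R then 1%R else (-1)%R.
have dist y : (a <= y <= b)%R -> `|x - y|%R = (sg * (y - x))%R /\ (0 < sg * (y - x))%R.
  move: xab; rewrite in_itv/= negb_and -!ltNge /sg => /orP[xa|bx] /andP[ay yb].
    by rewrite xa mul1r ltr0_norm; lra.
  have -> : (x < a)%R = false by apply/negbTE; rewrite -leNgt; lra.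
  by rewrite gtr0_norm; lra.
have [dxi dxi0] := dist _ xiab.
set u := (sg * (xi - x))%R in dxi dxi0.
have xix : (xi - x)%R != 0%R by apply: contraTneq dxi0 => E; rewrite /u E mulr0 ltxx.
have sg0 : sg != 0%R by apply: contraTneq dxi0 => E; rewrite /u E mul0r ltxx.
(* The form p + q xi expected by [affine_le], which turns the claim into the tangent inequality at
   each point of the cell. *)
have -> : (- ln `|x - xi|)%R = ((- ln u + 1 + sg * x / u) + (- sg / u) * xi)%R.
  by rewrite dxi /u; field; rewrite sg0 xix.
apply: affine_le; first exact: int_log.
move=> t _; have [dX dX0] := dist _ (arc_itv ab t).
rewrite log_kernelE; last by rewrite -subr_eq0 -normr_eq0 dX gt_eqF.
rewrite -EFinM lee_fin ler_wpM2r// dX.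
have := ln_jensen dxi0 dX0.
have -> : (sg * (X t - x) / u = - (sg * x / u + (- sg / u) * X t))%R by ring.
lra.
Qed.

(** The linear term integrates to zero by the choice of [xi], and only the quadratic error of
    [ln_jensen_quadratic] survives. *)
Lemma cell_far x w l : (0 < w)%R -> (forall t, J t -> w <= x - X t)%R \/ (forall t, J t -> w <= X t - x)%R ->
  (forall t, J t -> `|xi - X t| <= l)%R ->
  \int[mu]_(t in J) (log_kernel x (X t) * (s t)%:E) <= (- ln `|x - xi| + (l / w) ^+ 2)%:E.
Proof.
move=> w0 side lX.
have [sg [sg1 dX]] : exists sg : R, (`|sg| = 1)%R /\ forall t, J t -> (w <= sg * (X t - x))%R.
  by case: side => h; [exists (-1)%R|exists 1%R]; split; rewrite ?normrN1 ?normr1// => t /h; lra.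
have dist y : (0 < sg * (y - x))%R -> `|x - y|%R = (sg * (y - x))%R.
  by move=> h; rewrite -(gtr0_norm h) normrM sg1 mul1r distrC.
have wxi : (w <= sg * (xi - x))%R.
  suff : (w + sg * x)%:E <= (0 + sg * xi)%:E by rewrite lee_fin; lra.
  rewrite -integral_affine_density (_ : w + sg * x = (w + sg * x) + 0 * xi)%R; last ring.
  apply: affine_le; first exact: int_affine.
  by move=> t /dX h; rewrite lee_fin mul0r addr0 add0r ler_wpM2r//; lra.
set u := (sg * (xi - x))%R in wxi.
have u0 := lt_le_trans w0 wxi.
have -> : (- ln `|x - xi| + (l / w) ^+ 2)%R =
    ((- ln u + 1 + sg * x / u + (l / w) ^+ 2) + (- sg / u) * xi)%R.
  have E1 : (1 = sg * xi / u - sg * x / u)%R by rewrite -mulrBl -mulrBr divff// gt_eqF.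
  have -> : (- sg / u * xi = - (sg * xi / u))%R by ring.
  by rewrite dist// -/u; lra.
apply: le_affine; first exact: int_log.
move=> t Jt; have wt := dX t Jt; have dX0 := lt_le_trans w0 wt.
rewrite log_kernelE; last by rewrite -subr_eq0 -normr_eq0 dist// gt_eqF.
rewrite -EFinM lee_fin ler_wpM2r// dist//.
have h : (`|u - sg * (X t - x)| <= l)%R.
  rewrite /u -mulrBr normrM sg1 mul1r (_ : _ - _ = xi - X t)%R; last ring.
  exact: lX.
have := ln_jensen_quadratic w0 wxi wt h.
have -> : (sg * (X t - x) / u = - (sg * x / u + (- sg / u) * X t))%R by ring.
lra.
Qed.

(* [20 r + 16 r^2 + 1 <= (10 r + 1)^2], where [r = (d - c) / |t - psi|]. *)
Lemma cell_near x psi : (0 <= psi <= pi / 2)%R -> x = X psi -> x != xi ->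
  (forall t, J t -> s t <= 8 / (d - c))%R ->
  (forall t, J t -> t != psi -> `|xi - X t| <= `|x - X t| *
     (20 * ((d - c) / `|t - psi|) + 16 * ((d - c) / `|t - psi|) ^+ 2))%R ->
  \int[mu]_(t in J) (log_kernel x (X t) * (s t)%:E) <= (- ln `|x - xi| + 416)%:E.
Proof.
move=> psiI xE xxi s8 ratio.
pose del := (d - c)%R; have del0 : (0 < del)%R by rewrite subr_gt0.
(* The loss in the logarithm is at most 2 ln (1 + 10 r) <= 13 sqrt r. Multiplied by the density
   bound 8 / del it is 104 / (sqrt del sqrt |t - psi|), whose integral over the cell is at most 104
   * 4 = 416. *)
pose g t := (- ln `|x - xi|)%:E * (s t)%:E + (104 / Num.sqrt del)%:E * isqrt_dist psi t.
have intis : mu.-integrable J (isqrt_dist psi).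
  by apply: integrableS (integrable_isqrt_dist psi) => //; exact: measurable_itv.
apply: (@le_trans _ _ (\int[mu]_(t in J) g t)); last first.
  rewrite integralD//; [|exact: integrableZl|exact: integrableZl].
  rewrite !integralZl// s1 mule1 EFinD leeD2l//.
  have q0 : (0 <= 104 / Num.sqrt del)%R by rewrite divr_ge0.
  have h := integral_isqrt_dist psi (ltW cd).
  apply: le_trans (lee_pmul _ _ (lexx _) h) _ => //.
    by apply: integral_ge0 => t _; exact: isqrt_dist_ge0.
  rewrite -EFinM lee_fin -/del mulrA -[leLHS]/(_ * _)%R mulrAC mulfVK ?gt_eqF ?sqrtr_gt0//.
  lra.
apply: le_integral => //.
  by apply: integrableD => //; exact: integrableZl.
move=> t /[!inE] Jt; rewrite /g.
have [->|tpsi] := eqVneq t psi.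
  rewrite /isqrt_dist subrr normr0 sqrtr0 inve0 gt0_muley ?lte_fin ?divr_gt0 ?sqrtr_gt0//.
  by rewrite addey ?leey.
have e0 : (0 < `|t - psi|)%R by rewrite normr_gt0 subr_eq0.
have q0 : (0 < Num.sqrt `|t - psi|)%R by rewrite sqrtr_gt0.
rewrite isqrt_distE//.
have h := ratio t Jt tpsi.
set r := ((d - c) / `|t - psi|)%R in h.
have r0 : (0 < r)%R by rewrite divr_gt0.
have xX : x != X t.
  apply/eqP => E; move: h; rewrite -E subrr normr0 mul0r normr_le0 subr_eq0 => /eqP E2.
  by move: xxi; rewrite E2 eqxx.
have XX0 : (0 < `|x - X t|)%R by rewrite normr_gt0 subr_eq0.
have xi0 : (0 < `|x - xi|)%R by rewrite normr_gt0 subr_eq0.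
rewrite log_kernelE// -!EFinM -EFinD lee_fin.
have tri : (`|x - xi| <= `|x - X t| * (1 + 10 * r) ^+ 2)%R.
  have := ler_distD (X t) x xi; rewrite (distrC (X t) xi) => h2.
  apply: le_trans h2 _; apply: le_trans (lerD (lexx _) h) _.
  rewrite -[X in (X + _ <= _)%R]mulr1 -mulrDr ler_wpM2l ?(ltW XX0)//.
  have := sqr_ge0 r; rewrite !expr2; nra.
have l1 : (ln `|x - xi| <= ln `|x - X t| + 13 * Num.sqrt r)%R.
  have : (ln `|x - xi| <= ln (`|x - X t| * (1 + 10 * r) ^+ 2))%R.
    by rewrite ler_ln ?posrE// (lt_le_trans xi0).
  rewrite lnM ?posrE ?exprn_gt0//; last lra.
  rewrite lnXn; last lra.
  have := @ln1D_le_sqrt _ (10 * r)%R ltac:(lra).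
  have : (Num.sqrt (10 * r) <= 13 / 4 * Num.sqrt r)%R.
    rewrite sqrtrM// ler_wpM2r ?sqrtr_ge0//.
    rewrite -[leRHS]ger0_norm; last lra.
    rewrite -sqrtr_sqr ler_wsqrtr// expr2; lra.
  rewrite -mulr_natl; lra.
have -> : (- ln `|x - X t| * s t <= - ln `|x - xi| * s t + 104 / Num.sqrt del * (Num.sqrt `|t - psi|)^-1)%R
    = ((ln `|x - xi| - ln `|x - X t|) * s t <= 104 / Num.sqrt del * (Num.sqrt `|t - psi|)^-1)%R.
  by apply/idP/idP; lra.
apply: (@le_trans _ _ (13 * Num.sqrt r * (8 / del)))%R.
  apply: (@le_trans _ _ (13 * Num.sqrt r * s t))%R; first by rewrite ler_wpM2r//; lra.
  by rewrite ler_wpM2l ?mulr_ge0 ?sqrtr_ge0//; exact: s8.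
have sd : (Num.sqrt del ^+ 2 = del)%R by rewrite sqr_sqrtr// ltW.
have sd0 : (0 < Num.sqrt del)%R by rewrite sqrtr_gt0.
rewrite /r -/del sqrtrM ?(ltW del0)// sqrtrV ?(ltW e0)// -{2}sd expr2.
set z := Num.sqrt del in sd0 *; set y := (Num.sqrt _)^-1%R.
have -> : (13 * (z * y) * (8 / (z * z)) = 104 / z * y)%R by field; rewrite gt_eqF.
exact: lexx.
Qed.

End cell.

(** * Sums of inverse squares *)

Section inverse_squares.
Context {R : realType}.
Implicit Types (n c k : nat).

(* [isq 0 = 0]. *)
Definition isq n : R := (n%:R ^+ 2)^-1.

Lemma isq_ge0 n : 0 <= isq n.
Proof. by rewrite invr_ge0 exprn_ge0. Qed.

Lemma isq0 : isq 0 = 0.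
Proof. by rewrite /isq expr0n invr0. Qed.

(** The comparison telescopes: 1 / (n + 1)^2 <= 1 / n - 1 / (n + 1). *)
Lemma sum_isq n : \sum_(j < n) isq j <= 2.
Proof.
suff h m : \sum_(j < m.+2) isq j <= 2 - m.+1%:R^-1.
  case: n => [|[|n]]; [by rewrite big_ord0|by rewrite big_ord1 isq0|].
  by apply: le_trans (h n) _; rewrite gerBl.
elim: m => [|m IH]; first by rewrite !big_ord_recl big_ord0 isq0 /isq !expr1n invr1; lra.
rewrite big_ord_recr/=; apply: le_trans (lerD IH (lexx _)) _.
rewrite /isq -[m.+2]addn1 natrD; set x : R := m.+1%:R.
have x0 : 0 < x by rewrite ltr0n.
rewrite -subr_ge0.
have -> : 2 - (x + 1)^-1 - (2 - x^-1 + ((x + 1) ^+ 2)^-1) = (x * (x + 1) ^+ 2)^-1.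
  by field; rewrite !gt_eqF//; lra.
by rewrite invr_ge0 mulr_ge0 ?exprn_ge0//; lra.
Qed.

(** Subtraction is truncated, so the indices j <= c contribute [isq 0], which is 0. *)
Lemma sum_isq_sub c k : \sum_(j < k) isq (j - c) <= 2.
Proof.
elim: c k => [|c IH] k; first by under eq_bigr do rewrite subn0; exact: sum_isq.
case: k => [|k]; first by rewrite big_ord0.
rewrite big_ord_recl sub0n isq0 add0r; under eq_bigr do rewrite /= /bump/= add1n subSS.
exact: IH.
Qed.

Lemma sum_sub_isq c k : \sum_(j < k) isq (c - j) <= 2.
Proof.
apply: (@le_trans _ _ (\sum_(j < c.+1) isq j)); last exact: sum_isq.
elim: c k => [|c IH] k.
  rewrite big1 => [|j _]; first by rewrite sumr_ge0// => j _; exact: isq_ge0.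
  by rewrite sub0n isq0.
case: k => [|k]; first by rewrite big_ord0 sumr_ge0// => j _; exact: isq_ge0.
rewrite [X in X <= _]big_ord_recl [X in _ <= X]big_ord_recr/= subn0 [X in X <= _]addrC.
apply: lerD => //.
by under eq_bigr do rewrite /= /bump/= add1n subSS; exact: IH.
Qed.

Lemma sum_eq_ord c k : \sum_(j < k) (j == c :> nat)%:R <= 1 :> R.
Proof.
have [ck|kc] := ltnP c k; last first.
  by rewrite big1// => j _; rewrite ltn_eqF// (leq_trans (ltn_ord j)).
rewrite (bigD1 (Ordinal ck))//= eqxx big1 ?addr0// => j; rewrite -val_eqE/=.
by move/negbTE => ->.
Qed.

End inverse_squares.

(** * Image length of a cell against the distance to a point *)

Section arc_ratio.
Context {R : realType}.
Variables (a b : R).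
Hypothesis ab : a < b.

Lemma arc_homo (u v : R) : 0 <= u -> u <= v -> v <= pi / 2 -> arc a b u <= arc a b v.
Proof.
move=> u0 uv vp; rewrite /arc lerD2l ler_wpM2l//; last exact: sqr_sin_homo.
by rewrite subr_ge0 ltW.
Qed.

(** Both differences are (b - a) times the sine of the difference times the sine of the sum of the
    angles. With D = |t - psi|, S = sin (psi + t) and e = d - c = r D, one has sin (d + c) <= S + e
    + D and D / 4 <= sin D <= S. The constants 20 and 16 come from using the factor 4 twice, once
    for sin D and once for D <= 4 S. *)
Lemma arc_ratio (c d t psi : R) : 0 <= c -> c <= t <= d -> d <= pi / 2 ->
  0 <= psi <= pi / 2 -> t != psi -> forall r, r = (d - c) / `|t - psi| ->
  arc a b d - arc a b c <= `|arc a b psi - arc a b t| * (20 * r + 16 * r ^+ 2).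
Proof.
move=> c0 /andP[ct td] dI /andP[psi0 psi1] tpsi r rE.
have tI : 0 <= t <= pi / 2 by lra.
have pI : 0 <= psi <= pi / 2 by lra.
have D0 : 0 < `|t - psi| by rewrite normr_gt0 subr_eq0.
have -> : arc a b d - arc a b c = (b - a) * (sin (d - c) * sin (d + c)).
  by rewrite -sinXsubX /arc; ring.
have -> : arc a b psi - arc a b t = (b - a) * (sin (psi - t) * sin (psi + t)).
  by rewrite -sinXsubX /arc; ring.
set D := `|t - psi| in D0 rE *; set S := sin (psi + t); set e := d - c.
have e0 : 0 <= e by rewrite /e; lra.
have DI : 0 <= D <= pi / 2.
  by rewrite (ltW D0)/= /D ler_norml; apply/andP; split; lra.
have sD := sin_ge DI.
have DS : sin D <= S by rewrite /S /D distrC; exact: sin_norm_le_sinD.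
have S0 : 0 < S by lra.
have nsin : `|sin (psi - t)| = sin D.
  have sD0 : 0 <= sin D by lra.
  rewrite -(ger0_norm sD0) /D; have [h|h] := leP 0 (t - psi).
    by rewrite (ger0_norm h) -[psi - t]opprB sinN normrN.
  by rewrite (ltr0_norm h) opprB.
rewrite !normrM (gtr0_norm (_ : 0 < b - a)) ?subr_gt0// nsin (gtr0_norm S0) -!mulrA.
rewrite ler_wpM2l//; first by rewrite subr_ge0 ltW.
have cS : sin (d + c) <= S + e + D.
  have -> : d + c = (psi + t) + (d + c - psi - t) by ring.
  rewrite sinD -/S; set h := d + c - psi - t.
  have hn : `|sin h| <= e + D.
    apply: le_trans (norm_sin_le h) _.
    have := ler_norm (t - psi); have := ler_norm (psi - t); rewrite (distrC psi t) -/D => h1 h2.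
    by rewrite /h ler_norml /e; apply/andP; split; lra.
  have c1 : S * cos h <= S by rewrite ler_piMr ?(ltW S0)// cos_le1.
  have c2 : cos (psi + t) * sin h <= `|sin h|.
    apply: le_trans (ler_norm _) _; rewrite normrM ler_piMl//.
    by rewrite ler_norml cos_geN1 cos_le1.
  lra.
have se : sin e <= e by exact: sin_le.
have se0 : 0 <= sin e by have := pi_gt0 R; move=> pi0; apply: sin_ge0_pi; rewrite e0/= /e; lra.
have er : e = r * D by rewrite rE mulfVK// gt_eqF.
have r0 : 0 <= r by rewrite rE divr_ge0// ltW.
apply: (@le_trans _ _ (e * (S + e + D))).
  apply: (@le_trans _ _ (sin e * (S + e + D))); first by rewrite ler_wpM2l.
  by rewrite ler_wpM2r//; lra.
apply: (@le_trans _ _ (D / 4 * (S * (20 * r + 16 * r ^+ 2)))); last first.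
  by rewrite ler_wpM2r// mulr_ge0 ?(ltW S0)// addr_ge0 ?mulr_ge0 ?exprn_ge0.
have -> : D / 4 * (S * (20 * r + 16 * r ^+ 2)) = r * D * (S + 4 * S * (1 + r)) by field.
rewrite er ler_wpM2l ?mulr_ge0 ?(ltW D0)// -addrA lerD2l.
have -> : r * D + D = D * (1 + r) by ring.
by rewrite ler_wpM2r//; lra.
Qed.

Lemma arc_lt (u v : R) : 0 <= u -> u < v -> v <= pi / 2 -> arc a b u < arc a b v.
Proof.
move=> u0 uv vp; have uI : 0 <= u <= pi / 2 by lra.
have vI : 0 <= v <= pi / 2 by lra.
have := sqrsin_dist_ge vI uI; rewrite [X in _ <= X]ger0_norm; last first.
  by rewrite subr_ge0; apply: sqr_sin_homo => //; exact: ltW.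
have : 0 < (`|v - u| / 4) ^+ 2 by rewrite exprn_gt0// divr_gt0// normr_gt0 subr_eq0 gt_eqF.
move=> h1 h2; rewrite /arc ltrD2l ltr_pM2l ?subr_gt0//; lra.
Qed.

Lemma arc_onto (x : R) : a <= x <= b -> exists2 t, 0 <= t <= pi / 2 & arc a b t = x.
Proof.
move=> xab; have p0 : 0 <= pi / 2 :> R by rewrite divr_ge0// pi_ge0.
have cA : {within `[0, pi / 2], continuous (arc a b)}.
  by apply: continuous_subspaceT => t; exact: continuous_arc.
have [|t] := IVT (v := x) p0 cA.
  rewrite /arc sin0 sin_pihalf expr0n expr1n mulr0 addr0 mulr1 addrC subrK.
  by rewrite minElt maxElt ab.
by rewrite in_itv/= => tI <-; exists t.
Qed.

Lemma quadratic_ratio (l w q r c : R) : 0 < w -> 0 <= l -> l <= w * (20 * r + 16 * r ^+ 2) ->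
  0 <= r -> r <= q -> r <= c -> (l / w) ^+ 2 <= ((20 + 16 * c) * q) ^+ 2.
Proof.
move=> w0 l0 h r0 rq rc.
have lw : l / w <= (20 + 16 * c) * q.
  rewrite ler_pdivrMr// mulrC; apply: le_trans h _; rewrite ler_wpM2l ?(ltW w0)//.
  have -> : 20 * r + 16 * r ^+ 2 = (20 + 16 * r) * r by ring.
  by apply: ler_pM => //; lra.
by rewrite ler_sqr ?nnegrE ?divr_ge0 ?(ltW w0)// (le_trans _ lw)// divr_ge0// ltW.
Qed.

End arc_ratio.

(** Five near cells cost 416 each; three families of far cells cost a square times a sum of inverse
    squares, at most 2. By [quadratic_ratio] the squared constants are 36 = 20 + 16, 336 = 4 (20 +
    64) and 168 = 2 (20 + 64). *)
Definition discretization_error {R : realType} : R :=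
  416 * 5 + (36 ^+ 2 + 336 ^+ 2 + 168 ^+ 2) * 2.

Lemma discretization_error_gt0 (R : realType) : 0 < discretization_error :> R.
Proof. by rewrite addr_gt0 ?mulr_gt0 ?addr_gt0 ?exprn_gt0 ?ltr0n. Qed.

(** * Cells of unit mass and the product over their means *)

Section discretization.
Context {R : realType}.
Local Notation mu := (@lebesgue_measure R).
Variables (a b M : R) (s : R -> R) (k : nat).
Hypothesis ab : a < b.
Hypothesis ms : measurable_fun [set: R] s.
Hypothesis s0 : forall t, 0 <= s t.
Hypothesis sM : forall t, s t <= M.
Hypothesis s_homo : forall u t, 0 <= u -> u <= t -> t <= pi / 2 -> s u <= s t.
Hypothesis s_half : forall t, 0 <= t -> t <= pi / 2 -> s t <= 4 * s (t / 2).
Local Notation X := (arc a b).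
Local Notation mass c d := (\int[mu]_(t in `[c, d]%classic) (s t)%:E)%E.

Let msD (D : set (measurableTypeR R)) : measurable_fun D (fun t => (s t)%:E).
Proof. by apply/measurable_EFinP; exact: measurable_funS ms. Qed.

Let integral_itv_cst (c d m : R) : c <= d ->
  (\int[mu]_(t in `[c, d]%classic) m%:E = (m * (d - c))%:E)%E.
Proof.
move=> cd; rewrite integral_cst//= lebesgue_measure_itv/= lte_fin.
have [_|dc] := ltP c d; first by rewrite -EFinB -EFinM.
have -> : d = c by apply/eqP; rewrite eq_le dc cd.
by rewrite subrr mulr0 mule0.
Qed.

Lemma mass_split (c d e : R) : c <= d -> d <= e -> (mass c e = mass c d + mass d e)%E.
Proof. by move=> cd de; apply: integral_itv_split => //; exact: msD. Qed.

Lemma mass_ge (c d m : R) : c <= d -> (forall t, c <= t <= d -> m <= s t) ->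
  ((m * (d - c))%:E <= mass c d)%E.
Proof.
move=> cd h; have [m0|m0] := leP 0 m; last first.
  apply: (@le_trans _ _ 0%E); first by rewrite lee_fin nmulr_rle0 ?subr_ge0.
  by apply: integral_ge0 => t _; rewrite lee_fin.
have -> : (m * (d - c))%:E = (\int[mu]_(t in `[c, d]%classic) m%:E)%E.
  by rewrite integral_itv_cst.
by apply: ge0_le_integral => // t /=; rewrite in_itv/= => /h; rewrite lee_fin.
Qed.

Lemma mass_le (c d m : R) : c <= d -> (forall t, c <= t <= d -> s t <= m) ->
  (mass c d <= (m * (d - c))%:E)%E.
Proof.
move=> cd h; have m0 : 0 <= m by apply: le_trans (s0 c) (h c _); rewrite lexx cd.
have -> : (m * (d - c))%:E = (\int[mu]_(t in `[c, d]%classic) m%:E)%E.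
  by rewrite integral_itv_cst.
by apply: ge0_le_integral => // t /=; rewrite in_itv/= => /h; rewrite lee_fin.
Qed.

Lemma ex_cells : (1 <= k)%N -> (mass 0%R (pi / 2)%R = k%:R%:E)%E ->
  exists th : nat -> R, [/\ th 0%N = 0, th k = pi / 2,
    forall j, (j < k)%N -> th j < th j.+1 & forall j, (j < k)%N -> (mass (th j) (th j.+1) = 1)%E].
Proof.
move=> k1 sk; have p0 : 0 < pi / 2 :> R by rewrite divr_gt0// pi_gt0.
have ints : mu.-integrable `[0, pi / 2] (EFin \o s).
  apply/integrableP; split; first exact: msD.
  by under eq_integral do rewrite /= ger0_norm//; rewrite sk ltry.
have cS := parameterized_integral_continuous (ltW p0) ints.
have massE (t : R) : 0 <= t <= pi / 2 -> (mass 0%R t = (\int[mu]_(u in `[0%R, t]) s u)%R%:E)%E.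
  move=> /andP[t0 t2]; rewrite /Rintegral fineK// ge0_fin_numE; last first.
    by apply: integral_ge0 => u _; rewrite lee_fin.
  apply: (@le_lt_trans _ _ (k%:R%:E)%E); rewrite ?ltry// -sk (mass_split t0 t2) leeDl//.
  by apply: integral_ge0 => u _; rewrite lee_fin.
(* The bound j <= k is placed inside so that [choice] gives a function on all of nat. The end nodes
   are prescribed, because the intermediate value theorem need not return 0 and pi / 2. *)
have node j : exists t : R, (j <= k)%N -> [/\ 0 <= t <= pi / 2, (mass 0%R t = j%:R%:E)%E,
    j = 0%N -> t = 0 & j = k -> t = pi / 2].
  have [->|j0] := eqVneq j 0%N.
    exists 0 => _; split=> //; first by rewrite lexx ltW.
      by rewrite set_itv1 integral_set1.
    by move=> E; move: k1; rewrite -E.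
  have [->|jk] := eqVneq j k.
    exists (pi / 2) => _; split=> //; first by rewrite lexx ltW.
    by move=> E; move: k1; rewrite E.
  have [kj|jk2] := ltnP k j; first by exists 0 => jk3; move: kj; rewrite ltnNge jk3.
  have I0 : (\int[mu]_(u in `[0%R, 0%R]) s u)%R = 0.
    by rewrite /Rintegral set_itv1 integral_set1.
  have Ik : (\int[mu]_(u in `[0%R, (pi / 2)%R]) s u)%R = k%:R by rewrite /Rintegral sk.
  have [|t tI tE] := IVT (v := j%:R) (ltW p0) cS.
    by rewrite /parameterized_integral I0 Ik minElt maxElt ltr0n k1 ler0n ler_nat.
  exists t => _; move: tI; rewrite in_itv/= => tI; split=> //.
  - by rewrite massE//; congr EFin.
  - by move=> E; rewrite E eqxx in j0.
  - by move=> E; rewrite E eqxx in jk.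
have [th thP] := choice node.
have step j : (j < k)%N -> th j < th j.+1.
  move=> jk; have [/andP[j1 j2] m1 _ _] := thP j (ltnW jk); have [/andP[j3 j4] m2 _ _] := thP j.+1 jk.
  rewrite ltNge; apply/negP => h; have := mass_split j3 h.
  rewrite m1 m2 => E; have : (j.+1%:R%:E <= j%:R%:E :> \bar R)%E.
    by rewrite E leeDl//; apply: integral_ge0 => u _; rewrite lee_fin.
  by rewrite lee_fin ler_nat ltnn.
exists th; split=> //.
- by have [_ _ ->] := thP 0%N (leq0n _).
- by have [_ _ _ ->] := thP k (leqnn _).
move=> j jk; have [/andP[j1 j2] m1 _ _] := thP j (ltnW jk); have [_ m2 _ _] := thP j.+1 jk.
have := mass_split j1 (ltW (step j jk)); rewrite m1 m2.
have : (0 <= mass (th j) (th j.+1))%E by apply: integral_ge0 => u _; rewrite lee_fin.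
case: (mass _ _) => [z| |]//= _ [E]; congr EFin.
by have := E; rewrite -natr1; lra.
Qed.

Section cells.
Variable th : nat -> R.
Hypothesis th0 : th 0%N = 0.
Hypothesis thk : th k = pi / 2.
Hypothesis thS : forall j, (j < k)%N -> th j < th j.+1.
Hypothesis th1 : forall j, (j < k)%N -> (mass (th j) (th j.+1) = 1)%E.
Local Notation xi j := (barycenter a b s (th j) (th j.+1)).
Local Notation del j := (th j.+1 - th j).

Lemma cell_homo i j : (i <= j <= k)%N -> th i <= th j.
Proof.
move=> /andP[]; elim: j => [|j IH]; first by rewrite leqn0 => /eqP ->.
rewrite leq_eqVlt => /predU1P[->//|ij] jk.
by apply: le_trans (IH ij (ltnW jk)) _; exact/ltW/thS.
Qed.

Lemma cell_ge0 j : (j <= k)%N -> 0 <= th j.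
Proof. by move=> jk; rewrite -th0; apply: cell_homo. Qed.

Lemma cell_le j : (j <= k)%N -> th j <= pi / 2.
Proof. by move=> jk; rewrite -thk; apply: cell_homo; rewrite jk leqnn. Qed.

Lemma integral_cells (f : R -> \bar R) : measurable_fun [set: R] f ->
  (\int[mu]_(t in `[0%R, (pi / 2)%R]) f t = \sum_(j < k) \int[mu]_(t in `[th j, th j.+1]) f t)%E.
Proof.
move=> mf; rewrite -thk -th0.
suff h n : (n <= k)%N ->
    (\int[mu]_(t in `[th 0%N, th n]) f t = \sum_(j < n) \int[mu]_(t in `[th j, th j.+1]) f t)%E.
  exact: h.
elim: n => [_|n IH nk]; first by rewrite big_ord0 set_itv1 integral_set1.
rewrite big_ord_recr/= -IH ?(ltnW nk)//; apply: integral_itv_split.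
- by apply: cell_homo; rewrite (ltnW nk).
- exact/ltW/thS.
- exact: measurable_funS mf.
Qed.

Lemma node_itv j : (j < k)%N -> forall p q, (forall t, th j <= t <= th j.+1 -> p <= X t <= q) ->
  p <= xi j <= q.
Proof.
move=> jk p q h; apply: (barycenter_itv ab ms s0 sM (cell_ge0 (ltnW jk)) (cell_le jk) (th1 jk)).
by move=> t /=; rewrite in_itv/=; exact: h.
Qed.

Lemma node_ab j : (j < k)%N -> a <= xi j <= b.
Proof. by move=> jk; apply: node_itv => // t _; exact: arc_itv. Qed.

Lemma nodes_lower x u : x \notin `[a, b] ->
  (\int[mu]_(t in `[0%R, (pi / 2)%R]) (log_kernel x (X t) * (s t)%:E) = u%:E)%E ->
  expR (- u) <= \prod_(j < k) `|x - xi j|.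
Proof.
move=> xab; rewrite integral_cells; last first.
  apply: emeasurable_funM; last exact: msD.
  by apply: measurable_log_kernel => //; exact: measurable_arc.
move=> E.
have pos j : (j < k)%N -> 0 < `|x - xi j|.
  move=> jk; rewrite normr_gt0 subr_eq0; apply: contraNneq xab => ->.
  by rewrite in_itv/=; exact: node_ab.
have : ((\sum_(j < k) - ln `|x - xi j|)%:E <= u%:E)%E.
  rewrite -E -sumEFin; apply: lee_sum => j _; apply: (cell_lower ab ms s0 sM) => //.
  - exact/cell_ge0/ltnW.
  - exact: cell_le.
  - exact: th1.
rewrite lee_fin sumrN => h.
have -> : \prod_(j < k) `|x - xi j| = expR (\sum_(j < k) ln `|x - xi j|).
  by rewrite expR_sum; apply: eq_bigr => j _; rewrite lnK// posrE pos.
by rewrite ler_expR; lra.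
Qed.

Lemma mass_cell_ge j : (j < k)%N -> 1 <= s (th j.+1) * del j.
Proof.
move=> jk; rewrite -lee_fin -(th1 jk); apply: mass_le => [|t /andP[t1 t2]]; first exact/ltW/thS.
by apply: s_homo => //; [exact: le_trans (cell_ge0 (ltnW jk)) t1|exact: cell_le].
Qed.

Lemma mass_cell_le j : (j < k)%N -> s (th j) * del j <= 1.
Proof.
move=> jk; rewrite -lee_fin -(th1 jk); apply: mass_ge => [|t /andP[t1 t2]]; first exact/ltW/thS.
by apply: s_homo => //; [exact/cell_ge0/ltnW|apply: le_trans t2 _; exact: cell_le].
Qed.

(** A cell has mass 1 and [s] is nondecreasing, so its width lies between the inverses of the two
    end values of [s]; comparing end values therefore compares widths. *)
Lemma cell_width_le i j q : (i < k)%N -> (j < k)%N -> 0 < q -> s (th i.+1) <= q * s (th j) ->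
  del j <= q * del i.
Proof.
move=> ik jk q0 h; have di : 0 < del i by rewrite subr_gt0 thS.
have hi := mass_cell_ge ik; have hj := mass_cell_le jk.
have sj : 0 < s (th j).
  rewrite lt_neqAle s0 andbT; apply/negP => /eqP E.
  by move: h hi; rewrite -E mulr0 => h; have := ler_wpM2r (ltW di) h; rewrite mul0r; lra.
rewrite -(ler_pM2l sj); apply: le_trans hj _; apply: le_trans hi _.
by have := ler_wpM2r (ltW di) h; lra.
Qed.

Lemma cell_width_homo i j : (i < j)%N -> (j < k)%N -> del j <= del i.
Proof.
move=> ij jk; rewrite -[del i]mul1r; apply: cell_width_le => //; first exact: ltn_trans jk.
rewrite mul1r; apply: s_homo; [exact/cell_ge0/(ltn_trans ij)| |exact/cell_le/ltnW].
by apply: cell_homo; rewrite ij ltnW.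
Qed.

Lemma cell_width_double i j : (i < k)%N -> (j < k)%N -> th i.+1 <= 2 * th j -> del j <= 4 * del i.
Proof.
move=> ik jk h; apply: cell_width_le => //.
have t0 := cell_ge0 ik; apply: le_trans (s_half t0 (cell_le ik)) _.
by rewrite ler_wpM2l// s_homo//; [lra|lra|exact/cell_le/ltnW].
Qed.

(** The right half of the cell has mass at most 1 and there s >= s(m), hence s(m) <= 2 / del. Half
    of the right end is at most [m], so doubling gives s <= 4 s(m) on the cell; whence 8. *)
Lemma density_cell_le j t : (j < k)%N -> th j <= t <= th j.+1 -> s t <= 8 / del j.
Proof.
move=> jk /andP[t1 t2]; have dj : 0 < del j by rewrite subr_gt0 thS.
have a0 := cell_ge0 (ltnW jk); have b2 := cell_le jk.
have st : s t <= s (th j.+1) by apply: s_homo => //; lra.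
pose m := (th j + th j.+1) / 2.
have sm : s (th j.+1) <= 4 * s m.
  have c0 := cell_ge0 jk; apply: le_trans (s_half c0 b2) _; rewrite ler_wpM2l// s_homo//; rewrite /m; lra.
have h : s m * (th j.+1 - m) <= 1.
  rewrite -lee_fin -(th1 jk) (@mass_split _ m); [|rewrite /m; lra|rewrite /m; lra].
  rewrite -[leLHS]add0e; apply: leeD; first by apply: integral_ge0 => u _; rewrite lee_fin.
  by apply: mass_ge => [|u /andP[u1 u2]]; [rewrite /m; lra|apply: s_homo => //; rewrite /m in u1 *; lra].
have Em : th j.+1 - m = del j / 2 by rewrite /m; field.
rewrite ler_pdivlMr//; rewrite Em in h.
have := ler_wpM2r (ltW dj) (le_trans st sm); lra.
Qed.

Lemma cell_sum_ge e i j : (i <= j <= k)%N -> (forall l, (i <= l < j)%N -> e <= del l) ->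
  (j - i)%:R * e <= th j - th i.
Proof.
move=> /andP[]; elim: j => [|j IH]; first by rewrite leqn0 => /eqP -> _ _; rewrite subnn mul0r subrr.
rewrite leq_eqVlt => /predU1P[->|ij] jk h; first by rewrite subnn mul0r subrr.
have {}IH : (j - i)%:R * e <= th j - th i.
  by apply: IH (ltnW jk) _ => // l /andP[il lj]; apply: h; rewrite il ltnW.
rewrite subSn// -natr1 mulrDl mul1r.
have : e <= del j by apply: h; rewrite ltnSn andbT.
lra.
Qed.

(* [cell_near] serves for the two cells next to 0 and the three cells around
   [psi]; on the others the error is quadratic in the ratio of the length of the
   cell to its distance to [psi], which monotonicity of [s] bounds on the right
   of [psi] and the doubling inequality [s_half] on its left. *)
Definition cell_error (m j : nat) : R :=
  416 * ((j == 0%N)%:R + (j == 1%N)%:R + (j == m.-1)%:R + (j == m)%:R + (j == m.+1)%:R) +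
  (36 ^+ 2 * isq (j - m.+1) + 336 ^+ 2 * isq (m.-1 - j) + 168 ^+ 2 * isq j).

Lemma sum_cell_error m n : \sum_(j < n) cell_error m j <= discretization_error.
Proof.
rewrite big_split/= -mulr_sumr !big_split/= -!mulr_sumr /discretization_error.
set K1 : R := 36 ^+ 2; set K2 : R := 336 ^+ 2; set K3 : R := 168 ^+ 2.
have K10 : 0 <= K1 by exact: sqr_ge0.
have K20 : 0 <= K2 by exact: sqr_ge0.
have K30 : 0 <= K3 by exact: sqr_ge0.
have := @sum_eq_ord R 0 n; have := @sum_eq_ord R 1 n; have := @sum_eq_ord R m.-1 n.
have := @sum_eq_ord R m n; have := @sum_eq_ord R m.+1 n.
have := ler_wpM2l K10 (@sum_isq_sub R m.+1 n); have := ler_wpM2l K20 (@sum_sub_isq R m.-1 n).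
have := ler_wpM2l K30 (@sum_isq R n).
lra.
Qed.

Section cell_gap.
Variables (m j : nat) (psi : R).
Hypothesis jk : (j < k)%N.
Hypothesis mk : (m < k)%N.
Hypothesis psim : th m <= psi <= th m.+1.
Local Notation x := (X psi).

Let psiI : 0 <= psi <= pi / 2.
Proof.
have := cell_ge0 (ltnW mk); have := cell_le mk; case/andP: psim => *; lra.
Qed.

Let d0 : 0 < del j. Proof. by rewrite subr_gt0 thS. Qed.
Let c0 : 0 <= th j. Proof. exact/cell_ge0/ltnW. Qed.
Let d1 : th j.+1 <= pi / 2. Proof. exact: cell_le. Qed.

Let arcJ t : th j <= t <= th j.+1 -> X (th j) <= X t <= X (th j.+1).
Proof. move=> /andP[t0 t1]; have h0 := c0; have h1 := d1.
by apply/andP; split; apply: arc_homo => //; lra. Qed.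

Let node_dist t : th j <= t <= th j.+1 -> `|xi j - X t| <= X (th j.+1) - X (th j).
Proof.
move=> tJ; have /andP[? ?] := arcJ tJ; have /andP[? ?] := node_itv jk arcJ.
by rewrite ler_norml; apply/andP; split; lra.
Qed.

Let l0 : 0 <= X (th j.+1) - X (th j).
Proof. by rewrite subr_ge0; apply: arc_homo => //; exact/ltW/thS. Qed.

Let near : [|| j == 0, j == 1, j == m.-1, j == m | j == m.+1]%N -> x != xi j ->
  (\int[mu]_(t in `[th j, th j.+1]%classic) (log_kernel x (X t) * (s t)%:E) <=
    (- ln `|x - xi j| + 416)%:E)%E.
Proof.
move=> _ xxi; apply: (@cell_near _ _ _ _ _ _ _ ab ms s0 sM c0 (thS jk) d1 (th1 jk) _ _ psiI erefl xxi).
  by move=> t /=; rewrite in_itv/=; exact: density_cell_le.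
move=> t /=; rewrite in_itv/= => tJ tpsi; apply: le_trans (node_dist tJ) _.
exact: arc_ratio.
Qed.

(** Widths decrease to the right, so the [n] cells from m.+1 to j - 1 are at least as wide as cell
    [j], and the ratio of width to distance is at most 1 / n. *)
Let far_right : (m.+1 < j)%N ->
  (\int[mu]_(t in `[th j, th j.+1]%classic) (log_kernel x (X t) * (s t)%:E) <=
    (- ln `|x - xi j| + 36 ^+ 2 * isq (j - m.+1))%:E)%E.
Proof.
move=> mj; set n := (j - m.+1)%N; have n0 : 0 < n%:R :> R by rewrite ltr0n subn_gt0.
have n1 : 1 <= n%:R :> R by rewrite ler1n subn_gt0.
have h : n%:R * del j <= th j - th m.+1.
  apply: cell_sum_ge => [|l /andP[_ lj]]; first by rewrite (ltnW mj) ltnW.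
  exact: cell_width_homo.
have pj : 0 < th j - psi by case/andP: psim => _ ?; have := mulr_gt0 n0 d0; lra.
have w0 : 0 < X (th j) - x by have h1 := cell_le (ltnW jk); case/andP: psiI => *; rewrite subr_gt0; apply: arc_lt => //; lra.
have thjpsi : th j != psi by rewrite -subr_eq0 gt_eqF.
apply: le_trans (@cell_far _ _ _ _ _ _ _ ab ms s0 sM c0 d1 (th1 jk) x _ _ w0 _ _) _.
- by right=> t /=; rewrite in_itv/= => /arcJ /andP[? _]; lra.
- by move=> t /=; rewrite in_itv/=; exact: node_dist.
rewrite lee_fin lerD2l.
have thj : th j <= th j <= th j.+1 by rewrite lexx ltW ?thS.
have := @arc_ratio _ _ _ ab _ _ _ _ c0 thj d1 psiI thjpsi _ erefl.
rewrite distrC (gtr0_norm w0) (gtr0_norm pj) => H.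
have r0 : 0 <= del j / (th j - psi) by rewrite divr_ge0 ?ltW.
have rn : del j / (th j - psi) <= n%:R^-1.
  by rewrite ler_pdivrMr// mulrC ler_pdivlMr// mulrC; case/andP: psim => _ ?; lra.
have r1 : del j / (th j - psi) <= 1 by apply: le_trans rn _; rewrite invf_le1.
apply: le_trans (quadratic_ratio w0 l0 H r0 rn r1) _.
rewrite /isq -exprVn; set y := n%:R^-1; rewrite exprMn; lra.
Qed.

(** If th m <= 2 th j, doubling makes the cells between at least a quarter as wide as cell [j], and
    the ratio is at most 4 / n. Otherwise the distance exceeds th j - del j >= th j / 2, and th j >=
    j del j because earlier cells are wider, so the ratio is at most 2 / j. *)
Let far_left : (1 < j)%N -> (j < m.-1)%N ->
  (\int[mu]_(t in `[th j, th j.+1]%classic) (log_kernel x (X t) * (s t)%:E) <=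
    (- ln `|x - xi j| + (336 ^+ 2 * isq (m.-1 - j) + 168 ^+ 2 * isq j))%:E)%E.
Proof.
move=> j1 jm; have jm1 : (j.+1 < m)%N by rewrite -ltn_predRL.
set n := (m.-1 - j)%N; have n0 : 0 < n%:R :> R by rewrite ltr0n subn_gt0.
have n1 : 1 <= n%:R :> R by rewrite ler1n subn_gt0.
have mm : (m <= k)%N := ltnW mk.
have lt1 : th j.+1 < th m.
  by apply: lt_le_trans (thS (ltn_trans jm1 mk)) _; apply: cell_homo; rewrite jm1.
have pj : 0 < psi - th j.+1 by case/andP: psim => *; lra.
have w0 : 0 < x - X (th j.+1).
  by case/andP: psiI => *; rewrite subr_gt0; apply: arc_lt => //; have := cell_ge0 jk; lra.
have thjpsi : th j.+1 != psi by rewrite eq_sym -subr_eq0 gt_eqF.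
apply: le_trans (@cell_far _ _ _ _ _ _ _ ab ms s0 sM c0 d1 (th1 jk) x _ _ w0 _ _) _.
- by left=> t /=; rewrite in_itv/= => /arcJ /andP[_ ?]; lra.
- by move=> t /=; rewrite in_itv/=; exact: node_dist.
rewrite lee_fin lerD2l.
have thj : th j <= th j.+1 <= th j.+1 by rewrite lexx ltW ?thS.
have := @arc_ratio _ _ _ ab _ _ _ _ c0 thj d1 psiI thjpsi _ erefl.
rewrite (gtr0_norm w0) [`|th j.+1 - psi|]distrC (gtr0_norm pj) => H.
have r0 : 0 <= del j / (psi - th j.+1) by rewrite divr_ge0 ?ltW.
have i1 := @isq_ge0 R n; have i2 := @isq_ge0 R j.
have [hm|hm] := leP (th m) (2 * th j).
  have h : n%:R * (del j / 4) <= th m - th j.+1.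
    have -> : n = (m - j.+1)%N by rewrite /n -subn1 -subnDA add1n.
    apply: cell_sum_ge => [|l /andP[jl lm]]; first by rewrite (ltnW jm1).
    have lk : (l < k)%N := ltn_trans lm mk.
    have : del j <= 4 * del l.
      by apply: cell_width_double => //; apply: le_trans hm; apply: cell_homo; rewrite lm.
    lra.
  have rn : del j / (psi - th j.+1) <= 4 * n%:R^-1.
    rewrite ler_pdivrMr// mulrAC ler_pdivlMr//; case/andP: psim => ? _; lra.
  have r4 : del j / (psi - th j.+1) <= 4.
    by apply: le_trans rn _; rewrite ler_piMr// invf_le1.
  apply: le_trans (quadratic_ratio w0 l0 H r0 rn r4) _.
  apply: (@le_trans _ _ (336 ^+ 2 * isq n)); last by lra.
  by rewrite /isq -exprVn; set y := n%:R^-1; rewrite !exprMn; lra.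
have jn : 2 <= j%:R :> R by rewrite ler_nat.
have hj : j%:R * del j <= th j.
  have := @cell_sum_ge (del j) 0 j; rewrite subn0 th0 subr0; apply.
    by rewrite leq0n (ltnW jk).
  by move=> l /andP[_ lj]; exact: cell_width_homo.
have h2 : 2 * del j <= th j by apply: le_trans hj; rewrite ler_pM2r.
have j0 : 0 < j%:R :> R by rewrite ltr0n ltnW.
have rn : del j / (psi - th j.+1) <= 2 * j%:R^-1.
  rewrite ler_pdivrMr// mulrAC ler_pdivlMr// mulrC; case/andP: psim => ? _; lra.
have r4 : del j / (psi - th j.+1) <= 4.
  apply: le_trans rn _; apply: (@le_trans _ _ 2); last by lra.
  by rewrite ler_piMr// invf_le1//; lra.
apply: le_trans (quadratic_ratio w0 l0 H r0 rn r4) _.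
apply: (@le_trans _ _ (168 ^+ 2 * isq j)); last by lra.
by rewrite /isq -exprVn; set y := j%:R^-1; rewrite !exprMn; lra.
Qed.

Lemma cell_error_le : x != xi j ->
  (\int[mu]_(t in `[th j, th j.+1]%classic) (log_kernel x (X t) * (s t)%:E) <=
    (- ln `|x - xi j| + cell_error m j)%:E)%E.
Proof.
move=> xxi; have B (c : bool) : 0 <= c%:R :> R by [].
have B0 := B (j == 0)%N; have B1 := B (j == 1)%N; have B2 := B (j == m.-1)%N.
have B3 := B (j == m)%N; have B4 := B (j == m.+1)%N.
have i1 := @isq_ge0 R (j - m.+1); have i2 := @isq_ge0 R (m.-1 - j); have i3 := @isq_ge0 R j.
have [nr|] := boolP [|| j == 0, j == 1, j == m.-1, j == m | j == m.+1]%N.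
  apply: le_trans (near nr xxi) _; rewrite lee_fin lerD2l /cell_error.
  have {}i1 := mulr_ge0 (sqr_ge0 36) i1; have {}i2 := mulr_ge0 (sqr_ge0 336) i2.
  have {}i3 := mulr_ge0 (sqr_ge0 168) i3.
  have I (c : bool) : c -> c%:R = 1 :> R by case: c.
  by case/or4P: nr => [/I|/I|/I|/orP[/I|/I]]; lra.
rewrite !negb_or => /and5P[n0 n1 n2 n3 n4].
have [jm|mj] := ltnP j m.
  have h1 : (1 < j)%N by case: (j) n0 n1 => [|[|]].
  have h2 : (j < m.-1)%N.
    by rewrite ltn_neqAle n2 -ltnS prednK//; exact: leq_ltn_trans jm.
  apply: le_trans (far_left h1 h2) _; rewrite lee_fin lerD2l /cell_error; lra.
have h1 : (m.+1 < j)%N by rewrite !ltn_neqAle eq_sym n4 eq_sym n3.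
apply: le_trans (far_right h1) _; rewrite lee_fin lerD2l /cell_error; lra.
Qed.

End cell_gap.

Lemma ex_cell psi : 0 <= psi <= pi / 2 -> (0 < k)%N ->
  exists2 m, (m < k)%N & th m <= psi <= th m.+1.
Proof.
move=> /andP[p0 p1] k0.
suff h n : (0 < n <= k)%N -> psi <= th n -> exists2 m, (m < k)%N & th m <= psi <= th m.+1.
  by apply: (h k); rewrite ?k0 ?leqnn// thk.
elim: n => [//|n IH] /andP[_ nk] pn.
have [np|/ltW np] := leP (th n) psi; first by exists n => //; rewrite np pn.
case: n IH nk pn np => [|n] IH nk pn np; last by apply: IH => //; exact: ltnW.
by exists 0%N => //; rewrite th0 p0.
Qed.

Lemma nodes_upper x u : (0 < k)%N -> a <= x <= b ->
  (\int[mu]_(t in `[0%R, (pi / 2)%R]) (log_kernel x (X t) * (s t)%:E) = u%:E)%E ->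
  \prod_(j < k) `|x - xi j| <= expR (discretization_error - u).
Proof.
move=> k0 xab; have [psi psiI <-] := arc_onto ab xab.
rewrite integral_cells; last first.
  apply: emeasurable_funM; last exact: msD.
  by apply: measurable_log_kernel => //; exact: measurable_arc.
move=> E; have [m mk psim] := ex_cell psiI k0.
(* At a node the product is 0; elsewhere every logarithm is finite and the cell estimates add up. *)
have [/existsP[j /eqP xj]|/existsPn nx] := boolP [exists j : 'I_k, X psi == xi j].
  by rewrite (bigD1 j)//= {1}xj subrr normr0 mul0r expR_ge0.
have : (u%:E <= (\sum_(j < k) (- ln `|X psi - xi j| + cell_error m j))%:E)%E.
  by rewrite -E -sumEFin; apply: lee_sum => j _; apply: cell_error_le.
rewrite lee_fin big_split/= sumrN => h; have h2 := sum_cell_error m k.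
have -> : \prod_(j < k) `|X psi - xi j| = expR (\sum_(j < k) ln `|X psi - xi j|).
  rewrite expR_sum; apply: eq_bigr => j _; rewrite lnK// posrE normr_gt0 subr_eq0.
  exact: nx.
by rewrite ler_expR; lra.
Qed.

End cells.

Lemma ex_nodes : (1 <= k)%N -> (mass 0%R (pi / 2)%R = k%:R%:E)%E ->
  exists xi : nat -> R,
    (forall x u, x \notin `[a, b] ->
       (\int[mu]_(t in `[0%R, (pi / 2)%R]) (log_kernel x (X t) * (s t)%:E) = u%:E)%E ->
       expR (- u) <= \prod_(j < k) `|x - xi j|) /\
    (forall x u, a <= x <= b ->
       (\int[mu]_(t in `[0%R, (pi / 2)%R]) (log_kernel x (X t) * (s t)%:E) = u%:E)%E ->
       \prod_(j < k) `|x - xi j| <= expR (discretization_error - u)).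
Proof.
move=> k1 sk; have [th [th0 thk thS th1]] := ex_cells k1 sk.
exists (fun j => barycenter a b s (th j) (th j.+1)); split=> x u.
  exact: nodes_lower.
exact: nodes_upper.
Qed.

End discretization.

(** * The left endpoint *)

Section eta_kernel.
Context {R : realType}.
Variables (b : R).
Local Notation TR := (measurableTypeR R).
Implicit Types (a y : R).

Definition eta_kernel a y : \bar R := sqrte ((b - y)%:E / (a - y)%:E)%E.

Lemma eta_kernel_ge0 a y : (0 <= eta_kernel a y)%E.
Proof. exact: sqrte_ge0. Qed.

Lemma eta_kernelE a y : a != y -> eta_kernel a y = (Num.sqrt ((b - y) / (a - y)))%:E.
Proof. by move=> ay; rewrite /eta_kernel inver subr_eq0 (negbTE ay) -EFinM. Qed.

Lemma eta_kernelxx a : a < b -> eta_kernel a a = +oo%E.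
Proof. by move=> ab; rewrite /eta_kernel subrr inve0 gt0_muley// lte_fin subr_gt0. Qed.

Lemma eta_kernel_ratio a y : y < a -> a < b -> eta_kernel a y = ((charge_ratio a b y)^-1)%:E.
Proof.
move=> ya ab; rewrite eta_kernelE ?gt_eqF// /charge_ratio -sqrtrV ?invf_div//.
by rewrite divr_ge0//; lra.
Qed.

Lemma measurable_eta_kernel a : measurable_fun [set: TR] (eta_kernel a).
Proof.
rewrite (_ : eta_kernel a = fun y => if y == a then eta_kernel a a
    else (Num.sqrt ((b - y) / (a - y)))%:E); last first.
  by apply/funext => y; case: eqVneq => [->//|ya]; rewrite eta_kernelE// eq_sym.
apply: measurable_fun_ifT => //.
  by apply: measurable_fun_eqr => //; exact: measurable_cst.
apply/measurable_EFinP; apply: measurableT_comp; first exact: measurable_sqrt.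
by apply: measurable_divr; apply: measurable_funB => //; exact: measurable_cst.
Qed.

Lemma eta_kernel_homo y x x' : y < x -> x <= x' -> y <= b -> (eta_kernel x' y <= eta_kernel x y)%E.
Proof.
move=> yx xx' yb; rewrite !eta_kernelE ?gt_eqF//; last exact: lt_le_trans xx'.
rewrite lee_fin ler_wsqrtr// ler_wpM2l ?subr_ge0// lef_pV2 ?posrE ?subr_gt0 ?lerB//.
exact: lt_le_trans xx'.
Qed.

(** A converse to [eta_kernel_homo] with a factor that tends to 1 as x' tends to [x], uniformly in y
    <= al. It rests on (x' - y) / (x - y) <= (x' - al) / (x - al). *)
Lemma eta_kernel_le y al x x' : y <= al -> al < x -> x <= x' -> y <= b ->
  (eta_kernel x y <= (Num.sqrt ((x' - al) / (x - al)))%:E * eta_kernel x' y)%E.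
Proof.
move=> yal alx xx' yb; have yx : y < x by lra.
have yx' : y < x' by lra.
rewrite !eta_kernelE ?gt_eqF// -EFinM -sqrtrM; last by rewrite divr_ge0; lra.
rewrite lee_fin ler_wsqrtr//.
have -> : (x' - al) / (x - al) * ((b - y) / (x' - y)) =
  (b - y) * (((x' - al) / (x - al)) / (x' - y)) by ring.
rewrite ler_wpM2l ?subr_ge0// ler_pdivlMr ?subr_gt0// mulrC ler_pdivrMr ?subr_gt0//.
rewrite mulrAC ler_pdivlMr ?subr_gt0//.
have : 0 <= (x' - x) * (al - y) by rewrite mulr_ge0; lra.
lra.
Qed.

End eta_kernel.


(** * Existence and properties of the left endpoint *)

Section left_endpoint.
Context {R : realType}.
Local Notation TR := (measurableTypeR R).
Variables (k : nat) (alpha b c : R) (rho : {finite_measure set (measurableTypeR R) -> \bar R}).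
Hypothesis k1 : (1 <= k)%N.
Hypothesis alb : alpha < b.
Hypothesis ca : c < alpha.
Hypothesis rhoS : rho (~` `[c, alpha]) = 0%E.
Local Notation S := (`[c, alpha]%classic : set TR).
Local Notation lam a := (charge_ratio a b).
Local Open Scope ereal_scope.

Definition charge_total : R := k%:R + fine (rho setT).
Local Notation N := charge_total.

Let mS : measurable S. Proof. exact: measurable_itv. Qed.

Lemma total_chargeE : total_charge k rho = N%:E.
Proof. by rewrite /total_charge /charge_total EFinD fineK// fin_num_measure. Qed.

Lemma etaE a : Defs.eta b rho a = \int[rho]_(y in S) eta_kernel b a y.
Proof.
apply: (ge0_integral_null mS _ _ rhoS); first exact: measurable_eta_kernel.
by move=> y; exact: eta_kernel_ge0.
Qed.

Let meta a : measurable_fun S (eta_kernel b a).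
Proof. exact: measurable_funS (measurable_eta_kernel b a). Qed.

Lemma eta_b : Defs.eta b rho b = rho setT.
Proof.
have -> : rho setT = \int[rho]_(y in S) cst 1 y.
  rewrite -(ge0_integral_null mS (measurable_cst _) (fun=> lee01) rhoS).
  by rewrite integral_cst// mul1e.
rewrite etaE.
apply: eq_integral => y /[!inE] /=; rewrite in_itv/= => /andP[_ ya].
have yb : (y < b)%R by exact: le_lt_trans alb.
by rewrite eta_kernelE ?gt_eqF// divff ?sqrtr1// subr_eq0 gt_eqF.
Qed.

(** The value a = b is excluded because eta(b) = |rho| falls short of [N] by k > 0. *)
Lemma left_endpoint_lt a : is_left_endpoint k alpha b rho a -> (alpha <= a < b)%R.
Proof.
rewrite /is_left_endpoint; case: ifP => [_ ->|h [aI E]]; first by rewrite lexx alb.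
move: aI; rewrite in_itv/= => /andP[-> ab]/=; rewrite lt_neqAle ab andbT.
apply/eqP => eab; move: E; rewrite eab eta_b /total_charge => /eqP.
have rf : rho setT \is a fin_num by rewrite fin_num_measure.
move: rf; case: (rho setT) => [r| |]// _; rewrite -EFinD eqe => /eqP E.
have : (k%:R : R)%R == 0%R by apply/eqP; lra.
by rewrite pnatr_eq0 => /eqP k0; have := k1; rewrite k0.
Qed.

Lemma left_endpoint_eta a : is_left_endpoint k alpha b rho a ->
  Defs.eta b rho a <= N%:E /\ ((alpha < a)%R -> Defs.eta b rho a = N%:E).
Proof.
rewrite /is_left_endpoint total_chargeE; case: ifP => [h ->|_ [_ ->]]//.
by split=> //; rewrite ltxx.
Qed.

(** When a = alpha, an atom at [a] would make eta(a) infinite, as the integrand is +oo there,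
    against eta(a) <= N. When alpha < a, the charge does not reach [a]. *)
Lemma left_endpoint_null a : is_left_endpoint k alpha b rho a -> rho (~` `[c, a[) = 0.
Proof.
move=> ha; have /andP[ala ab] := left_endpoint_lt ha.
have [eN _] := left_endpoint_eta ha.
have atom : rho ([set a] : set TR) = 0.
  have [aa|aa] := eqVneq alpha a; last first.
    have m1 : measurable ([set a] : set TR) by exact: measurable_set1.
    have m2 : measurable (~` S) by exact: measurableC.
    apply: (subset_measure0 m1 m2 _ rhoS) => x /= ->; rewrite in_itv/= => /andP[_ h].
    by move: aa; rewrite eq_le ala h.
  apply/eqP; rewrite eq_le measure_ge0 andbT leNgt; apply/negP => a0.
  have : \int[rho]_(y in [set a]) eta_kernel b a y <= \int[rho]_(y in S) eta_kernel b a y.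
    apply: ge0_subset_integral => //; first by move=> y _; exact: eta_kernel_ge0.
    by move=> y /= ->; rewrite in_itv/= -aa lexx andbT ltW.
  rewrite -etaE (eq_integral (cst +oo)); last first.
    by move=> y /[!inE] /= ->; rewrite eta_kernelxx.
  rewrite integral_cst// gt0_mulye// => h.
  by have := le_trans h eN; rewrite leye_eq.
have null0 : rho (~` S `|` ([set a] : set TR)) = 0.
  have m1 : measurable (~` S) by exact: measurableC.
  have m2 : measurable ([set a] : set TR) by exact: measurable_set1.
  exact: null_set_setU.
apply: (@subset_measure0 _ _ _ rho _ (~` S `|` [set a])) null0.
- by apply: measurableC; exact: measurable_itv.
- by apply: measurableU => //; exact: measurableC.
- move=> x /= h; have [->|xa] := eqVneq x a; [by right|left].
  move: h; rewrite !in_itv/= => h; apply: contra_not h => /andP[-> h2]/=.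
  by rewrite lt_neqAle xa (le_trans h2 ala).
Qed.

Lemma left_endpoint_ratio a : is_left_endpoint k alpha b rho a ->
  \int[rho]_(y in `[c, a[) ((lam a y)^-1)%:E <= N%:E.
Proof.
move=> ha; have /andP[ala ab] := left_endpoint_lt ha; have [eN _] := left_endpoint_eta ha.
have mD : measurable (`[c, a[%classic : set TR) by exact: measurable_itv.
apply: le_trans eN; rewrite /Defs.eta -/(eta_kernel b a _).
rewrite [leRHS](ge0_integral_null mD _ _ (left_endpoint_null ha)); last 2 first.
- exact: measurable_eta_kernel.
- by move=> y; exact: eta_kernel_ge0.
rewrite le_eqVlt; apply/orP; left; apply/eqP; apply: eq_integral => y /[!inE] /=.
by rewrite in_itv/= => /andP[_ ya]; rewrite -eta_kernel_ratio.
Qed.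

Lemma left_endpoint_ratio_eq a : is_left_endpoint k alpha b rho a -> (alpha < a)%R ->
  \int[rho]_(y in S) ((lam a y)^-1)%:E = N%:E.
Proof.
move=> ha ala; have /andP[_ ab] := left_endpoint_lt ha; have [_ h] := left_endpoint_eta ha.
rewrite -h// etaE; apply: eq_integral => y /[!inE] /=.
by rewrite in_itv/= => /andP[_ ya]; rewrite eta_kernel_ratio//; exact: le_lt_trans ala.
Qed.

Lemma green_field_le0 a x : is_left_endpoint k alpha b rho a -> (alpha <= x)%R -> (x < a)%R ->
  total_charge k rho * green_itv a b None x - \int[rho]_y green_itv a b (Some (real_pt y)) x <= 0.
Proof.
move=> ha alx xa; have /andP[_ ab] := left_endpoint_lt ha.
have ala : (alpha < a)%R by exact: le_lt_trans xa.
have g0 : 0 <= green_itv a b None x.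
  rewrite green_itv_infty// lee_fin subr_ge0 ler_ln ?posrE ?subr_gt0//; last first.
    by apply: sqsum_gt0; rewrite subr_eq0 (lt_eqF xa).
  apply: le_trans (sqsum_ge _ _); rewrite ltr0_norm ?ltr0_norm; lra.
have Y y : S y -> y \notin `[a, b].
  by rewrite /= !in_itv/= => /andP[_ ya]; rewrite negb_and -ltNge (le_lt_trans ya ala).
rewrite sube_le0 total_chargeE -(left_endpoint_ratio_eq ha ala).
rewrite [leRHS](@ge0_integral_null _ _ _ rho S)//; last 2 first.
- exact: measurable_green_itv.
- move=> y; have [h|h] := boolP (y \in `[a, b]); first by rewrite green_itv_pole_in.
  exact: green_itv_ge0.
have mV : measurable_fun S (fun y => ((lam a y)^-1)%:E).
  apply/measurable_EFinP; apply: measurable_funS; last first.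
    by apply: measurableT_comp; [exact: measurable_inv|exact: measurable_charge_ratio].
  - by [].
  - exact: measurableT.
rewrite -ge0_integralZr//; last by move=> y _; rewrite lee_fin invr_ge0 charge_ratio_ge0.
apply: ge0_le_integral => //.
- by move=> y _; rewrite mule_ge0// lee_fin invr_ge0 charge_ratio_ge0.
- by apply: emeasurable_funM => //; exact: measurable_cst.
- by apply: measurable_funS (measurable_green_itv ab x).
move=> y Sy; apply: green_itv_superhomogeneous => //.
by move: Sy; rewrite /= in_itv/= => /andP[_ ya]; exact: le_trans alx.
Qed.

Lemma eta_ge0 a : 0 <= Defs.eta b rho a.
Proof. by apply: integral_ge0 => y _; exact: eta_kernel_ge0. Qed.

Lemma eta_homo x x' : (alpha < x)%R -> (x <= x')%R -> Defs.eta b rho x' <= Defs.eta b rho x.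
Proof.
move=> ax xx'; have k0 z y : 0 <= eta_kernel b z y by exact: eta_kernel_ge0.
rewrite !etaE; apply: ge0_le_integral => //.
move=> y; rewrite /= in_itv/= => /andP[_ ya]; apply: eta_kernel_homo => //.
  exact: le_lt_trans ax.
exact: le_trans ya (ltW alb).
Qed.

Lemma eta_le x x' : (alpha < x)%R -> (x <= x')%R ->
  Defs.eta b rho x <= (Num.sqrt ((x' - alpha) / (x - alpha)))%:E * Defs.eta b rho x'.
Proof.
move=> ax xx'; have k0 z y : 0 <= eta_kernel b z y by exact: eta_kernel_ge0.
rewrite !etaE -ge0_integralZl//.
have m1 : measurable_fun S (fun y => (Num.sqrt ((x' - alpha) / (x - alpha)))%:E * eta_kernel b x' y).
  by apply: emeasurable_funM => //; exact: measurable_cst.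
have p1 y : 0 <= (Num.sqrt ((x' - alpha) / (x - alpha)))%:E * eta_kernel b x' y.
  by rewrite mule_ge0 ?eta_kernel_ge0// lee_fin sqrtr_ge0.
apply: ge0_le_integral => //.
move=> y; rewrite /= in_itv/= => /andP[_ ya]; apply: eta_kernel_le => //.
exact: le_trans ya (ltW alb).
Qed.

Lemma eta_fin x : (alpha < x)%R -> Defs.eta b rho x \is a fin_num.
Proof.
move=> ax; rewrite ge0_fin_numE ?eta_ge0//.
have [xb|bx] := leP x b; last first.
  by apply: le_lt_trans (eta_homo alb (ltW bx)) _; rewrite eta_b -ge0_fin_numE// fin_num_measure.
apply: le_lt_trans (eta_le ax xb) _; rewrite eta_b lte_mul_pinfty ?lee_fin ?sqrtr_ge0//.
by rewrite -ge0_fin_numE// fin_num_measure.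
Qed.

Let h x := fine (Defs.eta b rho x).
Let hE x : (alpha < x)%R -> Defs.eta b rho x = (h x)%:E.
Proof. by move=> ax; rewrite fineK// eta_fin. Qed.

Let q x0 x := Num.sqrt ((x0 - alpha) / (x - alpha)).

Let q_cvg (x0 : R) : (alpha < x0)%R -> q x0 x @[x --> x0] --> (1%R : R).
Proof.
move=> ax0; have d0 : (x0 - alpha)%R != 0%R by rewrite subr_eq0 gt_eqF.
rewrite -[X in _ --> X](@sqrtr1 R) -(divff d0).
have hc : ((x0 - alpha) / (x - alpha))%R @[x --> x0] --> ((x0 - alpha) / (x0 - alpha))%R.
  apply: cvgM; first exact: cvg_cst.
  by apply: cvgV => //; apply: cvgB; [exact: cvg_id|exact: cvg_cst].
exact: (cvg_comp _ _ hc (@sqrt_continuous R _)).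
Qed.

(** By [eta_homo] and [eta_le], h x lies between h x0 and q h x0, on either side of x0. *)
Let h_dist (x0 x : R) : (alpha < x0)%R -> (alpha < x)%R -> (`|h x - h x0| <= h x0 * `|q x0 x - 1|)%R.
Proof.
move=> ax0 ax.
have h00 : (0 <= h x0)%R by rewrite -lee_fin -hE// eta_ge0.
have [xx0|/ltW xx0] := leP x x0.
  have h1 : (h x0 <= h x)%R by rewrite -lee_fin -!hE// eta_homo.
  have h2 : (h x <= q x0 x * h x0)%R by rewrite -lee_fin EFinM -!hE// eta_le.
  rewrite ger0_norm ?subr_ge0//.
  have := ler_wpM2l h00 (ler_norm (q x0 x - 1)%R); lra.
have h1 : (h x <= h x0)%R by rewrite -lee_fin -!hE// eta_homo.
have h2 : (h x0 <= Num.sqrt ((x - alpha) / (x0 - alpha)) * h x)%R.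
  by rewrite -lee_fin EFinM -!hE// eta_le.
have q1 : (q x0 x * Num.sqrt ((x - alpha) / (x0 - alpha)) = 1)%R.
  rewrite -sqrtrM; last by rewrite divr_ge0; lra.
  rewrite -[RHS](@sqrtr1 R); congr Num.sqrt; field.
  by rewrite !subr_eq0 !gt_eqF.
have h3 : (q x0 x * h x0 <= h x)%R.
  by have := ler_wpM2l (sqrtr_ge0 ((x0 - alpha) / (x - alpha))) h2; rewrite mulrA -/(q x0 x) q1 mul1r.
rewrite ler0_norm ?subr_le0//.
have := ler_wpM2l h00 (ler_norm (- (q x0 x - 1))%R); rewrite normrN; lra.
Qed.

Let h_continuous (x0 : R) : (alpha < x0)%R -> {for x0, continuous h}.
Proof.
move=> ax0; have qc := q_cvg ax0.
have dc : (h x0 * `|q x0 x - 1|)%R @[x --> x0] --> (0%R : R).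
  rewrite -[X in _ --> X](mulr0 (h x0)) -[X in (_ * X)%R](@normr0 _ R) -(subrr (1%R : R)).
  apply: cvgM; first exact: cvg_cst.
  by apply: cvg_norm; apply: cvgB => //; exact: cvg_cst.
apply: (@squeeze_cvgr _ _ _ _ (fun x => h x0 - h x0 * `|q x0 x - 1|)%R (fun x => h x0 + h x0 * `|q x0 x - 1|)%R).
- near=> x; have ax : (alpha < x)%R by near: x; exact: lt_nbhsr.
  have := h_dist ax0 ax; rewrite ler_norml => /andP[? ?]; apply/andP; split; lra.
- by rewrite -[X in _ --> X](subr0 (h x0)); apply: cvgB => //; exact: cvg_cst.
- by rewrite -[X in _ --> X](addr0 (h x0)); apply: cvgD => //; exact: cvg_cst.
Unshelve. all: by end_near.
Qed.

(** The square makes the kernel at y = alpha equal to n + 1, so its divergence is explicit. *)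
Let x_ (n : nat) : R := alpha + (b - alpha) / n.+1%:R ^+ 2.

Let x_gt n : (alpha < x_ n)%R.
Proof. by rewrite ltrDl divr_gt0 ?subr_gt0// exprn_gt0. Qed.

Let x_le n : (x_ n <= b)%R.
Proof.
have : ((b - alpha) / n.+1%:R ^+ 2 <= b - alpha)%R.
  by rewrite ler_pdivrMr ?exprn_gt0// ler_peMr ?subr_ge0 ?(ltW alb)// exprn_ege1// ler1n.
by rewrite /x_ => H; rewrite -lerBrDl.
Qed.

Let x_cvg : x_ n @[n --> \oo] --> alpha.
Proof.
rewrite -[X in _ --> X]addr0 -(mulr0 (b - alpha)%R).
apply: cvgD; first exact: cvg_cst.
apply: cvgM; first exact: cvg_cst.
have hh : (harmonic n * harmonic n)%R @[n --> \oo] --> (0%R : R).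
  by rewrite -[X in _ --> X](mulr0 (0%R : R)); apply: cvgM; exact: cvg_harmonic.
rewrite (_ : (fun n : nat => _) = (fun n => harmonic n * harmonic n)%R)//.
by apply/funext => n; rewrite expr2 invfM.
Qed.

(** As [x_] decreases to alpha the kernels increase to the one at alpha, so monotone convergence
    applies even when the limit is +oo. *)
Let eta_cvg : Defs.eta b rho (x_ n) @[n --> \oo] --> Defs.eta b rho alpha.
Proof.
under eq_fun do rewrite etaE.
have -> : Defs.eta b rho alpha = \int[rho]_(y in S) limn (fun n => eta_kernel b (x_ n) y).
  rewrite etaE; apply: eq_integral => y /[!inE] /=; rewrite in_itv/= => /andP[_ ya].
  apply/esym/cvg_lim => //; have [->|yalpha] := eqVneq y alpha.
    rewrite eta_kernelxx//.
    have -> : (fun n => eta_kernel b (x_ n) alpha) = (fun n : nat => n.+1%:R%:E).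
      apply/funext => n; rewrite eta_kernelE ?gt_eqF//; congr EFin.
      rewrite -[RHS]ger0_norm// -sqrtr_sqr; congr Num.sqrt.
      rewrite /x_ [(alpha + _)%R]addrC addrK; field.
      rewrite subr_eq0 (gt_eqF alb) andbT -(natrD _ 1 n) pnatr_eq0//.
    apply/cvgeryP/cvgrnyP.
    have := cvg_addnr 1; rewrite (_ : addn^~ 1%N = succn)//.
    by apply/funext => n; rewrite addn1.
  have ya' : (y < alpha)%R by rewrite lt_neqAle yalpha.
  rewrite eta_kernelE ?gt_eqF//.
  under eq_fun do rewrite eta_kernelE ?gt_eqF ?(lt_trans ya' (x_gt _))//.
  apply: cvg_EFin; first by near=> n.
  apply: continuous_cvg; first exact: sqrt_continuous.
  apply: cvgM; first exact: cvg_cst.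
  apply: cvgV; first by rewrite subr_eq0 gt_eqF.
  by apply: cvgB => //; exact: cvg_cst.
apply: cvg_monotone_convergence => //.
- by move=> n y _; exact: eta_kernel_ge0.
move=> y; rewrite /= in_itv/= => /andP[_ ya] m n mn; apply: eta_kernel_homo.
- exact: le_lt_trans (x_gt n).
- rewrite /x_ lerD2l ler_wpM2l ?subr_ge0 ?(ltW alb)// lef_pV2 ?posrE ?exprn_gt0//.
  by rewrite lerXn2r ?nnegrE// ler_nat.
- exact: le_trans (ltW alb).
Unshelve. all: by end_near.
Qed.

Lemma ex_left_endpoint : exists a, is_left_endpoint k alpha b rho a.
Proof.
have [Na|Na] := boolP (Defs.eta b rho alpha <= total_charge k rho).
  by exists alpha; rewrite /is_left_endpoint Na.
rewrite /is_left_endpoint (negbTE Na); move: Na; rewrite -ltNge total_chargeE => Na.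
(* This moves the left end of the search into the region x > alpha, where eta is finite and
   continuous. *)
have [n Nn] : exists n, N%:E < Defs.eta b rho (x_ n).
  apply: contrapT => /forallNP H; move: Na; rewrite ltNge => /negP; apply.
  apply: (cvge_to_le eta_cvg); apply: nearW => n; rewrite leNgt; exact/negP.
have xb := x_le n.
have cW : {within `[x_ n, b], continuous h}.
  apply: continuous_in_subspaceT => x; rewrite inE/= in_itv/= => /andP[nx _].
  by apply: h_continuous; exact: lt_le_trans nx.
have hb : (h b <= N)%R.
  by rewrite -lee_fin -hE// eta_b -total_chargeE leeDr// lee_fin.
have hn : (N <= h (x_ n))%R by rewrite -lee_fin -hE// ltW.
have [|a aI aN] := IVT (v := N) xb cW.
  by rewrite ge_min hb orbT le_max hn.
exists a; move: aI; rewrite !in_itv/= => /andP[na ab].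
have alphaa : (alpha < a)%R by exact: lt_le_trans na.
by rewrite (ltW alphaa) ab; split=> //; rewrite hE// aN.
Qed.

End left_endpoint.

(** * The extremal measure and the extremal polynomials *)

Section equilibrium.
Context {R : realType}.
Local Notation TR := (measurableTypeR R).
Local Notation leb := (@lebesgue_measure R).
Local Notation I := (`[0%R, (pi / 2 : R)%R]%classic).
Variables (k : nat) (alpha b : R) (rho : {finite_measure set (measurableTypeR R) -> \bar R}).
Hypothesis k1 : (1 <= k)%N.
Hypothesis alb : alpha < b.
Hypothesis adm : admissible_charge alpha rho.
Local Notation Q := (ext_field k rho).
Local Notation N := (charge_total k rho).
Local Open Scope ereal_scope.

Let k0 : (0 < k%:R :> R)%R. Proof. by rewrite ltr0n. Qed.

Lemma ex_charge_support : exists2 c, (c < alpha)%R & rho (~` `[c, alpha]) = 0.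
Proof.
have [cpt sub] := adm; have [M [_ hM]] := compact_bounded cpt.
exists (Num.min (alpha - 1) (- (M + 1)))%R.
  by rewrite gt_min; apply/orP; left; lra.
apply: supp_itv_null => y ys; have := sub _ ys; rewrite /= !in_itv/= => ->; rewrite andbT.
have : (`|y| <= M + 1)%R by apply: hM ys; lra.
rewrite ler_norml => /andP[h _].
by rewrite ge_min h orbT.
Qed.

Lemma ext_fieldE x : Q x = (k%:R^-1)%:E * log_potential rho x.
Proof.
rewrite /ext_field /log_potential integral_mscale//; first by rewrite /= invr_gt0.
exact: measurable_log_kernel.
Qed.

Lemma measurable_ext_field : measurable_fun [set: R] Q.
Proof.
rewrite (_ : ext_field k rho = fun x => (k%:R^-1)%:E * log_potential rho x); last first.
  by apply/funext => x; exact: ext_fieldE.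
by apply: emeasurable_funM; [exact: measurable_cst|exact: measurable_log_potential].
Qed.

Lemma ext_field_ge (u v : R) : exists L : R, forall x, (u <= x <= v)%R -> (- L)%:E <= Q x.
Proof.
have [c ca rhoS] := ex_charge_support.
have [L L0 hL] := ex_log_kernel_lbound (Num.min c u) (Num.max alpha v).
have mD : measurable (`[c, alpha]%classic : set TR) by exact: measurable_itv.
have [r rE] : exists r : R, rho setT = r%:E.
  by exists (fine (rho setT)); rewrite fineK// fin_num_measure.
have rfin : rho setT < +oo by rewrite rE ltry.
exists (k%:R^-1 * (L * r))%R.
move=> x /andP[ux xv].
have hx t : (`[c, alpha]%classic : set R) t -> (- L)%:E <= log_kernel x t.
  rewrite /= in_itv/= => /andP[ct ta].
  by apply: hL; rewrite ge_min le_max ?ux ?xv ?ct ?ta ?orbT.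
have := log_potential_shift mD rhoS rfin L0 hx.
have : 0 <= \int[rho]_(t in `[c, alpha]) (log_kernel x t + L%:E).
  by apply: integral_ge0 => t Dt; rewrite -leeBlDr// sub0e; exact: hx.
move=> + E; have {}E : \int[rho]_(t in `[c, alpha]) (log_kernel x t + L%:E) =
    log_potential rho x + (L * r)%:E.
  by rewrite E; congr (_ + _); rewrite EFinM; congr (_ * _); exact: rE.
rewrite E ext_fieldE -leeBlDr// sub0e => h.
by rewrite -mulrN EFinM; rewrite lee_pmul2l => //; rewrite lte_fin invr_gt0.
Qed.

Lemma ext_field_gtNy x : Q x != -oo.
Proof.
have [L /(_ x)] := ext_field_ge x x; rewrite lexx => /(_ isT).
by case: (Q x).
Qed.

Section left_endpoint_fixed.
Variables (a c : R).
Hypothesis ha : is_left_endpoint k alpha b rho a.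
Hypothesis ca : (c < alpha)%R.
Hypothesis rhoS : rho (~` `[c, alpha]) = 0.
Local Notation s := (equi_density a b N rho).

Let ab : (a < b)%R. Proof. by have /andP[] := left_endpoint_lt k1 alb rhoS ha. Qed.
Let ala : (alpha <= a)%R. Proof. by have /andP[] := left_endpoint_lt k1 alb rhoS ha. Qed.
Let ca' : (c < a)%R. Proof. exact: lt_le_trans ala. Qed.
Let rhoD : rho (~` `[c, a[) = 0. Proof. exact: (left_endpoint_null k1 alb ca). Qed.
Let totN : k%:R%:E + rho setT = N%:E. Proof. exact: total_chargeE. Qed.
Let eta_le : \int[rho]_(y in `[c, a[) ((charge_ratio a b y)^-1)%:E <= N%:E.
Proof. exact: (left_endpoint_ratio k1 alb ca). Qed.

Let s0 t : (0 <= s t)%R. Proof. exact: (equi_density_ge0 k1 ab ca' rhoD totN eta_le). Qed.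
Let sN t : (s t <= 2 / pi * N)%R. Proof. exact: equi_density_le. Qed.
Let ms : measurable_fun [set: R] s. Proof. exact: measurable_equi_density. Qed.

Lemma ex_equilibrium_nodes : exists xi : nat -> R,
    (forall x u : R, (x \notin `[a, b])%R ->
       \int[leb]_(t in I) (log_kernel x (arc a b t) * (s t)%:E) = u%:E ->
       (expR (- u) <= \prod_(j < k) `|x - xi j|)%R) /\
    (forall x u : R, (a <= x <= b)%R ->
       \int[leb]_(t in I) (log_kernel x (arc a b t) * (s t)%:E) = u%:E ->
       (\prod_(j < k) `|x - xi j| <= expR (discretization_error - u))%R).
Proof.
apply: (ex_nodes ab ms s0 sN _ _ k1).
- exact: (equi_density_homo ab ca' rhoD eta_le).
- exact: (equi_density_half ab ca' rhoD eta_le).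
- exact: (integral_equi_density1 k1 ab ca' rhoD totN eta_le).
Qed.

Lemma ex_equilibrium : exists (mu0 : probability TR R) (F0 : R),
  [/\ is_extremal `[alpha, b] Q mu0, is_extremal_constant `[alpha, b] Q mu0 F0,
      supp mu0 = `[a, b]%classic,
      forall x, log_potential mu0 x \is a fin_num /\
        \int[leb]_(t in I) (log_kernel x (arc a b t) * (s t)%:E) = k%:R%:E * log_potential mu0 x &
      (forall x, k%:R%:E * extremal_fun Q mu0 F0 x =
         total_charge k rho * green_itv a b None x -
         \int[rho]_y green_itv a b (Some (real_pt y)) x) /\
      forall P : probability TR R, is_extremal `[alpha, b] Q P ->
        forall A, measurable A -> P A = mu0 A].
Proof.
have [mu0 mu0E] := ex_equilibrium_measure k1 ab ca' rhoD totN eta_le.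
have [F0 [Ufin fE]] := equilibrium_field k1 ab ca' rhoD totN eta_le mu0E.
have null0 := equilibrium_itv_null k1 ab mu0E.
have suppE := supp_equilibrium k1 ab ca' rhoD totN eta_le mu0E.
have kE : 0 < k%:R%:E :> \bar R by rewrite lte_fin.
have f0 x : x \in `[a, b] -> extremal_fun Q mu0 F0 x = 0.
  move=> xab; have := fE x; rewrite green_itv_in// mule0 integral0_eq; last first.
    by move=> y _; rewrite green_itv_in.
  by rewrite sube0 => /eqP; rewrite mule_eq0 eqe (gt_eqF k0)/= => /eqP.
have fle x : (`[alpha, b]%classic : set R) x -> extremal_fun Q mu0 F0 x <= 0.
  rewrite /= in_itv/= => /andP[ax xb]; have [ax'|xa] := leP a x.
    by rewrite f0// in_itv/= ax' xb.
  have := green_field_le0 k1 alb rhoS ha ax xa; rewrite -fE => h.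
  by rewrite leNgt; apply/negP => h2; have := mule_gt0 kE h2; rewrite ltNge h.
have [L QL'] := ext_field_ge alpha b.
have QL x : x \in `[alpha, b] -> (- L)%:E <= Q x by rewrite in_itv/=; exact: QL'.
have mQ := measurable_ext_field.
have mab : measurable (`[a, b]%classic : set TR) by exact: measurable_itv.
have sub : `[a, b]%classic `<=` `[alpha, b]%classic.
  by move=> x; rewrite /= !in_itv/= => /andP[ax ->]; rewrite (le_trans ala ax).
have f0' x : (`[a, b]%classic : set R) x -> extremal_fun Q mu0 F0 x = 0 by exact: f0.
exists mu0, F0; split.
- exact: (extremal_of_field alb mQ QL mab sub null0 Ufin f0' fle).
- by split=> // x; rewrite suppE; exact: f0.
- exact: suppE.
- move=> x; split; first exact: Ufin.
  have [L' L'0 hL] := ex_log_kernel_lbound (Num.min a x) (Num.max b x).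
  have hx t : (`[a, b]%classic : set R) t -> (- L')%:E <= log_kernel x t.
    rewrite /= in_itv/= => /andP[at_ tb].
    by apply: hL; rewrite ge_min le_max ?lexx ?at_ ?tb ?orbT.
  (* The measure is known through nonnegative functions only. The formula is applied to the shifted
     and truncated kernel, and the finite shift, L' times k, is removed at the end. *)
  pose h y : \bar R := maxe (log_kernel x y + L'%:E) 0.
  have h0 y : 0 <= h y by rewrite le_max lexx orbT.
  have mh : measurable_fun [set: TR] h.
    apply: measurable_maxe; last exact: measurable_cst.
    by apply: emeasurable_funD; [exact: measurable_log_kernel|exact: measurable_cst].
  have hE y : (`[a, b]%classic : set R) y -> h y = log_kernel x y + L'%:E.
    by move=> yab; rewrite /h (max_idPl _)// -leeBlDr// sub0e; exact: hx.
  have := mu0E h mh h0.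
  rewrite (ge0_integral_null mab mh h0 null0).
  have -> : \int[mu0]_(y in `[a, b]) h y = log_potential mu0 x + L'%:E.
    transitivity (log_potential mu0 x + L'%:E * mu0 setT); last by rewrite probability_setT mule1.
    rewrite -(log_potential_shift mab null0 _ L'0 hx); last exact: le_lt_trans (probability_le1 mu0 measurableT) (ltry _).
    by apply: eq_integral => y /[!inE]; exact: hE.
  have is1 : leb.-integrable I (fun t => log_kernel x (arc a b t) * (s t)%:E).
    by apply: (integrable_mul_bounded _ ms s0 sN) => //; exact: integrable_log_kernel_arc.
  have is2 : leb.-integrable I (fun t => L'%:E * (s t)%:E).
    by apply: (integrable_mul_bounded _ ms s0 sN) => //; exact: integrable_quarter_cst.
  have is3 : leb.-integrable I (fun t => (s t)%:E).
    have := @integrable_mul_bounded _ I (cst 1) s _ _ ms s0 sN (integrable_quarter_cst 1).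
    by move=> /(_ (measurable_itv _)); apply: eq_integrable => // t _; rewrite mul1e.
  have -> : \int[leb]_(t in I) (h (arc a b t) * (s t)%:E) =
      \int[leb]_(t in I) (log_kernel x (arc a b t) * (s t)%:E) + L'%:E * k%:R%:E.
    rewrite -(integral_equi_density1 k1 ab ca' rhoD totN eta_le) -integralZl// -integralD//.
    apply: eq_integral => t _; rewrite hE; last by rewrite /= in_itv/=; exact: arc_itv.
    by rewrite muleDl// fin_num_adde_defl.
  have := Ufin x; move: (\int[leb]_(t in I) (log_kernel x (arc a b t) * (s t)%:E)) => z.
  case: (log_potential mu0 x) => [u| |]//= _; case: z => [z| |]//=.
  by rewrite -?EFinD -?EFinM => -[E]; congr EFin; lra.
- split=> // P; exact: (extremal_unique alb mQ QL mab sub null0 Ufin f0' fle).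
Qed.

End left_endpoint_fixed.

(** Uniqueness identifies an arbitrary extremal measure with the constructed one, so that support,
    potential and nodes carry over. The constants agree too, because both extremal functions vanish
    at [a], a point of the common support. *)
Lemma extremal_data_equilibrium a (mu : probability TR R) F : extremal_data k alpha b rho a mu F ->
  [/\ (a < b)%R, supp mu = `[a, b]%classic,
    exists xi : nat -> R, forall x, exists u : R, [/\ log_potential mu x = u%:E,
      (x \notin `[a, b])%R -> (expR (- (k%:R * u)) <= \prod_(j < k) `|x - xi j|)%R &
      (a <= x <= b)%R -> (\prod_(j < k) `|x - xi j| <= expR (discretization_error - k%:R * u))%R] &
    forall x, k%:R%:E * extremal_fun Q mu F x = total_charge k rho * green_itv a b None x -
         \int[rho]_y green_itv a b (Some (real_pt y)) x].
Proof.
move=> [ha ext cst]; have [c ca rhoS] := ex_charge_support.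
have /andP[_ ab] := left_endpoint_lt k1 alb rhoS ha.
have [mu0 [F0 [ext0 [c0 _] supp0 U0 [f0 uniq]]]] := ex_equilibrium ha ca rhoS.
have [xi [out inn]] := ex_equilibrium_nodes ha ca rhoS.
have muE := uniq mu ext.
have UE x : log_potential mu x = log_potential mu0 x.
  by apply: eq_measure_integral => A mA _; exact: muE.
have suppE : supp mu = `[a, b]%classic.
  rewrite -supp0; apply/seteqP; split=> x h U oU Ux.
    exact: (eq_ind _ (fun z => 0 < z) (h U oU Ux) _ (muE U (open_measurable oU))).
  exact: (eq_ind _ (fun z => 0 < z) (h U oU Ux) _ (esym (muE U (open_measurable oU)))).
have FF : F = F0.
  have aS : (`[a, b]%classic : set R) a by rewrite /= in_itv/= lexx ltW.
  have := cst.1 a; rewrite suppE => /(_ aS).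
  have := c0 a; rewrite supp0 => /(_ aS); rewrite /extremal_fun UE.
  have [+ _] := U0 a; case: (log_potential mu0 a) => [u| |]//= _.
  case: (Q a) => [q| |]//=; rewrite -?EFinN -?EFinD => -[h1] [h2]; lra.
split=> //.
  exists xi => x; have [+ E] := U0 x; rewrite UE; move: E.
  case: (log_potential mu0 x) => [u| |]//= E _; exists u; split=> // h.
    by apply: out => //; rewrite E.
  by apply: inn => //; rewrite E.
by move=> x; rewrite -f0 /extremal_fun UE FF.
Qed.

Lemma ex_extremal_data : exists (a : R) (mu : probability TR R) (F : R),
  extremal_data k alpha b rho a mu F.
Proof.
have [c ca rhoS] := ex_charge_support.
have [a ha] := ex_left_endpoint k alb rhoS.
have [mu0 [F0 [ext0 c0 _ _ _]]] := ex_equilibrium ha ca rhoS.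
by exists a, mu0, F0.
Qed.

(** Where the field is +oo both sides are 0, the power being at least one. *)
Lemma weightX x : weight k rho x ^+ k = expeR (- (k%:R%:E * Q x)).
Proof.
rewrite /weight; have := ext_field_gtNy x; case: (Q x) => [q| |]//= _.
  by rewrite -EFin_expe -expRM_natl -mulrN.
by rewrite gt0_muley ?lte_fin//= -(prednK k1) expeS mul0e.
Qed.

Lemma extremal_polynomial a (mu : probability TR R) F : extremal_data k alpha b rho a mu F ->
  exists P : {poly R}, size P = k.+1 /\ forall x0 : R, (x0 \notin `[a, b])%R ->
    (expR (- discretization_error))%:E * expeR (k%:R%:E * extremal_fun Q mu F x0) <=
    `|weight k rho x0 ^+ k * P.[x0]%:E| /
    max_norm (supp mu) (fun x => weight k rho x ^+ k * P.[x]%:E).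
Proof.
move=> data; have [ab suppE [xi nodes] _] := extremal_data_equilibrium data.
pose P : {poly R} := (\prod_(j < k) ('X - (xi j)%:P))%R.
have PE x : `|P.[x]|%R = (\prod_(j < k) `|x - xi j|)%R.
  rewrite /P horner_prod normr_prod; apply: eq_bigr => j _.
  by rewrite hornerXsubC.
exists P; split.
  by rewrite size_prod_XsubC -[index_enum _]enumT size_enum_ord.
move=> x0 x0ab; rewrite suppE.
set h := (fun x => weight k rho x ^+ k * P.[x]%:E).
(* On [a, b] potential and field add up to [F], so the upper bound on the product of distances
   becomes a bound on the weighted polynomial free of [x]. *)
pose E := expR (discretization_error - k%:R * F).
have [_ _ [fS _]] := data.
have hE x : (`[a, b]%classic : set R) x -> `|h x| <= E%:E.
  move=> xab; have := fS x; rewrite suppE => /(_ xab).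
  have [u [uE _ inn]] := nodes x.
  rewrite /h weightX /extremal_fun uE; case: (Q x) => [q| |]//=.
  rewrite -?EFinN -?EFinD => -[Fuq]; rewrite lee_fin normrM PE (ger0_norm (expR_ge0 _)).
  have := inn xab => /(ler_wpM2l (expR_ge0 (- (k%:R * q)))) H.
  apply: le_trans H _; rewrite -expRD ler_expR /E.
  have -> : F = (u + q)%R by lra.
  by lra.
have m0 : 0 <= max_norm `[a, b] h.
  apply: le_trans (abse_ge0 (h a)) _; apply: ereal_sup_ubound.
  by exists a => //=; rewrite in_itv/= lexx ltW.
have mE : max_norm `[a, b] h <= E%:E.
  by apply: ge_ereal_sup => _ [x xab <-]; exact: hE.
have [u [uE out _]] := nodes x0.
have {}out := out x0ab.
rewrite -/(h x0) {1}/extremal_fun uE; have := ext_field_gtNy x0.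
have E0 : (0 < E)%R by exact: expR_gt0.
have kp : 0 < k%:R%:E :> \bar R by rewrite lte_fin.
case qE : (Q x0) => [q| |]// _; last first.
  (* If the field is +oo at [x0], the exponential on the left is 0. *)
  by rewrite addeNy gt0_muleNy//= mule0 mule_ge0 ?inve_ge0.
have hx0 : (expR (- (k%:R * q) - k%:R * u))%:E <= `|h x0|.
  rewrite /h weightX qE /= lee_fin normrM PE (ger0_norm (expR_ge0 _)) expRD.
  by rewrite ler_wpM2l ?expR_ge0.
rewrite -?EFinN -?EFinD -?EFinM /= -?EFinM -expRD.
apply: (@le_trans _ _ ((expR (- (k%:R * q) - k%:R * u))%:E * (E^-1)%:E)).
  rewrite -EFinM lee_fin /E -expRN -expRD ler_expR; lra.
apply: lee_pmul => //; rewrite ?lee_fin ?expR_ge0 ?invr_ge0 ?(ltW E0)//.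
move: m0 mE; case: (max_norm _ _) => [m| |]//; rewrite !lee_fin => m0 mE.
(* A zero norm has inverse +oo in [\bar R], and the bound is then immediate. *)
have [->|mn0] := eqVneq m 0%R; first by rewrite inve0 leey.
by rewrite inver (negbTE mn0) lee_fin lef_pV2 ?posrE// lt_neqAle eq_sym mn0.
Qed.

End equilibrium.

Theorem theorem1p3 (R : realType) :
  (forall (k : nat) (alpha b : R)
          (rho : {finite_measure set (measurableTypeR R) -> \bar R}),
     (1 <= k)%N -> alpha < b -> admissible_charge alpha rho ->
     (exists (a : R) (mu : probability (measurableTypeR R) R) (F : R),
        extremal_data k alpha b rho a mu F) /\
     (forall (a : R) (mu : probability (measurableTypeR R) R) (F : R),
        extremal_data k alpha b rho a mu F ->
        supp mu = `[a, b]%classic /\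
        forall x : R,
          (k%:R%:E * extremal_fun (ext_field k rho) mu F x =
           total_charge k rho * green_itv a b None x -
           \int[rho]_y green_itv a b (Some (real_pt y)) x)%E)) /\
  (exists C_BW : R, 0 < C_BW /\
     forall (k : nat) (alpha b : R)
            (rho : {finite_measure set (measurableTypeR R) -> \bar R}),
       (2 <= k)%N -> alpha < b -> admissible_charge alpha rho ->
       forall (a : R) (mu : probability (measurableTypeR R) R) (F : R),
         extremal_data k alpha b rho a mu F ->
         exists P : {poly R}, size P = k.+1 /\
           forall x0 : R, x0 \notin `[a, b] ->
             ((expR (- C_BW))%:E * expeR (k%:R%:E * extremal_fun (ext_field k rho) mu F x0) <=
              `|weight k rho x0 ^+ k * P.[x0]%:E| /
              max_norm (supp mu) (fun x => weight k rho x ^+ k * P.[x]%:E))%E).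
Proof.
split=> [k alpha b rho k1 alb adm|].
  split; first exact: ex_extremal_data.
  by move=> a mu F /(extremal_data_equilibrium k1 alb adm)[].
exists discretization_error; split; first exact: discretization_error_gt0.
by move=> k alpha b rho /ltnW k1 alb adm a mu F; exact: extremal_polynomial.
Qed.
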